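(* Let $n\in{\mathbb N}$, let $f_1,\dots, f_n\in{\mathbb C}(x)$ be non-exceptional rational functions of degrees $>1$, and let $\Phi(x_1,\dots,x_n)=(f_1(x_1),\dots,f_n(x_n))$ be their coordinatewise action on $({\mathbb P}^1)^n$. If $V\subset ({\mathbb P}^1)^n$ is a preperiodic (irreducible) subvariety under the action of $\Phi$, then there exists a finite set $S$ of pairs $(i,j)\in\{1,\dots, n\}\times \{1,\dots, n\}$ together with curves $C_{i,j}\subset {\mathbb P}^1\times {\mathbb P}^1$ which are preperiodic under the coordinatewise action $(x_i,x_j)\mapsto (f_i(x_i),f_j(x_j))$ such that $V$ is an irreducible component of $\bigcap_{(i,j)\in S} \pi_{i,j}^{-1}\left(C_{i,j}\right)$, where $\pi_{i,j}:({\mathbb P}^1)^n\to ({\mathbb P}^1)^2$ is the projection onto the $i$-th and $j$-th coordinates.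
   Context: The Chebyshev polynomial $T_d$ satisfies $T_d(z+1/z)=z^d+1/z^d$. A Lattès map is a rational function obtained as a quotient $\Theta\circ L\circ\Theta^{-1}$ of an affine map $L(z)=az+b$ on an elliptic curve via a finite holomorphic map $\Theta$ to ${\mathbb P}^1$. A rational function of degree $d>1$ is exceptional if it is conjugate by a Möbius transformation to $z^{\pm d}$, to $\pm T_d(z)$, or to a Lattès map. A subvariety $W$ is periodic under a map $F$ if the Zariski closure of $F^k(W)$ equals $W$ for some $k\ge1$, and preperiodic if the Zariski closure of $F^m(W)$ is periodic for some $m\ge 0$. *)

(* Defs.v *)
From Stdlib Require List.
From HB Require Import structures.
From mathcomp Require Import all_boot all_order all_algebra.
From mathcomp Require Import reals.
From mathcomp Require Import complex.
From mathcomp Require Import mpoly.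
Set Implicit Arguments. Unset Strict Implicit. Unset Printing Implicit Defensive.
Import Order.TTheory GRing.Theory Num.Theory.
Local Open Scope ring_scope.
Local Open Scope complex_scope.

Section Defs.
Variable R : realType.
Local Notation C := R[i].

(* ---------- The projective line P^1(C) = C ∪ {∞}: [Some z] is z, [None] is ∞ *)
Definition P1 := option C.

(* ---------- Rational functions f = p/q, (p,q) coprime (in lowest terms). *)
Definition rdeg (p q : {poly C}) : nat := (maxn (size p) (size q)).-1.

(* action on P^1 of f = p/q (coprime p q); at ∞ we evaluate the
   homogenisations Y^d p(X/Y), Y^d q(X/Y) at (1,0), d = rdeg p q. *)
Definition ratP1 (p q : {poly C}) (x : P1) : P1 :=
  match x with
  | Some z => if q.[z] != 0 then Some (p.[z] / q.[z]) else None
  | None => let d := rdeg p q in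
            if q`_d != 0 then Some (p`_d / q`_d) else None
  end.

Definition mobius (a b c d : C) (x : P1) : P1 :=
  match x with
  | Some z => if c * z + d != 0 then Some ((a * z + b) / (c * z + d)) else None
  | None => if c != 0 then Some (a / c) else None
  end.

Definition mobius_conj (g1 g2 : P1 -> P1) : Prop :=
  exists a b c d : C, a * d - b * c != 0 /\
    forall x, mobius a b c d (g1 x) = g2 (mobius a b c d x).

Definition chebyshev (d : nat) (T : {poly C}) : Prop :=
  forall z : C, z != 0 -> T.[z + z^-1] = z ^+ d + z ^- d.

Definition cdiff (h : C -> C) (z0 : C) : Prop :=
  exists l : C, forall e : R, 0 < e -> exists dl : R, 0 < dl /\
    forall z : C, z != z0 -> `|z - z0| < dl%:C ->
      `|(h z - h z0) / (z - z0) - l| < e%:C.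

Definition chart_inf (u : C) : P1 := if u == 0 then None else Some u^-1.

Definition holoP1 (Theta : C -> P1) : Prop :=
  forall z0 : C, exists dl : R, 0 < dl /\ exists h : C -> C, cdiff h z0 /\
    ((forall z, `|z - z0| < dl%:C -> Theta z = Some (h z)) \/
     (forall z, `|z - z0| < dl%:C -> Theta z = chart_inf (h z))).

Definition lattice_pt (w1 w2 : C) (m k : int) : C := m%:~R * w1 + k%:~R * w2.

(* f = p/q is a Lattès map: there is an elliptic curve E = C / Lambda
   (Lambda = Z w1 + Z w2 a lattice), an affine map L(z) = a z + b on E
   (well defined: a Lambda ⊆ Lambda) and a nonconstant holomorphic map
   Theta : E -> P^1 (a Lambda-periodic holomorphic map C -> P^1; nonconstant
   holomorphic maps from a compact Riemann surface are finite) such that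
   f o Theta = Theta o L, i.e. f = Theta o L o Theta^-1. *)
Definition lattes (p q : {poly C}) : Prop :=
  exists w1 w2 : C, w1 != 0 /\ (w2 / w1) \notin Num.real /\
  exists a b : C,
    (forall m k : int, exists m' k' : int,
        a * lattice_pt w1 w2 m k = lattice_pt w1 w2 m' k') /\
  exists Theta : C -> P1,
    (forall z (m k : int), Theta (z + lattice_pt w1 w2 m k) = Theta z) /\
    holoP1 Theta /\
    (exists z1 z2, Theta z1 <> Theta z2) /\
    (forall z, ratP1 p q (Theta z) = Theta (a * z + b)).

Definition exceptional (p q : {poly C}) : Prop :=
  let d := rdeg p q in
  mobius_conj (ratP1 p q) (ratP1 'X^d 1) \/
  mobius_conj (ratP1 p q) (ratP1 1 'X^d) \/
  (exists T, chebyshev d T /\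
     (mobius_conj (ratP1 p q) (ratP1 T 1) \/
      mobius_conj (ratP1 p q) (ratP1 (- T) 1))) \/
  lattes p q.

Definition pt (n : nat) := 'I_n -> P1.
Definition pset (n : nat) := pt n -> Prop.

(* homogeneous coordinates: variables lshift i = X_i, rshift i = Y_i;
   z ~ (z : 1), ∞ ~ (1 : 0) *)
Definition hcoord (n : nat) (x : pt n) (k : 'I_(n + n)) : C :=
  match split k with
  | inl i => if x i is Some z then z else 1
  | inr i => if x i is Some _ then 1 else 0
  end.

Definition multihom (n : nat) (P : {mpoly C[n + n]}) : Prop :=
  exists dg : 'I_n -> nat, forall m, m \in msupp P ->
    forall i : 'I_n, (m (lshift n i) + m (rshift n i))%N = dg i.

Definition zclosed (n : nat) (Z : pset n) : Prop :=
  exists E : {mpoly C[n + n]} -> Prop,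
    (forall P, E P -> multihom P) /\
    forall x, Z x <-> (forall P, E P -> P.@[hcoord x] = 0).

Definition subs (n : nat) (A B : pset n) : Prop := forall x, A x -> B x.
Definition seteq (n : nat) (A B : pset n) : Prop := forall x, A x <-> B x.

Definition zclosure (n : nat) (A : pset n) : pset n :=
  fun x => forall Z, zclosed Z -> subs A Z -> Z x.

Definition irred (n : nat) (V : pset n) : Prop :=
  zclosed V /\ (exists x, V x) /\
  forall Z1 Z2 : pset n, zclosed Z1 -> zclosed Z2 ->
    subs V (fun x => Z1 x \/ Z2 x) -> subs V Z1 \/ subs V Z2.

Definition irr_component (n : nat) (V W : pset n) : Prop :=
  irred V /\ subs V W /\
  forall V' : pset n, irred V' -> subs V V' -> subs V' W -> seteq V' V.

Definition image (n : nat) (F : pt n -> pt n) (A : pset n) : pset n :=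
  fun y => exists x, A x /\ F x = y.

Definition periodic (n : nat) (F : pt n -> pt n) (W : pset n) : Prop :=
  exists k : nat, (0 < k)%N /\ seteq (zclosure (image (iter k F) W)) W.

Definition preperiodic (n : nat) (F : pt n -> pt n) (W : pset n) : Prop :=
  exists m : nat, periodic F (zclosure (image (iter m F) W)).

(* a curve in P^1 x P^1: irreducible closed, proper, infinite
   (hence of dimension exactly 1) *)
Definition curve2 (Cv : pset 2) : Prop :=
  irred Cv /\ (exists x, ~ Cv x) /\
  forall l : list (pt 2), exists x, Cv x /\ ~ List.In x l.

Definition Phi (n : nat) (p q : 'I_n -> {poly C}) (x : pt n) : pt n :=
  fun k => ratP1 (p k) (q k) (x k).

Definition Phi2 (n : nat) (p q : 'I_n -> {poly C}) (i j : 'I_n) (y : pt 2)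
  : pt 2 :=
  fun k => if val k == 0%N then ratP1 (p i) (q i) (y k)
           else ratP1 (p j) (q j) (y k).

Definition proj2 (n : nat) (i j : 'I_n) (x : pt n) : pt 2 :=
  fun k => if val k == 0%N then x i else x j.

End Defs.

(* Main.v *)
Require Import Defs.
From Stdlib Require List.
From HB Require Import structures.
From mathcomp Require Import all_boot all_order all_algebra.
From mathcomp Require Import boolp classical_sets functions reals complex mpoly.
From mathcomp Require Import ring lra zify.
Set Implicit Arguments. Unset Strict Implicit. Unset Printing Implicit Defensive.
Import Order.TTheory GRing.Theory Num.Theory.
Local Open Scope ring_scope.
Local Open Scope complex_scope.

(* Algebraic dependence between the coordinates of an irreducible closed set is a matroid, and the coordinates x_i
   and f_i(x_i) are parallel in it.  Let F be the iterate of Phi fixing the eventual image of V, and let H be an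
   equation of least degree for the projection of that image to a circuit a, b, c, ... of at least three coordinates.
   The ratio of the partial derivatives H_a, H_b is algebraic over the functions of the coordinates other than c, and
   comparing its minimal relation with the pull-back of that relation by F gives N(F u) F_a'^D = N(u) F_b'^D for a
   rational function N and some D > 0.  Along an orbit this specialises to a form w = (alpha / beta) dx^D on the
   projective line with f_a^* w = k w.
   A map with such a form is exceptional: the orders r of w satisfy r(x) = e_x r(f x) after a shift, hence
   0 <= r <= D and r = 0 or r divides D.  The set r = 0 has at most two points; two of them give a power map, one a
   Chebyshev polynomial, none a Lattes map.  In the last case the linearisation at a repelling fixed point yields
   an entire solution of T'^D = C0 b(T) with T(lam z) = f(T(z)), and recurrence of generic values makes T doubly periodic.
   So circuits have at most two elements.  If V' is an irreducible set containing V and lying on the curves of all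
   dependent pairs, every coordinate on V' is algebraic over a maximal independent family T0 of V.  A function
   vanishing on V but not on V' would then divide a nonzero function of the coordinates T0 that vanishes on V. *)

(** * Compactness in the complex plane *)

(** A circuit of at least three coordinates leaves, besides [a] and [b], a coordinate [c] to
    eliminate. Polynomials free of [X_c] vanish on the variety only if they are zero, so an identity
    between such polynomials on the variety holds on the whole affine space. This lets the other
    coordinates move along an arbitrary orbit, off the variety, when the relation is specialised; a
    pair of coordinates offers no such elimination. The specialised forms are at first only related
    by pull-back, each to the next, up to constants. Their quotients have bounded degree and turn
    out constant on fibres of iterates that are larger than this degree, hence constant, which makes
    a single form invariant. The elliptic curve of the Lattes case is not obtained from an orbifold
    covering but from one global solution of a differential equation. Uniqueness of solutions gives
    a symmetry s -> w + al (s - z) for any two points z, w with the same generic value, where al is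
    a root of unity; two symmetries with the same z and al differ by a period. A bound on how far
    one must move to reach a given generic value supplies periods in all directions. *)

Section Nm.
Variable R : realType.
Local Notation C := R[i].

(** The norm of [C] takes its values in [C]; [nm] is the same modulus as an element of [R], where
    suprema and linear arithmetic apply. *)
Definition nm (z : C) : R := complex.Re `|z|.

Lemma nmE z : `|z| = (nm z)%:C.
Proof.
rewrite /nm; have : `|z| \is Num.real by apply: normr_real.
by case: z => a b; rewrite normc_def.
Qed.

Lemma nm_ge0 z : 0 <= nm z.
Proof. by have := normr_ge0 z; rewrite nmE lecR. Qed.

Lemma nm0 : nm 0 = 0. Proof. by rewrite /nm normr0. Qed.
Lemma nm1 : nm 1 = 1. Proof. by rewrite /nm normr1. Qed.

Lemma nm_eq0 z : (nm z == 0) = (z == 0).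
Proof. by rewrite -[RHS]normr_eq0 nmE -(inj_eq (@complexI R)). Qed.

Lemma nm_gt0 z : (0 < nm z) = (z != 0).
Proof. by rewrite lt_neqAle nm_ge0 andbT eq_sym nm_eq0. Qed.

Lemma nmM x y : nm (x * y) = nm x * nm y.
Proof. by apply: (@complexI R); rewrite rmorphM -!nmE normrM. Qed.

Lemma nmV x : nm x^-1 = (nm x)^-1.
Proof. by apply: (@complexI R); rewrite fmorphV -!nmE normfV. Qed.

Lemma nmX x n : nm (x ^+ n) = nm x ^+ n.
Proof. by apply: (@complexI R); rewrite rmorphXn -!nmE normrX. Qed.

Lemma nmN x : nm (- x) = nm x.
Proof. by rewrite /nm normrN. Qed.

Lemma nmB x y : nm (x - y) = nm (y - x).
Proof. by rewrite -nmN opprB. Qed.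

Lemma nmD x y : nm (x + y) <= nm x + nm y.
Proof. by rewrite -lecR rmorphD /= -!nmE ler_normD. Qed.

Lemma nmD3 (y x z : C) : nm (x - z) <= nm (x - y) + nm (y - z).
Proof. by have := nmD (x - y) (y - z); rewrite addrA subrK. Qed.

Lemma nm_sub x y : nm x - nm y <= nm (x - y).
Proof. by have := nmD (x - y) y; rewrite subrK -lerBlDr. Qed.

Lemma nmR (r : R) : nm r%:C = `|r|.
Proof. by apply: (@complexI R); rewrite -nmE normc_def /= expr0n addr0 sqrtr_sqr. Qed.

Lemma nm_real (r : R) : 0 <= r -> nm r%:C = r.
Proof. by move=> h; rewrite nmR ger0_norm. Qed.

Lemma nm_nat n : nm n%:R = n%:R.
Proof. by rewrite -(rmorph_nat (@real_complex R)) nm_real. Qed.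

Lemma nmRe (z : C) : `|complex.Re z| <= nm z.
Proof.
case: z => a b; rewrite /nm normc_def /= -sqrtr_sqr ler_wsqrtr //.
by rewrite lerDl sqr_ge0.
Qed.

Lemma nmIm (z : C) : `|complex.Im z| <= nm z.
Proof.
case: z => a b; rewrite /nm normc_def /= -sqrtr_sqr ler_wsqrtr //.
by rewrite lerDr sqr_ge0.
Qed.

Lemma nm_ReIm (z : C) : nm z <= `|complex.Re z| + `|complex.Im z|.
Proof.
case: z => a b /=.
have -> : a +i* b = a%:C + 'i * b%:C by simpc.
apply: le_trans (nmD _ _) _; rewrite nmM !nmR.
have -> : nm 'i = 1; last by rewrite mul1r.
by rewrite /nm normc_def /= expr0n expr1n add0r sqrtr1.
Qed.

Lemma nm_expr_eq1 (z : C) n : (0 < n)%N -> z ^+ n = 1 -> nm z = 1.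
Proof.
move=> n0 /(congr1 nm); rewrite nmX nm1 => /eqP.
by rewrite pexpr_eq1 ?nm_ge0 // => /eqP.
Qed.

Lemma nm_expr_gt1 (z : C) n : (0 < n)%N -> 1 < nm (z ^+ n) -> 1 < nm z.
Proof.
move=> n0; rewrite nmX => h; rewrite ltNge; apply/negP => h2.
by move: h; rewrite ltNge exprn_ile1 ?nm_ge0.
Qed.

Lemma nm_lt (z : C) (r : R) : (`|z| < r%:C) = (nm z < r).
Proof. by rewrite nmE ltcR. Qed.

Lemma archi_nat (x : R) : exists n : nat, x < n%:R.
Proof.
exists (Num.bound `|x|); apply: le_lt_trans (ler_norm _) _.
by apply: archi_boundP; rewrite normr_ge0.
Qed.

Lemma bern (x : R) n : 0 <= x -> 1 + n%:R * x <= (1 + x) ^+ n.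
Proof.
move=> x0; elim: n => [|n IH]; first by rewrite mul0r addr0.
rewrite exprS -natr1; apply: le_trans (ler_wpM2l _ IH); last by lra.
have : 0 <= n%:R * x * x by rewrite !mulr_ge0.
lra.
Qed.

Lemma bern_sub (x : R) n : 0 <= x <= 1 -> 1 - n%:R * x <= (1 - x) ^+ n.
Proof.
move=> /andP[x0 x1]; elim: n => [|n IH]; first by rewrite mul0r subr0.
rewrite exprS -natr1; apply: le_trans (ler_wpM2l _ IH); last by lra.
have : 0 <= n%:R * x * x by rewrite !mulr_ge0.
lra.
Qed.

Lemma expr_large (t M : R) : 1 < t -> exists j, M < t ^+ j.
Proof.
move=> t1; have [n hn] := archi_nat (M / (t - 1)); exists n.
have h : 0 <= t - 1 by lra.
have := bern n h; rewrite subrKC; apply: lt_le_trans.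
by move: hn; rewrite ltr_pdivrMr; lra.
Qed.

Lemma expr_small (t e : R) : 0 <= t < 1 -> 0 < e -> exists j, t ^+ j < e.
Proof.
move=> /andP[t0 t1] e0; have [->|tn0] := eqVneq t 0.
  by exists 1%N; rewrite expr1.
have tp : 0 < t by rewrite lt_neqAle eq_sym tn0.
have [] := @expr_large t^-1 e^-1; first by rewrite invf_gt1.
by move=> j hj; exists j; move: hj; rewrite exprVn ltf_pV2 ?posrE ?exprn_gt0.
Qed.

(** Continuous induction: let s be the supremum of the t such that [P] holds on [0, t]. The limit
    hypothesis gives [P s], and if s < 1 the step hypothesis pushes beyond s. *)
Lemma real_ind (P : R -> Prop) :
  P 0 ->
  (forall t : R, 0 <= t < 1 -> P t -> exists2 e : R, 0 < e & forall s : R, t <= s <= t + e -> P s) ->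
  (forall t : R, 0 < t <= 1 -> (forall s : R, 0 <= s < t -> P s) -> P t) ->
  forall t : R, 0 <= t <= 1 -> P t.
Proof.
move=> P0 Ps Pl; pose S := [set t : R | 0 <= t <= 1 /\ forall s : R, 0 <= s <= t -> P s]%classic.
have S0 : S 0.
  split; first by rewrite lexx ler01.
  by move=> s hs; have -> : s = 0 by lra.
have hS : has_sup S by split; [exists 0 | exists 1 => t [h _]; lra].
have ub : forall t, S t -> t <= sup S by move=> t; apply: sup_upper_bound.
have s0 : 0 <= sup S by apply: ub.
have s1 : sup S <= 1 by apply: ge_sup; [exists 0| move=> t [h _]; lra].
have below : forall s : R, 0 <= s < sup S -> P s.
  move=> s /andP[h0 h1]; have [t [_ tP] st] := sup_adherent (eps := sup S - s) ltac:(lra) hS.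
  by apply: tP; lra.
have PS : P (sup S).
  have [e|n0] := eqVneq (sup S) 0; first by rewrite e.
  by apply: Pl => //; rewrite s1 andbT lt_neqAle eq_sym n0.
have SS : forall s : R, 0 <= s <= sup S -> P s.
  move=> s hs; have [e|n0] := eqVneq s (sup S); first by rewrite e.
  by apply: below; rewrite lt_neqAle n0 /=; lra.
have [e1|n1] := eqVneq (sup S) 1.
  by move=> t ht; apply: SS; rewrite e1.
have lt1 : sup S < 1 by rewrite lt_neqAle n1.
have [|e e0 he] := Ps (sup S) _ PS; first by rewrite s0 lt1.
pose e' := Num.min e (1 - sup S).
have e'0 : 0 < e' by rewrite lt_min; apply/andP; split; lra.
have e'1 : e' <= e by rewrite ge_min lexx.
have e'2 : e' <= 1 - sup S by rewrite ge_min lexx orbT.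
have : S (sup S + e').
  split; first by lra.
  move=> s hs; have [h|h] := leP s (sup S); first by apply: SS; lra.
  by apply: he; lra.
by move/ub; lra.
Qed.

(* Heine-Borel for a property of sets that is stable under subsets and unions. *)
Definition hb_stable (T : Type) (Q : (T -> Prop) -> Prop) :=
  (forall A B : T -> Prop, (forall x, A x -> B x) -> Q B -> Q A) /\
  (forall A B : T -> Prop, Q A -> Q B -> Q (fun x => A x \/ B x)).

(** Continuous induction on t, for [Q] of the segment [a, a + t (b - a)]; a union with the local
    neighbourhood advances the claim both at a step and at a limit. *)
Lemma hb1 (Q : (R -> Prop) -> Prop) (a b : R) : hb_stable Q -> a < b ->
  (forall x : R, a <= x <= b -> exists2 e : R, 0 < e & Q (fun y : R => `|y - x| < e)) ->
  Q (fun y : R => a <= y <= b).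
Proof.
move=> [Qs Qu] ab loc.
suff H : forall t : R, 0 <= t <= 1 -> Q (fun y : R => a <= y <= a + t * (b - a)).
  by apply: Qs (H 1 ltac:(lra)) => y; lra.
apply: real_ind.
- have [e e0] := loc a ltac:(lra); apply: Qs => y hy.
  have -> : y = a by lra.
  by rewrite subrr normr0.
- move=> t ht IH; have [|e e0 he] := loc (a + t * (b - a)); first by nra.
  exists (e / 2 / (b - a)); first by rewrite !divr_gt0 //; lra.
  move=> s hs; apply: Qs (Qu _ _ IH he) => y hy.
  have [h|h] := leP y (a + t * (b - a)); first by left; lra.
  right; rewrite ger0_norm; last by lra.
  have : (s - t) * (b - a) <= e / 2.
    by rewrite -ler_pdivlMr; lra.
  nra.
- move=> t ht IH; have [|e e0 he] := loc (a + t * (b - a)); first by nra.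
  pose s := Num.max 0 (t - e / 2 / (b - a)).
  have hs : 0 <= s < t.
    rewrite /s le_max lexx /= gt_max; apply/andP; split; first by lra.
    have : 0 < e / 2 / (b - a) by rewrite !divr_gt0 //; lra.
    lra.
  have hs2 : (t - s) * (b - a) <= e / 2.
    rewrite -ler_pdivlMr; last by lra.
    have : t - e / 2 / (b - a) <= s by rewrite /s le_max lexx orbT.
    lra.
  apply: Qs (Qu _ _ (IH _ hs) he) => y hy.
  have [h|h] := leP y (a + s * (b - a)); first by left; lra.
  by right; rewrite ltr_norml; nra.
Qed.

Lemma hb2 (Q : (C -> Prop) -> Prop) (M : R) : hb_stable Q ->
  (forall z, exists2 e : R, 0 < e & Q (fun y => nm (y - z) < e)) ->
  Q (fun y => nm y <= M).
Proof.
move=> [Qs Qu] loc.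
pose N := Num.max 1 M.
have N1 : 1 <= N by rewrite le_max lexx.
have NM : M <= N by rewrite le_max lexx orbT.
suff H : Q (fun y => - N <= complex.Re y <= N /\ - N <= complex.Im y <= N).
  apply: Qs H => y hy; have := nmRe y; have := nmIm y.
  by rewrite !ler_norml; lra.
apply: (@hb1 (fun A => Q (fun y => A (complex.Re y) /\ - N <= complex.Im y <= N)) (-N) N).
- split=> [A B AB|A B QA QB].
    by apply: Qs => y [h1 h2]; split=> //; apply: AB.
  by apply: Qs (Qu _ _ QA QB) => y [[h|h] h2]; [left|right].
- by lra.
move=> x hx.
(* Tube lemma: a second Heine-Borel argument, on the imaginary parts, gives a strip of positive
   width around the abscissa x. *)
pose Q1 := fun B : R -> Prop => exists2 e : R, 0 < e &
   Q (fun y => `|complex.Re y - x| < e /\ B (complex.Im y)).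
suff : Q1 (fun y : R => - N <= y <= N) by [].
apply: hb1; [|by lra|].
  split=> [A B AB [e e0 he]|A B [e e0 he] [e' e0' he']].
    by exists e => //; apply: Qs he => y [h1 h2]; split=> //; apply: AB.
  exists (Num.min e e'); first by rewrite lt_min e0.
  apply: Qs (Qu _ _ he he') => y; rewrite lt_min => -[/andP[h1 h2] [h|h]]; [left|right]; by split.
move=> y hy; have [e e0 he] := loc (x +i* y).
exists (e / 2); first by lra.
exists (e / 2); first by lra.
apply: Qs he => z [h1 h2].
have := nm_ReIm (z - (x +i* y)); case: z h1 h2 => a b /=; lra.
Qed.

Lemma evt_min (g : C -> R) (M : R) : 0 <= M ->
  (forall z (e : R), 0 < e -> exists2 d : R, 0 < d & forall w, nm (w - z) < d -> `|g w - g z| < e) ->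
  (exists m, forall z, m <= g z) ->
  exists2 z, nm z <= M & forall w, nm w <= M -> g z <= g w.
Proof.
move=> M0 gc [m hm].
pose S := [set y : R | exists2 z, nm z <= M & y = g z]%classic.
have iS : has_inf S.
  by split; [exists (g 0); exists 0; rewrite ?nm0 | exists m => y [z _ ->]].
have lb : forall z, nm z <= M -> inf S <= g z.
  by move=> z hz; apply: inf_lbound; [case: iS | exists z].
(* If the infimum is not attained, [g] stays above it by a margin near every point of the disc, and
   Heine-Borel makes the margin uniform. *)
apply: contrapT => no.
suff [e e0 he] : exists2 e : R, 0 < e & forall z, nm z <= M -> nm z <= M -> inf S + e <= g z.
  have [y [z hz ->]] := inf_adherent e0 iS; have := he _ hz hz; lra.
pose Q := fun A : C -> Prop => exists2 e : R, 0 < e & forall z, A z -> nm z <= M -> inf S + e <= g z.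
apply: (hb2 (Q := Q)).
  split=> [A B AB [e e0 he]|A B [e e0 he] [e' e0' he']].
    by exists e => // z /AB; apply: he.
  exists (Num.min e e'); first by rewrite lt_min e0.
  move=> z [/he h|/he' h] /h {}h; apply: le_trans h; by rewrite lerD2l ge_min lexx ?orbT.
move=> z; have [hz|hz] := leP (nm z) M; last first.
  exists (nm z - M); first by lra.
  exists 1 => // w hw hw2; have := nm_sub z w; rewrite nmB; lra.
have gz : inf S < g z.
  rewrite ltNge; apply/negP => h; apply: no; exists z => // w hw.
  by apply: le_trans h (lb _ hw).
have [d d0 hd] := gc z ((g z - inf S) / 2) ltac:(lra).
exists d => //; exists ((g z - inf S) / 2); first by lra.
by move=> w /hd; rewrite ltr_norml => h _; lra.
Qed.

(* Caristi/Ekeland: a nonnegative function whose descent slope exceeds c wherever it is positive has a zero. *)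
Lemma ekeland (g : C -> R) (z : C) (c : R) : 0 < c ->
  (forall w (e : R), 0 < e -> exists2 d : R, 0 < d & forall v, nm (v - w) < d -> `|g v - g w| < e) ->
  (forall w, 0 <= g w) ->
  (forall w, 0 < g w <= g z -> exists v, v != w /\ g v < g w - c * nm (v - w)) ->
  exists2 w, g w = 0 & nm (w - z) <= g z / c.
Proof.
move=> c0 gc g0 desc.
pose h := fun y => g (z + y) + c * nm y.
have hc : forall w (e : R), 0 < e -> exists2 d : R, 0 < d & forall v, nm (v - w) < d -> `|h v - h w| < e.
  move=> w e e0; have [d d0 hd] := gc (z + w) (e / 2) ltac:(lra).
  exists (Num.min d (e / 2 / c)); first by rewrite lt_min d0 !divr_gt0 //; lra.
  move=> v; rewrite lt_min ltr_pdivlMr // => /andP[h1 h2].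
  have := hd (z + v); rewrite opprD addrACA subrr add0r => /(_ h1).
  have a1 := nm_sub v w; have a2 := nm_sub w v; rewrite (nmB w) in a2.
  rewrite /h !ltr_norml; nra.
(* A point with h <= g z lies within g z / c, so the radius g z / c + 1 makes the minimum on the
   disc a minimum on the whole plane. *)
have [w hw wmin] : exists2 w, nm w <= g z / c + 1 & forall v, nm v <= g z / c + 1 -> h w <= h v.
  apply: evt_min => //; first by rewrite addr_ge0 // divr_ge0 // ltW.
  by exists 0 => v; rewrite addr_ge0 // mulr_ge0 ?nm_ge0 // ltW.
have h0 : h w <= g z.
  by have := wmin 0; rewrite /h addr0 nm0 mulr0 addr0; apply; rewrite addr_ge0 // divr_ge0 // ltW.
have wle : nm w <= g z / c.
  by rewrite ler_pdivlMr //; have := g0 (z + w); rewrite /h in h0; lra.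
exists (z + w); last by rewrite addrC addKr.
apply/eqP; rewrite eq_le g0 andbT leNgt; apply/negP => gp.
have [|v [vw hv]] := desc (z + w).
  by rewrite gp /=; have := nm_ge0 w; rewrite /h in h0; nra.
have a1 := nmD w (v - (z + w)).
have e1 : w + (v - (z + w)) = v - z by ring.
rewrite e1 in a1.
have hv2 : h (v - z) < h w by rewrite /h subrKC; nra.
have : nm (v - z) <= g z / c + 1.
  have : nm (v - z) <= g z / c.
    rewrite ler_pdivlMr //; have := g0 v; move: hv2; rewrite {1}/h subrKC; lra.
  lra.
by move/wmin; lra.
Qed.

Lemma bolzano_weierstrass (M : R) (u : nat -> C) : (forall j, nm (u j) <= M) ->
  exists y, forall e : R, 0 < e -> forall N, exists2 j, (N <= j)%N & nm (u j - y) < e.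
Proof.
move=> hu; apply: contrapT => no.
pose Q := fun A : C -> Prop => exists N, forall j, (N <= j)%N -> ~ A (u j).
have [] : Q (fun y => nm y <= M).
  apply: hb2.
    split=> [A B AB [N hN]|A B [N hN] [N' hN']].
      by exists N => j /hN h /AB.
    exists (maxn N N') => j; rewrite geq_max => /andP[/hN h1 /hN' h2]; by case.
  move=> y; apply: contrapT => no2; apply: no; exists y => e e0 N.
  apply: contrapT => no3; apply: no2; exists e => //; exists N => j hj hj2.
  by apply: no3; exists j.
by move=> N /(_ N (leqnn _)); apply.
Qed.

(** The intervals of radius d j = M th^j / (1 - th) around u j are nested, because d j - d (j + 1)
    is exactly the allowed step; the supremum of their left ends lies in all of them. *)
Lemma geom_limR (u : nat -> R) (M th : R) : 0 <= th < 1 -> 0 <= M ->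
  (forall j, `|u j.+1 - u j| <= M * th ^+ j) ->
  exists l, forall j, `|l - u j| <= M * th ^+ j / (1 - th).
Proof.
move=> /andP[t0 t1] M0 hu.
pose d j := M * th ^+ j / (1 - th).
have dS j : d j - d j.+1 = M * th ^+ j by rewrite /d exprS; field; lra.
have lo i j : (i <= j)%N -> u i - d i <= u j - d j.
  move=> /subnKC <-; elim: (j - i)%N => [|k IH]; first by rewrite addn0.
  apply: le_trans IH _; rewrite addnS.
  by have := hu (i + k)%N; have := dS (i + k)%N; rewrite ler_norml; lra.
have hi i j : (i <= j)%N -> u j + d j <= u i + d i.
  move=> /subnKC <-; elim: (j - i)%N => [|k IH]; first by rewrite addn0.
  apply: le_trans IH; rewrite addnS.
  by have := hu (i + k)%N; have := dS (i + k)%N; rewrite ler_norml; lra.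
have dge j : 0 <= d j by rewrite /d divr_ge0 // ?mulr_ge0 ?exprn_ge0 //; lra.
pose S := [set y : R | exists j, y = u j - d j]%classic.
have ub i : ubound S (u i + d i).
  move=> _ [j ->]; have := dge i; have := dge j.
  by have [/lo|/ltnW/hi] := leqP j i; lra.
have hS : has_sup S by split; [exists (u 0%N - d 0%N); exists 0%N | exists (u 0%N + d 0%N)].
exists (sup S) => j; rewrite ler_norml.
have : u j - d j <= sup S by apply: sup_upper_bound => //; exists j.
have : sup S <= u j + d j by apply: ge_sup (ub j); case: hS.
rewrite /d; lra.
Qed.

Lemma geom_lim (u : nat -> C) (M th : R) : 0 <= th < 1 -> 0 <= M ->
  (forall j, nm (u j.+1 - u j) <= M * th ^+ j) ->
  exists l, forall j, nm (l - u j) <= 2 * M * th ^+ j / (1 - th).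
Proof.
move=> ht M0 hu.
have reB (x y : C) : complex.Re (x - y) = complex.Re x - complex.Re y by case: x y => [? ?] [].
have imB (x y : C) : complex.Im (x - y) = complex.Im x - complex.Im y by case: x y => [? ?] [].
have [a ha] := @geom_limR (fun j => complex.Re (u j)) M th ht M0
  (fun j => le_trans (eq_ind _ (fun x => `|x| <= _) (nmRe _) _ (reB _ _)) (hu j)).
have [b hb] := @geom_limR (fun j => complex.Im (u j)) M th ht M0
  (fun j => le_trans (eq_ind _ (fun x => `|x| <= _) (nmIm _) _ (imB _ _)) (hu j)).
exists (a +i* b) => j; apply: le_trans (nm_ReIm _) _.
by rewrite reB imB /=; have := ha j; have := hb j; lra.
Qed.

End Nm.

(** * Functions with a uniform quadratic Taylor remainder *)

Section Smooth.
Variable R : realType.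
Local Notation C := R[i].
Local Notation nm := (@nm R).
Implicit Types (h k : C -> C) (z w : C) (r K : R).

Definition near z (P : C -> Prop) := exists2 r : R, 0 < r & forall w, nm (w - z) < r -> P w.

Lemma near_and z (P Q : C -> Prop) : near z P -> near z Q -> near z (fun w => P w /\ Q w).
Proof.
move=> [r r0 hr] [s s0 hs]; exists (Num.min r s); first by rewrite lt_min r0.
by move=> w; rewrite lt_min => /andP[/hr ? /hs].
Qed.

Lemma near_imp z (P Q : C -> Prop) : (forall w, P w -> Q w) -> near z P -> near z Q.
Proof. by move=> PQ [r r0 hr]; exists r => // w /hr /PQ. Qed.

Lemma near_self z (P : C -> Prop) : near z P -> P z.
Proof. by move=> [r r0]; apply; rewrite subrr nm0. Qed.

Lemma near_all z (P : C -> Prop) : (forall w, P w) -> near z P.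
Proof. by move=> h; exists 1. Qed.

Lemma near_near z (P : C -> Prop) : near z P -> near z (fun w => near w P).
Proof.
move=> [r r0 hr]; exists r => // w hw; exists (r - nm (w - z)); first by lra.
by move=> v hv; apply: hr; have := nmD3 w v z; lra.
Qed.

Lemma near_ball z r : 0 < r -> near z (fun w => nm (w - z) < r).
Proof. by move=> r0; exists r. Qed.

(* Quadratic Taylor remainder, uniformly on a disc; this class is stable under pointwise limits with fixed K. *)
Definition c11 h h' z r K := forall v w, nm (v - z) < r -> nm (w - z) < r ->
  nm (h w - h v - h' v * (w - v)) <= K * nm (w - v) ^+ 2.

Definition sm h h' z := exists r K, [/\ 0 < r, 0 <= K & c11 h h' z r K].

(** Add the remainder from v to w and the one from w to v: the values cancel and (h' w - h' v) (w -
    v) is left. *)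
Lemma c11_lip' h h' z r K v w : c11 h h' z r K -> nm (v - z) < r -> nm (w - z) < r ->
  nm (h' w - h' v) <= 2 * K * nm (w - v).
Proof.
move=> H hv hw; have [->|ne] := eqVneq w v; first by rewrite !subrr nm0 mulr0.
have p0 : 0 < nm (w - v) by rewrite nm_gt0 subr_eq0.
have h1 := H w v hw hv; have h2 := H v w hv hw; rewrite (nmB v w) in h1.
have := nmD (h v - h w - h' w * (v - w)) (h w - h v - h' v * (w - v)).
have -> : h v - h w - h' w * (v - w) + (h w - h v - h' v * (w - v)) = (h' w - h' v) * (w - v) by ring.
rewrite nmM => h3; rewrite -(ler_pM2r p0); nra.
Qed.

(** One radius and one constant for the remainder, the sizes and the Lipschitz constants together,
    so that estimates on products and compositions need no further bookkeeping. *)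
Lemma sm_bd h h' z : sm h h' z -> exists r K, [/\ 0 < r, 0 < K & forall v w, nm (v - z) < r -> nm (w - z) < r ->
  [/\ nm (h w - h v - h' v * (w - v)) <= K * nm (w - v) ^+ 2, nm (h' v) <= K, nm (h v) <= K &
      nm (h w - h v) <= K * nm (w - v) /\ nm (h' w - h' v) <= K * nm (w - v)]].
Proof.
move=> [r [K [r0 K0 H]]].
pose r1 := Num.min r 1.
have r10 : 0 < r1 by rewrite lt_min r0 ltr01.
have r1r : r1 <= r by rewrite ge_min lexx.
have r11 : r1 <= 1 by rewrite ge_min lexx orbT.
pose B := nm (h' z) + 2 * K.
have B0 : 0 <= B by rewrite addr_ge0 ?nm_ge0 ?mulr_ge0.
have zz : nm (z - z) < r by rewrite subrr nm0.
have hB v : nm (v - z) < r1 -> nm (h' v) <= B.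
  move=> hv; have hv2 : nm (v - z) < r by lra.
  have := c11_lip' H zz hv2; have := nm_sub (h' v) (h' z); have := nm_ge0 (v - z); rewrite /B; nra.
have hL v w : nm (v - z) < r1 -> nm (w - z) < r1 -> nm (h w - h v) <= (B + 2 * K) * nm (w - v).
  move=> hv hw; have hv2 : nm (v - z) < r by lra. have hw2 : nm (w - z) < r by lra.
  have a1 := H v w hv2 hw2; have a2 := hB v hv; have a3 := nm_sub (h w - h v) (h' v * (w - v)).
  have a4 := nmD3 z w v; rewrite (nmB z v) in a4; rewrite nmM in a3; have p := nm_ge0 (w - v).
  have a5 : nm (h' v) * nm (w - v) <= B * nm (w - v) by apply: ler_wpM2r.
  have a6 : K * nm (w - v) * nm (w - v) <= K * nm (w - v) * 2.
    by apply: ler_wpM2l; [rewrite mulr_ge0|lra].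
  rewrite expr2 in a1; nra.
exists r1, (B + 2 * K + nm (h z) + 1); split=> //.
  by have := nm_ge0 (h z); lra.
move=> v w hv hw; have hv2 : nm (v - z) < r by lra. have hw2 : nm (w - z) < r by lra.
have := nm_ge0 (h z); have p := nm_ge0 (w - v); have p2 := sqr_ge0 (nm (w - v)) => q.
split.
- by apply: le_trans (H v w hv2 hw2) _; nra.
- by have := hB v hv; lra.
- have zz1 : nm (z - z) < r1 by rewrite subrr nm0.
  have := hL z v zz1 hv; have := nm_sub (h v) (h z); have := nm_ge0 (v - z); nra.
split; first by have := hL v w hv hw; nra.
by have := c11_lip' H hv2 hw2; nra.
Qed.

Lemma sm_near h h' z : sm h h' z -> near z (sm h h').
Proof.
move=> [r [K [r0 K0 H]]]; exists r => // w hw; exists (r - nm (w - z)), K; split=> //; first by lra.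
by move=> u v hu hv; apply: H; [have := nmD3 w u z | have := nmD3 w v z]; lra.
Qed.

Lemma sm_cont2 h h' z (e : R) : sm h h' z -> 0 < e ->
  near z (fun w => nm (h w - h z) < e /\ nm (h' w - h' z) < e).
Proof.
move=> /sm_bd [r [K [r0 K0 H]]] e0; exists (Num.min r (e / K)).
  by rewrite lt_min r0 divr_gt0.
move=> w; rewrite lt_min ltr_pdivlMr // => /andP[h1 h2].
have [] := H z w _ h1; first by rewrite subrr nm0.
by move=> _ _ _ [a b]; split; nra.
Qed.

Lemma sm_cont h h' z (e : R) : sm h h' z -> 0 < e -> near z (fun w => nm (h w - h z) < e).
Proof. by move=> H /(sm_cont2 H); apply: near_imp => w []. Qed.

Lemma sm_ne0 h h' z : sm h h' z -> h z != 0 -> near z (fun w => h w != 0).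
Proof.
move=> H; rewrite -nm_gt0 => /(sm_cont H); apply: near_imp => w hw.
by rewrite -nm_gt0; have := nm_sub (h z) (h w); rewrite nmB; lra.
Qed.

Lemma sm_comp_near h h' z (P : C -> Prop) : sm h h' z -> near (h z) P -> near z (fun w => P (h w)).
Proof. by move=> H [e e0 he]; apply: near_imp (sm_cont H e0) => w /he. Qed.

Lemma sm_ext h h' k k' z : near z (fun w => k w = h w /\ k' w = h' w) -> sm h h' z -> sm k k' z.
Proof.
move=> [s s0 hs] [r [K [r0 K0 H]]]; exists (Num.min r s), K; split=> //; first by rewrite lt_min r0.
move=> v w; rewrite !lt_min => /andP[v1 v2] /andP[w1 w2].
by have [-> ->] := hs v v2; have [-> _] := hs w w2; apply: H.
Qed.

Lemma sm_const c z : sm (fun=> c) (fun=> 0) z.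
Proof. by exists 1, 0; split=> // v w _ _; rewrite subrr mul0r subrr nm0 mul0r. Qed.

Lemma sm_id z : sm id (fun=> 1) z.
Proof. by exists 1, 0; split=> // v w _ _ /=; rewrite mul1r subrr nm0 mul0r. Qed.

Lemma sm_add h h' k k' z : sm h h' z -> sm k k' z -> sm (fun w => h w + k w) (fun w => h' w + k' w) z.
Proof.
move=> [r [K [r0 K0 H]]] [r1 [K1 [r10 K10 H1]]].
exists (Num.min r r1), (K + K1); split; [by rewrite lt_min r0|by rewrite addr_ge0|].
move=> v w; rewrite !lt_min => /andP[v1 v2] /andP[w1 w2].
have -> : h w + k w - (h v + k v) - (h' v + k' v) * (w - v) =
  (h w - h v - h' v * (w - v)) + (k w - k v - k' v * (w - v)) by ring.
by apply: le_trans (nmD _ _) _; rewrite mulrDl; apply: lerD; [apply: H|apply: H1].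
Qed.

Lemma sm_mul h h' k k' z : sm h h' z -> sm k k' z ->
  sm (fun w => h w * k w) (fun w => h' w * k w + h w * k' w) z.
Proof.
move=> /sm_bd[r [K [r0 K0 H]]] /sm_bd[r1 [K1 [r10 K10 H1]]].
exists (Num.min r r1), (K * K1 + K * K1 + K * K1); split.
- by rewrite lt_min r0.
- by rewrite !addr_ge0 // mulr_ge0 // ltW.
move=> v w; rewrite !lt_min => /andP[v1 v2] /andP[w1 w2].
have [a1 a2 a3 [a4 _]] := H v w v1 w1; have [b1 b2 b3 [b4 _]] := H1 v w v2 w2.
have [_ _ a5 _] := H w v w1 v1.
have -> : h w * k w - h v * k v - (h' v * k v + h v * k' v) * (w - v) =
  h w * (k w - k v - k' v * (w - v)) + (h w - h v) * (k' v * (w - v)) + (h w - h v - h' v * (w - v)) * k v by ring.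
apply: le_trans (nmD _ _) _; rewrite [X in _ <= X]mulrDl; apply: lerD.
  apply: le_trans (nmD _ _) _; rewrite [X in _ <= X]mulrDl; apply: lerD; rewrite nmM -mulrA.
    by apply: ler_pM; rewrite ?nm_ge0.
  have -> : K * (K1 * nm (w - v) ^+ 2) = (K * nm (w - v)) * (K1 * nm (w - v)) by ring.
  by apply: ler_pM; rewrite ?nm_ge0 // nmM ler_wpM2r ?nm_ge0.
rewrite nmM [K * K1 * _]mulrAC.
by apply: ler_pM; rewrite ?nm_ge0.
Qed.

Lemma sm_comp h h' k k' z : sm h h' z -> sm k k' (h z) -> sm (fun w => k (h w)) (fun w => k' (h w) * h' w) z.
Proof.
move=> /sm_bd[r [K [r0 K0 H]]] /sm_bd[r1 [K1 [r10 K10 H1]]].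
exists (Num.min r (r1 / K)), (K1 * K ^+ 2 + K1 * K); split.
- by rewrite lt_min r0 divr_gt0.
- by rewrite addr_ge0 // !mulr_ge0 ?exprn_ge0 // ltW.
move=> v w; rewrite !lt_min !ltr_pdivlMr // => /andP[v1 v2] /andP[w1 w2].
have zz : nm (z - z) < r by rewrite subrr nm0.
have [a1 a2 a3 [a4 _]] := H v w v1 w1.
have hv : nm (h v - h z) < r1 by have [_ _ _ [? _]] := H z v zz v1; nra.
have hw : nm (h w - h z) < r1 by have [_ _ _ [? _]] := H z w zz w1; nra.
have [b1 b2 b3 [b4 _]] := H1 (h v) (h w) hv hw.
have -> : k (h w) - k (h v) - k' (h v) * h' v * (w - v) =
  (k (h w) - k (h v) - k' (h v) * (h w - h v)) + k' (h v) * (h w - h v - h' v * (w - v)) by ring.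
apply: le_trans (nmD _ _) _; rewrite mulrDl; apply: lerD.
  apply: le_trans b1 _; rewrite -mulrA; apply: ler_wpM2l; first exact: ltW.
  by rewrite -exprMn; apply: lerXn2r; rewrite ?nnegrE ?mulr_ge0 ?nm_ge0 // ltW.
by rewrite nmM -mulrA; apply: ler_pM; rewrite ?nm_ge0.
Qed.

Lemma sm_inv z : z != 0 -> sm (fun w => w^-1) (fun w => - (w ^- 2)) z.
Proof.
rewrite -nm_gt0 => z0; pose a := nm z / 2.
have a0 : 0 < a by rewrite /a; lra.
exists a, (a ^- 3); split=> //; first by rewrite invr_ge0 exprn_ge0 // ltW.
have low v : nm (v - z) < a -> a <= nm v.
  by have := nm_sub z v; rewrite nmB /a; lra.
move=> v w /low hv /low hw.
have v0 : v != 0 by rewrite -nm_gt0; lra.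
have w0 : w != 0 by rewrite -nm_gt0; lra.
have -> : w^-1 - v^-1 - - v ^- 2 * (w - v) = (w - v) ^+ 2 * (w^-1 * v^-1 ^+ 2) by field; rewrite v0 w0.
rewrite nmM nmX mulrC ler_wpM2r ?sqr_ge0 // nmM nmX !nmV.
have -> : a ^- 3 = a^-1 * a^-1 ^+ 2 by rewrite -exprS exprVn.
have iv x : a <= nm x -> (nm x)^-1 <= a^-1 by move=> ?; rewrite lef_pV2 ?posrE //; lra.
apply: ler_pM; rewrite ?exprn_ge0 ?invr_ge0 ?nm_ge0 ?iv //.
by apply: lerXn2r; rewrite ?nnegrE ?invr_ge0 ?nm_ge0 ?iv // ltW.
Qed.

Lemma sm_div h h' k k' z : sm h h' z -> sm k k' z -> k z != 0 ->
  sm (fun w => h w / k w) (fun w => (h' w * k w - h w * k' w) / k w ^+ 2) z.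
Proof.
move=> H1 H2 k0; apply: sm_ext (sm_mul H1 (sm_comp H2 (sm_inv k0))).
apply: near_imp (sm_ne0 H2 k0) => w kw; split=> //; by field.
Qed.

Lemma sm_X h h' z n : sm h h' z -> sm (fun w => h w ^+ n) (fun w => n%:R * h w ^+ n.-1 * h' w) z.
Proof.
move=> H; elim: n => [|n IH].
  by apply: sm_ext (sm_const 1 z); apply: near_all => w; rewrite !mul0r expr0.
apply: sm_ext (sm_mul H IH); apply: near_all => w; rewrite exprS; split=> //=.
case: n {IH} => [|n] /=; first by rewrite !expr0; ring.
have -> : (n.+2%:R : C) = n.+1%:R + 1 by rewrite natr1.
by rewrite exprS; ring.
Qed.

Lemma sm_poly (p : {poly C}) z : sm (horner p) (horner p^`()) z.
Proof.
elim/poly_ind: p => [|p c IH].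
  by apply: sm_ext (sm_const 0 z); apply: near_all => w; rewrite deriv0 !horner0.
apply: sm_ext (sm_add (sm_mul IH (sm_id z)) (sm_const c z)); apply: near_all => w.
by rewrite derivD derivM derivX derivC !hornerE.
Qed.

Lemma sm_pcomp (p : {poly C}) h h' z : sm h h' z -> sm (fun w => p.[h w]) (fun w => p^`().[h w] * h' w) z.
Proof. by move=> H; apply: sm_comp H (sm_poly p _). Qed.

Lemma sm_uniq h h' k' z : sm h h' z -> sm h k' z -> h' z = k' z.
Proof.
move=> [r [K [r0 K0 H]]] [s [L [s0 L0 H2]]].
apply/eqP; rewrite -subr_eq0 -nm_eq0 eq_le nm_ge0 andbT leNgt; apply/negP => p.
pose t := Num.min (Num.min r s) (nm (h' z - k' z) / (K + L + 1)).
have t0 : 0 < t by rewrite !lt_min r0 s0 /= divr_gt0 //; lra.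
have zz a : 0 < a -> nm (z - z) < a by rewrite subrr nm0.
pose w := z + (t / 2)%:C.
have ew : nm (w - z) = t / 2 by rewrite /w addrC addKr nm_real //; lra.
have [tr ts] : t <= r /\ t <= s by split; rewrite !ge_min lexx ?orbT.
have tq : t * (K + L + 1) <= nm (h' z - k' z).
  by rewrite -ler_pdivlMr; [rewrite !ge_min lexx ?orbT|lra].
have h1 := H z w (zz _ r0) ltac:(lra). have h2 := H2 z w (zz _ s0) ltac:(lra).
rewrite ew in h1 h2.
have := nmD3 (h w - h z) (h' z * (w - z)) (k' z * (w - z)).
rewrite -mulrBl nmM ew (nmB (h' z * _)); nra.
Qed.

Lemma sm_uniq_near h h' k k' z : sm h h' z -> sm k k' z -> near z (fun w => h w = k w) -> h' z = k' z.
Proof.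
move=> H1 H2 e; apply: sm_uniq H1 (sm_ext _ H2).
by apply: near_imp e => w ->.
Qed.

Lemma sm_cdiff h h' z : sm h h' z -> cdiff h z.
Proof.
move=> [r [K [r0 K0 H]]]; exists (h' z) => e e0.
exists (Num.min r (e / (K + 1))); split; first by rewrite lt_min r0 divr_gt0 //; lra.
move=> w wz; rewrite nm_lt lt_min ltr_pdivlMr; last by lra.
move=> /andP[w1 w2]; rewrite nm_lt.
have p : 0 < nm (w - z) by rewrite nm_gt0 subr_eq0.
have := H z w _ w1; rewrite subrr nm0 => /(_ r0).
have -> : (h w - h z) / (w - z) - h' z = (h w - h z - h' z * (w - z)) / (w - z).
  by field; rewrite subr_eq0.
rewrite nmM nmV => h1; rewrite ltr_pdivrMr //; nra.
Qed.

Lemma near_avoid z (P : C -> Prop) (s : seq C) : near z P -> exists2 w, P w & w \notin s.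
Proof.
move=> [r r0 hr].
pose u (j : nat) : C := z + (r / (j.+2)%:R)%:C.
have inj : injective u.
  move=> i j /addrI /(@complexI R) e.
  have /mulfI/(_ _ _ e)/invr_inj/eqP : r != 0 by rewrite gt_eqF.
  by rewrite eqr_nat => /eqP [].
have [j hj] : exists j, u j \notin s.
  apply: contrapT => no.
  have sub : {subset [seq u j | j <- iota 0 (size s).+1] <= s}.
    by move=> x /mapP[j _ ->]; apply: contrapT => /negP h; apply: no; exists j.
  have := uniq_leq_size _ sub; rewrite map_inj_uniq ?iota_uniq // size_map size_iota => /(_ isT).
  by rewrite ltnn.
exists (u j) => //; apply: hr.
rewrite /u addrC addKr nm_real; last by rewrite divr_ge0 // ltW.
by rewrite ltr_pdivrMr ?ltr0n // ltr_pMr // ltr1n.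
Qed.

Lemma near_eq_lim h h' k k' z : sm h h' z -> sm k k' z ->
  (forall e : R, 0 < e -> exists2 w, nm (w - z) < e & h w = k w) -> h z = k z.
Proof.
move=> H1 H2 e; apply/eqP; rewrite -subr_eq0 -nm_eq0 eq_le nm_ge0 andbT leNgt; apply/negP => p.
have [r r0 hr] := near_and (sm_cont H1 (e := nm (h z - k z) / 2) ltac:(lra)) (sm_cont H2 (e := nm (h z - k z) / 2) ltac:(lra)).
have [w /hr [h1 h2] ew] := e r r0.
have a := nmD3 (k w) (h z) (k z); rewrite (nmB (h z) (k w)) in a; rewrite ew in h1; lra.
Qed.

End Smooth.

(** * Linearisation at a repelling point *)

Section Koenigs.
Variable R : realType.
Local Notation C := R[i].
Local Notation nm := (@nm R).

Lemma le_geom (x B D th : R) : 0 <= th < 1 -> (forall j, x <= B + D * th ^+ j) -> x <= B.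
Proof.
move=> ht H; rewrite leNgt; apply/negP => lt.
have [j hj] := expr_small ht (e := (x - B) / (`|D| + 1)) ltac:(rewrite divr_gt0 //; have := normr_ge0 D; lra).
have p := normr_ge0 D; move: hj; rewrite ltr_pdivlMr; last by lra.
have := H j; have := ler_norm D; have : 0 <= th ^+ j by rewrite exprn_ge0 //; lra.
nra.
Qed.

Section Fixed0.
Variables (F F' : C -> C) (mu : C) (r K : R).
Hypotheses (r0 : 0 < r) (K0 : 0 < K) (mu1 : 1 < nm mu) (F0 : F 0 = 0) (F'0 : F' 0 = mu).
Hypothesis HF : forall v w, nm v < r -> nm w < r ->
  nm (F w - F v - F' v * (w - v)) <= K * nm (w - v) ^+ 2 /\ nm (F' w - F' v) <= K * nm (w - v).

(** Here a^2 = a + 2 b and K1 b = 9 K, so that 9 K + (a + b / 3) K1 <= K1 a^2: this is what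
    preserves the remainder constant [K1] under the operator [T] below. The three bounds in [e] keep
    3 e within the radius r, the variation of F' within b / 3, and the derivative of p within 2. *)
Let a := nm mu.
Let b := (a ^+ 2 - a) / 2.
Let K1 := 18 * K / (a ^+ 2 - a).
Let e := Num.min (r / 3) (Num.min (b / (9 * K)) (2 * K1)^-1).
Let th := (a + b) / a ^+ 2.

Let a1 : 1 < a. Proof. exact: mu1. Qed.
Let b0 : 0 < b. Proof. by rewrite /b expr2; have := a1; nra. Qed.
Let K10 : 0 < K1. Proof. by rewrite /K1 divr_gt0 ?mulr_gt0 // expr2; have := a1; nra. Qed.
Let K1b : K1 * b = 9 * K.
Proof. by rewrite /K1 /b; field; have := a1; rewrite expr2; nra. Qed.
Let e0 : 0 < e.
Proof.
have h1 : 0 < r / 3 by apply: divr_gt0.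
have h2 : 0 < b / (9 * K) by apply: divr_gt0; [exact: b0|apply: mulr_gt0].
have h3 : 0 < (2 * K1)^-1 by rewrite invr_gt0; apply: mulr_gt0 => //; exact: K10.
by rewrite /e !lt_min h1 h2 h3.
Qed.
Let e_r : 3 * e <= r.
Proof. by have : e <= r / 3 by [rewrite ge_min lexx]; lra. Qed.
Let e_b : 9 * K * e <= b.
Proof.
have : e <= b / (9 * K) by rewrite !ge_min lexx orbT.
by rewrite ler_pdivlMr ?mulr_gt0 //; lra.
Qed.
Let e_K1 : 2 * K1 * e <= 1.
Proof.
have h : e <= (2 * K1)^-1 by rewrite !ge_min lexx !orbT.
have p : 0 < 2 * K1 by have := K10; lra.
by rewrite mulrC -ler_pdivlMr // mul1r.
Qed.
Let tha : th * a ^+ 2 = a + b.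
Proof. by rewrite /th divfK // expf_neq0 // gt_eqF //; have := a1; lra. Qed.
Let th01 : 0 <= th < 1.
Proof.
have := a1; have := b0; rewrite /th /b => h1 h2.
rewrite divr_ge0 ?exprn_ge0 //=; [|lra..].
by rewrite ltr_pdivrMr ?exprn_gt0 //; lra.
Qed.

Let mu0 : mu != 0. Proof. by rewrite -nm_gt0; have := a1; rewrite /a; lra. Qed.
Let nmd z : nm (z / mu) * a = nm z.
Proof. by rewrite /a -nmM divfK. Qed.
Let nmdle z : nm (z / mu) <= nm z.
Proof. by rewrite -(nmd z); have := nm_ge0 (z / mu); have := a1; nra. Qed.

(** The class in which the linearisation is sought; the operator [T] maps it to itself with the same
    radius and constant, so the limit stays in it. *)
Let S (p p' : C -> C) := [/\ p 0 = 0, p' 0 = 1 & c11 p p' 0 e K1].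

Let Sbd p p' v w : S p p' -> nm v < e -> nm w < e ->
  [/\ nm (p' v) <= 2, nm (p w - p v) <= 3 * nm (w - v) & nm (p v) <= 3 * nm v].
Proof.
move=> [p0 p1 H] hv hw.
have sub0 x : nm x < e -> nm (x - 0) < e by rewrite subr0.
have z0 : nm (0 - 0 : C) < e by rewrite subrr nm0; exact: e0.
have bd x : nm x < e -> nm (p' x) <= 2.
  move=> hx; have := c11_lip' H z0 (sub0 _ hx); have := nm_sub (p' x) (p' 0).
  rewrite p1 nm1 subr0; have := nm_ge0 x; have := K10; have := e_K1; nra.
have lip x y : nm x < e -> nm y < e -> nm (p y - p x) <= 3 * nm (y - x).
  move=> hx hy; have := H x y (sub0 _ hx) (sub0 _ hy); have := bd x hx.
  have := nm_sub (p y - p x) (p' x * (y - x)); rewrite nmM.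
  have := nm_ge0 (y - x); have := nmD3 0 y x; rewrite subr0 sub0r nmN => h1 h2 h3 h4 h5.
  have h6 : nm (p' x) * nm (y - x) <= 2 * nm (y - x) by apply: ler_wpM2r.
  have h7 : K1 * nm (y - x) * nm (y - x) <= 1 * nm (y - x).
    by apply: ler_wpM2r => //; have := K10; have := e_K1; nra.
  by rewrite expr2 in h5; nra.
split; [exact: bd|exact: lip|].
by have := lip 0 v _ hv; rewrite p0 !subr0; apply; rewrite nm0; exact: e0.
Qed.

(** A fixed point of [T] satisfies p (mu z) = F (p z); it is the limit of the iterates of [T] on the
    identity. *)
Let T (p : C -> C) z := F (p (z / mu)).
Let T' (p p' : C -> C) z := F' (p (z / mu)) * p' (z / mu) / mu.

Let F'bd x : nm x < r -> nm (F' x) <= a + K * nm x.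
Proof.
move=> hx; have [|_] := HF (v := 0) (w := x) _ hx; first by rewrite nm0.
by rewrite subr0 F'0 => h; have := nm_sub (F' x) mu; rewrite /a; lra.
Qed.

Let small p p' v : S p p' -> nm v < e -> nm (p (v / mu)) < r /\ nm (p (v / mu)) <= 3 * nm (v / mu).
Proof.
move=> HS hv; have h := nmdle v; have h2 : nm (v / mu) < e by lra.
by have [_ _ h3] := Sbd HS h2 h2; have := e_r; split; lra.
Qed.

Let ST p p' : S p p' -> S (T p) (T' p p').
Proof.
move=> HS; have [p0 p1 H] := HS; rewrite /T /T'; split.
- by rewrite mul0r p0 F0.
- by rewrite mul0r p0 F'0 p1 mulr1 divff.
move=> v w; rewrite !subr0 => hv hw.
have hv' : nm (v / mu) < e by apply: le_lt_trans (nmdle _) hv.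
have hw' : nm (w / mu) < e by apply: le_lt_trans (nmdle _) hw.
have [s1 s2] := small HS hv; have [s3 _] := small HS hw.
have [q1 _] := HF s1 s3.
have [_ q2 _] := Sbd HS hv' hw'.
have q3 := H (v / mu) (w / mu); rewrite !subr0 in q3; have {}q3 := q3 hv' hw'.
have q4 := F'bd s1.
have -> : F (p (w / mu)) - F (p (v / mu)) - F' (p (v / mu)) * p' (v / mu) / mu * (w - v) =
  (F (p (w / mu)) - F (p (v / mu)) - F' (p (v / mu)) * (p (w / mu) - p (v / mu)))
   + F' (p (v / mu)) * (p (w / mu) - p (v / mu) - p' (v / mu) * (w / mu - v / mu)) by ring.
apply: le_trans (nmD _ _) _; rewrite nmM.
have ed : nm (w - v) = nm (w / mu - v / mu) * a by rewrite -mulrBl nmd.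
rewrite ed; set d := nm (w / mu - v / mu) in ed q2 q3 *.
have d0 : 0 <= d by rewrite nm_ge0.
set X := nm (p (w / mu) - p (v / mu)) in q1 q2.
have X0 : 0 <= X by rewrite nm_ge0.
have g1 : K * X ^+ 2 <= K * (9 * d ^+ 2).
  by rewrite ler_pM2l // (_ : 9 * d ^+ 2 = (3 * d) ^+ 2); [rewrite lerXn2r ?nnegrE ?mulr_ge0|ring].
have g2 : nm (F' (p (v / mu))) <= a + b / 3.
  by have := nmdle v; have := K0; have := e_b; nra.
have g3 : nm (F' (p (v / mu))) * nm (p (w / mu) - p (v / mu) - p' (v / mu) * (w / mu - v / mu)) <= (a + b / 3) * (K1 * d ^+ 2).
  by apply: ler_pM; rewrite ?nm_ge0.
apply: le_trans (lerD q1 g3) _; apply: le_trans (lerD g1 (lexx _)) _.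
have d20 : 0 <= d ^+ 2 by rewrite exprn_ge0.
have -> : K * (9 * d ^+ 2) + (a + b / 3) * (K1 * d ^+ 2) = (9 * K + (a + b / 3) * K1) * d ^+ 2 by ring.
have -> : K1 * (d * a) ^+ 2 = (K1 * a ^+ 2) * d ^+ 2 by ring.
apply: ler_wpM2r => //.
have -> : a ^+ 2 = a + 2 * b by rewrite /b; field.
by have := K1b; have := b0; have := K10; nra.
Qed.

Let it j : (C -> C) * (C -> C) := iter j (fun pp => (T pp.1, T' pp.1 pp.2)) (id, fun=> 1).
Let ph j := (it j).1.
Let ph' j := (it j).2.

Let Sit j : S (ph j) (ph' j).
Proof.
elim: j => [|j IH]; last exact: ST.
split=> // v w _ _ /=; rewrite mul1r subrr nm0 mulr_ge0 ?sqr_ge0 //; exact: ltW.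
Qed.

(** On the discs concerned F is Lipschitz with constant at most a + b, while passing from z to z /
    mu divides nm z ^ 2 by a^2: the quotient is th. For derivatives one factor a comes from the
    argument and one from the division by mu. *)
Let dif j z : nm z < e -> nm (ph j.+1 z - ph j z) <= K * th ^+ j * nm z ^+ 2 /\
   nm (ph' j.+1 z - ph' j z) <= K * th ^+ j * nm z.
Proof.
elim: j z => [|j IH] z hz.
  have hz' : nm (z / mu) < r by have := nmdle z; have := e_r; have := nm_ge0 z; lra.
  have [|h1 h2] := HF (v := 0) (w := z / mu) _ hz'; first by rewrite nm0.
  rewrite !subr0 F0 F'0 subr0 in h1 h2; rewrite expr0 mulr1; split.
    have em : mu * (z / mu) = z by rewrite mulrC divfK //; exact: mu0.
    rewrite /ph /= /T /=; rewrite em in h1; apply: le_trans h1 _.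
    by rewrite ler_pM2l // lerXn2r ?nnegrE ?nm_ge0.
  rewrite /ph' /= /T' /= mulr1.
  have -> : F' (z / mu) / mu - 1 = (F' (z / mu) - mu) / mu by rewrite mulrBl divff.
  have := nmd (F' (z / mu) - mu); have := nm_ge0 ((F' (z / mu) - mu) / mu).
  by have := nmdle z; have := a1; have := K0; nra.
have hz' : nm (z / mu) < e by apply: le_lt_trans (nmdle _) hz.
have [h1 h2] := IH _ hz'.
have [s1 s1'] := small (Sit j.+1) hz; have [s2 s2'] := small (Sit j) hz.
have [f1 f2] := HF s2 s1.
have g2 x : nm x <= 3 * nm (z / mu) -> nm x < r -> nm (F' x) <= a + b / 3.
  by move=> hx hr; have := F'bd hr; have := K0; have := e_b; nra.
have th0 : 0 <= th ^+ j by rewrite exprn_ge0 //; case/andP: th01.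
have zz := nmd z; have pz := nm_ge0 (z / mu).
have tz : K * th ^+ j.+1 * nm z ^+ 2 = (a + b) * (K * th ^+ j * nm (z / mu) ^+ 2).
  by rewrite -zz exprS -tha; ring.
split.
  rewrite tz; change (ph j.+2 z) with (F (ph j.+1 (z / mu))); change (ph j.+1 z) with (F (ph j (z / mu))).
  set x := ph j.+1 _ in h1 s1 s1' f1 f2 *; set y := ph j _ in h1 s2 s2' f1 f2 *.
  have q1 := nm_sub (F x - F y) (F' y * (x - y)); rewrite nmM in q1.
  have q2 := g2 y s2' s2; have q3 := nmD3 0 x y; rewrite subr0 sub0r nmN in q3.
  have q4 : K * nm (x - y) <= 2 * b / 3 by have := e_b; have := K0; nra.
  have q5 : nm (F' y) * nm (x - y) <= (a + b / 3) * nm (x - y) by apply: ler_wpM2r; rewrite ?nm_ge0.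
  have q6 : K * nm (x - y) * nm (x - y) <= 2 * b / 3 * nm (x - y) by apply: ler_wpM2r; rewrite ?nm_ge0.
  rewrite expr2 mulrA in f1.
  apply: le_trans (_ : (a + b) * nm (x - y) <= _); first by nra.
  by apply: ler_wpM2l => //; have := b0; have := a1; lra.
have tz' : K * th ^+ j.+1 * nm z * a = (a + b) * (K * th ^+ j * nm (z / mu)).
  by rewrite -{1}zz exprS -tha; ring.
rewrite -(ler_pM2r (_ : 0 < a)); last by have := a1; lra.
rewrite tz' /a -nmM.
change (ph' j.+2 z) with (F' (ph j.+1 (z / mu)) * ph' j.+1 (z / mu) / mu).
change (ph' j.+1 z) with (F' (ph j (z / mu)) * ph' j (z / mu) / mu).
set x := ph j.+1 _ in h1 s1 s1' f1 f2 *; set y := ph j _ in h1 s2 s2' f1 f2 *.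
set x' := ph' j.+1 _ in h2 *; set y' := ph' j _ in h2 *.
have -> : (F' x * x' / mu - F' y * y' / mu) * mu = (F' x - F' y) * x' + F' y * (x' - y').
  by field.
apply: le_trans (nmD _ _) _; rewrite (nmM (F' x - F' y) x') (nmM (F' y) (x' - y')).
have [x'2 _ _] : [/\ nm x' <= 2, True & True].
  by have [] := Sbd (Sit j.+1) hz' hz'.
have q2 := g2 y s2' s2.
have q5 : nm (F' y) * nm (x' - y') <= (a + b / 3) * (K * th ^+ j * nm (z / mu)) by apply: ler_pM; rewrite ?nm_ge0.
have q6 : nm (F' x - F' y) * nm x' <= (K * nm (x - y)) * 2 by apply: ler_pM; rewrite ?nm_ge0.
have q7 : K * nm (x - y) <= K * (K * th ^+ j * nm (z / mu) * e).
  rewrite ler_pM2l //; apply: le_trans h1 _; rewrite expr2 mulrA ler_wpM2l //.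
    by rewrite !mulr_ge0 //; exact: ltW.
  exact: ltW.
have q8 : K * (K * th ^+ j * nm (z / mu) * e) <= b / 9 * (K * th ^+ j * nm (z / mu)).
  have -> : K * (K * th ^+ j * nm (z / mu) * e) = (K * e) * (K * th ^+ j * nm (z / mu)) by ring.
  apply: ler_wpM2r; first by rewrite !mulr_ge0 //; exact: ltW.
  by have := e_b; lra.
have : 0 <= K * th ^+ j * nm (z / mu) by rewrite !mulr_ge0 //; exact: ltW.
by have := b0; nra.
Qed.

Lemma koenigs0 : exists p p' (e1 K2 : R),
  [/\ 0 < e1, 0 <= K2, c11 p p' 0 e1 K2, p 0 = 0 /\ p' 0 = 1 &
   forall z, nm (mu * z) < e1 -> nm (p z) < r /\ p (mu * z) = F (p z)].
Proof.
pose D := 2 * (K * (e ^+ 2 + e)) / (1 - th).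
have th1 : 0 <= 1 - th by case/andP: th01; lra.
have M0 : 0 <= K * (e ^+ 2 + e).
  by apply: mulr_ge0; [exact: ltW|apply: addr_ge0; [exact: sqr_ge0|exact: ltW e0]].
have D0 : 0 <= D by apply: divr_ge0 => //; lra.
have lim z : exists l, nm z < e -> forall j, nm (l.1 - ph j z) <= D * th ^+ j /\ nm (l.2 - ph' j z) <= D * th ^+ j.
  have [hz|hz] := ltP (nm z) e; last by exists (0, 0); lra.
  have z0 := nm_ge0 z; have th0 j : 0 <= th ^+ j by rewrite exprn_ge0 //; case/andP: th01.
  have e20 : 0 <= e ^+ 2 by exact: sqr_ge0.
  have zz : nm z ^+ 2 <= e ^+ 2 by rewrite lerXn2r ?nnegrE ?(ltW e0) ?(ltW hz).
  have c1 j : nm (ph j.+1 z - ph j z) <= K * (e ^+ 2 + e) * th ^+ j.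
    apply: le_trans (proj1 (dif j hz)) _; rewrite mulrAC; apply: ler_wpM2r => //.
    by rewrite ler_pM2l //; have := e0; lra.
  have c2 j : nm (ph' j.+1 z - ph' j z) <= K * (e ^+ 2 + e) * th ^+ j.
    have [_ h] := dif j hz; apply: (le_trans h); rewrite mulrAC; apply: ler_wpM2r => //.
    by rewrite ler_pM2l //; lra.
  have [l1 h1] := geom_lim th01 M0 c1.
  have [l2 h2] := geom_lim th01 M0 c2.
  exists (l1, l2) => _ j; rewrite /D.
  by have h3 := h1 j; have h4 := h2 j; split; rewrite /= mulrAC.
have [l hl] := choice lim.
pose p z := (l z).1; pose p' z := (l z).2.
have p_ok z j : nm z < e -> nm (p z - ph j z) <= D * th ^+ j /\ nm (p' z - ph' j z) <= D * th ^+ j.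
  by move=> hz; exact: hl.
have eq_lim x y (E : R) : (forall j, nm (x - y) <= E * th ^+ j) -> x = y.
  move=> h; apply/eqP; rewrite -subr_eq0 -nm_eq0 eq_le nm_ge0 andbT.
  by apply: (le_geom (D := E) th01) => j; rewrite add0r.
have z0 : nm 0 < e by rewrite nm0; exact: e0.
exists p, p', e, K1; split; [exact: e0|exact: ltW K10| | |].
- move=> v w; rewrite !subr0 => hv hw; apply: (le_geom (D := 4 * D + 2 * D * nm (w - v)) th01) => j.
  have [_ _ H] := Sit j; have := H v w; rewrite !subr0 => /(_ hv hw) h1.
  have [h2 h3] := p_ok v j hv; have [h4 _] := p_ok w j hw.
  have -> : p w - p v - p' v * (w - v) = (ph j w - ph j v - ph' j v * (w - v)) +
     ((p w - ph j w) - (p v - ph j v) - (p' v - ph' j v) * (w - v)) by ring.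
  apply: le_trans (nmD _ _) _; apply: lerD => //.
  apply: le_trans (nmD _ _) _; rewrite nmN nmM.
  have h5 := nmD (p w - ph j w) (- (p v - ph j v)); rewrite nmN in h5.
  have h6 : nm (p' v - ph' j v) * nm (w - v) <= D * th ^+ j * nm (w - v) by apply: ler_wpM2r; rewrite ?nm_ge0.
  have t0 : 0 <= D * th ^+ j by rewrite mulr_ge0 ?exprn_ge0 //; case/andP: th01.
  have := nm_ge0 (w - v); nra.
- have pq j : ph j 0 = 0 /\ ph' j 0 = 1 by have [] := Sit j.
  split; apply: (eq_lim _ _ D) => j; have [h1 h2] := p_ok 0 j z0; have [e1 e2] := pq j.
    by rewrite e1 in h1.
  by rewrite e2 in h2.
move=> z hz.
have hz' : nm z < e.
  by move: hz; rewrite nmM; have := mu1; have := nm_ge0 z; nra.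
have small2 : nm (p z) <= 3 * nm z.
  apply: (le_geom (D := D) th01) => j; have [_ _ h1] := Sbd (Sit j) hz' hz'.
  by have [h2 _] := p_ok z j hz'; have := nm_sub (p z) (ph j z); lra.
have pr : nm (p z) < r by have := e_r; lra.
split=> //; apply: (eq_lim _ _ (D + (a + 3 * K * r) * D)) => j.
have [h1 _] := p_ok (mu * z) j.+1 hz.
have [h2 _] := p_ok z j hz'.
have [_ _ h3] := Sbd (Sit j) hz' hz'.
have pr2 : nm (ph j z) < r by have := e_r; lra.
have ez : ph j.+1 (mu * z) = F (ph j z) by rewrite {1}/ph /= /T mulrC mulKf.
rewrite ez in h1; have q := nmD3 (F (ph j z)) (p (mu * z)) (F (p z)).
have [f1 _] := HF pr pr2; have q4 := F'bd pr.
have q1 := nm_sub (F (ph j z) - F (p z)) (F' (p z) * (ph j z - p z)); rewrite nmM in q1.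
rewrite (nmB (ph j z)) in q1 f1.
have q5 : nm (F' (p z)) * nm (p z - ph j z) <= (a + K * r) * nm (p z - ph j z).
  by apply: ler_wpM2r; rewrite ?nm_ge0 //; have := K0; nra.
have q6 : K * nm (p z - ph j z) * nm (p z - ph j z) <= K * (2 * r) * nm (p z - ph j z).
  apply: ler_wpM2r; rewrite ?nm_ge0 // ler_pM2l //.
  by have := nmD3 0 (p z) (ph j z); rewrite subr0 sub0r nmN; lra.
have thj : th ^+ j.+1 <= th ^+ j.
  have : 0 <= th ^+ j by rewrite exprn_ge0 //; case/andP: th01.
  by rewrite exprS; case/andP: th01 => ? ?; nra.
rewrite expr2 mulrA in f1.
have q7 : nm (F (ph j z) - F (p z)) <= (a + 3 * K * r) * nm (p z - ph j z) by nra.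
have q8 : D * th ^+ j.+1 <= D * th ^+ j by apply: ler_wpM2l.
have q9 : (a + 3 * K * r) * nm (p z - ph j z) <= (a + 3 * K * r) * (D * th ^+ j).
  by apply: ler_wpM2l => //; have := a1; have := K0; have := r0; nra.
have : 0 <= D * th ^+ j by rewrite mulr_ge0 ?exprn_ge0 //; case/andP: th01.
have := K0; have := r0; nra.
Qed.

End Fixed0.

Lemma koenigs (f f' : C -> C) x0 : sm f f' x0 -> f x0 = x0 -> 1 < nm (f' x0) ->
  exists p p' (e K : R), [/\ 0 < e, 0 <= K, c11 p p' 0 e K, p 0 = x0 /\ p' 0 = 1 &
    forall z, nm (f' x0 * z) < e -> p (f' x0 * z) = f (p z)].
Proof.
move=> /sm_bd [r [K [r0 K0 H]]] fx mu1.
have [||v w hv hw|p [p' [e [L [e0 L0 Hp [p0 p1] fe]]]]] :=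
  @koenigs0 (fun z => f (x0 + z) - x0) (fun z => f' (x0 + z)) (f' x0) r K r0 K0 mu1.
- by rewrite addr0 fx subrr.
- by rewrite addr0.
- have [] := H (x0 + v) (x0 + w); rewrite ?[x0 + _ - x0]addrC ?addKr //.
  rewrite opprD [x0 + w + _]addrACA subrr add0r => h1 _ _ [_ h2]; split=> //.
  by rewrite [f _ - x0 - _](_ : _ = f (x0 + w) - f (x0 + v)) //; ring.
exists (fun z => x0 + p z), p', e, L; split=> //.
- by move=> v w hv hw; rewrite opprD addrACA subrr add0r; apply: Hp.
- by rewrite p0 addr0.
by move=> z /fe [_ ->]; rewrite subrKC.
Qed.

End Koenigs.

(** * Rational maps of the projective line *)

Section Forms.
Variable R : realType.
Local Notation C := R[i].
Local Notation P1 := (P1 R).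
Implicit Types (p q : {poly C}) (z X Y : C).

Lemma roots_seq p : p != 0 -> exists s : seq C, forall x, root p x = (x \in s).
Proof.
move=> p0; have [s e] := closed_field_poly_normal p; exists s => x.
by rewrite e rootZ ?lead_coef_eq0 // root_prod_XsubC.
Qed.

Lemma coprimep_rootP p q : reflect (forall x, ~ (root p x /\ root q x)) (coprimep p q).
Proof.
apply: (iffP idP) => [c x [h1 h2]|h].
  by have := coprimep_root c h1; rewrite (rootP h2) eqxx.
by apply/negPn/negP; rewrite coprimep_def => /closed_rootP[x]; rewrite root_gcd => /andP /h.
Qed.

Lemma deriv_eq0 p : p^`() = 0 -> (size p <= 1)%N.
Proof.
move=> e; apply/leq_sizeP => j hj.
have := coef_deriv p j.-1; rewrite e coef0 prednK // => /esym/eqP.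
by rewrite -mulr_natr mulf_eq0 pnatr_eq0 orbC eqn0Ngt hj => /eqP.
Qed.

(** The point with homogeneous coordinates [a : b]; the pair (0, 0), which is no point, is sent to
    infinity. *)
Definition fr (a b : C) : P1 := if b != 0 then Some (a / b) else None.

Lemma fr_scale t a b : t != 0 -> fr (t * a) (t * b) = fr a b.
Proof.
by move=> t0; rewrite /fr mulf_eq0 (negPf t0); case: eqP => //= /eqP b0; congr Some; field; rewrite t0 b0.
Qed.

Lemma fr_eq a b c d : (a != 0) || (b != 0) -> (c != 0) || (d != 0) ->
  (fr a b = fr c d) <-> a * d = b * c.
Proof.
rewrite /fr; have [->|b0] := eqVneq b 0; have [->|d0] := eqVneq d 0; rewrite /= ?orbF.
- by move=> a0 c0; rewrite mulr0 mul0r.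
- by move=> a0 _; split=> // /eqP; rewrite mul0r mulf_eq0 (negPf a0) (negPf d0).
- move=> _ c0; split=> // /esym/eqP; rewrite mulr0 mulf_eq0 (negPf c0) (negPf b0) //.
- by move=> _ _; split=> [[/eqP]|e]; [rewrite eqr_div // => /eqP ->; rewrite mulrC|
     congr Some; apply/eqP; rewrite eqr_div // e mulrC].
Qed.

Lemma fr_surj (x : P1) : exists a b, ((a != 0) || (b != 0)) /\ x = fr a b.
Proof.
case: x => [z|]; first by exists z, 1; rewrite oner_eq0 orbT /fr oner_eq0 divr1.
by exists 1, 0; rewrite oner_eq0 /fr eqxx.
Qed.

Lemma fr_Some z : fr z 1 = Some z. Proof. by rewrite /fr oner_eq0 divr1. Qed.
(** The homogenisation of p in degree d, evaluated at (X, Y); [hpol] is its value on polynomials,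
    the numerator Q^d p(P / Q). *)
Definition hev (d : nat) p X Y : C := \sum_(i < d.+1) p`_i * (X ^+ i * Y ^+ (d - i)).
Definition hpol (d : nat) p (P Q : {poly C}) : {poly C} := \sum_(i < d.+1) p`_i *: (P ^+ i * Q ^+ (d - i)).

Lemma hpolE d p P Q x : (hpol d p P Q).[x] = hev d p P.[x] Q.[x].
Proof.
by rewrite /hpol horner_sum; apply: eq_bigr => i _; rewrite hornerZ hornerM !horner_exp.
Qed.

Lemma hev_scale d p t X Y : hev d p (t * X) (t * Y) = t ^+ d * hev d p X Y.
Proof.
rewrite /hev mulr_sumr; apply: eq_bigr => i _; rewrite !exprMn.
by rewrite -[in t ^+ d](subnKC (ltnSE (ltn_ord i))) exprD; ring.
Qed.

Lemma hev_fin d p x : (size p <= d.+1)%N -> hev d p x 1 = p.[x].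
Proof.
by move=> hs; rewrite (horner_coef_wide _ hs); apply: eq_bigr => i _; rewrite expr1n mulr1.
Qed.

Lemma hev_inf d p X : hev d p X 0 = p`_d * X ^+ d.
Proof.
rewrite /hev big_ord_recr /= subnn mulr1 big1 ?add0r // => i _.
by rewrite [in 0 ^+ _]expr0n subn_eq0 leqNgt ltn_ord mulr0 mulr0.
Qed.

Lemma hev_Y d p X Y : (size p <= d.+1)%N -> Y != 0 -> hev d p X Y = Y ^+ d * p.[X / Y].
Proof. by move=> hs Y0; rewrite -(hev_fin _ hs) -hev_scale mulr1 mulrC divfK. Qed.

Lemma rdeg_size p q : (size p <= (rdeg p q).+1)%N /\ (size q <= (rdeg p q).+1)%N.
Proof. by rewrite /rdeg; split; [have := leq_maxl (size p) (size q) | have := leq_maxr (size p) (size q)]; lia. Qed.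

Lemma rdeg_coef p q : coprimep p q -> (p`_(rdeg p q) != 0) || (q`_(rdeg p q) != 0).
Proof.
move=> c; have p0q0 : (p != 0) || (q != 0).
  by apply/negPn/negP; rewrite negb_or !negbK => /andP[/eqP e1 /eqP e2]; move: c; rewrite e1 e2 coprimep0 -size_poly_eq1 size_poly0.
have [h|h] := leqP (size p) (size q); rewrite /rdeg.
  rewrite (maxn_idPr h); have q0 : q != 0.
    apply: contraLR p0q0; rewrite negbK => /eqP q0; rewrite q0 eqxx orbF negbK -size_poly_eq0 -leqn0.
    by move: h; rewrite q0 size_poly0.
  by rewrite -[q`__]/(lead_coef q) lead_coef_eq0 q0 orbT.
rewrite (maxn_idPl (ltnW h)) -[p`__]/(lead_coef p) lead_coef_eq0.
by rewrite -size_poly_gt0 (leq_ltn_trans _ h).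
Qed.

Lemma hev_ne0 p q X Y : coprimep p q -> (X != 0) || (Y != 0) ->
  (hev (rdeg p q) p X Y != 0) || (hev (rdeg p q) q X Y != 0).
Proof.
move=> c; have [s1 s2] := rdeg_size p q.
have [->|Y0 _] := eqVneq Y 0.
  by rewrite orbF !hev_inf => X0; rewrite !mulf_eq0 !expf_eq0 (negPf X0) !andbF !orbF; apply: rdeg_coef.
rewrite !hev_Y // !mulf_eq0 !expf_eq0 (negPf Y0) !andbF /=.
rewrite -negb_and; apply/negP => h.
by have /coprimep_rootP/(_ (X / Y)) := c; apply; apply/andP; rewrite !rootE.
Qed.

Lemma ratP1_fr p q X Y : coprimep p q -> (X != 0) || (Y != 0) ->
  ratP1 p q (fr X Y) = fr (hev (rdeg p q) p X Y) (hev (rdeg p q) q X Y).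
Proof.
move=> c; have [s1 s2] := rdeg_size p q; rewrite {1}/fr.
have [->|Y0 _] := eqVneq Y 0; rewrite /=.
  rewrite orbF => X0; rewrite !hev_inf ![_ * X ^+ _]mulrC fr_scale ?expf_neq0 //.
by rewrite !hev_Y // fr_scale ?expf_neq0.
Qed.

Lemma coef_top_X (P : {poly C}) d i : (size P <= d.+1)%N -> (size (P ^+ i) <= (d * i).+1)%N /\ (P ^+ i)`_(d * i) = P`_d ^+ i.
Proof.
move=> hP; elim: i => [|i [IH1 IH2]]; first by rewrite muln0 !expr0 coef1 size_poly1.
rewrite mulnS exprS; split.
  by apply: leq_trans (size_polyMleq _ _) _; move: hP IH1; lia.
rewrite coefM (bigD1 (inord d)) //= inordK ?ltnS ?leq_addr // addKn IH2 exprS big1 ?addr0 // => j.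
rewrite -val_eqE /= inordK ?ltnS ?leq_addr // => jd.
have [h|h] := leqP j d.
  have hj : (j < d)%N by rewrite ltn_neqAle jd.
  by rewrite [X in _ * X]nth_default ?mulr0 //; apply: leq_trans IH1 _; move: hj; lia.
by rewrite [X in X * _]nth_default ?mul0r //; apply: leq_trans hP _.
Qed.

Lemma coef_top_M (P Q : {poly C}) d e : (size P <= d.+1)%N -> (size Q <= e.+1)%N ->
  (size (P * Q : {poly C})%R <= (d + e).+1)%N /\ (P * Q : {poly C})`_(d + e) = P`_d * Q`_e.
Proof.
move=> hP hQ; split; first by apply: leq_trans (size_polyMleq _ _) _; move: hP hQ; lia.
rewrite coefM (bigD1 (inord d)) //= inordK ?ltnS ?leq_addr // addKn big1 ?addr0 // => j.
rewrite -val_eqE /= inordK ?ltnS ?leq_addr // => jd.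
have [h|h] := leqP j d.
  have hj : (j < d)%N by rewrite ltn_neqAle jd.
  by rewrite [X in _ * X]nth_default ?mulr0 //; apply: leq_trans hQ _; move: hj; lia.
by rewrite [X in X * _]nth_default ?mul0r //; apply: leq_trans hP _.
Qed.

Lemma hpol_top d e (p P Q : {poly C}) : (size P <= e.+1)%N -> (size Q <= e.+1)%N ->
  (size (hpol d p P Q) <= (e * d).+1)%N /\ (hpol d p P Q)`_(e * d) = hev d p P`_e Q`_e.
Proof.
move=> hP hQ.
have H (i : 'I_d.+1) : (size (P ^+ i * Q ^+ (d - i) : {poly C})%R <= (e * d).+1)%N /\
    (P ^+ i * Q ^+ (d - i) : {poly C})`_(e * d) = P`_e ^+ i * Q`_e ^+ (d - i).
  have [a1 a2] := coef_top_X i hP; have [b1 b2] := coef_top_X (d - i) hQ.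
  have := coef_top_M a1 b1; rewrite a2 b2 -mulnDr subnKC //; by rewrite -ltnS.
split.
  apply: leq_trans (size_sum _ _ _) _; apply/bigmax_leqP => i _.
  by apply: leq_trans (size_scale_leq _ _) _; case: (H i).
by rewrite coef_sum; apply: eq_bigr => i _; rewrite coefZ; case: (H i) => _ ->.
Qed.

Section Comp.
Variables p1 q1 p2 q2 : {poly C}.
Hypotheses (c1 : coprimep p1 q1) (c2 : coprimep p2 q2).
Let d1 := rdeg p1 q1.
Let d2 := rdeg p2 q2.
Definition rcp := hpol (rdeg p1 q1) p1 p2 q2.
Definition rcq := hpol (rdeg p1 q1) q1 p2 q2.

Lemma rc_coprime : coprimep rcp rcq.
Proof.
apply/coprimep_rootP => x; rewrite !rootE !hpolE => /andP; apply/negP.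
rewrite negb_and; apply: hev_ne0 => //; rewrite -negb_and; apply/negP => /andP h.
by have /coprimep_rootP/(_ x) := c2; apply; rewrite !rootE.
Qed.

(** The coefficients of index d1 d2 are the two homogenised forms evaluated at the leading pair of
    (p2, q2), that is at the image of infinity; coprime forms have no common zero, so one of them is
    nonzero. *)
Lemma rc_rdeg : rdeg rcp rcq = (d1 * d2)%N.
Proof.
have [s1 s2] := rdeg_size p2 q2.
have [a1 a2] := hpol_top (rdeg p1 q1) p1 s1 s2; have [b1 b2] := hpol_top (rdeg p1 q1) q1 s1 s2.
have := hev_ne0 c1 (rdeg_coef c2); rewrite -a2 -b2 -/rcp -/rcq.
rewrite /d1 /d2 [(rdeg p1 q1 * _)%N]mulnC => h.
apply/eqP; rewrite eqn_leq {1}/rdeg; apply/andP; split.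
  by move: a1 b1; rewrite -/rcp -/rcq; lia.
have [s3 s4] := rdeg_size rcp rcq.
rewrite leqNgt; apply/negP => lt; case/orP: h => /eqP; apply; apply: nth_default.
  by apply: leq_trans s3 _.
by apply: leq_trans s4 _.
Qed.

Lemma rc_ratP1 x : ratP1 rcp rcq x = ratP1 p1 q1 (ratP1 p2 q2 x).
Proof.
have [a [b [ab ->]]] := fr_surj x.
rewrite (ratP1_fr c2 ab) (ratP1_fr c1 (hev_ne0 c2 ab)) (ratP1_fr rc_coprime ab) rc_rdeg.
have [s1 s2] := rdeg_size p2 q2.
have [a1 a2] := hpol_top (rdeg p1 q1) p1 s1 s2; have [b1 b2] := hpol_top (rdeg p1 q1) q1 s1 s2.
have E p (P : {poly C}) : (size P <= (d2 * d1).+1)%N -> P`_(d2 * d1) = hev d1 p p2`_d2 q2`_d2 ->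
   (forall x, P.[x] = hev d1 p p2.[x] q2.[x]) -> hev (d1 * d2) P a b = hev d1 p (hev d2 p2 a b) (hev d2 q2 a b).
  rewrite [(d2 * d1)%N]mulnC => sP tP eP; have [b0|b0] := eqVneq b 0.
    by rewrite b0 !hev_inf tP ![_ * a ^+ d2]mulrC hev_scale mulnC exprM mulrC.
  rewrite (hev_Y a sP b0) (hev_Y a s1 b0) (hev_Y a s2 b0) hev_scale eP.
  by rewrite /d2 mulnC exprM.
by congr fr; apply: E => // t; rewrite hpolE.
Qed.

End Comp.

Lemma iter_rat p q k : coprimep p q -> exists pk qk,
  [/\ coprimep pk qk, rdeg pk qk = (rdeg p q ^ k)%N & forall x, ratP1 pk qk x = iter k (ratP1 p q) x].
Proof.
move=> c; elim: k => [|k [pk [qk [ck dk ek]]]].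
  exists 'X, 1; split; first exact: coprimep1.
    by rewrite /rdeg size_polyX size_poly1.
  move=> [z|] /=; first by rewrite hornerX hornerC oner_eq0 divr1.
  by rewrite /rdeg size_polyX size_poly1 /= coef1 eqxx.
exists (rcp p q pk qk), (rcq p q pk qk); split; first exact: rc_coprime.
  by rewrite rc_rdeg // dk expnS.
by move=> x; rewrite rc_ratP1 // ek.
Qed.

Definition wron p q := p^`() * q - p * q^`().

(** If the Wronskian vanished, coprimality would make each of p and q divide its own derivative, so
    both would be constant. *)
Lemma wron_neq0 p q : coprimep p q -> (0 < rdeg p q)%N -> wron p q != 0.
Proof.
move=> c d0; apply/eqP => /eqP; rewrite subr_eq0 => /eqP e.
have sm' (a : {poly C}) : a %| a^`() -> (size a <= 1)%N.
  move=> h; have [/deriv_eq0 //|n0] := eqVneq a^`() 0.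
  have a0 : a != 0 by apply: contraNneq n0 => ->; rewrite deriv0.
  by have := dvdp_leq n0 h; rewrite leqNgt lt_size_deriv.
have cs : coprimep q p by rewrite coprimep_sym.
have h1 : (size q <= 1)%N by apply: sm'; rewrite -(Gauss_dvdpr q^`() cs) -e dvdp_mull.
have h2 : (size p <= 1)%N by apply: sm'; rewrite -(Gauss_dvdpl p^`() c) e dvdp_mulr.
by move: d0 h1 h2; rewrite /rdeg; lia.
Qed.

Lemma sub_neq0 p q t : coprimep p q -> (0 < rdeg p q)%N -> p - t *: q != 0.
Proof.
move=> c d0; apply/eqP => /eqP; rewrite subr_eq0 => /eqP e.
by have := wron_neq0 c d0; rewrite /wron e derivZ -!scalerAl [_ * q]mulrC subrr eqxx.
Qed.

Lemma q_neq0 p q : coprimep p q -> (0 < rdeg p q)%N -> q != 0.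
Proof.
by move=> c d0; apply: contraTneq (wron_neq0 c d0) => ->; rewrite /wron deriv0 !mulr0 subrr negbK.
Qed.

Lemma fin_fiber p q (B : seq P1) : coprimep p q -> (0 < rdeg p q)%N ->
  exists B' : seq P1, forall x, ratP1 p q x \in B -> x \in B'.
Proof.
move=> c d0; elim: B => [|b B [B' IH]]; first by exists [::].
suff [B1 h] : exists B1 : seq P1, forall x, ratP1 p q x = b -> x \in B1.
  by exists (B1 ++ B') => x; rewrite inE mem_cat => /orP[/eqP/h->|/IH->]; rewrite ?orbT.
case: b => [b|].
  have [s hs] := roots_seq (sub_neq0 b c d0).
  exists (None :: [seq Some z | z <- s]) => -[z|] // h; rewrite inE /= mem_map; last by move=> ? ? [].
  rewrite -hs rootE !hornerE; move: h => /=; case: eqP => //= /eqP q0 [<-].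
  by rewrite divfK // subrr.
have [s hs] := roots_seq (q_neq0 c d0).
exists (None :: [seq Some z | z <- s]) => -[z|] // h; rewrite inE /= mem_map; last by move=> ? ? [].
by rewrite -hs rootE; move: h => /=; case: eqP.
Qed.

(** All preimages of a value other than the image of infinity are finite, so none of the degree of p
    - t q is lost. *)
Lemma size_sub_gen p q t : coprimep p q -> ratP1 p q None != Some t ->
  size (p - t *: q) = (rdeg p q).+1.
Proof.
move=> c /= h; have [s1 s2] := rdeg_size p q; apply/eqP; rewrite eqn_leq; apply/andP; split.
  apply: leq_trans (size_polyD _ _) _; rewrite geq_max s1 size_polyN.
  by apply: leq_trans (size_scale_leq _ _) _.
rewrite ltnNge; apply/negP => /leq_sizeP/(_ _ (leqnn _)); rewrite coefB coefZ => /eqP.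
rewrite subr_eq0 => /eqP e; have := rdeg_coef c; rewrite e mulf_eq0 negb_or.
move: h; rewrite e; have [->|q0] := eqVneq q`_(rdeg p q) 0; first by rewrite andbF.
by rewrite mulfK // eqxx.
Qed.

Lemma ratP1_root p q t x : coprimep p q -> root (p - t *: q) x -> q.[x] != 0 /\ p.[x] / q.[x] = t.
Proof.
move=> c; rewrite rootE !hornerE subr_eq0 => /eqP e.
have q0 : q.[x] != 0.
  apply/eqP => q0; have /coprimep_rootP/(_ x) := c; apply.
  by rewrite !rootE e q0 mulr0.
by split=> //; rewrite e mulfK.
Qed.

Lemma ratP1_surj p q y : coprimep p q -> (0 < rdeg p q)%N -> exists x, ratP1 p q x = y.
Proof.
move=> c d0; case: y => [t|].
  have [e|ne] := eqVneq (ratP1 p q None) (Some t); first by exists None.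
  have : size (p - t *: q) != 1%N by rewrite size_sub_gen // eqSS -lt0n.
  move/closed_rootP => [x /(ratP1_root c) [q0 e]]; exists (Some x) => /=.
  by rewrite q0 e.
have [e|ne] := eqVneq (size q) 1%N; last first.
  by have /closed_rootP[x /rootP hx] := ne; exists (Some x); rewrite /= hx eqxx.
exists None => /=; have -> : q`_(rdeg p q) = 0; last by rewrite eqxx.
by apply: nth_default; rewrite e.
Qed.

(** Away from critical values a point has at least two preimages, so fibres of iterates at least
    double. The list [avoid] lets a caller keep the entire backward orbits, beyond the base point,
    off a finite set. *)
Lemma many_preimages p q J (avoid : seq C) : coprimep p q -> (1 < rdeg p q)%N ->
  exists bad : seq C, forall t, t \notin bad -> exists s : seq C,
   [/\ uniq s, (2 ^ J <= size s)%N & forall x, x \in s -> iter J (ratP1 p q) (Some x) = Some t /\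
     forall i, (i < J)%N -> exists2 u, u \notin avoid & iter i (ratP1 p q) (Some x) = Some u].
Proof.
move=> c d1; have d0 := ltnW d1.
elim: J => [|J [bad IH]].
  exists [::] => t _; exists [:: t]; split=> // x; rewrite inE => /eqP -> //.
have [crit hcrit] := roots_seq (wron_neq0 c d0).
(* Values to exclude: images of infinity, of critical points and of the points to be avoided. The
   default 0 for the value infinity only enlarges the list. *)
pose img := [seq odflt 0 (ratP1 p q x) | x : P1 <- None :: [seq Some z | z <- crit ++ bad ++ avoid]].
exists img => t ht.
have nimg x : ratP1 p q x = Some t -> x \in None :: [seq Some z | z <- crit ++ bad ++ avoid] -> False.
  move=> e hx; move: ht; rewrite /img => /negP; apply.
  by apply/mapP; exists x => //; rewrite e.
have hN : ratP1 p q None != Some t by apply/eqP => /nimg; apply; rewrite inE.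
have good x : root (p - t *: q) x -> [/\ ratP1 p q (Some x) = Some t, ~~ root (wron p q) x, x \notin bad & x \notin avoid].
  move=> /(ratP1_root c) [q0 e]; have e2 : ratP1 p q (Some x) = Some t by rewrite /= q0 e.
  have : x \notin crit ++ bad ++ avoid.
    by apply/negP => h; apply: (nimg _ e2); rewrite inE /= mem_map // => ? ? [].
  by rewrite !mem_cat !negb_or -hcrit => /and3P[].
have sz := size_sub_gen c hN.
have [x1 r1] : exists x, root (p - t *: q) x.
  by apply/closed_rootP; rewrite sz eqSS -lt0n.
have [g1 g2 g3 g4] := good _ r1.
have [Q eQ] := factor_theorem _ _ r1.
have Q0 : Q != 0.
  by apply/eqP => e; move: sz; rewrite eQ e mul0r size_poly0.
have [x2 r2] : exists x, root Q x.
  apply/closed_rootP; move: sz; rewrite eQ size_Mmonic ?monicXsubC // size_XsubC addn2 /= => -[->].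
  by rewrite neq_ltn d1 orbT.
have r2' : root (p - t *: q) x2 by rewrite eQ rootM r2.
have [k1 k2 k3 k4] := good _ r2'.
(* A double root of p - t q would be a root of the Wronskian. *)
have ne : x1 != x2.
  apply/eqP => e; move/negP: g2; apply; rewrite rootE /wron !hornerE.
  have h1 : p.[x1] = t * q.[x1].
    by apply/eqP; rewrite -subr_eq0; move: r1; rewrite rootE !hornerE.
  have h2 : p^`().[x1] = t * q^`().[x1].
    apply/eqP; rewrite -subr_eq0.
    have : (p - t *: q)^`().[x1] = 0.
      by rewrite eQ derivM derivB derivX derivC !hornerE e (rootP r2) subrr !(mul0r, mulr0, addr0).
    by rewrite derivB derivZ !hornerE => ->.
  by rewrite h1 h2; apply/eqP; ring.
have [s1 [u1 z1 f1]] := IH _ g3; have [s2 [u2 z2 f2]] := IH _ k3.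
exists (s1 ++ s2); split.
- rewrite cat_uniq u1 u2 andbT; apply/hasPn => x /f2 [e2 _]; apply/negP => /f1 [e1 _].
  by move: e1; rewrite e2 => -[] /eqP; rewrite eq_sym (negPf ne).
- by rewrite size_cat expnS mul2n -addnn leq_add.
move=> x; rewrite mem_cat => /orP[/f1|/f2] [e f]; rewrite iterS e; split=> // i.
  by rewrite ltnS leq_eqVlt => /orP[/eqP ->|/f //]; exists x1.
by rewrite ltnS leq_eqVlt => /orP[/eqP ->|/f //]; exists x2.
Qed.

End Forms.

(** * The differential equation T'^m = C0 b(T) *)

Section Theta.
Variable R : realType.
Local Notation C := R[i].
Local Notation nm := (@nm R).
Local Notation P1 := (P1 R).

(** Smoothness into the projective line through homogeneous coordinates without common zero; finite
    values and infinity are treated alike, and rational maps act by their forms. *)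
Definition smP (T : C -> P1) (z : C) := exists a a' b b', [/\ sm a a' z, sm b b' z,
  (a z != 0) || (b z != 0) & near z (fun w => T w = fr (a w) (b w))].

Lemma smP_Some h h' T z : sm h h' z -> near z (fun w => T w = Some (h w)) -> smP T z.
Proof.
move=> H e; exists h, h', (fun=> 1), (fun=> 0); split=> //; first exact: sm_const.
  by rewrite oner_eq0 orbT.
by apply: near_imp e => w ->; rewrite fr_Some.
Qed.

Lemma smP_fin T z y : smP T z -> T z = Some y ->
  exists h h', sm h h' z /\ near z (fun w => T w = Some (h w)).
Proof.
move=> [a [a' [b [b' [Ha Hb _ e]]]]]; rewrite (near_self e) /fr; case: eqP => //= /eqP b0 _.
exists (fun w => a w / b w), (fun w => (a' w * b w - a w * b' w) / b w ^+ 2); split; first exact: sm_div.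
by apply: near_imp (near_and e (sm_ne0 Hb b0)) => w [-> bw]; rewrite /fr bw.
Qed.

Lemma smP_inf T z : smP T z -> T z = None ->
  exists h h', [/\ sm h h' z, h z = 0 & near z (fun w => T w = chart_inf (h w))].
Proof.
move=> [a [a' [b [b' [Ha Hb ab e]]]]]; rewrite (near_self e) /fr; case: eqP => //= b0 _.
have a0 : a z != 0 by move: ab; rewrite b0 eqxx orbF.
exists (fun w => b w / a w), (fun w => (b' w * a w - b w * a' w) / a w ^+ 2); split.
- exact: sm_div.
- by rewrite b0 mul0r.
apply: near_imp (near_and e (sm_ne0 Ha a0)) => w [-> aw]; rewrite /fr /chart_inf mulf_eq0 invr_eq0 (negPf aw) orbF.
by case: eqP => //= _; rewrite invfM invrK mulrC.
Qed.

Lemma smP_holo T : (forall z, smP T z) -> holoP1 T.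
Proof.
move=> H z; case e : (T z) => [y|].
  have [h [h' [Hh [r r0 hr]]]] := smP_fin (H z) e.
  exists r; split=> //; exists h; split; first exact: sm_cdiff Hh.
  by left=> w; rewrite nm_lt => /hr.
have [h [h' [Hh _ [r r0 hr]]]] := smP_inf (H z) e.
exists r; split=> //; exists h; split; first exact: sm_cdiff Hh.
by right=> w; rewrite nm_lt => /hr.
Qed.

Lemma sm_hev d (p : {poly C}) a a' b b' z : sm a a' z -> sm b b' z ->
  exists g', sm (fun w => hev d p (a w) (b w)) g' z.
Proof.
move=> Ha Hb; rewrite /hev.
elim: (index_enum _) => [|i r [g' IH]].
  exists (fun=> 0); apply: sm_ext (sm_const 0 z); apply: near_all => w; by rewrite big_nil.
have H1 := sm_mul (sm_const p`_i z) (sm_mul (sm_X i Ha) (sm_X (d - i) Hb)).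
eexists; apply: sm_ext (sm_add H1 IH); apply: near_all => w; by rewrite big_cons.
Qed.

Lemma smP_rat p q T z : coprimep p q -> smP T z -> smP (fun w => ratP1 p q (T w)) z.
Proof.
move=> c [a [a' [b [b' [Ha Hb ab e]]]]].
have [g1 H1] := sm_hev (rdeg p q) p Ha Hb; have [g2 H2] := sm_hev (rdeg p q) q Ha Hb.
exists (fun w => hev (rdeg p q) p (a w) (b w)), g1, (fun w => hev (rdeg p q) q (a w) (b w)), g2; split=> //.
  exact: hev_ne0.
have ab2 : near z (fun w => (a w != 0) || (b w != 0)).
  by case/orP: ab => h; [apply: near_imp (sm_ne0 Ha h) | apply: near_imp (sm_ne0 Hb h)] => w ->; rewrite ?orbT.
by apply: near_imp (near_and e ab2) => w [-> h]; rewrite ratP1_fr.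
Qed.

Lemma smP_ext T U z : near z (fun w => U w = T w) -> smP T z -> smP U z.
Proof.
move=> e [a [a' [b [b' [Ha Hb ab e2]]]]]; exists a, a', b, b'; split=> //.
by apply: near_imp (near_and e e2) => w [-> ->].
Qed.

Lemma smP_comp T h h' z : sm h h' z -> smP T (h z) -> smP (fun w => T (h w)) z.
Proof.
move=> H [a [a' [b [b' [Ha Hb ab e2]]]]].
exists (fun w => a (h w)), (fun w => a' (h w) * h' w), (fun w => b (h w)), (fun w => b' (h w) * h' w).
by split=> //; [exact: sm_comp|exact: sm_comp|exact: sm_comp_near H e2].
Qed.

Lemma smP_eq T U z : smP T z -> smP U z ->
  (forall e : R, 0 < e -> exists2 w, nm (w - z) < e & T w = U w) -> T z = U z.
Proof.
move=> [a [a' [b [b' [Ha Hb ab e]]]]] [c [c' [d [d' [Hc Hd cd e2]]]]] E.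
rewrite (near_self e) (near_self e2); apply/fr_eq => //.
have ne f f' g g' : sm f f' z -> sm g g' z -> (f z != 0) || (g z != 0) -> near z (fun w => (f w != 0) || (g w != 0)).
  by move=> Hf Hg /orP[] h; [apply: near_imp (sm_ne0 Hf h) | apply: near_imp (sm_ne0 Hg h)] => w ->; rewrite ?orbT.
apply: (near_eq_lim (sm_mul Ha Hd) (sm_mul Hb Hc)) => r r0.
have [s s0 hs] := near_and (near_and e e2) (near_and (ne _ _ _ _ Ha Hb ab) (ne _ _ _ _ Hc Hd cd)).
have [w] := E (Num.min r s) ltac:(by rewrite lt_min r0).
rewrite lt_min => /andP[wr /hs [[e3 e4] [n1 n2]]] e5; exists w => //.
by apply/fr_eq => //; rewrite -e3 -e4.
Qed.

(* Solutions of T'^m = C0 b(T) with values in the projective line. *)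
Record solution (b : {poly C}) (m : nat) (C0 : C) (T : C -> P1) : Prop := Solution {
  sol_sm : forall z, smP T z;
  sol_fin : forall (B : seq P1) (M : R), exists s : seq C, forall z, nm z < M -> T z \in B -> z \in s;
  sol_ode : forall z h h', sm h h' z -> near z (fun w => T w = Some (h w)) ->
     h' z ^+ m = C0 * b.[h z] }.

(** Both sides are continuous. This recovers the equation at isolated points where a computation has
    to divide by zero or meets the value infinity. *)
Lemma ode_lim b m C0 h h' z : sm h h' z ->
  (forall e : R, 0 < e -> exists2 w, nm (w - z) < e & h' w ^+ m = C0 * b.[h w]) ->
  h' z ^+ m = C0 * b.[h z] :> C.
Proof.
move=> H E.
apply/eqP; rewrite -subr_eq0 -nm_eq0 eq_le nm_ge0 andbT leNgt; apply/negP => p.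
set D := nm _ in p.
have [r r0 hr] := sm_cont (sm_poly 'X^m (h' z)) (e := D / 2) ltac:(lra).
have [s s0 hs] := near_and (sm_cont2 H r0) (sm_cont (sm_mul (sm_const C0 z) (sm_pcomp b H)) (e := D / 2) ltac:(lra)).
have [w /hs [[_ /hr h1] h2] ew] := E s s0.
rewrite !hornerXn ew in h1.
have := nmD3 (C0 * b.[h w]) (h' z ^+ m) (C0 * b.[h z]).
by rewrite -/D nmB; rewrite nmB in h1; move: h1 h2; rewrite nmB (nmB (C0 * b.[h w])) (nmB (h' z ^+ m)); lra.
Qed.

Lemma nm_div_lt (t mu : C) (r : R) j : 0 < r -> 1 < nm mu -> nm t / r < nm mu ^+ j -> nm (t / mu ^+ j) < r.
Proof.
move=> r0 m1 h; have mp : 0 < nm mu ^+ j by rewrite exprn_gt0 //; lra.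
by rewrite nmM nmV nmX ltr_pdivrMr //; move: h; rewrite ltr_pdivrMr // mulrC.
Qed.

Lemma quot_lim m l (B0 : C) (d : R) : B0 != 0 -> 0 < d -> exists2 r : R, 0 < r & forall A B E : C,
  nm (A - 1) < r -> nm (B - 1) < r -> nm (E - B0) < r -> nm (A ^+ m / (B ^+ l * E) - B0^-1) < d.
Proof.
move=> b0 dp.
have nB0 : 0 < nm B0^-1 by rewrite nm_gt0 invr_eq0.
have S1 : sm (fun w : C => w ^+ m) (fun w => m%:R * w ^+ m.-1 * 1) 1 by exact: sm_X (sm_id 1).
have S2 : sm (fun w : C => w ^+ l) (fun w => l%:R * w ^+ l.-1 * 1) 1 by exact: sm_X (sm_id 1).
have [ra ra0 ha] := sm_cont (sm_inv b0) (e := Num.min (nm B0^-1) (d / 8)) ltac:(rewrite lt_min nB0; lra).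
pose M := 2 * nm B0^-1.
have M0 : 0 < 8 * M by rewrite /M; lra.
pose dd := Num.min 1 (d / (8 * M)).
have dd0 : 0 < dd by rewrite lt_min ltr01 divr_gt0.
have [rb rb0 hb] := sm_cont S1 dd0.
have S3 : sm (fun w : C => (w ^+ l)^-1) (fun w => - (w ^+ l) ^- 2 * (l%:R * w ^+ l.-1 * 1)) 1.
  by apply: sm_comp S2 (sm_inv _); rewrite expr1n oner_eq0.
have [rc rc0 hc] := sm_cont S3 dd0.
exists (Num.min ra (Num.min rb rc)); first by rewrite !lt_min ra0 rb0.
move=> A B E; rewrite !lt_min => /and3P[a1 a2 a3] /and3P[f1 f2 f3] /and3P[g1 g2 g3].
have k1 := hb A a2; have k2 := hc B f3; have k3 := ha E g1.
rewrite expr1n in k1; rewrite expr1n invr1 in k2.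
have [k4 k5] : nm (E^-1 - B0^-1) < nm B0^-1 /\ nm (E^-1 - B0^-1) < d / 8.
  by move: k3; rewrite lt_min => /andP.
have j1 : dd <= 1 by rewrite ge_min lexx.
have j2 : dd * (8 * M) <= d by rewrite -ler_pdivlMr // ge_min lexx orbT.
have -> : A ^+ m / (B ^+ l * E) - B0^-1 = (A ^+ m - 1) * (B ^+ l)^-1 * E^-1 + ((B ^+ l)^-1 - 1) * E^-1 + (E^-1 - B0^-1).
  by rewrite invfM; ring.
have nE : nm E^-1 <= M by have := nm_sub E^-1 B0^-1; rewrite /M; lra.
have nB : nm (B ^+ l)^-1 <= 2 by have := nm_sub (B ^+ l)^-1 1; rewrite nm1; lra.
have n1 := nmD ((A ^+ m - 1) * (B ^+ l)^-1 * E^-1 + ((B ^+ l)^-1 - 1) * E^-1) (E^-1 - B0^-1).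
have n2 := nmD ((A ^+ m - 1) * (B ^+ l)^-1 * E^-1) (((B ^+ l)^-1 - 1) * E^-1).
rewrite 3!nmM in n2.
have o1 : nm (A ^+ m - 1) * nm (B ^+ l)^-1 * nm E^-1 <= dd * 2 * M.
  by apply: ler_pM; rewrite ?mulr_ge0 ?nm_ge0 //; apply: ler_pM; rewrite ?nm_ge0 //; exact: ltW.
have o2 : nm ((B ^+ l)^-1 - 1) * nm E^-1 <= dd * M.
  by apply: ler_pM; rewrite ?nm_ge0 //; exact: ltW.
lra.
Qed.

Section Construct.
Variables (p q b : {poly C}) (m n l : nat) (c x0 : C).
Hypotheses (cpq : coprimep p q) (d0 : (0 < rdeg p q)%N) (m0 : (0 < m)%N) (c0 : c != 0).
Hypothesis sb : (size b <= (2 * m).+1)%N.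
(** With f = p / q this reads f'^m b = c b(f): pull-back by f multiplies the form dx^m / b by c. *)
Hypothesis form : wron p q ^+ m * b = c *: hpol (2 * m) b p q.
Variable b1 : {poly C}.
Hypotheses (eb : b = ('X - x0%:P) ^+ l * b1) (b10 : b1.[x0] != 0).
Hypotheses (hn : (n * (m - l))%N = m) (lm : (l < m)%N).
Hypotheses (fixx : p.[x0] = x0 * q.[x0]) (qx0 : q.[x0] != 0).
Let f x := p.[x] / q.[x].
Let f' x := (p^`().[x] * q.[x] - p.[x] * q^`().[x]) / q.[x] ^+ 2.
Variable mu : C.
Hypotheses (emu : f' x0 = mu) (mu1 : 1 < nm mu) (muc : mu ^+ (m - l) = c).

Let smf x : q.[x] != 0 -> sm f f' x.
Proof. by move=> q0; exact: sm_div (sm_poly p x) (sm_poly q x) q0. Qed.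

Let inv x : q.[x] != 0 -> f' x ^+ m * b.[x] = c * b.[f x].
Proof.
move=> q0; have := congr1 (horner^~ x) form.
rewrite hornerM horner_exp hornerZ hpolE /wron !hornerE (hev_Y _ sb q0) -/(f x) => e.
have -> : f' x ^+ m = (p^`().[x] * q.[x] - p.[x] * q^`().[x]) ^+ m / q.[x] ^+ (2 * m).
  by rewrite /f' expr_div_n -exprM.
by rewrite mulrAC e; field; rewrite expf_neq0.
Qed.

Let n0 : (0 < n)%N. Proof. by case: n hn m0 => // <-; rewrite mul0n. Qed.

(** The linearisation ph at x0 satisfies ph'^m t^l = C1 b(ph), the factor t^l being due to the zero
    of b at x0. The substitution t = z^n absorbs it, since n (m - l) = m gives (n - 1) m = n l. The
    multiplier mu becomes its n-th root lam, with lam^m = mu^(m - l) = c, and the functional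
    equation extends the solution to the plane. *)
Theorem theta_exists : exists T lam C0, [/\ solution b m C0 T, C0 != 0, 1 < nm lam &
   forall z, ratP1 p q (T z) = T (lam * z)].
Proof.
have ebx (x : C) : b.[x] = (x - x0) ^+ l * b1.[x] by rewrite eb !hornerE.
have fx0 : f x0 = x0 by rewrite /f fixx mulfK.
have mu1r : (1 : R) < nm mu := mu1.
have mu1' : 1 < nm (f' x0) by rewrite emu.
have [ph [ph' [e [K [e0 K0 Hph [ph0 ph'0] phf]]]]] := koenigs (smf qx0) fx0 mu1'.
rewrite emu in phf.
have smph t : nm t < e -> sm ph ph' t.
  move=> te; exists (e - nm t), K; split=> //; first by lra.
  by move=> v w hv hw; apply: Hph; rewrite subr0; [have := nmD3 t v 0|have := nmD3 t w 0]; rewrite !subr0; lra.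
have sm0 : sm ph ph' 0 by apply: smph; rewrite nm0.
have [r1 r10 hr1] : near 0 (fun t => q.[ph t] != 0 /\ b1.[ph t] != 0).
  by apply: near_and; [apply: sm_ne0 (sm_pcomp q sm0) _|apply: sm_ne0 (sm_pcomp b1 sm0) _]; rewrite ph0.
(* The last bound makes ph injective on the disc of radius e1: there ph' differs from 1 by at most 2
   K e1, and the quadratic remainder costs as much again. *)
pose e1 := Num.min (Num.min e r1) (5 * (K + 1))^-1.
have e10 : 0 < e1 by rewrite /e1 !lt_min e0 r10 invr_gt0; lra.
have [e1e e1r] : e1 <= e /\ e1 <= r1 by split; rewrite !ge_min lexx ?orbT.
have e1K : 5 * (K + 1) * e1 <= 1.
  by rewrite mulrC -ler_pdivlMr ?mul1r; [rewrite ge_min lexx orbT|lra].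
have inj v w : nm v < e1 -> nm w < e1 -> ph v = ph w -> v = w.
  move=> hv hw ev; apply/eqP; rewrite eq_sym -subr_eq0 -nm_eq0 eq_le nm_ge0 andbT leNgt; apply/negP => P.
  have z0 : nm (0 - 0 : C) < e by rewrite subr0 nm0.
  have v0 : nm (v - 0) < e by rewrite subr0; lra.
  have w0 : nm (w - 0) < e by rewrite subr0; lra.
  have h1 := Hph v w v0 w0; have h2 := c11_lip' Hph z0 v0.
  rewrite ev subrr sub0r nmN nmM in h1; rewrite ph'0 subr0 in h2.
  have h3 := nm_sub 1 (ph' v); rewrite nm1 (nmB 1) in h3.
  have h4 := nmD3 0 w v; rewrite subr0 sub0r nmN in h4.
  have h5 : (1 - 2 * K * e1) * nm (w - v) <= nm (ph' v) * nm (w - v).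
    by apply: ler_wpM2r; rewrite ?nm_ge0 //; nra.
  have h6 : K * nm (w - v) * nm (w - v) <= 2 * K * e1 * nm (w - v).
    by apply: ler_wpM2r; rewrite ?nm_ge0 //; nra.
  rewrite expr2 mulrA in h1.
  have : (1 - 4 * K * e1) * nm (w - v) <= 0 by nra.
  have : 0 < (1 - 4 * K * e1) * nm (w - v) by apply: mulr_gt0 => //; nra.
  lra.
have phfun (t : C) : nm (mu * t) < e1 -> ph (mu * t) = f (ph t).
  by move=> h; apply: phf; lra.
have mut (t : C) : nm t <= nm (mu * t) by rewrite nmM; have := nm_ge0 t; nra.
have mu0 : mu != 0 by rewrite -nm_gt0; lra.
pose C1 := b1.[x0]^-1.
(* The quotient [Q] of the two sides, up to the constant C1, is invariant under s -> mu s by the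
   linearisation and [inv]. Following t / mu^j to 0 identifies it with its limit 1 / b1(x0) = C1. *)
have odeph (t : C) : nm t < e1 -> t != 0 -> ph' t ^+ m * t ^+ l = C1 * b.[ph t].
  pose g (s : C) : C := (ph s - x0) / s.
  pose Q (s : C) : C := ph' s ^+ m / (g s ^+ l * b1.[ph s]).
  have gn0 (s : C) : nm s < e1 -> s != 0 -> g s != 0 /\ b1.[ph s] != 0.
    move=> hs s0; have [_ h] := hr1 s ltac:(rewrite subr0; lra); split=> //.
    rewrite /g mulf_neq0 ?invr_eq0 // subr_eq0 -ph0; apply: contra_neq s0 => /inj; apply=> //.
    by rewrite nm0.
  have Qinv (s : C) : nm (mu * s) < e1 -> s != 0 -> Q (mu * s) = Q s.
    move=> hs s0; have hs1 : nm s < e1 by have := mut s; lra.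
    have [qs bs] := hr1 s ltac:(rewrite subr0; lra).
    have ms0 : mu * s != 0 by rewrite mulf_neq0.
    have [g1 b1s] := gn0 _ hs ms0; have [g2 b2s] := gn0 _ hs1 s0.
    have D : ph' (mu * s) * mu = f' (ph s) * ph' s.
      have A1 : sm (fun w => ph (mu * w)) (fun w => ph' (mu * w) * (0 * w + mu * 1)) s.
        by apply: sm_comp (sm_mul (sm_const mu s) (sm_id s)) _; apply: smph; lra.
      have A2 : sm (fun w => f (ph w)) (fun w => f' (ph w) * ph' w) s.
        by apply: sm_comp (smph _ _) (smf qs); lra.
      have := sm_uniq_near A1 A2; rewrite mul0r add0r mulr1; apply.
      have [r rr hr] : near s (fun w => nm (mu * w) < e1).
        exists ((e1 - nm (mu * s)) / nm mu); first by rewrite divr_gt0 //; lra.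
        move=> w; rewrite ltr_pdivlMr; last by lra.
        by rewrite mulrC -nmM mulrBr; have := nmD3 (mu * s) (mu * w) 0; rewrite !subr0; lra.
      by exists r => // w /hr /phfun.
    have I := inv qs; rewrite !ebx in I.
    have F0 : f' (ph s) ^+ m * g s ^+ l * b1.[ph s] = c * mu ^+ l * g (mu * s) ^+ l * b1.[ph (mu * s)].
      apply: (mulfI (expf_neq0 l s0)).
      transitivity (f' (ph s) ^+ m * ((ph s - x0) ^+ l * b1.[ph s])).
        by rewrite /g [((ph s - x0) / s) ^+ l]expr_div_n; move: (f' (ph s)) => F; field; rewrite expf_neq0.
      by rewrite I phfun // /g phfun // expr_div_n exprMn; field; rewrite !expf_neq0.
    have mu_m : mu ^+ m = c * mu ^+ l by rewrite -muc -exprD subnK // ltnW.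
    rewrite /Q; apply/eqP; rewrite eqr_div ?mulf_neq0 ?expf_neq0 //; apply/eqP.
    apply: (mulfI (expf_neq0 m mu0)).
    transitivity ((ph' (mu * s) * mu) ^+ m * (g s ^+ l * b1.[ph s])); first by rewrite [(_ * mu) ^+ m]exprMn; ring.
    rewrite D [(_ * ph' s) ^+ m]exprMn mu_m.
    by transitivity (ph' s ^+ m * (f' (ph s) ^+ m * g s ^+ l * b1.[ph s])); [|rewrite F0]; ring.
  have Qit j (s : C) : nm s < e1 -> s != 0 -> Q (s / mu ^+ j) = Q s.
    move=> hs s0; elim: j => [|j IH]; first by rewrite expr0 divr1.
    have muj : mu ^+ j != 0 by rewrite expf_neq0.
    rewrite -IH -Qinv; last by rewrite mulf_neq0 // invr_eq0 expf_neq0.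
      by congr Q; rewrite exprS; field; rewrite mu0 muj.
    have -> : mu * (s / mu ^+ j.+1) = s / mu ^+ j by rewrite exprS; field; rewrite mu0 muj.
    apply: le_lt_trans hs; rewrite nmM nmV nmX ler_piMr ?nm_ge0 // invf_le1 ?exprn_gt0 //; last by lra.
    by apply: exprn_ege1; lra.
  have glim (d : R) : 0 < d -> exists2 r : R, 0 < r & forall s, nm s < r -> s != 0 -> nm (g s - 1) < d.
    move=> dp; exists (Num.min e (d / (K + 1))); first by rewrite lt_min e0 divr_gt0 //; lra.
    move=> s; rewrite lt_min ltr_pdivlMr; last by lra.
    move=> /andP[s1 s2] s0; have z0 : nm (0 - 0 : C) < e by rewrite subr0 nm0.
    have := Hph 0 s z0; rewrite !subr0 ph0 ph'0 mul1r => /(_ s1) h.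
    have sp : 0 < nm s by rewrite nm_gt0.
    have -> : g s - 1 = (ph s - x0 - s) / s by rewrite /g; field.
    by rewrite nmM nmV ltr_pdivrMr //; nra.
  move=> te t0.
  have Qt : Q t = C1.
    apply/eqP; rewrite -subr_eq0 -nm_eq0 eq_le nm_ge0 andbT leNgt; apply/negP => P.
    set D := nm _ in P.
    have [s [sA [sB [sC sD]]]] : exists s, nm s < e1 /\ s != 0 /\ Q s = Q t /\
        nm (Q s - C1) < D.
      have [r rp hr] := quot_lim m l b10 P.
      have [ra ra0 ha] := glim r rp.
      have [rb rb0 hb] := sm_cont2 sm0 rp.
      have [rc rc0 hc] := sm_cont (sm_pcomp b1 sm0) rp.
      pose rr := Num.min ra (Num.min rb rc).
      have rr0 : 0 < rr by rewrite !lt_min ra0 rb0.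
      have [j hj] := expr_large (nm t / rr) mu1r.
      have small : nm (t / mu ^+ j) < rr.
        exact: nm_div_lt.
      have tj0 : t / mu ^+ j != 0 by rewrite mulf_neq0 // invr_eq0 expf_neq0.
      exists (t / mu ^+ j); split.
        apply: le_lt_trans te; rewrite nmM nmV nmX ler_piMr ?nm_ge0 // invf_le1 ?exprn_gt0 //; last by lra.
        by apply: exprn_ege1; lra.
      split=> //; split; first exact: Qit.
      move: small; rewrite !lt_min => /and3P[t1 t2 t3]; rewrite /Q; apply: hr.
      - by have := hb (t / mu ^+ j); rewrite subr0 ph'0 => /(_ t2) [].
      - exact: ha.
      by have := hc (t / mu ^+ j); rewrite subr0 ph0 => /(_ t3).
    by move: sD; rewrite sC -/D ltxx.
  have [gt bt] := gn0 t te t0.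
  have -> : ph' t ^+ m = C1 * (g t ^+ l * b1.[ph t]) by rewrite -Qt /Q divfK // mulf_neq0 // expf_neq0.
  by rewrite ebx /g expr_div_n; field; rewrite expf_neq0.
(* the solution near 0 and its extension by the functional equation *)
pose lam := n.-root mu.
have lamn : lam ^+ n = mu by rewrite /lam rootCK.
have lam1 : 1 < nm lam by apply: (nm_expr_gt1 n0); rewrite lamn.
have lam0 : lam != 0 by rewrite -nm_gt0; lra.
have lamm : lam ^+ m = c by rewrite -hn exprM lamn muc.
pose rho := Num.min 1 e1.
have rho0 : 0 < rho by rewrite lt_min ltr01.
have small z : nm z < rho -> nm (z ^+ n) <= nm z /\ nm (z ^+ n) < e1.
  rewrite lt_min => /andP[z1 z2]; have h : nm (z ^+ n) <= nm z.
    by rewrite nmX -[leRHS]expr1; apply: ler_wiXn2l; rewrite ?nm_ge0 // ltW.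
  by split=> //; lra.
pose th z := ph (z ^+ n).
have thf z : nm (lam * z) < rho -> ratP1 p q (Some (th z)) = Some (th (lam * z)).
  move=> hz; have hz1 : nm z < rho.
    by move: hz; rewrite nmM; have := nm_ge0 z; nra.
  have [_ s1] := small _ hz1; have [_ s2] := small _ hz.
  have [qs _] := hr1 (z ^+ n) ltac:(rewrite subr0; lra).
  by rewrite /= qs /th exprMn lamn phfun //; rewrite -lamn -exprMn.
pose F := ratP1 p q.
have exj z : exists j, nm (z / lam ^+ j) < rho.
  have [j hj] := expr_large (nm z / rho) lam1; exists j.
  exact: nm_div_lt.
have [J hJ] := choice exj.
(* [J z] is any number of steps bringing z / lam^J into the disc where [th] is defined; by [steps]
   the value does not depend on it. *)
pose T z := iter (J z) F (Some (th (z / lam ^+ J z))).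
have shrink z j : nm (z / lam ^+ j) < rho -> nm (z / lam ^+ j.+1) < rho.
  move=> h; apply: le_lt_trans h; rewrite exprSr invfM mulrA nmM nmV ler_piMr ?nm_ge0 //.
  by rewrite invf_le1; lra.
have step z j : nm (z / lam ^+ j) < rho ->
   iter j.+1 F (Some (th (z / lam ^+ j.+1))) = iter j F (Some (th (z / lam ^+ j))).
  move=> h; rewrite iterSr {2}/F thf.
    by congr (iter _ _ (Some (th _))); rewrite exprS; field; rewrite lam0 expf_neq0.
  by have -> : lam * (z / lam ^+ j.+1) = z / lam ^+ j by rewrite exprS; field; rewrite lam0 expf_neq0.
have steps z i k : nm (z / lam ^+ i) < rho -> nm (z / lam ^+ (i + k)) < rho /\
   iter (i + k) F (Some (th (z / lam ^+ (i + k)))) = iter i F (Some (th (z / lam ^+ i))).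
  move=> h; elim: k => [|k [IH1 IH2]]; first by rewrite addn0.
  by rewrite addnS; split; [exact: shrink|rewrite step].
have TE z j : nm (z / lam ^+ j) < rho -> T z = iter j F (Some (th (z / lam ^+ j))).
  move=> h; rewrite /T; have [/subnKC e2|/ltnW/subnKC e2] := leqP (J z) j.
    by have [_] := steps z (J z) (j - J z)%N (hJ z); rewrite e2.
  by have [_] := steps z j (J z - j)%N h; rewrite e2.
have TF z : F (T z) = T (lam * z).
  have E : lam * z / lam ^+ (J z).+1 = z / lam ^+ J z by rewrite exprS; field; rewrite lam0 expf_neq0.
  by rewrite (@TE (lam * z) (J z).+1) E //; exact: hJ.
have smth z : nm z < rho -> sm th (fun w => ph' (w ^+ n) * (n%:R * w ^+ n.-1 * 1)) z.
  by move=> /small [_ s1]; apply: sm_comp (sm_X n (sm_id z)) _; apply: smph; lra.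
have near_j z j : nm (z / lam ^+ j) < rho -> near z (fun w => nm (w / lam ^+ j) < rho).
  move=> h; exists ((rho - nm (z / lam ^+ j)) * nm (lam ^+ j)).
    by rewrite mulr_gt0 ?nm_gt0 ?expf_neq0 //; lra.
  move=> w; rewrite -ltr_pdivrMr ?nm_gt0 ?expf_neq0 // -nmV -nmM mulrBl.
  by have := nmD3 (z / lam ^+ j) (w / lam ^+ j) 0; rewrite !subr0; lra.
have smT z : smP T z.
  have h := hJ z; set j := J z in h.
  apply: (@smP_ext (fun w => iter j F (Some (th (w / lam ^+ j))))).
    by apply: near_imp (near_j _ _ h) => w /TE.
  elim: (X in iter X) => [|k IH]; last exact: smP_rat.
  have S : sm (fun w => w * (lam ^+ j)^-1) (fun w => 1 * (lam ^+ j)^-1 + w * 0) z.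
    exact: sm_mul (sm_id z) (sm_const _ z).
  by apply: smP_Some (sm_comp S (smth _ h)) _; exact: near_all.
have finT (B : seq P1) (M : R) : exists s : seq C, forall z, nm z < M -> T z \in B -> z \in s.
  have [j hj] := expr_large (M / rho) lam1.
  have okj z : nm z < M -> nm (z / lam ^+ j) < rho.
    move=> h; apply: nm_div_lt => //; apply: lt_trans hj; rewrite ltr_pM2r ?invr_gt0 //.
  have [B1 hB1] : exists B1 : seq P1, forall x, iter j F x \in B -> x \in B1.
    elim: j {hj okj} B => [|j IH] B; first by exists B.
    have [B' hB'] := fin_fiber B cpq d0; have [B1 hB1] := IH B'.
    by exists B1 => x /hB'/hB1.
  (* Each value is taken at most once by ph on the small disc, and the n-th power map has finite
     fibres. *)
  have [ts hts] : exists ts : seq C, forall t, nm t < e1 -> Some (ph t) \in B1 -> t \in ts.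
    elim: B1 {hB1} => [|y B1 [ts IH]]; first by exists [::].
    have [[t0 [h1 h2]]|no] := pselect (exists t0, nm t0 < e1 /\ Some (ph t0) = y).
      exists (t0 :: ts) => t ht; rewrite !inE => /orP[/eqP et|/IH->//]; last by rewrite orbT.
      by move: et; rewrite -h2 => -[/inj ->] //; rewrite eqxx.
    exists ts => t ht; rewrite inE => /orP[/eqP et|]; last exact: IH.
    by case: no; exists t.
  have [zs hzs] : exists zs : seq C, forall z, (z / lam ^+ j) ^+ n \in ts -> z \in zs.
    elim: ts {hts} => [|t ts [zs IH]]; first by exists [::].
    have [|zt hzt] := @roots_seq R ('X^n - (t * (lam ^+ j) ^+ n)%:P).
      by rewrite -size_poly_gt0 size_XnsubC.
    exists (zt ++ zs) => z; rewrite inE mem_cat => /orP[/eqP h|/IH ->]; last by rewrite orbT.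
    rewrite -hzt rootE !hornerE -h expr_div_n divfK ?subrr ?eqxx //.
    by rewrite !expf_neq0.
  exists zs => z h1 h2; apply: hzs; apply: hts; first by have [_] := small _ (okj _ h1).
  by apply: hB1; rewrite -TE ?okj.
pose C0 := n%:R ^+ m * C1.
exists T, lam, C0; split=> //; last by rewrite mulf_neq0 ?invr_eq0 // expf_neq0 // pnatr_eq0 -lt0n.
split=> //.
have enl : ((n.-1) * m = n * l)%N.
  have e2 : (n * m = m + n * l)%N by rewrite -[in RHS]hn -mulnDr subnK // ltnW.
  by rewrite -subn1 mulnBl mul1n e2 addKn.
have ode0 z : nm z < rho -> z != 0 -> (ph' (z ^+ n) * (n%:R * z ^+ n.-1 * 1)) ^+ m = C0 * b.[th z].
  move=> hz z0; have [_ s1] := small _ hz.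
  have := odeph _ s1 (expf_neq0 n z0); rewrite -exprM -enl => h.
  transitivity (n%:R ^+ m * (C1 * b.[ph (z ^+ n)])); last by rewrite /C0 mulrA.
  by rewrite -h mulr1 exprMn [(n%:R * _) ^+ m]exprMn -exprM; ring.
(* Induction on the number of applications of f needed to compute T at z. Differentiating T(lam u) =
   f(T u) and using [inv] transports the equation, lam^m = c balancing the constants. *)
suff main j : forall z h h', nm (z / lam ^+ j) < rho -> sm h h' z -> near z (fun w => T w = Some (h w)) ->
    h' z ^+ m = C0 * b.[h z].
  by move=> z h h'; apply: main (hJ z).
elim: j => [|j IH] z h h' hz Hh Th.
  apply: (ode_lim Hh) => e2 e20.
  have Hz := near_and (near_and (near_j _ _ hz) (near_ball z e20)) (near_and (near_near Th) (sm_near Hh)).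
  have [w [[w1 w2] [w3 w4]] w5] := near_avoid [:: 0] Hz.
  exists w => //; have w0 : w != 0 by move: w5; rewrite inE.
  rewrite expr0 divr1 in w1.
  have Tw : near w (fun v => T v = Some (th v)).
    have := near_j w 0%N; rewrite expr0 divr1 => /(_ w1); apply: near_imp => v hv.
    by rewrite (@TE v 0%N) expr0 // divr1.
  have E : near w (fun v => h v = th v) by apply: near_imp (near_and w3 Tw) => v [->] [].
  by rewrite (sm_uniq_near w4 (smth _ w1) E) (near_self E); apply: ode0.
apply: (ode_lim Hh) => e2 e20.
have [s hs] := finT [:: None] ((nm z + 1) / nm lam).
have Hz := near_and (near_and (near_j _ _ hz) (near_ball z e20)) (near_and (near_and (near_near Th) (sm_near Hh)) (near_ball z (ltr01 : (0 : R) < 1))).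
have [w [[w1 w2] [[w3 w4] w6]] w5] := near_avoid [seq lam * x | x <- s] Hz.
exists w => //; pose v := w / lam.
have lv : lam * v = w by rewrite /v mulrC divfK.
have Tv : T v != None.
  apply/negP => /eqP e3; move/negP: w5; apply; rewrite -lv; apply: map_f; apply: hs; last by rewrite e3 inE.
  by rewrite /v nmM nmV ltr_pM2r ?invr_gt0; [have := nmD3 z w 0; rewrite !subr0; lra|lra].
case e4 : (T v) Tv => [y|] // _.
have [k [k' [Hk Tk]]] := smP_fin (smT v) e4.
have I : k' v ^+ m = C0 * b.[k v].
  apply: IH Hk Tk; have -> : v / lam ^+ j = w / lam ^+ j.+1 by rewrite /v exprS; field; rewrite lam0 expf_neq0.
  exact: w1.
have Hlam : sm (fun u => lam * u) (fun u => 0 * u + lam * 1) v by exact: sm_mul (sm_const _ _) (sm_id _).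
have E : near v (fun u => ratP1 p q (Some (k u)) = Some (h (lam * u))).
  have h1 : near v (fun u => T (lam * u) = Some (h (lam * u))).
    apply: (sm_comp_near Hlam (P := fun w => T w = Some (h w))); by rewrite lv.
  by apply: near_imp (near_and Tk h1) => u [<- <-]; rewrite -TF.
have qk : q.[k v] != 0.
  by have := near_self E => /=; case: eqP.
have E2 : near v (fun u => h (lam * u) = f (k u)).
  apply: near_imp (near_and E (sm_ne0 (sm_pcomp q Hk) qk)) => u [/= e5 e6].
  by move: e5; rewrite e6 => -[].
have S1 : sm (fun u => h (lam * u)) (fun u => h' (lam * u) * (0 * u + lam * 1)) v.
  by apply: sm_comp Hlam _; rewrite lv.
have S2 := sm_comp Hk (smf qk).
have D := sm_uniq_near S1 S2 E2; rewrite mul0r add0r mulr1 lv in D.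
have hw : h w = f (k v) by rewrite -lv (near_self E2).
apply: (mulIf (expf_neq0 m lam0)).
by rewrite -exprMn D exprMn I hw lamm mulrCA inv //; ring.
Qed.
End Construct.
End Theta.

(** * Continuation of solutions *)

Section Continuation.
Variable R : realType.
Local Notation C := R[i].
Local Notation nm := (@nm R).
Local Notation P1 := (P1 R).

Lemma inj_notin (X : eqType) (u : nat -> X) (s : seq X) : injective u -> exists j, u j \notin s.
Proof.
move=> inj; apply: contrapT => no.
have sub : {subset [seq u j | j <- iota 0 (size s).+1] <= s}.
  by move=> x /mapP[j _ ->]; apply: contrapT => /negP h; apply: no; exists j.
have := uniq_leq_size _ sub; rewrite map_inj_uniq ?iota_uniq // size_map size_iota => /(_ isT).
by rewrite ltnn.
Qed.

(** Cut the segment into N equal steps: the remainders add up to a term of order 1 / N, and N is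
    arbitrary. *)
Lemma mean_value (D D' : C -> C) z w (r K B : R) : c11 D D' z r K -> 0 <= K -> 0 <= B -> nm (w - z) < r ->
  (forall v, nm (v - z) < r -> nm (D' v) <= B) -> nm (D w - D z) <= B * nm (w - z).
Proof.
move=> H K0 B0 wr HB; set d := nm (w - z).
have d0 : 0 <= d by rewrite nm_ge0.
have main (N : nat) : (0 < N)%N -> nm (D w - D z) <= B * d + K * d ^+ 2 / N%:R.
  move=> N0; have NR : 0 < N%:R :> R by rewrite ltr0n.
  have NC : N%:R != 0 :> C by rewrite pnatr_eq0 -lt0n.
  pose u i : C := z + i%:R / N%:R * (w - z).
  have ud i : (i <= N)%N -> nm (u i - z) < r.
    move=> iN; rewrite /u addrC addKr nmM nmM nmV !nm_nat; apply: le_lt_trans wr.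
    by rewrite -/d ler_piMl // ler_pdivrMr // mul1r ler_nat.
  have us i : nm (u i.+1 - u i) = d / N%:R.
    rewrite /u opprD addrACA subrr add0r -mulrBl -mulrBl -natrB // subSnn nmM nmM nmV !nm_nat -/d.
    by rewrite mul1r mulrC.
  have st i : (i <= N)%N -> nm (D (u i) - D z) <= i%:R * (B * d / N%:R + K * d ^+ 2 / N%:R ^+ 2).
    elim: i => [|i IH] iN; first by rewrite /u !mul0r addr0 subrr nm0.
    apply: le_trans (nmD3 (D (u i)) _ _) _; rewrite -natr1 mulrDl mul1r addrC.
    apply: lerD; first by apply: IH; apply: ltnW.
    have h1 := H _ _ (ud i (ltnW iN)) (ud _ iN); have h2 := HB _ (ud i (ltnW iN)).
    have := nm_sub (D (u i.+1) - D (u i)) (D' (u i) * (u i.+1 - u i)); rewrite nmM us.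
    have h3 : nm (D' (u i)) * (d / N%:R) <= B * (d / N%:R).
      by apply: ler_wpM2r => //; rewrite divr_ge0 // ltW.
    move: h1; rewrite us expr_div_n mulrA mulrA in h3 *; lra.
  have := st N (leqnn N); rewrite {1}/u divff // mul1r subrKC.
  have -> // : N%:R * (B * d / N%:R + K * d ^+ 2 / N%:R ^+ 2) = B * d + K * d ^+ 2 / N%:R.
  by field; rewrite gt_eqF.
rewrite leNgt; apply/negP => lt.
have [N hN] := archi_nat (K * d ^+ 2 / (nm (D w - D z) - B * d)).
have := main N.+1 isT; rewrite -lerBlDl ler_pdivlMr ?ltr0n // => h.
move: hN; rewrite ltr_pdivrMr; last by lra.
have : N%:R <= N.+1%:R :> R by rewrite ler_nat.
nra.
Qed.

(** The mean value bound improves |D| <= X to |D| <= L r X <= X / 2 on the same disc; iterate. *)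
Lemma gronwall (D D' : C -> C) z (r K L M : R) : c11 D D' z r K -> 0 <= K -> 0 <= L -> D z = 0 ->
  (forall v, nm (v - z) < r -> nm (D v) <= M /\ nm (D' v) <= L * nm (D v)) -> L * r <= 1 / 2 ->
  forall v, nm (v - z) < r -> D v = 0.
Proof.
move=> H K0 L0 Dz HM Lr v hv.
have r0 : 0 < r by have := nm_ge0 (v - z); lra.
have M0 : 0 <= M by have [h _] := HM v hv; have := nm_ge0 (D v); lra.
have it j : forall w, nm (w - z) < r -> nm (D w) <= M * (1 / 2) ^+ j.
  elim: j => [|j IH] w hw; first by rewrite mulr1; case: (HM w hw).
  have X0 : 0 <= M * (1 / 2) ^+ j by apply: mulr_ge0 => //; apply: exprn_ge0; lra.
  have := @mean_value D D' z w r K (L * (M * (1 / 2) ^+ j)) H K0 _ hw; rewrite Dz subr0.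
  have h1 : 0 <= L * (M * (1 / 2) ^+ j) by rewrite mulr_ge0.
  move=> /(_ h1) h2; apply: le_trans (h2 _) _.
    by move=> u hu; have [_ h3] := HM u hu; apply: le_trans h3 _; apply: ler_wpM2l => //; apply: IH.
  by rewrite exprS; have := nm_ge0 (w - z); nra.
apply/eqP; rewrite -nm_eq0 eq_le nm_ge0 andbT.
apply: (@le_geom R _ 0 M (1 / 2)); first by lra.
by move=> j; rewrite add0r; apply: it.
Qed.

Lemma sm_prim_near h h' z (e : R) : @sm R h h' z -> 0 < e -> exists r K, [/\ 0 < r, r <= e, 0 <= K & c11 h h' z r K].
Proof.
move=> [r [K [r0 K0 H]]] e0; exists (Num.min r e), K; split=> //; first by rewrite lt_min r0.
  by rewrite ge_min lexx orbT.
by move=> v w; rewrite !lt_min => /andP[v1 _] /andP[w1 _]; apply: H.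
Qed.

(** The equation fixes only the m-th power of the derivative. Near the nonzero number h' z the m-th
    power map expands distances by at least sg > 0, which turns the equation into |h' - k'| <= L |h
    - k|, and [gronwall] concludes. *)
Lemma ode_unique (b : {poly C}) m C0 h h' k k' z : (0 < m)%N -> sm h h' z -> sm k k' z ->
  near z (fun w => h' w ^+ m = C0 * b.[h w]) -> near z (fun w => k' w ^+ m = C0 * b.[k w]) ->
  h z = k z -> h' z = k' z -> h' z != 0 -> near z (fun w => h w = k w).
Proof.
move=> m0 Hh Hk Eh Ek e1 e2 n0.
have [rX [KX [rX0 KX0 HX]]] := sm_bd (sm_X m (sm_id (h' z))).
pose A := nm (m%:R * h' z ^+ m.-1 * 1).
have A0 : 0 < A by rewrite nm_gt0 mulr1 mulf_neq0 ?expf_neq0 // pnatr_eq0 -lt0n.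
pose sg := A / 2.
have sg0 : 0 < sg by rewrite /sg; lra.
pose d := Num.min rX (A / 8 / KX).
have d0 : 0 < d by rewrite lt_min rX0 !divr_gt0.
have hd x y : nm (x - h' z) < d -> nm (y - h' z) < d -> sg * nm (x - y) <= nm (x ^+ m - y ^+ m).
  rewrite !lt_min !ltr_pdivlMr // => /andP[x1 x2] /andP[y1 y2].
  have zz : nm (h' z - h' z) < rX by rewrite subrr nm0.
  have [_ _ _ [_ a1]] := HX _ y zz y1; have [a2 _ _ _] := HX y x y1 x1.
  rewrite /= in a1 a2.
  have a3 := nm_sub (m%:R * h' z ^+ m.-1 * 1) (m%:R * y ^+ m.-1 * 1); rewrite -/A nmB in a3.
  have a4 := nm_sub (m%:R * y ^+ m.-1 * 1 * (x - y)) (x ^+ m - y ^+ m); rewrite nmM (nmB (_ * (x - y))) in a4.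
  have a5 := nmD3 (h' z) x y; rewrite (nmB (h' z)) in a5.
  have p := nm_ge0 (x - y).
  have a6 : A * (7 / 8) * nm (x - y) <= nm (m%:R * y ^+ m.-1 * 1) * nm (x - y) by apply: ler_wpM2r => //; lra.
  have a7 : KX * nm (x - y) * nm (x - y) <= A / 4 * nm (x - y) by apply: ler_wpM2r => //; nra.
  rewrite expr2 mulrA in a2; rewrite /sg; nra.
have [rb [Kb [rb0 Kb0 Hb]]] := sm_bd (sm_poly b (h z)).
pose L := nm C0 * Kb / sg.
have L0 : 0 <= L by apply: divr_ge0; [apply: mulr_ge0; [exact: nm_ge0|exact: ltW]|exact: ltW].
have HD : sm (fun w => h w + (-1) * k w) (fun w => h' w + (0 * k w + (-1) * k' w)) z.
  exact: sm_add Hh (sm_mul (sm_const (-1) z) Hk).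
have [s0 [M0 [s00 M00 HM0]]] := sm_bd HD.
have [t t0 ht] := near_and (near_and (near_and Eh Ek) (near_and (sm_cont2 Hh d0) (sm_cont2 Hk d0)))
   (near_and (near_and (sm_cont Hh rb0) (sm_cont Hk rb0)) (near_ball z s00)).
have [r [K [r0 rt K0 H]]] := sm_prim_near HD (e := Num.min t (1 / (2 * L + 1))) ltac:(rewrite lt_min t0 divr_gt0 //; lra).
have [rt1 rt2] : r <= t /\ r <= 1 / (2 * L + 1) by move: rt; rewrite le_min => /andP.
exists r => // w hw.
have : h w + (-1) * k w = 0; last by rewrite mulN1r => /eqP; rewrite subr_eq0 => /eqP.
apply: (gronwall (M := M0) H K0 L0) hw.
- by rewrite e1 mulN1r subrr.
- move=> v hv; have [[[o1 o2] [[_ q1] [_ q2]]] [[u1 u2] u3]] := ht v (lt_le_trans hv rt1).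
  split; first by have [] := HM0 v v u3 u3.
  have sv := hd (h' v) (k' v) q1 ltac:(by rewrite e2).
  rewrite mul0r add0r !mulN1r.
  have G : nm (b.[h v] - b.[k v]) <= Kb * nm (h v - k v).
    by have [] := Hb (k v) (h v) ltac:(by rewrite e1) u1 => _ _ _ [].
  have i2 : nm C0 * nm (b.[h v] - b.[k v]) <= nm C0 * (Kb * nm (h v - k v)) by apply: ler_wpM2l; rewrite ?nm_ge0.
  rewrite o1 o2 -mulrBr nmM in sv.
  have -> : L * nm (h v - k v) = nm C0 * (Kb * nm (h v - k v)) / sg by rewrite /L; ring.
  by rewrite ler_pdivlMr // mulrC; lra.
move: rt2; rewrite ler_pdivlMr; lra.
Qed.

(** The values at which the equation gives no local uniqueness: at a root of b the derivative
    vanishes, and infinity lies outside the affine chart. *)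
Definition bad (b : {poly C}) (x : P1) : bool := if x is Some y then root b y else true.

Lemma bad_list b : b != 0 -> exists B : seq P1, forall x, bad b x -> x \in B.
Proof.
move=> /roots_seq[s hs]; exists (None :: [seq Some y | y <- s]) => -[y|] //= h.
by rewrite inE /= mem_map -?hs // => ? ? [].
Qed.

Section Sol.
Variables (b : {poly C}) (m : nat) (C0 : C).
Hypotheses (b0 : b != 0) (m0 : (0 < m)%N) (C00 : C0 != 0).

Lemma sol_bad T (M : R) : solution b m C0 T -> exists s : seq C, forall z, nm z < M -> bad b (T z) -> z \in s.
Proof.
move=> S; have [B hB] := bad_list b0; have [s hs] := sol_fin S B M.
by exists s => z h1 /hB; apply: hs.
Qed.

Lemma sol_generic T z (P : C -> Prop) : solution b m C0 T -> near z P -> exists2 w, P w & ~~ bad b (T w).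
Proof.
move=> S NP; have [s hs] := sol_bad (nm z + 1) S.
have [w [w1 w2] w3] := near_avoid s (near_and NP (near_ball z (ltr01 : (0 : R) < 1))).
exists w => //; apply/negP => h; move/negP: w3; apply; apply: hs => //.
by have := nmD3 z w 0; rewrite !subr0; lra.
Qed.

Lemma sol_chart T z : solution b m C0 T -> ~~ bad b (T z) -> exists h h',
  [/\ sm h h' z, near z (fun w => T w = Some (h w)), near z (fun w => h' w ^+ m = C0 * b.[h w]) & h' z != 0].
Proof.
move=> S; case e : (T z) => [y|] //= ny.
have [h [h' [Hh Th]]] := smP_fin (sol_sm S z) e.
have O : near z (fun w => h' w ^+ m = C0 * b.[h w]).
  by apply: near_imp (near_and (sm_near Hh) (near_near Th)) => w [] /(sol_ode S).
exists h, h'; split=> //.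
have := near_self O; have := near_self Th; rewrite e => -[<-] /eqP.
by apply: contraTneq => ->; rewrite expr0n gtn_eqF // eq_sym mulf_neq0.
Qed.

(** The set of local agreement is closed at generic points: agreement near points accumulating at z
    gives equal values and, by continuity, equal derivatives at z, so [ode_unique] applies. *)
Lemma sol_unique T U z : solution b m C0 T -> solution b m C0 U -> ~~ bad b (T z) ->
  (forall e : R, 0 < e -> exists2 w, nm (w - z) < e & near w (fun v => T v = U v)) ->
  near z (fun w => T w = U w).
Proof.
move=> ST SU ng E.
have Tz : T z = U z.
  apply: smP_eq (sol_sm ST z) (sol_sm SU z) _ => e /E [w we /near_self]; by exists w.
have [h [h' [Hh Th Oh nh]]] := sol_chart ST ng.
have [|k [k' [Hk Uk Ok nk]]] := sol_chart (z := z) SU; first by rewrite -Tz.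
have hk : h z = k z by have := near_self Th; have := near_self Uk; rewrite -Tz => -> [].
have hk' : h' z = k' z.
  apply/eqP; rewrite -subr_eq0 -nm_eq0 eq_le nm_ge0 andbT leNgt; apply/negP => p.
  have N := near_and (near_and (near_near Th) (near_near Uk)) (near_and (near_and (sm_near Hh) (sm_near Hk))
    (near_and (sm_cont2 Hh (e := nm (h' z - k' z) / 2) ltac:(lra)) (sm_cont2 Hk (e := nm (h' z - k' z) / 2) ltac:(lra)))).
  have [r r0 hr] := N; have [w wr wE] := E r r0.
  have [[t1 t2] [[s1 s2] [[_ d1] [_ d2]]]] := hr w wr.
  have e3 : h' w = k' w.
    apply: sm_uniq_near s1 s2 _; apply: near_imp (near_and wE (near_and t1 t2)) => v [e4 [e5 e6]].
    by move: e4; rewrite e5 e6 => -[].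
  by have := nmD3 (k' w) (h' z) (k' z); rewrite (nmB (h' z) (k' w)); rewrite e3 in d1; lra.
have := ode_unique m0 Hh Hk Oh Ok hk hk' nh => H.
by apply: near_imp (near_and H (near_and Th Uk)) => w [e1 [-> ->]]; rewrite e1.
Qed.

Lemma sol_segment T U (a a' : C) : solution b m C0 T -> solution b m C0 U ->
  near a (fun w => T w = U w) ->
  (forall t : R, 0 <= t <= 1 -> ~~ bad b (T (a + t%:C * (a' - a)))) -> near a' (fun w => T w = U w).
Proof.
move=> ST SU Na ng.
pose g (t : R) := a + t%:C * (a' - a).
have gd (s t : R) : nm (g s - g t) = `|s - t| * nm (a' - a).
  by rewrite /g opprD addrACA subrr add0r -mulrBl -rmorphB nmM nmR.
have A0 : 0 < nm (a' - a) + 1 by have := nm_ge0 (a' - a); lra.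
suff : forall t : R, 0 <= t <= 1 -> near (g t) (fun w => T w = U w).
  by move/(_ 1); rewrite /g mul1r subrKC; apply; lra.
apply: real_ind.
- by rewrite /g mul0r addr0.
- move=> t ht [r r0 hr]; exists (r / 2 / (nm (a' - a) + 1)); first by rewrite !divr_gt0.
  move=> s hs; exists (r / 2); first by lra.
  move=> w hw; apply: hr; have := nmD3 (g s) w (g t); rewrite gd ger0_norm; last by lra.
  have : (s - t) * (nm (a' - a) + 1) <= r / 2 by rewrite -ler_pdivlMr //; lra.
  by have := nm_ge0 (a' - a); nra.
move=> t ht IH; apply: sol_unique => //; first by apply: ng; lra.
move=> e e0.
pose s := Num.max 0 (t - e / 2 / (nm (a' - a) + 1)).
have q0 : 0 < e / 2 / (nm (a' - a) + 1) by rewrite !divr_gt0.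
have hs : 0 <= s < t by rewrite /s le_max lexx /= gt_max; apply/andP; split; lra.
exists (g s); last exact: IH.
rewrite gd ler0_norm; last by lra.
have h1 : t - e / 2 / (nm (a' - a) + 1) <= s by rewrite /s le_max lexx orbT.
have : (t - s) * (nm (a' - a) + 1) <= e / 2 by rewrite -ler_pdivlMr //; lra.
by have := nm_ge0 (a' - a); nra.
Qed.

(** Bad points are finite in number in every disc, so two generic points are joined by a path of two
    segments avoiding them, along which agreement propagates; the remaining points follow by
    continuity. *)
Lemma sol_continue T U a : solution b m C0 T -> solution b m C0 U -> near a (fun w => T w = U w) ->
  forall z, T z = U z.
Proof.
move=> ST SU Na z.
have [a1 N1 g1] := sol_generic ST (near_near Na).
apply: smP_eq (sol_sm ST z) (sol_sm SU z) _ => e e0.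
have [z1 Nz [g2 az]] : exists2 z1, nm (z1 - z) < e & ~~ bad b (T z1) /\ z1 != a1.
  have [s hs] := sol_bad (nm z + 1) ST.
  have [w [w1 w2] w3] := near_avoid (a1 :: s) (near_and (near_ball z e0) (near_ball z (ltr01 : (0 : R) < 1))).
  move: w3; rewrite inE negb_or => /andP[w3 w4]; exists w => //; split=> //.
  apply/negP => h; move/negP: w4; apply; apply: hs => //.
  by have := nmD3 z w 0; rewrite !subr0; lra.
exists z1 => //; suff : near z1 (fun w => T w = U w) by apply: near_self.
pose D := z1 - a1; have D0 : D != 0 by rewrite subr_eq0.
have [s hs] := sol_bad (nm a1 + 4 * nm D + 1) ST.
(* The corner of the path is c = a1 + (1 / 2 + i tau) D. For a point x on the first segment [t1 x]
   recovers tau, on the second [t2 x] does, so finitely many bad points exclude finitely many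
   tau. *)
pose t1 (x : C) := complex.Im ((x - a1) / D) / complex.Re ((x - a1) / D) / 2.
pose t2 (x : C) := complex.Im ((x - z1) / D) / complex.Re ((x - z1) / D) / -2.
have [j hj] : exists j : nat, (j.+1%:R : R)^-1 \notin [seq t1 x | x <- s] ++ [seq t2 x | x <- s].
  apply: (inj_notin (u := fun j : nat => (j.+1%:R : R)^-1)) => i k /invr_inj/eqP.
  by rewrite eqr_nat => /eqP [].
set tau := _^-1 in hj.
have tau1 : 0 < tau <= 1.
  by rewrite invr_gt0 ltr0n invf_le1 ?ltr0n // ler1n.
pose c := a1 + (1 / 2 +i* tau) * D.
have nmw : nm (1 / 2 +i* tau) <= 2.
  by apply: le_trans (nm_ReIm _) _; rewrite /= !ger0_norm; lra.
have nD := nm_ge0 D.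
have sc (t x y : R) : t%:C * (x +i* y) = (t * x) +i* (t * y) by simpc.
have Na1 : near a1 (fun w => T w = U w) by [].
have Nc : near c (fun w => T w = U w).
  apply: sol_segment Na1 _ => // t ht.
  have ec : a1 + t%:C * (c - a1) = a1 + t%:C * (1 / 2 +i* tau) * D by rewrite /c; move: (_ +i* _) => X; ring.
  rewrite ec; have [->|t0] := eqVneq t 0; first by rewrite !mul0r addr0.
  apply/negP => h.
  have xs : a1 + t%:C * (1 / 2 +i* tau) * D \in s.
    apply: hs h; have := nmD a1 (t%:C * (1 / 2 +i* tau) * D); rewrite !nmM nmR ger0_norm; last by lra.
    have : t * nm (1 / 2 +i* tau) * nm D <= 2 * nm D.
      by apply: ler_wpM2r => //; have := nm_ge0 (1 / 2 +i* tau); nra.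
    lra.
  move/negP: hj; apply; rewrite mem_cat; apply/orP; left; apply/mapP; eexists; first exact: xs.
  by rewrite /t1 addrC addKr mulfK // sc /=; field.
apply: sol_segment Nc _ => // t ht.
have ec : c + t%:C * (z1 - c) = z1 - (1 - t)%:C * (1 / 2 -i* tau) * D.
  have e1 : z1 - c = (1 / 2 -i* tau) * D.
    have -> : z1 - c = D - (1 / 2 +i* tau) * D by rewrite /c /D; ring.
    rewrite -{1}[D]mul1r -mulrBl; congr (_ * _); by apply/eqP; rewrite eq_complex /=; apply/andP; split; apply/eqP; lra.
  have -> : c + t%:C * (z1 - c) = z1 - (1 - t%:C) * (z1 - c) by ring.
  by rewrite e1 rmorphB mulrA.
rewrite ec; have [->|t0] := eqVneq t 1; first by rewrite subrr !mul0r subr0.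
have t0' : 1 - t != 0 by rewrite subr_eq0 eq_sym.
apply/negP => h.
have xs : z1 - (1 - t)%:C * (1 / 2 -i* tau) * D \in s.
  apply: hs h; have := nmD z1 (- ((1 - t)%:C * (1 / 2 -i* tau) * D)).
  rewrite nmN !nmM nmR ger0_norm; last by lra.
  have nmw' : nm (1 / 2 -i* tau) <= 2.
    by apply: le_trans (nm_ReIm _) _; rewrite /= normrN !ger0_norm; lra.
  have : (1 - t) * nm (1 / 2 -i* tau) * nm D <= 2 * nm D.
    by apply: ler_wpM2r => //; have := nm_ge0 (1 / 2 -i* tau); nra.
  have := nmD a1 D; rewrite /D subrKC -/D; lra.
move/negP: hj; apply; rewrite mem_cat; apply/orP; right; apply/mapP; eexists; first exact: xs.
rewrite /t2 addrC addKr mulNr mulfK // sc /=; field; exact: t0'.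
Qed.

Lemma sol_affine T (al be : C) : al != 0 -> al ^+ m = 1 -> solution b m C0 T ->
  solution b m C0 (fun s => T (al * s + be)).
Proof.
move=> al0 alm S.
have Sa z : sm (fun s => al * s + be) (fun s => (0 * s + al * 1) + 0) z.
  exact: sm_add (sm_mul (sm_const _ _) (sm_id _)) (sm_const _ _).
have na : nm al = 1 by apply: nm_expr_eq1 alm.
split=> [z|B M|z h h' Hh Th].
- exact: smP_comp (Sa z) (sol_sm S _).
- have [s hs] := sol_fin S B (M + nm be); exists [seq (x - be) / al | x <- s] => z hz hB.
  apply/mapP; exists (al * z + be); last by field.
  by apply: hs => //; have := nmD (al * z) be; rewrite nmM na mul1r; lra.
have Tz : T (al * z + be) = Some (h z) by rewrite (near_self Th).
have [k [k' [Hk Tk]]] := smP_fin (sol_sm S _) Tz.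
have := sol_ode S Hk Tk.
have hk : near z (fun w => h w = k (al * w + be)).
  by apply: near_imp (near_and Th (sm_comp_near (Sa z) Tk)) => w [-> []].
have := sm_uniq_near Hh (sm_comp (Sa z) Hk) hk; rewrite mul0r add0r mulr1 addr0 => ->.
by rewrite exprMn alm mulr1 (near_self hk).
Qed.

(** Equal values give derivatives with equal m-th powers, so their quotient al is a root of unity.
    The solution s -> T (w + al (s - z)) has the same value and derivative as T at z. *)
Lemma sol_sym T z w : solution b m C0 T -> T z = T w -> ~~ bad b (T z) ->
  exists2 al, al ^+ m = 1 & forall s, T (w + al * (s - z)) = T s.
Proof.
move=> S e ng.
have [h [h' [Hh Th Oh nh]]] := sol_chart S ng.
have [|k [k' [Hk Uk Ok nk]]] := sol_chart (z := w) S; first by rewrite -e.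
have hk : h z = k w by have := near_self Th; have := near_self Uk; rewrite -e => -> [].
pose al := h' z / k' w.
have alm : al ^+ m = 1.
  rewrite expr_div_n (near_self Oh) hk -(near_self Ok) divff // expf_neq0 //.
have al0 : al != 0 by rewrite mulf_neq0 // invr_eq0.
exists al => // s.
have ew : forall s, w + al * (s - z) = al * s + (w - al * z) by move=> ?; ring.
rewrite ew; apply: (sol_continue (T := fun s => T (al * s + (w - al * z))) (a := z)) => //.
  exact: sol_affine.
have SU := sol_affine (w - al * z) al0 alm S.
have Sa : sm (fun s => al * s + (w - al * z)) (fun s => (0 * s + al * 1) + 0) z.
  exact: sm_add (sm_mul (sm_const _ _) (sm_id _)) (sm_const _ _).
have ez : al * z + (w - al * z) = w by ring.
have Hk2 : sm (fun s => k (al * s + (w - al * z))) (fun s => k' (al * s + (w - al * z)) * ((0 * s + al * 1) + 0)) z.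
  by apply: sm_comp Sa _; rewrite ez.
have Uk2 : near z (fun s => T (al * s + (w - al * z)) = Some (k (al * s + (w - al * z)))).
  by apply: (sm_comp_near Sa (P := fun v => T v = Some (k v))); rewrite ez.
have Ok2 : near z (fun s => (k' (al * s + (w - al * z)) * ((0 * s + al * 1) + 0)) ^+ m = C0 * b.[k (al * s + (w - al * z))]).
  by apply: near_imp (near_and (sm_near Hk2) (near_near Uk2)) => v []; apply: (sol_ode SU).
have H : near z (fun s => k (al * s + (w - al * z)) = h s).
  apply: ode_unique m0 Hk2 Hh Ok2 Oh _ _ _; rewrite /= ez ?hk //.
    by rewrite mul0r add0r mulr1 addr0 /al mulrC divfK.
  by rewrite mul0r add0r mulr1 addr0 mulf_neq0.
by apply: near_imp (near_and H (near_and Th Uk2)) => v [e1 [-> ->]]; rewrite e1.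
Qed.

End Sol.
End Continuation.

(** * Escape from exceptional values *)

Section Escape.
Variable R : realType.
Local Notation C := R[i].
Local Notation nm := (@nm R).
Local Notation P1 := (P1 R).

Section Root.
Variable k : nat.
Definition rt (x : R) : R := iter k Num.sqrt x.
Let K := (2 ^ k)%N.

Lemma rt_ge0 x : 0 <= x -> 0 <= rt x.
Proof. by move=> x0; rewrite /rt; elim: k => //= j _; exact: sqrtr_ge0. Qed.

Lemma rtK x : 0 <= x -> rt x ^+ (2 ^ k) = x.
Proof.
move=> x0; rewrite /rt; elim: k => [|j IH]; first by rewrite expr1.
rewrite iterS expnS exprM sqr_sqrtr // -/(rt x).
by elim: j {IH} => //= j _; exact: sqrtr_ge0.
Qed.

Let K0 : (0 < K)%N. Proof. by rewrite expn_gt0. Qed.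

Lemma rt_le x t : 0 <= x -> 0 <= t -> x <= t ^+ (2 ^ k) -> rt x <= t.
Proof.
move=> x0 t0 h; rewrite leNgt; apply/negP => lt.
have := ltr_pXn2r K0; move=> /(_ _ t (rt x)); rewrite !nnegrE t0 rt_ge0 // => /(_ isT isT).
by rewrite lt rtK // => h2; lra.
Qed.

Lemma le_rt x t : 0 <= x -> 0 <= t -> t ^+ (2 ^ k) <= x -> t <= rt x.
Proof.
move=> x0 t0 h; rewrite leNgt; apply/negP => lt.
have := ltr_pXn2r K0; move=> /(_ _ (rt x) t); rewrite !nnegrE t0 rt_ge0 // => /(_ isT isT).
by rewrite lt rtK // => h2; lra.
Qed.

Lemma superadd (a c : R) n : 0 <= a -> 0 <= c -> (0 < n)%N -> a ^+ n + c ^+ n <= (a + c) ^+ n.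
Proof.
move=> a0 c0; case: n => // n _; elim: n => [|n IH]; first by rewrite !expr1.
rewrite exprS (exprS c) (exprS (a + c)); have h1 : 0 <= a ^+ n.+1 by apply: exprn_ge0.
have h2 : 0 <= c ^+ n.+1 by apply: exprn_ge0.
have h3 : (a + c) * (a ^+ n.+1 + c ^+ n.+1) <= (a + c) * (a + c) ^+ n.+1 by apply: ler_wpM2l => //; lra.
nra.
Qed.

Lemma rt_cont x y e : 0 <= x -> 0 <= y -> 0 < e -> `|x - y| < e ^+ (2 ^ k) -> `|rt x - rt y| < e.
Proof.
move=> x0 y0 e0.
wlog xy : x y x0 y0 / x <= y.
  move=> H; case/orP: (le_total x y) => h; first exact: H.
  by move=> h2; rewrite distrC; apply: H => //; rewrite distrC.
have h := le_rt y0 (rt_ge0 x0); rewrite rtK // in h; have {}h := h xy.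
rewrite ler0_norm ?subr_le0 // ler0_norm ?subr_le0 // !opprB => h2.
rewrite ltNge; apply/negP => h3.
have := superadd (rt_ge0 x0) (ltW e0) K0; rewrite -/K in h2; rewrite /K rtK // => h4.
have : (rt x + e) ^+ (2 ^ k) <= y.
  rewrite -(rtK y0); apply: lerXn2r; rewrite ?nnegrE ?addr_ge0 ?rt_ge0 ?(ltW e0) //; lra.
rewrite /K in h2; lra.
Qed.

(** The effect on the root of multiplying x = t^K by about 1 + eta: it grows by at least t eta / (2
    K). The window between 3/4 and 5/4 leaves room for a Taylor remainder of eta / 4. *)
Lemma rt_up x t eta : 0 < t -> 0 < eta <= 1 / 2 ->
  t ^+ (2 ^ k) * (1 + 3 / 4 * eta) <= x <= t ^+ (2 ^ k) * (1 + 5 / 4 * eta) ->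
  t * (1 + eta / (2 * K%:R)) <= rt x <= t * (1 + 5 / 4 * eta).
Proof.
move=> t0 he /andP[x1 x2].
have KR : 1 <= K%:R :> R by rewrite ler1n.
have tK : 0 < t ^+ (2 ^ k) by rewrite exprn_gt0.
have x0 : 0 <= x by apply: le_trans x1; rewrite mulr_ge0 ?(ltW tK) //; lra.
pose y := eta / (2 * K%:R).
have y0 : 0 < y by rewrite divr_gt0; lra.
have yK : K%:R * y = eta / 2 by rewrite /y; field; rewrite gt_eqF; lra.
have y1 : y <= eta / 2 by rewrite -yK ler_peMl //; lra.
apply/andP; split.
  apply: le_rt => //; first by rewrite mulr_ge0 // ?ltW // -/y; lra.
  rewrite exprMn -/y; apply: le_trans x1; rewrite ler_pM2l // -/K.
  have h1 := bern_sub (x := y) K ltac:(lra); rewrite yK in h1.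
  have h2 : (1 + y) ^+ K * (1 - y) ^+ K <= 1.
    by rewrite -exprMn; apply: exprn_ile1; nra.
  have h3 : 0 <= (1 + y) ^+ K by apply: exprn_ge0; lra.
  nra.
apply: rt_le => //; first by rewrite mulr_ge0 // ?ltW //; lra.
apply: (le_trans x2); rewrite exprMn ler_pM2l //.
by have := bern (x := 5 / 4 * eta) K ltac:(lra); rewrite /K in KR *; nra.
Qed.

Lemma rt_down x t eta : 0 < t -> 0 < eta <= 1 / 2 ->
  t ^+ (2 ^ k) * (1 - 5 / 4 * eta) <= x <= t ^+ (2 ^ k) * (1 - 3 / 4 * eta) ->
  t * (1 - 5 / 4 * eta) <= rt x <= t * (1 - eta / (2 * K%:R)).
Proof.
move=> t0 he /andP[x1 x2].
have KR : 1 <= K%:R :> R by rewrite ler1n.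
have tK : 0 < t ^+ (2 ^ k) by rewrite exprn_gt0.
have x0 : 0 <= x by apply: le_trans x1; rewrite mulr_ge0 ?(ltW tK) //; lra.
pose y := eta / (2 * K%:R).
have y0 : 0 < y by rewrite divr_gt0; lra.
have yK : K%:R * y = eta / 2 by rewrite /y; field; rewrite gt_eqF; lra.
have y1 : y <= eta / 2 by rewrite -yK ler_peMl //; lra.
apply/andP; split.
  apply: le_rt => //; first by rewrite mulr_ge0 // ?ltW //; lra.
  apply: le_trans x1; rewrite exprMn ler_pM2l //.
  have p : 0 <= 1 - 5 / 4 * eta <= 1 by lra.
  by rewrite -[leRHS]expr1; apply: ler_wiXn2l => //; case/andP: p.
apply: rt_le => //; first by rewrite mulr_ge0 // ?ltW // -/y; lra.
apply: (le_trans x2); rewrite exprMn ler_pM2l // -/y -/K.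
by have := bern_sub (x := y) K ltac:(lra); rewrite yK; lra.
Qed.
Lemma rt_toward (tv tau eta x : R) : 0 < tv -> 0 < eta <= 1 / 2 -> eta * (5 * tv) <= 4 * `|tv - tau| ->
  (if tv < tau then tv ^+ (2 ^ k) * (1 + 3 / 4 * eta) <= x <= tv ^+ (2 ^ k) * (1 + 5 / 4 * eta)
   else tv ^+ (2 ^ k) * (1 - 5 / 4 * eta) <= x <= tv ^+ (2 ^ k) * (1 - 3 / 4 * eta)) ->
  `|rt x - tau| <= `|tv - tau| - tv * (eta / (2 * K%:R)).
Proof.
move=> t0 he; case: (ltP tv tau) => [lt|ge] h5 hx.
  have /andP[u1 u2] := rt_up t0 he hx.
  rewrite [`|tv - tau|]ltr0_norm in h5 *; [|lra..].
  by rewrite ler0_norm; lra.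
have /andP[u1 u2] := rt_down t0 he hx.
rewrite [`|tv - tau|]ger0_norm in h5 *; [|lra..].
by rewrite ger0_norm; lra.
Qed.
Lemma small_val (x sg eta r rho : R) : x - (1 + sg * eta) * r <= eta / 4 * r -> 0 < r -> r <= rho / 2 ->
  rho <= 1 / 4 -> 0 < eta -> eta <= 1 / 2 -> `|sg| = 1 -> x <= 1.
Proof.
move=> h r0 h1 h2 e0 e1 hs; have er : eta * r <= 1 / 2 * r by apply: ler_wpM2r => //; exact: ltW.
have : sg * eta * r <= eta * r.
  by rewrite -mulrA ler_piMl ?mulr_ge0 ?(ltW e0) ?(ltW r0) //; have := ler_norm sg; rewrite hs.
lra.
Qed.

Lemma sg_ge0 (sg eta : R) : `|sg| = 1 -> 0 < eta -> eta <= 1 / 2 -> 0 <= 1 + sg * eta.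
Proof.
move=> hs e0 e1; have : - (sg * eta) <= eta.
  by rewrite -mulNr ler_piMl ?(ltW e0) //; have := ler_norm (- sg); rewrite normrN hs.
lra.
Qed.

Lemma near_target (x eta r : R) (tv tau : R) (sg := if tv < tau then 1 else -1) :
  x - (1 + sg * eta) * r <= eta / 4 * r -> (1 + sg * eta) * r - x <= eta / 4 * r ->
  if tv < tau then r * (1 + 3 / 4 * eta) <= x <= r * (1 + 5 / 4 * eta)
   else r * (1 - 5 / 4 * eta) <= x <= r * (1 - 3 / 4 * eta).
Proof. by rewrite /sg; case: ifP => _; lra. Qed.
End Root.

Section One.
Variables (b b1 : {poly C}) (m l : nat) (C0 : C) (T : C -> P1).
Hypotheses (m0 : (0 < m)%N) (C00 : C0 != 0) (lm : (l < m)%N).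
Hypotheses (eb : forall x, b.[x] = x ^+ l * b1.[x]) (b10 : b1.[0] != 0) (S : solution b m C0 T).

(** Truncation at 1 makes the modulus of T continuous through its poles. *)
Let val z : R := if T z is Some x then Num.min (nm x) 1 else 1.

Let val01 z : 0 <= val z <= 1.
Proof.
by rewrite /val; case: (T z) => [x|]; rewrite ?ler01 ?lexx //= le_min nm_ge0 ler01 ge_min lexx orbT.
Qed.

Let val_lt z : val z < 1 -> exists2 x, T z = Some x & val z = nm x.
Proof.
rewrite /val; case: (T z) => [x|]; last by rewrite ltxx.
rewrite gt_min ltxx orbF => h; exists x => //.
by rewrite min_l // ltW.
Qed.

Let minlip (x y : R) : `|Num.min x 1 - Num.min y 1| <= `|x - y|.
Proof.
have a1 := ler_norm (x - y); have a2 := ler_norm (y - x); rewrite distrC in a2.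
rewrite ler_norml; case: (lerP x 1) => h1; case: (lerP y 1) => h2;
  by rewrite ?(min_l h1) ?(min_l h2) ?(min_r (ltW h1)) ?(min_r (ltW h2)); lra.
Qed.

Let val_cont z (e : R) : 0 < e -> exists2 d : R, 0 < d & forall w, nm (w - z) < d -> `|val w - val z| < e.
Proof.
move=> e0; case eT : (T z) => [x|].
  have [h [h' [Hh Th]]] := smP_fin (sol_sm S z) eT.
  have [r r0 hr] := near_and (sm_cont Hh e0) Th; exists r => // w /hr [h1 h2].
  rewrite /val h2 (near_self Th); apply: le_lt_trans (minlip _ _) _; apply: le_lt_trans h1.
  by rewrite ler_norml; have := nm_sub (h w) (h z); have := nm_sub (h z) (h w); rewrite (nmB (h z)); lra.
have [h [h' [Hh hz Th]]] := smP_inf (sol_sm S z) eT.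
have [r r0 hr] := near_and (sm_cont Hh (ltr01 : (0 : R) < 1)) Th; exists r => // w /hr [h1 h2].
suff -> : val w = 1 by rewrite /val eT subrr normr0.
rewrite /val h2 /chart_inf; case: eqP => // /eqP hw; rewrite min_r // nmV.
by rewrite hz subr0 in h1; rewrite invf_ge1 ?nm_gt0 // ltW.
Qed.

(** Near a root of b of multiplicity l < m, placed at 0, the equation makes |T'| comparable to
    |T|^(l / m). Hence |T|^(1 / K) has slope bounded below once 1 / K <= 1 - l / m, and K = 2^k >= m
    ensures this while needing square roots only. The principle [ekeland], applied to the distance
    from |T|^(1 / K) to the K-th root tau of the target modulus, gives a point at bounded
    distance. *)
Lemma escape : exists dm L, [/\ 0 < dm, 0 <= L & forall z x (d : R), T z = Some x -> nm x <= dm -> 0 <= d <= dm ->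
  d = 0 \/ 0 < nm x <= d -> exists z' x', [/\ T z' = Some x', nm x' = d & nm (z' - z) <= L]].
Proof.
have [k hk] : exists k, (m <= 2 ^ k)%N by exists m; apply: ltnW; apply: ltn_expl.
pose K := (2 ^ k)%N; have K0 : (0 < K)%N by rewrite expn_gt0.
have KR : 1 <= K%:R :> R by rewrite ler1n.
have K00 : 0 < K%:R :> R by rewrite ltr0n.
have n0 : 0 < nm (C0 * b1.[0]) by rewrite nm_gt0 mulf_neq0.
pose g0 := nm (C0 * b1.[0]) / 2.
have g00 : 0 < g0 by rewrite /g0; lra.
have [r1 r10 hr1] := sm_cont (sm_mul (sm_const C0 0) (sm_poly b1 0)) g00.
pose c1 := Num.min 1 g0.
have c10 : 0 < c1 by rewrite lt_min ltr01.
have c11 : c1 <= 1 by rewrite ge_min lexx.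
have c1g : c1 <= g0 by rewrite ge_min lexx orbT.
pose rho := Num.min r1 (1 / 4).
have rho0 : 0 < rho by rewrite lt_min r10 /=; lra.
have rho1 : rho <= 1 / 4 by rewrite ge_min lexx orbT.
have rhor : rho <= r1 by rewrite ge_min lexx.
pose dm := rho / 2 ^+ K.+1.
have dm0 : 0 < dm by rewrite divr_gt0 ?exprn_gt0.
have dmK : 2 ^+ K * dm = rho / 2 by rewrite /dm exprS; field; rewrite expf_neq0 // pnatr_eq0.
have dm1 : dm < 1.
  have : 1 <= 2 ^+ K :> R by apply: exprn_ege1; lra.
  nra.
pose tm := rt k dm.
have tm0 : 0 <= tm by apply: rt_ge0; exact: ltW.
have tmK : tm ^+ K = dm by rewrite /tm rtK // ltW.
pose c := c1 / (4 * K%:R).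
have c0 : 0 < c by rewrite divr_gt0 //; lra.
exists dm, (tm / c); split=> //; first by rewrite divr_ge0 // ltW.
move=> z x d Tz xd /andP[d0 ddm] hd.
pose tau := rt k d; pose t0 := rt k (nm x).
have tau0 : 0 <= tau by apply: rt_ge0.
have tauK : tau ^+ K = d by rewrite /tau rtK.
have t00 : 0 <= t0 by apply: rt_ge0; rewrite nm_ge0.
have mono (u v : R) : 0 <= u -> u <= v -> rt k u <= rt k v.
  by move=> u0 uv; apply: le_rt; rewrite ?rt_ge0 ?rtK //; lra.
have taum : tau <= tm by apply: mono.
have t0m : t0 <= tm by apply: mono; rewrite ?nm_ge0.
pose g w := `|rt k (val w) - tau|.
have valz : val z = nm x by rewrite /val Tz min_l //; lra.
have gz : g z = `|t0 - tau| by rewrite /g valz.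
have gzm : g z <= tm by rewrite gz ler_norml; lra.
have val0 w : 0 <= val w by case/andP: (val01 w).
have [|||w gw wz] := @ekeland R g z c c0.
- move=> w e e0; have eK : 0 < e ^+ (2 ^ k) by rewrite exprn_gt0.
  have [dd dd0 hdd] := val_cont w eK; exists dd => // v /hdd h.
  rewrite /g; apply: le_lt_trans (ler_dist_dist _ _) _.
  by rewrite opprB addrA subrK; apply: rt_cont.
- by move=> w; rewrite normr_ge0.
- move=> w /andP[gw0 gwz]; set tv := rt k (val w) in gw0 gwz *.
  have tv0 : 0 <= tv by apply: rt_ge0.
  have tvm : tv <= 2 * tm.
    by have := le_trans gwz gzm; rewrite /g -/tv ler_norml; lra.
  (* No descent is asked for at a zero of T: if d = 0 such a point already has g = 0, and if 0 < nm
     x <= d then g w <= g z keeps the root above t0 > 0. *)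
  have tvp : 0 < tv.
    rewrite lt_neqAle tv0 andbT eq_sym; apply/eqP => e.
    case: hd => [d00|/andP[x0 xd']].
      by move: gw0; rewrite /g -/tv e /tau d00 (_ : rt k 0 = 0) ?subrr ?normr0 ?ltxx //; apply/eqP; rewrite eq_le rt_ge0 // rt_le // expr0n.
    have t0p : 0 < t0.
      rewrite lt_neqAle t00 andbT; apply/eqP => e2; have := rtK k (nm_ge0 x); rewrite -/t0 -e2 expr0n eqn0Ngt K0 /= => e3; lra.
    have : t0 <= tau by apply: mono; rewrite ?nm_ge0.
    by move: gwz; rewrite gz /g -/tv e => h1 h2; move: h1; rewrite sub0r normrN ger0_norm // ler0_norm; lra.
  have tvK : tv ^+ K = val w by rewrite /tv rtK.
  have vrho : val w <= rho / 2.
    by rewrite -tvK -dmK -tmK -exprMn; apply: lerXn2r; rewrite ?nnegrE ?mulr_ge0.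
  have [y Tw vy] := val_lt (z := w) ltac:(lra).
  have [h [h' [Hh Th]]] := smP_fin (sol_sm S w) Tw.
  have hw : h w = y by have := near_self Th; rewrite Tw => -[].
  set r := val w in tvK vrho vy.
  have rp : 0 < r by rewrite -tvK exprn_gt0.
  have tv1 : tv <= 1.
    by rewrite leNgt; apply/negP => gt; have := exprn_ege1 K (ltW gt); rewrite tvK; lra.
  (* Uses (K - 1) m >= K l, which follows from l < m <= K. *)
  have slope : c1 * tv ^+ K.-1 <= nm (h' w).
    rewrite leNgt; apply/negP => lt.
    have O := congr1 nm (sol_ode S Hh Th); rewrite nmX hw eb mulrCA nmM nmX -vy in O.
    have gb : g0 <= nm (C0 * b1.[y]).
      have := hr1 y; rewrite subr0 -vy => /(_ ltac:(lra)).
      by have := nm_sub (C0 * b1.[0]) (C0 * b1.[y]); rewrite nmB /g0; lra.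
    have h1 : nm (h' w) ^+ m < (c1 * tv ^+ K.-1) ^+ m.
      by rewrite ltr_pXn2r // nnegrE ?nm_ge0 // mulr_ge0 ?exprn_ge0 // ltW.
    rewrite O exprMn in h1.
    have h2 : c1 ^+ m <= c1 by rewrite -[leRHS]expr1; apply: ler_wiXn2l => //; exact: ltW.
    have h3 : (tv ^+ K.-1) ^+ m <= r ^+ l.
      rewrite -tvK -!exprM; apply: ler_wiXn2l => //; rewrite -/K in hk.
      by move: hk lm K0; clear; case: K => // K' /=; nia.
    have h4 : c1 ^+ m * (tv ^+ K.-1) ^+ m <= c1 * r ^+ l.
      by apply: ler_pM => //; rewrite ?exprn_ge0 // ltW.
    have h5 : c1 * r ^+ l <= r ^+ l * nm (C0 * b1.[y]).
      by rewrite mulrC; apply: ler_wpM2l; rewrite ?exprn_ge0 ?(ltW rp) //; lra.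
    lra.
  have h'0 : 0 < nm (h' w) by apply: lt_le_trans slope; rewrite mulr_gt0 ?exprn_gt0.
  have [rr [KK [rr0 KK0 HB]]] := sm_bd Hh.
  have [q q0 hq] := Th.
  pose qq := Num.min rr q; have qq0 : 0 < qq by rewrite lt_min rr0.
  (* The move s below multiplies T by 1 + sg eta to first order. The four bounds keep eta at most
     1/2, keep the move inside the disc of control, make the remainder at most eta r / 4, and
     prevent overshooting tau. *)
  pose eta := Num.min (Num.min (1 / 2) (qq * nm (h' w) / (2 * r))) (Num.min (nm (h' w) ^+ 2 / (4 * KK * r)) (4 * g w / (5 * tv))).
  have eta0 : 0 < eta.
    by rewrite !lt_min !divr_gt0 ?mulr_gt0 ?exprn_gt0.
  have [e1 e2 e3 e4] : [/\ eta <= 1 / 2, eta * (2 * r) <= qq * nm (h' w), eta * (4 * KK * r) <= nm (h' w) ^+ 2 & eta * (5 * tv) <= 4 * g w].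
    by split; rewrite -?ler_pdivlMr ?mulr_gt0 // ?ge_min ?lexx ?orbT //; lra.
  pose sg : R := if tv < tau then 1 else -1.
  have sg2 : `|sg| = 1 by rewrite /sg; case: ifP; rewrite ?normrN normr1.
  pose s : C := (sg * eta)%:C * h w / h' w.
  have h'C : h' w != 0 by rewrite -nm_gt0.
  have ns : nm s = eta * r / nm (h' w).
    by rewrite /s !nmM nmV nmR normrM sg2 mul1r ger0_norm ?(ltW eta0) // hw -vy.
  have nsq : nm s < qq.
    rewrite ns ltr_pdivrMr //; apply: lt_le_trans e2.
    by rewrite ltr_pM2l // ltr_pMl // ltr1n.
  have [nsr nsq'] : nm s < rr /\ nm s < q by move: nsq; rewrite lt_min => /andP.
  exists (w + s).
  have es : w + s - w = s by rewrite addrC addKr.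
  have sne : s != 0 by rewrite -nm_gt0 ns divr_gt0 // mulr_gt0.
  split; first by rewrite -subr_eq0 es.
  have [B1 _ _ _] := HB w (w + s) ltac:(by rewrite subrr nm0) ltac:(by rewrite es).
  rewrite es in B1.
  have eh : h' w * s = (sg * eta)%:C * h w by rewrite /s; field.
  rewrite eh in B1.
  have B2 : KK * nm s ^+ 2 <= eta / 4 * r.
    rewrite ns expr_div_n mulrA ler_pdivrMr ?exprn_gt0 //.
    have -> : KK * (eta * r) ^+ 2 = (eta * (4 * KK * r)) * (eta / 4 * r) by field.
    by rewrite mulrC; apply: ler_wpM2l => //; rewrite mulr_ge0 ?divr_ge0 // ltW.
  have Tv : T (w + s) = Some (h (w + s)) by apply: hq; rewrite es.
  have B3 : nm (h (w + s) - (1 + (sg * eta)%:C) * h w) <= eta / 4 * r.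
    by rewrite mulrDl mul1r opprD addrA; exact: le_trans B1 B2.
  have B4 : nm ((1 + (sg * eta)%:C) * h w) = (1 + sg * eta) * r.
    have -> : 1 + (sg * eta)%:C = (1 + sg * eta)%:C :> C by rewrite rmorphD.
    by rewrite nmM nmR hw -vy ger0_norm //; exact: (sg_ge0 sg2 eta0 e1).
  have B5 := nm_sub (h (w + s)) ((1 + (sg * eta)%:C) * h w).
  have B6 := nm_sub ((1 + (sg * eta)%:C) * h w) (h (w + s)).
  rewrite (nmB ((1 + _) * _)) in B6; rewrite B4 in B5 B6.
  have vv : val (w + s) = nm (h (w + s)).
    rewrite /val Tv min_l //; exact: (small_val (le_trans B5 B3) rp vrho rho1 eta0 e1 sg2).
  have gain : g (w + s) <= g w - tv * (eta / (2 * K%:R)).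
    rewrite /g vv -/tv; apply: rt_toward => //; first by rewrite eta0.
    rewrite -/K tvK; apply: near_target; [exact: le_trans B5 B3|exact: le_trans B6 B3].
  apply: le_lt_trans gain _; rewrite ltrD2l ltrN2 es ns.
  have b1' : r = tv * tv ^+ K.-1 by rewrite -exprS prednK // tvK.
  have : eta * r / nm (h' w) <= eta * tv / c1.
    rewrite ler_pdivrMr // mulrAC ler_pdivlMr // b1'.
    have -> : eta * (tv * tv ^+ K.-1) * c1 = (eta * tv) * (c1 * tv ^+ K.-1) by ring.
    by apply: ler_wpM2l => //; rewrite mulr_ge0 // ltW.
  move=> h5; apply: le_lt_trans (_ : c * (eta * tv / c1) < _); first by apply: ler_wpM2l => //; exact: ltW.
  have -> : c * (eta * tv / c1) = tv * (eta / (2 * K%:R)) / 2 by rewrite /c; field; rewrite (gt_eqF c10) (gt_eqF K00).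
  have : 0 < tv * (eta / (2 * K%:R)) by rewrite mulr_gt0 // divr_gt0 // mulr_gt0.
  by move=> h6; rewrite ltr_pdivrMr // ltr_pMr // ltr1n.
have tw : rt k (val w) = tau by move/eqP: gw; rewrite normr_eq0 subr_eq0 => /eqP.
have vw : val w = d by rewrite -(rtK k (val0 w)) tw.
have [y Ty vy] := val_lt (z := w) ltac:(lra).
exists w, y; split=> //; first by rewrite -vy.
by apply: le_trans wz _; rewrite ler_pM2r ?invr_gt0.
Qed.
End One.

End Escape.

(** * Other values of the solution and return to a compact set of values *)

Section Two.
Variable R : realType.
Local Notation C := R[i].
Local Notation nm := (@nm R).
Local Notation P1 := (P1 R).

(** Translation and inversion carry solutions to solutions, so [escape], stated at the value 0,
    becomes available at every finite value and at infinity. *)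
Definition sh (y : C) (x : P1) : P1 := if x is Some v then Some (v - y) else None.
Definition pinv (x : P1) : P1 := if x is Some v then chart_inf v else Some 0.

Lemma sh_fr y a c : sh y (fr a c) = fr (a - y * c) c.
Proof. by rewrite /fr; case: eqP => //= /eqP c0; congr Some; field. Qed.

Lemma pinv_fr a c : (a != 0) || (c != 0) -> pinv (fr a c) = fr c a.
Proof.
rewrite /fr; have [->|c0] /= := eqVneq c 0; first by rewrite orbF => a0; rewrite a0 mul0r.
move=> _; rewrite /chart_inf mulf_eq0 invr_eq0 (negPf c0) orbF.
by case: eqP => //= _; rewrite invfM invrK mulrC.
Qed.

Lemma pinvK x : pinv (pinv x) = x.
Proof.
case: x => [v|] /=; last by rewrite /chart_inf eqxx.
rewrite /chart_inf; have [->|v0] //= := eqVneq v 0.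
by rewrite /chart_inf invr_eq0 (negPf v0) invrK.
Qed.

Lemma shK y : cancel (sh y) (sh (- y)).
Proof. by case=> [v|] //=; rewrite opprK subrK. Qed.

Variables (b : {poly C}) (m : nat) (C0 : C) (T : C -> P1).
Hypotheses (m0 : (0 < m)%N) (C00 : C0 != 0) (sb : size b = (2 * m).+1) (S : solution b m C0 T).

Let b0 : b != 0. Proof. by rewrite -size_poly_gt0 sb. Qed.

Lemma sol_shift y : solution (b \Po ('X + y%:P)) m C0 (fun z => sh y (T z)).
Proof.
split=> [z|B M|z h h' Hh Th].
- have [a [a' [c [c' [Ha Hc ac e]]]]] := sol_sm S z.
  exists (fun w => a w + (- y) * c w), (fun w => a' w + (0 * c w + (- y) * c' w)), c, c'; split=> //.
  + exact: sm_add Ha (sm_mul (sm_const _ _) Hc).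
  + by have [c0|] := eqVneq (c z) 0; [move: ac; rewrite c0 mulr0 addr0 eqxx|rewrite orbT].
  by apply: near_imp e => w ->; rewrite sh_fr mulNr.
- have [s hs] := sol_fin S [seq sh (- y) x | x <- B] M; exists s => z h1 h2.
  by apply: hs => //; rewrite -(shK y (T z)) map_f.
have Th2 : near z (fun w => T w = Some (h w + y)).
  by apply: near_imp Th => w e; rewrite -(shK y (T w)) e /= opprK.
have := sol_ode S (sm_add Hh (sm_const y z)) Th2.
by rewrite addr0 horner_comp !hornerE.
Qed.

(** Under x -> 1 / x the form dx^m / b becomes dx^m / brev. As b has degree exactly 2 m, brev does
    not vanish at 0: infinity is an ordinary value. *)
Definition brev : {poly C} := (-1) ^+ m *: hpol (2 * m) b 1 'X.

Lemma brev0 : brev.[0] != 0.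
Proof.
rewrite hornerZ hpolE hornerC hornerX hev_inf expr1n mulr1 mulf_neq0 ?expf_neq0 ?oppr_eq0 ?oner_eq0 //.
by have := b0; rewrite -lead_coef_eq0 lead_coefE sb.
Qed.

Lemma sol_inv : solution brev m C0 (fun z => pinv (T z)).
Proof.
have smI z : smP (fun z => pinv (T z)) z.
  have [a [a' [c [c' [Ha Hc ac e]]]]] := sol_sm S z.
  exists c, c', a, a'; split=> //; first by rewrite orbC.
  have ac2 : near z (fun w => (a w != 0) || (c w != 0)).
    by case/orP: ac => h; [apply: near_imp (sm_ne0 Ha h) | apply: near_imp (sm_ne0 Hc h)] => w ->; rewrite ?orbT.
  by apply: near_imp (near_and e ac2) => w [-> h]; rewrite pinv_fr.
split=> // [B M|z h h' Hh Th].
  have [s hs] := sol_fin S [seq pinv x | x <- B] M; exists s => z h1 h2.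
  by apply: hs => //; rewrite -(pinvK (T z)) map_f.
have main w : sm h h' w -> near w (fun w => pinv (T w) = Some (h w)) -> h w != 0 -> h' w ^+ m = C0 * brev.[h w].
  move=> Hw Tw hw0.
  have Tw2 : near w (fun w => T w = Some (h w)^-1).
    by apply: near_imp (near_and Tw (sm_ne0 Hw hw0)) => v [e h0]; rewrite -(pinvK (T v)) e /= /chart_inf (negPf h0).
  have := sol_ode S (sm_comp Hw (sm_inv hw0)) Tw2.
  rewrite /brev hornerZ hpolE hornerC hornerX hev_Y ?sb // mul1r exprMn => e.
  have k1 : ((-1) ^+ m * h w ^+ (2 * m)) * (- (h w ^- 2)) ^+ m = 1.
    by rewrite exprM -exprMn mulN1r -exprMn mulrNN divff ?expr1n // expf_neq0.
  transitivity (((-1) ^+ m * h w ^+ (2 * m)) * ((- (h w ^- 2)) ^+ m * h' w ^+ m)).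
    by rewrite mulrA k1 mul1r.
  by rewrite e; ring.
apply: (ode_lim Hh) => e e0.
have [s hs] := sol_fin S [:: None] (nm z + 1).
have [w [[w1 w2] [w3 w4]] w5] := near_avoid s (near_and (near_and (near_ball z e0) (near_ball z (ltr01 : (0 : R) < 1))) (near_and (sm_near Hh) (near_near Th))).
exists w => //; apply: main => //; apply/eqP => hw; move/negP: w5; apply; apply: hs.
  by have := nmD3 z w 0; rewrite !subr0; lra.
by rewrite inE -(pinvK (T w)) (near_self w4) /= hw /chart_inf eqxx.
Qed.

Lemma escape_at y : ~~ (('X - y%:P) ^+ m %| b) ->
  exists dm L, [/\ 0 < dm, 0 <= L & forall z x (d : R), T z = Some x -> nm (x - y) <= dm -> 0 <= d <= dm ->
  d = 0 \/ 0 < nm (x - y) <= d -> exists z' x', [/\ T z' = Some x', nm (x' - y) = d & nm (z' - z) <= L]].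
Proof.
move=> nd.
have [l [b1]] := multiplicity_XsubC b y; rewrite b0 /= => /negP b1y eb.
have lm : (l < m)%N.
  rewrite ltnNge; apply/negP => ml; move/negP: nd; apply; rewrite eb -(subnK ml) exprD mulrA.
  exact: dvdp_mull.
have [||dm [L [d0 L0 H]]] := @escape R (b \Po ('X + y%:P)) (b1 \Po ('X + y%:P)) m l C0 _ m0 C00 lm _ _ (sol_shift y).
- by move=> x; rewrite !horner_comp !hornerE eb hornerM horner_exp !hornerE addrK mulrC.
- by rewrite horner_comp !hornerE; apply/negP.
exists dm, L; split=> // z x d Tz h1 h2 h3.
have [|z' [x' [Tz' e1 e2]]] := H z (x - y) d _ h1 h2 h3; first by rewrite Tz.
case e : (T z') Tz' => [v|] //= [ev]; exists z', v; split=> //; by rewrite ev.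
Qed.

Lemma escape_inf : exists dm L, [/\ 0 < dm, 0 <= L & forall z x (d : R), 0 < d <= dm -> T z = Some x -> d^-1 < nm x ->
   exists z' x', [/\ T z' = Some x', nm x' = d^-1 & nm (z' - z) <= L]].
Proof.
have [|dm [L [d0 L0 H]]] := @escape R brev brev m 0 C0 _ m0 C00 m0 _ brev0 sol_inv.
  by move=> x; rewrite expr0 mul1r.
exists dm, L; split=> // z x d /andP[dp dd] Tz h1.
have x0 : 0 < nm x by apply: lt_trans h1; rewrite invr_gt0.
have h2 : nm x^-1 < d by rewrite nmV -[d]invrK ltf_pV2 ?posrE ?invr_gt0.
have [||||z' [x' [Tz' e1 e2]]] := H z x^-1 d.
- by rewrite Tz /= /chart_inf -nm_eq0 gt_eqF.
- by apply: ltW; apply: lt_le_trans h2 dd.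
- by rewrite dd ltW.
- by right; rewrite ltW // nmV invr_gt0 x0.
exists z', x'^-1; split=> //; last by rewrite nmV e1.
by rewrite -(pinvK (T z')) Tz' /= /chart_inf -nm_eq0 e1 gt_eqF.
Qed.

Lemma fin_lb (X : eqType) (s : seq X) (P : X -> R -> R -> Prop) :
  (forall x d d' L L', P x d L -> 0 < d' <= d -> L <= L' -> P x d' L') ->
  (forall x, x \in s -> exists d L, [/\ 0 < d, 0 <= L & P x d L]) ->
  exists d L, [/\ 0 < d, 0 <= L & forall x, x \in s -> P x d L].
Proof.
move=> mono; elim: s => [|x s IH] H; first by exists 1, 0.
have [d [L [d0 L0 hd]]] := H x (mem_head _ _).
have [|d' [L' [d'0 L'0 hd']]] := IH; first by move=> y ys; apply: H; rewrite inE ys orbT.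
have mm : 0 < Num.min d d' by rewrite lt_min d0.
exists (Num.min d d'), (L + L'); split=> //; first by rewrite addr_ge0.
move=> y; rewrite inE => /orP[/eqP ->|/hd' h].
  by apply: mono hd _ _; [rewrite mm ge_min lexx|rewrite lerDl].
by apply: mono h _ _; [rewrite mm ge_min lexx orbT|rewrite lerDr].
Qed.

(** A value close to a root of b, or to infinity, is pushed out to a fixed distance by a bounded
    move. The radii are small enough that leaving one of these neighbourhoods does not enter
    another. *)
Lemma return_compact : (forall y, ~~ (('X - y%:P) ^+ m %| b)) ->
  exists M de L, [/\ 0 < de, 0 <= L & forall z, ~~ bad b (T z) -> exists z' x,
    [/\ T z' = Some x, nm x <= M, (forall y, root b y -> de <= nm (x - y)) & nm (z' - z) <= L]].
Proof.
move=> nd; have [ys hys] := roots_seq b0.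
have [di [Li [di0 Li0 Hi]]] := escape_inf.
(* A radius valid for all roots at once: the discs of radius d1 lie inside modulus 1 / d1, roots are
   at least 2 d1 apart, and [escape_at] works up to d1. *)
have [d1 [L1 [d10 L10 H1]]] : exists d L, [/\ 0 < d, 0 <= L & forall y, y \in ys ->
   [/\ nm y + 1 <= d^-1, forall y', y' \in ys -> y' != y -> 2 * d <= nm (y - y') &
     forall z x (d' : R), 0 < d' <= d -> T z = Some x -> 0 < nm (x - y) <= d' ->
     exists z' x', [/\ T z' = Some x', nm (x' - y) = d' & nm (z' - z) <= L]]].
  apply: fin_lb => [y d d' L L' [h1 h2 h3] hd hL|y yys].
    split.
    - by apply: le_trans h1 _; rewrite lef_pV2 ?posrE //; lra.
    - by move=> y' /h2 h /h; lra.
    move=> z x e he Tz hx; have he' : 0 < e <= d by lra.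
    by have [z' [x' [a1 a2 a3]]] := h3 z x e he' Tz hx; exists z', x'; split=> //; lra.
  have [dm [L [dm0 L0 H]]] := escape_at (nd y).
  have [d2 [_ [d20 _ H2]]] : exists d (L : R), [/\ 0 < d, 0 <= L & forall y', y' \in ys -> y' != y -> 2 * d <= nm (y - y')].
    apply: (@fin_lb _ ys (fun y' d _ => y' != y -> 2 * d <= nm (y - y'))) => [x d d' _ _ h1 h2 _ /h1|y' _]; first by lra.
    have [->|ne] := eqVneq y' y; first by exists 1, 0.
    exists (nm (y - y') / 2), 0; split=> //; last by move=> _; lra.
    by rewrite divr_gt0 // nm_gt0 subr_eq0 eq_sym.
  have n1 : 0 < nm y + 1 by have := nm_ge0 y; lra.
  exists (Num.min dm (Num.min d2 (nm y + 1)^-1)), L; split=> //; first by rewrite !lt_min dm0 d20 invr_gt0.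
  split.
  - rewrite -[leLHS]invrK lef_pV2 ?posrE ?invr_gt0 ?lt_min ?dm0 ?d20 ?invr_gt0 //.
    by rewrite !ge_min lexx !orbT.
  - move=> y' h1 /(H2 _ h1); apply: le_trans; rewrite ler_pM2l // !ge_min lexx ?orbT //.
  move=> z x d' /andP[d'0]; rewrite le_min => /andP[d'1 _] Tz /andP[x0 xd].
  by apply: (H z x d' Tz); [lra|lra|right; rewrite x0 xd].
pose de := Num.min d1 di.
have [de0 ded1 dedi] : [/\ 0 < de, de <= d1 & de <= di] by rewrite lt_min d10 di0 !ge_min !lexx orbT.
have dV : d1^-1 <= de^-1 by rewrite lef_pV2 ?posrE.
pose e := Num.min de (1 / 2).
have h12 : 0 < 1 / 2 :> R by lra.
have [e0 ed e1] : [/\ 0 < e, e <= de & e <= 1 / 2] 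
  by split; [rewrite lt_min de0 h12 | rewrite /e ge_min lexx | rewrite /e ge_min lexx orbT].
exists (de^-1 + 1), e, (Li + L1); split=> //; first by rewrite addr_ge0.
move=> z; case Tz : (T z) => [x|] //= nb.
have far z' x' : T z' = Some x' -> nm x' = de^-1 -> nm (z' - z) <= Li + L1 ->
   exists z' x, [/\ T z' = Some x, nm x <= de^-1 + 1, (forall y, root b y -> e <= nm (x - y)) & nm (z' - z) <= Li + L1].
  move=> a1 a2 a3; exists z', x'; split=> //; first by lra.
  move=> y; rewrite hys => /H1 [h1 _ _]; have := nm_sub x' y; lra.
have [hx|hx] := ltP de^-1 (nm x).
  have [|z' [x' [a1 a2 a3]]] := Hi z x de _ Tz hx; first by rewrite de0.
  by apply: far a1 a2 _; lra.
have [[y [ry hy]]|no] := pselect (exists y, root b y /\ nm (x - y) < e).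
  have yys : y \in ys by rewrite -hys.
  have [h1 h2 h3] := H1 y yys.
  have he' : 0 < e <= d1 by rewrite e0; exact: le_trans ed ded1.
  have hx' : 0 < nm (x - y) <= e by rewrite (ltW hy) andbT nm_gt0 subr_eq0; apply: contraNneq nb => ->.
  have [z' [x' [a1 a2 a3]]] := h3 z x e he' Tz hx'.
  exists z', x'; split=> //; last by lra.
    by have := nm_sub x' y; lra.
  move=> y' ry'; have [->|ne] := eqVneq y' y; first by rewrite a2.
  have := h2 y' ltac:(by rewrite -hys) ne; have := nmD3 x' y y'; rewrite (nmB y x') a2; lra.
exists z, x; split=> //; first by lra.
  by move=> y ry; rewrite leNgt; apply/negP => h; apply: no; exists y.
by rewrite subrr nm0; lra.
Qed.

End Two.

(** * Periods *)

Section Periods.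
Variable R : realType.
Local Notation C := R[i].
Local Notation nm := (@nm R).
Local Notation P1 := (P1 R).

Lemma seq_argmin (X : eqType) (s : seq X) (P : X -> Prop) (f : X -> R) : (exists2 x, x \in s & P x) ->
  exists x, [/\ x \in s, P x & forall y, y \in s -> P y -> f x <= f y].
Proof.
elim: s => [|a s IH] [x xs Px]; first by [].
have [[y ys Py]|no] := pselect (exists2 y, y \in s & P y).
  have [|z [zs Pz zm]] := IH; first by exists y.
  have [[Pa fa]|no2] := pselect (P a /\ f a <= f z).
    exists a; split=> //; first by rewrite mem_head.
    by move=> u; rewrite inE => /orP[/eqP ->//|us Pu]; apply: le_trans fa (zm _ us Pu).
  exists z; split=> //; first by rewrite inE zs orbT.
  move=> u; rewrite inE => /orP[/eqP ->|us] Pu; last exact: zm.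
  by rewrite leNgt; apply/negP => lt; apply: no2; split=> //; apply: ltW.
move: xs; rewrite inE => /orP[/eqP xa|xs]; last by case: no; exists x.
exists a; split; [by rewrite mem_head|by rewrite -xa|].
by move=> u; rewrite inE => /orP[/eqP ->//|us Pu]; case: no; exists u.
Qed.

Lemma ImB (x y : C) : complex.Im (x - y) = complex.Im x - complex.Im y. Proof. by case: x y => [? ?] []. Qed.
Lemma ReB (x y : C) : complex.Re (x - y) = complex.Re x - complex.Re y. Proof. by case: x y => [? ?] []. Qed.
Lemma ReZ (r : R) (x : C) : complex.Re (r%:C * x) = r * complex.Re x. Proof. by case: x => u v /=; rewrite mul0r subr0. Qed.
Lemma ImZ (r : R) (x : C) : complex.Im (r%:C * x) = r * complex.Im x. Proof. by case: x => u v /=; rewrite mul0r addr0. Qed.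
Lemma int_C (n : int) : n%:~R = (n%:~R : R)%:C :> C. Proof. by rewrite (rmorph_int (real_complex R)). Qed.

Lemma round (x : R) : exists n : int, `|x - n%:~R| <= 1 / 2.
Proof.
exists (Num.floor (x + 1 / 2)); have := floor_itv (x + 1 / 2); rewrite ler_norml intrD.
by move=> /andP[]; lra.
Qed.

Section Lattice.
Variable (L : C -> Prop) (e : R).
Hypotheses (L0 : L 0) (LB : forall x y, L x -> L y -> L (x - y)) (e0 : 0 < e)
  (Ldisc : forall t, L t -> nm t < e -> t = 0).

Lemma subgroupZ (n : int) x : L x -> L (n%:~R * x).
Proof.
move=> Lx; have LN y : L y -> L (- y) by move=> h; rewrite -sub0r; apply: LB.
have Lnat (k : nat) : L (k%:R * x).
  elim: k => [|k IH]; first by rewrite mul0r.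
  by rewrite -natr1 mulrDl mul1r -[x in _ + x]opprK; apply: LB => //; apply: LN.
by case: n => k; [exact: Lnat|rewrite NegzE mulrNz mulNr; apply: LN; exact: Lnat].
Qed.

Let Lfin (M : R) : exists s : seq C, forall t, L t -> nm t <= M -> t \in s.
Proof.
suff [s hs] : exists s : seq C, forall t, nm t <= M -> L t -> t \in s by exists s => t h1 h2; apply: hs.
apply: (@hb2 R (fun A => exists s : seq C, forall t, A t -> L t -> t \in s)).
  split=> [A B AB [s hs]|A B [s hs] [s' hs']]; first by exists s => t /AB /hs.
  by exists (s ++ s') => t [/hs h|/hs' h] /h; rewrite mem_cat => ->; rewrite ?orbT.
have e00 : (0 : R) < e := e0.
move=> z; exists (e / 2); first by lra.
have [[t [h1 h2]]|no] := pselect (exists t, nm (t - z) < e / 2 /\ L t).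
  exists [:: t] => u u1 u2; rewrite inE -subr_eq0; apply/eqP; apply: Ldisc; first exact: LB.
  by have := nmD3 z u t; rewrite (nmB z); lra.
by exists [::] => t h1 h2; case: no; exists t.
Qed.

(** Take w1 shortest and w2 of least nonzero height |Im (w2 / w1)|. Subtracting nearest integer
    multiples leaves a height at most half the least one, hence 0, and then a length at most half
    the shortest one, hence 0. *)
Lemma lattice_basis t1 t2 : L t1 -> L t2 -> t1 != 0 -> complex.Im (t2 / t1) != 0 ->
  exists w1 w2, [/\ w1 != 0, complex.Im (w2 / w1) != 0, L w1, L w2 &
    forall t, L t -> exists m k : int, t = lattice_pt w1 w2 m k].
Proof.
move=> h1 h2 n1 n2.
have [s hs] := Lfin (nm t1).
have [|w1 [_ [Lw1 w10] w1m]] := @seq_argmin _ s (fun t => L t /\ t != 0) nm.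
  by exists t1 => //; apply: hs.
have w1min t : L t -> t != 0 -> nm w1 <= nm t.
  move=> Lt t0; have [h|/ltW h] := leP (nm t) (nm t1); first by apply: w1m => //; exact: hs.
  by apply: le_trans h; apply: w1m => //; apply: hs.
have ImZw (n : int) t : complex.Im ((t - n%:~R * w1) / w1) = complex.Im (t / w1).
  by rewrite mulrBl mulfK // ImB int_C /= subr0.
have [u [Lu nu]] : exists u, L u /\ complex.Im (u / w1) != 0.
  apply: contrapT => no; have r1 t : L t -> t / w1 = (complex.Re (t / w1))%:C.
    move=> Lt; case e1 : (t / w1) => [x y] /=; congr (_ +i* _); apply/eqP/negPn/negP => y0.
    by apply: no; exists t; rewrite e1.
  move/negP: n2; apply; have -> : t2 / t1 = (t2 / w1) / (t1 / w1) by field; rewrite n1 w10.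
  by rewrite (r1 _ h1) (r1 _ h2) -fmorph_div /=.
pose f t := `|complex.Im (t / w1)|.
have [s2 hs2] := Lfin ((1 + f u) * nm w1).
have red t : L t -> exists n : int, L (t - n%:~R * w1) /\ nm (t - n%:~R * w1) <= (1 / 2 + f t) * nm w1.
  move=> Lt; have [n hn] := round (complex.Re (t / w1)); exists n; split; first by apply: LB => //; exact: subgroupZ.
  have -> : t - n%:~R * w1 = ((t - n%:~R * w1) / w1) * w1 by rewrite divfK.
  rewrite nmM; apply: ler_wpM2r; rewrite ?nm_ge0 //.
  apply: le_trans (nm_ReIm _) _; rewrite ImZw -/(f t).
  by rewrite mulrBl mulfK // ReB int_C /=; lra.
have nw := nm_ge0 w1.
have [|w2 [_ [Lw2 w20] w2m]] := @seq_argmin _ s2 (fun t => L t /\ complex.Im (t / w1) != 0) f.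
  have [n [h3 h4]] := red u Lu; exists (u - n%:~R * w1); last by rewrite ImZw.
  by apply: hs2 => //; apply: le_trans h4 _; apply: ler_wpM2r => //; lra.
have w2min t : L t -> complex.Im (t / w1) != 0 -> f w2 <= f t.
  move=> Lt nt; have [n [h3 h4]] := red t Lt.
  have ft : f (t - n%:~R * w1) = f t by rewrite /f ImZw.
  have [h|/ltW h] := leP (f t) (f u).
    rewrite -ft; apply: w2m; last by rewrite ImZw.
    by apply: hs2 => //; apply: le_trans h4 _; apply: ler_wpM2r => //; lra.
  have [n' [h5 h6]] := red u Lu; apply: le_trans h.
  have fu : f (u - n'%:~R * w1) = f u by rewrite /f ImZw.
  rewrite -fu; apply: w2m; last by rewrite ImZw.
  by apply: hs2 => //; apply: le_trans h6 _; apply: ler_wpM2r => //; lra.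
exists w1, w2; split=> // t Lt.
pose Y := complex.Im (w2 / w1); have Y0 : 0 < `|Y| by rewrite normr_gt0.
have [k hk] := round (complex.Im (t / w1) / Y).
have It : complex.Im ((t - k%:~R * w2) / w1) = complex.Im (t / w1) - k%:~R * Y.
  by rewrite mulrBl -mulrA ImB int_C ImZ.
have Lt' : L (t - k%:~R * w2) by apply: LB => //; exact: subgroupZ.
have I0 : complex.Im ((t - k%:~R * w2) / w1) = 0.
  apply/eqP/negPn/negP => /(w2min _ Lt'); rewrite /f It -/Y.
  have -> : complex.Im (t / w1) - k%:~R * Y = (complex.Im (t / w1) / Y - k%:~R) * Y.
    by rewrite mulrBl divfK // -normr_gt0.
  rewrite normrM; move: hk; nra.
have [m hm] := round (complex.Re ((t - k%:~R * w2) / w1)).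
exists m, k; rewrite /lattice_pt.
set t' := t - k%:~R * w2 in I0 hm Lt' *.
suff E : t' - m%:~R * w1 = 0.
  have -> : t = (t' - m%:~R * w1) + (m%:~R * w1 + k%:~R * w2) by rewrite /t'; ring.
  by rewrite E add0r.
apply/eqP/negPn/negP => n0; have := w1min _ (LB Lt' (subgroupZ m Lw1)) n0.
have -> : t' - m%:~R * w1 = (t' / w1 - m%:~R) * w1 by rewrite mulrBl divfK.
rewrite nmM; have : nm (t' / w1 - m%:~R) <= 1 / 2.
  apply: le_trans (nm_ReIm _) _; rewrite ReB ImB I0 int_C /= subr0 normr0 addr0; exact: hm.
have : 0 < nm w1 by rewrite nm_gt0.
nra.
Qed.
End Lattice.

Variables (b : {poly C}) (m : nat) (C0 : C) (T : C -> P1).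
Hypotheses (m0 : (0 < m)%N) (C00 : C0 != 0) (sb : size b = (2 * m).+1) (S : solution b m C0 T).
Hypothesis nd : forall y, ~~ (('X - y%:P) ^+ m %| b).

Let b0 : b != 0. Proof. by rewrite -size_poly_gt0 sb. Qed.

Definition period t := forall z, T (z + t) = T z.

Lemma period0 : period 0. Proof. by move=> z; rewrite addr0. Qed.
Lemma periodB x y : period x -> period y -> period (x - y).
Proof. by move=> hx hy z; rewrite -(hy (z + (x - y))) -addrA subrK hx. Qed.

(** At a generic point the derivative of T is nonzero, so T (z0 + t) differs from T z0 for small
    nonzero t. *)
Lemma period_discrete : exists2 e : R, 0 < e & forall t, period t -> nm t < e -> t = 0.
Proof.
have [z0 _ ng] := sol_generic b0 S (near_all 0 (fun=> I)).
have [h [h' [Hh Th _ nh]]] := sol_chart m0 C00 S ng.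
have [r [K [r0 K0 HB]]] := sm_bd Hh; have [q q0 hq] := Th.
have p : 0 < nm (h' z0) by rewrite nm_gt0.
exists (Num.min (Num.min r q) (nm (h' z0) / K)); first by rewrite !lt_min r0 q0 divr_gt0.
move=> t Pt; rewrite !lt_min ltr_pdivlMr // => /andP[/andP[t1 t2] t3].
have ez : z0 + t - z0 = t by rewrite addrC addKr.
have zz a : 0 < a -> nm (z0 - z0) < a by rewrite subrr nm0.
have e : h (z0 + t) = h z0.
  by have := Pt z0; rewrite hq ?ez // hq ?zz // => -[].
have [B1 _ _ _] := HB z0 (z0 + t) (zz _ r0) ltac:(by rewrite ez).
rewrite e subrr sub0r nmN ez nmM in B1.
apply/eqP; rewrite -nm_eq0 eq_le nm_ge0 andbT leNgt; apply/negP => tp.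
by rewrite expr2 mulrA ler_pM2r // in B1; nra.
Qed.

Lemma pigeonhole (X : eqType) (u : nat -> X) (s : seq X) : (forall i, u i \in s) -> exists i j, (i < j)%N /\ u i = u j.
Proof.
move=> hu; apply: contrapT => no.
have [|j] := @inj_notin X u s; last by rewrite hu.
move=> i j e; apply/eqP; rewrite eqn_leq; apply/andP; split; rewrite leqNgt; apply/negP => lt; apply: no.
  by exists j, i.
by exists i, j.
Qed.

(** Within bounded distance of each j e there is a point with value in a compact set of generic
    values. Near an accumulation value y a further bounded move, [escape_at] with d = 0, reaches y
    exactly. The symmetries between these points rotate by one of finitely many roots of unity, and
    two with the same rotation differ by a translation. *)
Lemma period_dir (e : C) : nm e = 1 -> exists t (a : R), [/\ period t, 0 < a & nm (t - a%:C * e) <= a / 4].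
Proof.
move=> ne; have [M [de [L [de0 L0 HK]]]] := return_compact m0 C00 sb S nd.
have exz (j : nat) : exists zx : C * C, [/\ nm (zx.1 - j%:R * e) <= 1 + L, T zx.1 = Some zx.2, nm zx.2 <= M &
    forall y, root b y -> de <= nm (zx.2 - y)].
  have [w w1 w2] := sol_generic b0 S (near_ball (j%:R * e) (ltr01 : (0 : R) < 1)).
  have [z' [x [a1 a2 a3 a4]]] := HK w w2; exists (z', x); split=> //=.
  by have := nmD3 w z' (j%:R * e); lra.
have [u hu] := choice exz.
have [|y hy] := @bolzano_weierstrass R M (fun j => (u j).2); first by move=> j; case: (hu j).
have nby : ~~ root b y.
  apply/negP => ry; have [j _ h] := hy de de0 0%N; have [_ _ _ /(_ y ry)] := hu j; lra.
have ngy : ~~ (('X - y%:P) ^+ m %| b).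
  by apply: nd.
have [dm [L2 [dm0 L20 HE]]] := escape_at m0 C00 sb S ngy.
(* The points deviate from the ray by at most 1 + L + L2 each; a gap of at least 8 (1 + L + L2)
   between indices makes the total deviation at most a quarter of the length. *)
pose G := 8 * (1 + L + L2) + 1.
have [g hg] := archi_nat G.
have exz2 (N : nat) : exists jz : nat * C, [/\ (N <= jz.1)%N, T jz.2 = Some y & nm (jz.2 - jz.1%:R * e) <= 1 + L + L2].
  have [j Nj hj] := hy dm dm0 N; have [a1 a2 a3 _] := hu j.
  have [||z' [x' [b1 b2 b3]]] := HE _ _ 0 a2 (ltW hj); first by rewrite lexx ltW.
    by left.
  exists (j, z'); split=> //=.
    by rewrite b1; congr Some; apply/eqP; rewrite -subr_eq0 -nm_eq0 b2.
  by have := nmD3 (u j).1 z' (j%:R * e); lra.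
have [v hv] := choice exz2.
pose idx := fix idx (i : nat) : nat := if i is i'.+1 then (v (idx i')).1 + g else 0%N.
pose z i := (v (idx i)).2; pose jj i := (v (idx i)).1.
have jlt i k : (jj i + g <= jj (i + k.+1))%N.
  elim: k => [|k IH]; first by rewrite addn1; have [h _ _] := hv (idx i.+1).
  have [h _ _] := hv (idx (i + k.+1).+1); rewrite addnS; apply: leq_trans h => /=.
  by apply: leq_trans IH _; rewrite leq_addr.
have Tz i : T (z i) = Some y by have [] := hv (idx i).
have zn i : nm (z i - (jj i)%:R * e) <= 1 + L + L2 by have [] := hv (idx i).
have exal i : exists al : C, al ^+ m = 1 /\ forall s, T (z i + al * (s - z 0%N)) = T s.
  have [||al a1 a2] := sol_sym b0 m0 C00 (T := T) (z := z 0%N) (w := z i) S; [by rewrite !Tz|by rewrite Tz|].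
  by exists al.
have [al hal] := choice exal.
have [|rts hr] := @roots_seq R ('X^m - 1); first by rewrite -size_poly_gt0 size_XnsubC.
have [|i [j [ij eij]]] := @pigeonhole _ al rts.
  by move=> i; rewrite -hr rootE !hornerE; have [-> _] := hal i; rewrite subrr.
exists (z j - z i), ((jj j)%:R - (jj i)%:R).
have gap : G <= (jj j)%:R - (jj i)%:R.
  have := jlt i (j - i.+1)%N; rewrite addnS -addSn subnKC // => h.
  have : ((jj i + g)%:R : R) <= (jj j)%:R by rewrite ler_nat.
  by rewrite natrD; lra.
split.
- move=> s; have [a1 a2] := hal i; have [a3 a4] := hal j; rewrite -eij in a3 a4.
  have al0 : al i != 0 by apply/eqP => e2; move: a1; rewrite e2 expr0n gtn_eqF // => /eqP; rewrite eq_sym oner_eq0.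
  pose x := z 0%N + (s - z i) / al i.
  (* Composing one symmetry with the inverse of the other at this x leaves the translation by z j -
     z i. *)
  have := a4 x; rewrite -(a2 x) /x addrAC subrr add0r mulrC divfK //.
  by have -> : z j + (s - z i) = s + (z j - z i) by [ring]; rewrite subrKC => ->.
- by rewrite /G in gap; lra.
have -> : z j - z i - ((jj j)%:R - (jj i)%:R)%:C * e = (z j - (jj j)%:R * e) - (z i - (jj i)%:R * e).
  by rewrite rmorphB !rmorph_nat; ring.
have := nmD (z j - (jj j)%:R * e) (- (z i - (jj i)%:R * e)); rewrite nmN.
by have := zn i; have := zn j; rewrite /G in gap; lra.
Qed.

(** Periods within a quarter of their length from the directions 1 and i are independent over the
    reals, so the discrete group of periods is a lattice. The functional equation shows that lam
    maps it into itself, and the affine map is multiplication by lam. *)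
Theorem lattes_of_solution p q u v (P Q : {poly C}) lam : coprimep u v -> injective (ratP1 u v) -> lam != 0 ->
  (forall z, ratP1 P Q (T z) = T (lam * z)) ->
  (forall x, ratP1 p q (ratP1 u v x) = ratP1 u v (ratP1 P Q x)) -> lattes p q.
Proof.
move=> c inj lam0 F conj.
have [t1 [a1 [P1' a10 h1]]] := period_dir (nm1 R).
pose ii : C := 0 +i* 1.
have ni : nm ii = 1 by rewrite /nm normc_def /= expr0n expr1n add0r sqrtr1.
have [t2 [a2 [P2 a20 h2]]] := period_dir ni.
rewrite mulr1 in h1.
have r1 := nmRe (t1 - a1%:C); have i1 := nmIm (t1 - a1%:C).
have r2 := nmRe (t2 - a2%:C * ii); have i2 := nmIm (t2 - a2%:C * ii).
rewrite ReB /= !ler_norml in r1; rewrite ImB /= subr0 !ler_norml in i1.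
rewrite ReB ReZ mulr0 subr0 !ler_norml in r2; rewrite ImB ImZ mulr1 !ler_norml in i2.
have t10 : t1 != 0 by apply/eqP => t0; rewrite t0 /= in r1 h1; lra.
have It : complex.Im (t2 / t1) != 0.
  apply/eqP => I0; have e : t2 = (complex.Re (t2 / t1))%:C * t1.
    by rewrite -{1}(divfK t10 t2); congr (_ * _); case: (t2 / t1) I0 => x y /= ->.
  have eR := congr1 (@complex.Re R) e; have eI := congr1 (@complex.Im R) e.
  rewrite ReZ in eR; rewrite ImZ in eI; move: eR eI; set k := complex.Re (t2 / t1) => eR eI.
  have [k0|/ltW k0] := leP 0 k.
    have p1 : 0 <= k * (a1 / 4 - complex.Im t1) by apply: mulr_ge0 => //; lra.
    have p2 : 0 <= k * (complex.Re t1 - 3 / 4 * a1) by apply: mulr_ge0 => //; lra.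
    lra.
  have p1 : 0 <= - k * (a1 / 4 + complex.Im t1) by apply: mulr_ge0; lra.
  have p2 : 0 <= - k * (complex.Re t1 - 3 / 4 * a1) by apply: mulr_ge0; lra.
  lra.
have [e e0 disc] := period_discrete.
have [w1 [w2 [w10 w2i L1 L2 LL]]] := lattice_basis period0 periodB e0 disc P1' P2 t10 It.
have per j k : period (lattice_pt w1 w2 j k).
  rewrite /lattice_pt -[_ * w2]opprK; apply: periodB; first exact: subgroupZ period0 periodB _ _ L1.
  by rewrite -mulNr -mulrNz; exact: subgroupZ period0 periodB _ _ L2.
exists w1, w2; split=> //; split.
  apply/negP => /Creal_ImP; rewrite -complexIm => /(@complexI R) h; by rewrite h eqxx in w2i.
exists lam, 0; split.
  move=> j k; apply: LL => z.
  have -> : z + lam * lattice_pt w1 w2 j k = lam * (z / lam + lattice_pt w1 w2 j k) by field.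
  by rewrite -F per F; congr T; field.
exists (fun z => ratP1 u v (T z)); split; first by move=> z j k; rewrite per.
split; first by apply: smP_holo => z; apply: smP_rat c (sol_sm S z).
split; last by move=> z; rewrite addr0 conj F.
apply: contrapT => no.
have [s hs] := sol_fin S [:: T 0] 1.
have [w w1' w2'] := near_avoid s (near_ball 0 (ltr01 : (0 : R) < 1)).
move/negP: w2'; apply; apply: hs; first by rewrite subr0 in w1'.
rewrite inE; apply/eqP; apply: contrapT => ne; apply: no; exists w, 0.
by move=> /inj.
Qed.
End Periods.

(** * Invariant forms *)

Section InvForm.
Variable R : realType.
Local Notation C := R[i].
Local Notation P1 := (P1 R).
Implicit Types (p q u v P Q : {poly C}) (a b c d : C).

Definition cof (Pr : C -> Prop) := exists bad : seq C, forall x, x \notin bad -> Pr x.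

Lemma cof_and (A B : C -> Prop) : cof A -> cof B -> cof (fun x => A x /\ B x).
Proof.
by move=> [s hs] [t ht]; exists (s ++ t) => x; rewrite mem_cat negb_or => /andP[/hs ? /ht].
Qed.

Lemma cof_imp (A B : C -> Prop) : (forall x, A x -> B x) -> cof A -> cof B.
Proof. by move=> AB [s hs]; exists s => x /hs /AB. Qed.

Lemma cof_root p : p != 0 -> cof (fun x => p.[x] != 0).
Proof. by move=> /roots_seq[s hs]; exists s => x; rewrite -hs rootE. Qed.

Lemma cof_ex (A : C -> Prop) : cof A -> exists x, A x.
Proof.
move=> [s hs]; have [j hj] := @inj_notin C (fun j => j%:R) s ltac:(by move=> i j /eqP; rewrite eqr_nat => /eqP).
by exists (j%:R); apply: hs.
Qed.

Lemma cof_eq p q : cof (fun x => p.[x] = q.[x]) -> p = q.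
Proof.
move=> H; apply/eqP; rewrite -subr_eq0; apply/negPn/negP => n0.
by have [x [e]] := cof_ex (cof_and H (cof_root n0)); rewrite hornerD hornerN e subrr eqxx.
Qed.

Definition fv p q x : C := p.[x] / q.[x].
Definition dr p q x : C := (wron p q).[x] / q.[x] ^+ 2.

Lemma ratP1_fv p q x : q.[x] != 0 -> ratP1 p q (Some x) = Some (fv p q x).
Proof. by rewrite /= => ->. Qed.

Lemma cof_pre P Q (A : C -> Prop) : coprimep P Q -> (0 < rdeg P Q)%N -> cof A ->
  cof (fun x => Q.[x] != 0 -> A (fv P Q x)).
Proof.
move=> c d0 [s hs]; have [B hB] := fin_fiber [seq Some y | y <- s] c d0.
exists [seq odflt 0 y | y <- B] => x hx Qx; apply: hs; apply/negP => h; move/negP: hx; apply.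
by apply/mapP; exists (Some x) => //; apply: hB; rewrite ratP1_fv // mem_map // => ? ? [].
Qed.

Lemma dr_sm p q x : q.[x] != 0 -> sm (fv p q) (dr p q) x.
Proof.
move=> q0; apply: sm_ext (sm_div (sm_poly p x) (sm_poly q x) q0).
by apply: near_all => w; rewrite /fv /dr /wron !hornerE.
Qed.

(* The pull-back of (a / b) dx^m by p / q is k times itself. *)
Definition inv_form p q (a b : {poly C}) m (k : C) :=
  cof (fun x => q.[x] != 0 -> a.[fv p q x] * b.[x] * dr p q x ^+ m = k * a.[x] * b.[fv p q x]).

Lemma chain p q u v P Q s : coprimep p q -> coprimep u v -> coprimep P Q ->
  (forall x, ratP1 p q (ratP1 u v x) = ratP1 u v (ratP1 P Q x)) ->
  v.[s] != 0 -> q.[fv u v s] != 0 -> Q.[s] != 0 -> v.[fv P Q s] != 0 ->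
  fv p q (fv u v s) = fv u v (fv P Q s) /\
  dr p q (fv u v s) * dr u v s = dr u v (fv P Q s) * dr P Q s.
Proof.
move=> c1 c2 c3 E h1 h2 h3 h4.
have S1 := dr_sm u h1; have S2 := dr_sm p h2; have S3 := dr_sm P h3; have S4 := dr_sm u h4.
have N : near s (fun w => fv p q (fv u v w) = fv u v (fv P Q w)).
  have N1 := sm_ne0 (sm_poly v s) h1; have N2 := sm_ne0 (sm_poly Q s) h3.
  have N3 := sm_comp_near S1 (sm_ne0 (sm_poly q _) h2); have N4 := sm_comp_near S3 (sm_ne0 (sm_poly v _) h4).
  apply: near_imp (near_and (near_and N1 N2) (near_and N3 N4)) => w [[n1 n2] [n3 n4]].
  by have := E (Some w); rewrite !ratP1_fv // => -[].
split; first exact: near_self N.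
exact: (sm_uniq_near (sm_comp S1 S2) (sm_comp S3 S4) N).
Qed.

(** With g = u / v, the pull-back of (a / b) dx^m is (a(g) / b(g)) g'^m dx^m; powers of v clear the
    denominators. Invariance follows from the chain rule, since g semiconjugates P / Q to p / q. *)
Lemma form_pullback p q u v P Q (a b : {poly C}) m k D : coprimep p q -> coprimep u v -> coprimep P Q ->
  (0 < rdeg p q)%N -> (0 < rdeg u v)%N -> (0 < rdeg P Q)%N ->
  (forall x, ratP1 p q (ratP1 u v x) = ratP1 u v (ratP1 P Q x)) ->
  (size a <= D.+1)%N -> (size b <= D.+1)%N -> inv_form p q a b m k ->
  inv_form P Q (hpol D a u v * wron u v ^+ m) (hpol D b u v * v ^+ (2 * m)) m k.
Proof.
move=> c1 c2 c3 d1 d2 d3 E sa sb I.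
have K := cof_and (cof_root (q_neq0 c2 d2)) (cof_and (cof_pre c2 d2 (cof_and I (cof_root (q_neq0 c1 d1))))
  (cof_pre c3 d3 (cof_root (q_neq0 c2 d2)))).
apply: cof_imp K => s [vs [/(_ vs) [I2 qs] J]] Qs; have vG := J Qs.
have [e1 e2] := chain c1 c2 c3 E vs qs Qs vG.
have {}I2 := I2 qs.
have H x (w : {poly C}) : (size w <= D.+1)%N -> v.[x] != 0 -> (hpol D w u v).[x] = v.[x] ^+ D * w.[fv u v x].
  by move=> sw vx; rewrite hpolE hev_Y.
have W x : v.[x] != 0 -> (wron u v).[x] = dr u v x * v.[x] ^+ 2.
  by move=> vx; rewrite /dr divfK // expf_neq0.
rewrite !hornerM !horner_exp !H // !W //.
move: e1 e2 I2; set N := fv u v s; set G := fv P Q s; move=> e1 e2 I2; rewrite -e1 !(exprMn m (dr _ _ _)) -!exprM.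
have e3 : dr u v G ^+ m * dr P Q s ^+ m = dr p q N ^+ m * dr u v s ^+ m by rewrite -!exprMn e2.
transitivity (v.[G] ^+ D * v.[s] ^+ D * v.[G] ^+ (2 * m) * v.[s] ^+ (2 * m) * a.[fv p q N] * b.[N] * (dr u v G ^+ m * dr P Q s ^+ m)).
  by ring.
rewrite e3; transitivity (v.[G] ^+ D * v.[s] ^+ D * v.[G] ^+ (2 * m) * v.[s] ^+ (2 * m) * dr u v s ^+ m * (a.[fv p q N] * b.[N] * dr p q N ^+ m)).
  by ring.
by rewrite I2; ring.
Qed.

Definition mp (a b : C) : {poly C} := a *: 'X + b%:P.

Lemma mp_coef a b : (size (mp a b) <= 2)%N /\ (mp a b)`_1 = a.
Proof.
split; last by rewrite coefD coefZ coefX coefC mulr1 addr0.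
apply: leq_trans (size_polyD _ _) _; rewrite geq_max; apply/andP; split.
  by apply: leq_trans (size_scale_leq _ _) _; rewrite size_polyX.
by apply: leq_trans (size_polyC_leq1 _) _.
Qed.

Lemma mpE a b x : (mp a b).[x] = a * x + b. Proof. by rewrite !hornerE. Qed.

Section Moebius.
Variables (a b c d : C).
Hypothesis det : a * d - b * c != 0.

Lemma mp_coprime : coprimep (mp a b) (mp c d).
Proof.
apply/coprimep_rootP => x; rewrite !rootE !mpE => -[/eqP e1 /eqP e2]; move/eqP: det; apply.
have -> : a * d - b * c = a * (c * x + d) - c * (a * x + b) by ring.
by rewrite e1 e2 !mulr0 subrr.
Qed.

Lemma mp_rdeg : rdeg (mp a b) (mp c d) = 1%N.
Proof.
have [s1 t1] := mp_coef a b; have [s2 t2] := mp_coef c d.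
apply/eqP; rewrite eqn_leq /rdeg; apply/andP; split; first by lia.
have : (1 < size (mp a b))%N || (1 < size (mp c d))%N.
  apply: contraR det; rewrite negb_or -!leqNgt => /andP[/leq_sizeP h1 /leq_sizeP h2].
  by rewrite -t1 -t2 h1 // h2 // mul0r mulr0 subrr.
by case/orP; set s := size _; set t := size _; lia.
Qed.

Lemma mp_ratP1 : ratP1 (mp a b) (mp c d) =1 mobius a b c d.
Proof.
case=> [x|] /=; first by rewrite !mpE.
by rewrite mp_rdeg; have [_ ->] := mp_coef a b; have [_ ->] := mp_coef c d.
Qed.

Lemma mobius_fr X Y : (X != 0) || (Y != 0) -> mobius a b c d (fr X Y) = fr (a * X + b * Y) (c * X + d * Y) /\
   ((a * X + b * Y != 0) || (c * X + d * Y != 0)).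
Proof.
move=> XY; have E w z : hev 1 (mp w z) X Y = w * X + z * Y.
  rewrite /hev !big_ord_recl big_ord0 /= !coefD !coefZ !coefX !coefC /= /bump /= !expr0 !expr1; ring.
split; last by rewrite -(E a b) -(E c d) -mp_rdeg; apply: hev_ne0 => //; exact: mp_coprime.
by rewrite -mp_ratP1 ratP1_fr ?mp_coprime // mp_rdeg !E.
Qed.

End Moebius.

Lemma mobiusK a b c d : a * d - b * c != 0 -> cancel (mobius a b c d) (mobius d (- b) (- c) a).
Proof.
move=> det x; have [X [Y [XY ->]]] := fr_surj x; have [-> h] := mobius_fr det XY.
have det' : d * a - - b * - c != 0 by rewrite mulrNN mulrC.
have [-> _] := mobius_fr det' h.
rewrite -(@fr_scale _ (a * d - b * c) X Y) //; congr fr; ring.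
Qed.

Lemma mobius_comp a b c d (a' b' c' d' : C) : a * d - b * c != 0 -> a' * d' - b' * c' != 0 ->
  exists a1 b1 c1 d1 : C, a1 * d1 - b1 * c1 != 0 /\ forall x, mobius a b c d (mobius a' b' c' d' x) = mobius a1 b1 c1 d1 x.
Proof.
move=> h h'; have h2 : (a * a' + b * c') * (c * b' + d * d') - (a * b' + b * d') * (c * a' + d * c') != 0.
  have -> : (a * a' + b * c') * (c * b' + d * d') - (a * b' + b * d') * (c * a' + d * c') = (a * d - b * c) * (a' * d' - b' * c').
    by ring.
  exact: mulf_neq0.
exists (a * a' + b * c'), (a * b' + b * d'), (c * a' + d * c'), (c * b' + d * d'); split=> // x.
have [X [Y [XY ->]]] := fr_surj x; have [-> k] := mobius_fr h' XY.
have [-> _] := mobius_fr h k; have [-> _] := mobius_fr h2 XY; congr fr; ring.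
Qed.

Lemma mobius_conj_trans a b c d (g1 g2 g3 : P1 -> P1) : a * d - b * c != 0 ->
  (forall x, mobius a b c d (g1 x) = g2 (mobius a b c d x)) -> mobius_conj g2 g3 -> mobius_conj g1 g3.
Proof.
move=> h e [a' [b' [c' [d' [h' e']]]]].
have [a1 [b1 [c1 [d1 [k1 k2]]]]] := mobius_comp h' h.
by exists a1, b1, c1, d1; split=> // x; rewrite -k2 e e' k2.
Qed.

Lemma conj_pair p q a b c d : coprimep p q -> (0 < rdeg p q)%N -> a * d - b * c != 0 -> exists P Q,
  [/\ coprimep P Q, rdeg P Q = rdeg p q & forall x, ratP1 p q (mobius a b c d x) = mobius a b c d (ratP1 P Q x)].
Proof.
move=> cpq d0 det; have det' : d * a - - b * - c != 0 by rewrite mulrNN mulrC.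
pose P2 := rcp p q (mp a b) (mp c d); pose Q2 := rcq p q (mp a b) (mp c d).
have c2 : coprimep P2 Q2 by apply: rc_coprime => //; exact: mp_coprime.
have c3 := rc_coprime (mp_coprime det') c2.
exists (rcp (mp d (- b)) (mp (- c) a) P2 Q2), (rcq (mp d (- b)) (mp (- c) a) P2 Q2); split=> //.
  by rewrite rc_rdeg ?mp_coprime // mp_rdeg // mul1n rc_rdeg ?mp_coprime // mp_rdeg // muln1.
move=> x; rewrite rc_ratP1 ?mp_coprime // rc_ratP1 ?mp_coprime // !mp_ratP1 //.
set y := ratP1 p q _; have := mobiusK det' y; rewrite !opprK => ->.
by [].
Qed.

End InvForm.

(** * Orders of an invariant form *)

Section Orders.
Variable R : realType.
Local Notation C := R[i].
Implicit Types (p q a b : {poly C}) (x y : C).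

Lemma hpol_eval n p q a x : (size a <= n.+1)%N -> q.[x] != 0 ->
  (hpol n a p q).[x] = q.[x] ^+ n * a.[fv p q x].
Proof. by move=> sa qx; rewrite hpolE hev_Y. Qed.

Lemma hpolM n1 n2 p q a b : q != 0 -> (size a <= n1.+1)%N -> (size b <= n2.+1)%N ->
  hpol (n1 + n2) (a * b) p q = hpol n1 a p q * hpol n2 b p q.
Proof.
move=> q0 sa sb; have sab : (size (a * b : {poly C})%R <= (n1 + n2).+1)%N.
  by apply: leq_trans (size_polyMleq _ _) _; move: sa sb; lia.
apply: cof_eq; apply: cof_imp (cof_root q0) => x qx.
by rewrite hornerM !hpol_eval // hornerM exprD; ring.
Qed.

Lemma hpolX n p q y : q != 0 -> hpol n (('X - y%:P) ^+ n) p q = (p - y *: q) ^+ n.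
Proof.
move=> q0; apply: cof_eq; apply: cof_imp (cof_root q0) => x qx.
rewrite hpol_eval ?size_exp_XsubC // !horner_exp !hornerE -exprMn; congr (_ ^+ _).
by rewrite /fv; field.
Qed.

Lemma mup_split a y : a != 0 -> exists a1, [/\ a = a1 * ('X - y%:P) ^+ mup y a, a1.[y] != 0 & a1 != 0].
Proof.
move=> a0; have [k [a1 /implyP h e]] := multiplicity_XsubC a y; have {}h := h a0.
have a10 : a1 != 0 by apply: contraNneq a0 => z; rewrite e z mul0r.
exists a1; split=> //; rewrite [in mup _ _]e mupMr // mup_XsubCX eqxx //.
Qed.

Lemma mupE a a1 y k : a = a1 * ('X - y%:P) ^+ k -> a1.[y] != 0 -> mup y a = k.
Proof. by move=> -> h; rewrite mupMr // mup_XsubCX eqxx. Qed.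

Lemma mupXn k a x : a != 0 -> mup x (a ^+ k) = (k * mup x a)%N.
Proof.
move=> a0; elim: k => [|k IH]; first by rewrite expr0 mupNroot // rootE hornerC oner_eq0.
by rewrite exprS mupM ?expf_neq0 // IH mulSn.
Qed.

Lemma mupZ c a x : c != 0 -> mup x (c *: a) = mup x a.
Proof. by move=> c0; rewrite -mul_polyC mupMr // rootE hornerC. Qed.

(** The ramification index read off the Wronskian: subtracting a multiple of q from p does not
    change it, and a factor (X - x)^(k+1) of the first argument leaves exactly (X - x)^k. *)
Lemma ramif p q x : coprimep p q -> (0 < rdeg p q)%N -> q.[x] != 0 ->
  mup x (p - fv p q x *: q) = (mup x (wron p q)).+1.
Proof.
move=> c d0 qx; have P0 := sub_neq0 (fv p q x) c d0.
set P := p - _ in P0 *; have [g [e gx g0]] := mup_split x P0.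
have rP : root P x by rewrite rootE !hornerE /fv divfK // subrr.
have k0 : (0 < mup x P)%N by rewrite -XsubC_dvd // dvdp_XsubCl.
move: e k0; set k := mup x P; case: k => // k e _; congr S.
apply/esym; apply: (@mupE _ (g^`() * ('X - x%:P) * q + k.+1%:R * (g * q) - g * ('X - x%:P) * q^`())).
  have -> : wron p q = wron P q by rewrite /wron /P derivB derivZ -!mul_polyC; ring.
  rewrite /wron e derivM deriv_exp derivXsubC mul1r exprS /= -mulr_natl.
  move: (('X - x%:P) ^+ k) (g^`()) (k.+1%:R : {poly C}) ('X - x%:P) (q^`()) => *; ring.
rewrite !(hornerD, hornerN, hornerM, hornerMn, hornerX, hornerC) !subrr !(mulr0, mul0r) add0r oppr0 addr0.
by rewrite !mulf_neq0 // pnatr_eq0.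
Qed.

Lemma mup_hpol n p q a x : coprimep p q -> (0 < rdeg p q)%N -> q.[x] != 0 -> a != 0 -> (size a <= n.+1)%N ->
  mup x (hpol n a p q) = ((mup x (wron p q)).+1 * mup (fv p q x) a)%N.
Proof.
move=> c d0 qx a0 sa; rewrite -ramif //.
have [a1 [e h a10]] := mup_split (fv p q x) a0; move: e; set k := mup _ a => e.
have q0 : q != 0 by apply: contraNneq qx => ->; rewrite horner0.
have sz : (size a1 + k)%N = size a.
  by rewrite e size_Mmonic ?monicXn ?monic_exp ?monicXsubC // size_exp_XsubC addnS.
have s1 : (size a1 <= (n - k).+1)%N.
  have := size_poly_eq0 a1; rewrite (negPf a10); move: sa sz; lia.
have kn : (k <= n)%N.
  have := size_poly_eq0 a1; rewrite (negPf a10); move: sa sz; lia.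
rewrite e -(subnK kn) hpolM ?size_exp_XsubC // hpolX // mupMr ?mupXn ?sub_neq0 // 1?mulnC //.
by rewrite rootE hpol_eval // mulf_neq0 ?expf_neq0.
Qed.

End Orders.

(** * Finite backward invariant sets are totally ramified *)

Section TotalRamification.
Variable R : realType.
Local Notation C := R[i].
Variables (p q : {poly C}).
Local Notation d := (rdeg p q).
Local Notation f := (fv p q).
Hypotheses (cpq : coprimep p q) (d1 : (1 < d)%N).
Variable Z : seq C.
Hypotheses (uZ : uniq Z) (bZ : forall x, q.[x] != 0 -> f x \in Z -> x \in Z)
  (gZ : forall z, z \in Z -> ratP1 p q None != Some z).

Lemma tr_pre z : z \in Z -> exists x, root (p - z *: q) x.
Proof.
move=> /gZ h; have : size (p - z *: q) != 1%N by rewrite size_sub_gen // eqSS -lt0n ltnW.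
by move/closed_rootP.
Qed.

(** A choice of preimages maps the finite set Z injectively into itself, hence onto, and f inverts
    it. The preimages are finite because no point of Z is the image of infinity. *)
Lemma tr_perm : {in Z, forall x, q.[x] != 0} /\ perm_eq [seq f x | x <- Z] Z.
Proof.
pose h z := if pselect (exists x, root (p - z *: q) x) is left e then projT1 (cid e) else 0.
have hP z : z \in Z -> q.[h z] != 0 /\ f (h z) = z.
  move=> zZ; rewrite /h; case: pselect => [e|[]]; last exact: tr_pre.
  by case: (cid e) => x /= /(ratP1_root cpq).
have hZ : {subset [seq h z | z <- Z] <= Z}.
  by move=> y /mapP[z zZ ->]; have [h1 h2] := hP z zZ; apply: bZ => //; rewrite h2.
have uh : uniq [seq h z | z <- Z].
  by rewrite map_inj_in_uniq // => y z /hP[_ e1] /hP[_ e2] e; rewrite -e1 e e2.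
have [_ E] := uniq_min_size uh hZ ltac:(by rewrite size_map).
have pe : perm_eq [seq h z | z <- Z] Z by rewrite uniq_perm.
split=> [x|]; first by rewrite -E => /mapP[z /hP[h1 _] ->].
rewrite (perm_trans _ (_ : perm_eq [seq f x | x <- [seq h z | z <- Z]] Z)) //.
  by rewrite perm_map // perm_sym.
by rewrite -map_comp (_ : [seq _ | _ <- Z] = Z) // -[RHS]map_id; apply/eq_in_map => z /hP[].
Qed.

(** The whole fibre of f x lies in Z, on which f is injective, so x is the only root of p - f(x)
    q. *)
Lemma tr_total x : x \in Z -> [/\ q.[x] != 0, f x \in Z & exists2 c, c != 0 & p - f x *: q = c *: ('X - x%:P) ^+ d].
Proof.
move=> xZ; have [qZ pe] := tr_perm; have qx := qZ x xZ.
have fZ : f x \in Z by rewrite -(perm_mem pe) map_f.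
split=> //; have uf : uniq [seq f x | x <- Z] by rewrite (perm_uniq pe).
have inj : {in Z &, injective f}.
  move=> u v uu vv e; have := nth_uniq (f u) (i := index u Z) (j := index v Z) _ _ uf.
  rewrite !size_map !index_mem => /(_ uu vv); rewrite !(nth_map u) ?index_mem // !nth_index // e eqxx.
  by move=> /esym/eqP e2; rewrite -[u](nth_index u uu) e2 nth_index.
have P0 := sub_neq0 (f x) cpq (ltnW d1); have [s es] := closed_field_poly_normal (p - f x *: q).
exists (lead_coef (p - f x *: q)); first by rewrite lead_coef_eq0.
have sz : size s = d.
  have := size_sub_gen cpq (gZ fZ); rewrite es size_scale ?lead_coef_eq0 // size_prod_XsubC => -[] //.
have all_x : all (pred1 x) s.
  apply/allP => y ys; have ry : root (p - f x *: q) y by rewrite es rootZ ?lead_coef_eq0 // root_prod_XsubC.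
  have [qy fy] := ratP1_root cpq ry; have yZ : y \in Z by apply: bZ => //; rewrite /fv fy.
  by apply/eqP/inj.
rewrite {1}es; congr (_ *: _); move/all_pred1P: all_x => ->.
by rewrite sz big_nseq iter_mulr_1.
Qed.

(** Summing over Z, which f permutes, gives S = d S, so S = 0, against positivity unless Z is
    empty. *)
Lemma tr_empty (r : C -> int) :
  (forall x, x \in Z -> r x = d%:Z * r (f x)) -> (forall x, x \in Z -> 0 < r x) -> Z = [::].
Proof.
move=> hr pos; have [_ pe] := tr_perm.
have E : \sum_(x <- Z) r x = d%:Z * \sum_(x <- Z) r x.
  rewrite -{2}(perm_big _ pe) /= big_map mulr_sumr !big_seq; exact: eq_bigr.
have S0 : \sum_(x <- Z) r x = 0 by move: E d1; set S := \sum_(_ <- _) _; nia.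
case: Z pos S0 => // z Z' pos; rewrite big_cons => S0.
have h1 : 0 < r z by apply: pos; rewrite inE eqxx.
have h2 : 0 <= \sum_(x <- Z') r x.
  by rewrite big_seq; apply: sumr_ge0 => x xZ; apply/ltW/pos; rewrite inE xZ orbT.
by have := ltr_pwDl h1 h2; rewrite S0 ltxx.
Qed.

End TotalRamification.

Lemma int_gt (e m : nat) (r : int) : m%:Z < r -> m%:Z < e.+1%:Z * r.
Proof. by nia. Qed.

Lemma int_lt (e : nat) (r : int) : r < 0 -> e.+1%:Z * r < 0.
Proof. by nia. Qed.

(** * Bounds on the orders of an invariant form *)

Section Normalise.
Variable R : realType.
Local Notation C := R[i].
Variables (p q a b : {poly C}) (A m : nat) (k : C).
Local Notation d := (rdeg p q).
Local Notation f := (fv p q).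
Hypotheses (cpq : coprimep p q) (d1 : (1 < d)%N) (m0 : (0 < m)%N) (k0 : k != 0) (a0 : a != 0) (b0 : b != 0).
Hypotheses (cab : coprimep a b) (sa : (size a <= A.+1)%N) (sb : (size b <= (A + 2 * m).+1)%N).
Hypothesis star : hpol A a p q * wron p q ^+ m * b = k *: (a * hpol (A + 2 * m) b p q).
Hypothesis gen : forall g, root (a * b) g -> ratP1 p q None != Some g.

(** The order of the form (a / b) dx^m shifted by m: the shift absorbs the contribution of f'^m, so
    that pull-back multiplies [rr] by the ramification index. *)
Definition rr x : int := m%:Z + (mup x a)%:Z - (mup x b)%:Z.

Lemma rrE x : q.[x] != 0 -> rr x = (mup x (wron p q)).+1%:Z * rr (f x).
Proof.
move=> qx; have d0 := ltnW d1.
have q0 : q != 0 by apply: contraNneq qx => ->; rewrite horner0.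
have h0 n (c : {poly C}) : (size c <= n.+1)%N -> c != 0 -> hpol n c p q != 0.
  move=> sc c0; have K := cof_ex (cof_and (cof_root q0) (cof_pre cpq d0 (cof_root c0))).
  have [y [qy /(_ qy) cy]] := K; apply/eqP => e.
  have := hpol_eval p sc qy; rewrite e horner0 => /esym/eqP; apply/negP.
  by rewrite mulf_neq0 ?expf_neq0.
have w0 := wron_neq0 cpq d0.
have := congr1 (mup x) star.
rewrite mupZ // !mupM ?mulf_neq0 ?expf_neq0 ?h0 // mupXn // !mup_hpol // /rr.
by set e := mup x (wron p q); lia.
Qed.

Lemma tr_mup Z x : uniq Z -> (forall x, q.[x] != 0 -> f x \in Z -> x \in Z) ->
  (forall z, z \in Z -> ratP1 p q None != Some z) -> x \in Z -> rr x = d%:Z * rr (f x).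
Proof.
move=> u h1 h2 xZ; have [qx fZ [c c0 e]] := tr_total cpq d1 u h1 h2 xZ.
by rewrite rrE // -ramif ?(ltnW d1) // e mupZ // mup_XsubCX eqxx.
Qed.

Lemma sel (Pr : C -> bool) : (forall x, Pr x -> root (a * b) x) ->
  exists Z, [/\ uniq Z, forall x, (x \in Z) = Pr x & forall z, z \in Z -> ratP1 p q None != Some z].
Proof.
move=> h; have [s hs] := roots_seq (mulf_neq0 a0 b0).
have E x : (x \in undup [seq x <- s | Pr x]) = Pr x.
  by rewrite mem_undup mem_filter -hs; case e: (Pr x) => //=; apply: h.
exists (undup [seq x <- s | Pr x]); split=> //; first exact: undup_uniq.
by move=> z; rewrite E => /h /gen.
Qed.

Lemma rr_root x : rr x != m%:Z -> root (a * b) x.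
Proof.
rewrite rootM; apply: contraR; rewrite negb_or => /andP[/mupNroot e1 /mupNroot e2].
by rewrite /rr e1 e2 addr0 subr0.
Qed.

(** The set where rr > m is finite, since rr = m off the roots of a b, and backward invariant, since
    the index only multiplies. So it is totally ramified, and [tr_empty] applies. The next two
    lemmas run the same argument with other sets. *)
Lemma rr_le x : rr x <= m%:Z.
Proof.
rewrite leNgt; apply/negP => h.
have [Z [u hZ g]] := @sel (fun x => m%:Z < rr x) ltac:(by move=> y hy; apply: rr_root; rewrite gt_eqF).
have : Z = [::].
  have bZ y : q.[y] != 0 -> f y \in Z -> y \in Z.
    by move=> qy; rewrite !hZ (rrE qy); apply: int_gt.
  apply: (tr_empty cpq d1 u bZ g (r := rr)) => y; first exact: tr_mup.
  by rewrite hZ; move: m0; lia.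
by move=> e; have := hZ x; rewrite e in_nil h.
Qed.

Lemma rr_ge x : 0 <= rr x.
Proof.
rewrite leNgt; apply/negP => h.
have [Z [u hZ g]] := @sel (fun x => rr x < 0) ltac:(by move=> y hy; apply: rr_root; rewrite lt_eqF //; lia).
have : Z = [::].
  have bZ y : q.[y] != 0 -> f y \in Z -> y \in Z.
    by move=> qy; rewrite !hZ (rrE qy); apply: int_lt.
  apply: (tr_empty cpq d1 u bZ g (r := fun x => - rr x)) => y.
    by move=> yZ; rewrite (tr_mup u bZ g yZ) mulrN.
  by rewrite hZ oppr_gt0.
by move=> e; have := hZ x; rewrite e in_nil h.
Qed.

(** If rr y divides m then so does rr (f y), which divides rr y; hence the set of failures is
    backward invariant. *)
Lemma rr_dvd x : rr x != 0 -> (`|rr x| %| m)%N.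
Proof.
move=> r0; apply/negPn/negP => h.
have [Z [u hZ g]] := @sel (fun x => (rr x != 0) && ~~ (`|rr x| %| m)%N)
  ltac:(by move=> y /andP[_ hy]; apply: rr_root; apply: contra hy => /eqP ->).
have : Z = [::].
  have bZ y : q.[y] != 0 -> f y \in Z -> y \in Z.
    move=> qy; rewrite !hZ (rrE qy); move=> /andP[h1 h2]; rewrite mulf_neq0 //=; apply: contra h2.
    by rewrite abszM; apply: dvdn_trans; apply: dvdn_mull.
  apply: (tr_empty cpq d1 u bZ g (r := rr)) => y; first exact: tr_mup.
  by rewrite hZ => /andP[h1 _]; rewrite lt_neqAle eq_sym h1 rr_ge.
by move=> e; have := hZ x; rewrite e in_nil h r0.
Qed.

(** A root of a is not a root of b, so its shifted order would exceed m. *)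
Lemma a_const : size a = 1%N.
Proof.
apply/eqP/negPn/negP => /closed_rootP[x rx].
have nb : ~~ root b x by apply/negP => rb; have /coprimep_rootP/(_ x) := cab; apply.
have := rr_le x; rewrite /rr (mupNroot nb) subr0.
by have := rx; rewrite -dvdp_XsubCl XsubC_dvd // => h1; move: h1; case: (mup x a) => // k' _; rewrite -PoszD lez_nat; lia.
Qed.

Lemma mup_a x : mup x a = 0%N.
Proof. by rewrite mupNroot //; apply/negP => h; have := size_poly_eq1 a; rewrite a_const eqxx => /esym/eqp_root/(_ x); rewrite h rootC oner_eq0. Qed.

Lemma mup_b_le x : (mup x b <= m)%N.
Proof. by have := rr_ge x; rewrite /rr mup_a; lia. Qed.

Lemma mup_b_dvd x : (mup x b < m)%N -> (m - mup x b %| m)%N.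
Proof.
move=> h; have E : rr x = (m - mup x b)%N%:Z by rewrite /rr mup_a; lia.
by have := @rr_dvd x; rewrite E /=; apply; lia.
Qed.

Lemma mup_b_top x : mup x b = m -> [/\ q.[x] != 0, mup (f x) b = m &
  exists2 c, c != 0 & p - f x *: q = c *: ('X - x%:P) ^+ d].
Proof.
move=> h; have E y : (rr y == 0) = (mup y b == m) by rewrite /rr mup_a; apply/eqP/eqP; lia.
have [Z [u hZ g]] := @sel (fun x => rr x == 0) ltac:(by move=> y hy; apply: rr_root; rewrite (eqP hy); apply/eqP => ?; lia).
have bZ y : q.[y] != 0 -> f y \in Z -> y \in Z.
  by move=> qy; rewrite !hZ (rrE qy) => /eqP ->; rewrite mulr0.
have xZ : x \in Z by rewrite hZ E h.
have [qx fZ e] := tr_total cpq d1 u bZ g xZ; split; [exact: qx | | exact: e].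
by apply/eqP; rewrite -E -hZ.
Qed.

End Normalise.

Lemma size_quot_sub (x y z D M : nat) : (0 < x)%N -> (0 < y)%N -> (0 < z)%N ->
  (x + z).-1 = D.+1 -> (y + z).-1 = (D + M).+1 -> y = (x + M)%N /\ (y <= (x.-1 + M).+1)%N.
Proof. lia. Qed.

(** * Normal form of an invariant form *)

Section NormalForm.
Variable R : realType.
Local Notation C := R[i].
Implicit Types (p q a b P Q : {poly C}) (t k : C).

(** The form is dx^m / b. Degree exactly 2 m means that it has neither zero nor pole at infinity;
    moreover infinity is not fixed and is not sent to a root of b, so everything special happens at
    finite points. *)
Record normal P Q b m k : Prop := Normal {
  nf_cop : coprimep P Q;
  nf_deg : (1 < rdeg P Q)%N;
  nf_m : (0 < m)%N;
  nf_size : size b = (2 * m).+1;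
  nf_k : k != 0;
  nf_form : wron P Q ^+ m * b = k *: hpol (2 * m) b P Q;
  nf_inf : ratP1 P Q None != None;
  nf_gen : forall g, root b g -> ratP1 P Q None != Some g;
  nf_le : forall x, (mup x b <= m)%N;
  nf_dvd : forall x, (mup x b < m)%N -> (m - mup x b %| m)%N;
  nf_top : forall x, mup x b = m -> [/\ Q.[x] != 0, mup (fv P Q x) b = m &
    exists2 c, c != 0 & P - fv P Q x *: Q = c *: ('X - x%:P) ^+ rdeg P Q] }.

Lemma form_star p q a b m k A : coprimep p q -> (0 < rdeg p q)%N -> inv_form p q a b m k ->
  (size a <= A.+1)%N -> (size b <= (A + 2 * m).+1)%N ->
  hpol A a p q * wron p q ^+ m * b = k *: (a * hpol (A + 2 * m) b p q).
Proof.
move=> c d0 I sa sb; apply: cof_eq.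
apply: cof_imp (cof_and I (cof_root (q_neq0 c d0))) => x [/[swap] qx /(_ qx) I2].
rewrite hornerZ !hornerM horner_exp !hpol_eval // exprD.
have -> : (wron p q).[x] = dr p q x * q.[x] ^+ 2 by rewrite /dr divfK // expf_neq0.
rewrite exprMn -exprM.
transitivity (q.[x] ^+ A * q.[x] ^+ (2 * m) * (a.[fv p q x] * b.[x] * dr p q x ^+ m)); first by ring.
by rewrite I2; ring.
Qed.

Lemma inv_form_gcd p q a b g m k : coprimep p q -> (0 < rdeg p q)%N -> g != 0 ->
  inv_form p q (a * g) (b * g) m k -> inv_form p q a b m k.
Proof.
move=> c d0 g0 I; have K := cof_and I (cof_and (cof_root g0) (cof_pre c d0 (cof_root g0))).
apply: cof_imp K => x [I2 [gx gf]] qx; have {}I2 := I2 qx; have {}gf := gf qx.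
apply: (mulfI gx); apply: (mulfI gf); rewrite !hornerM in I2.
transitivity (a.[fv p q x] * g.[fv p q x] * (b.[x] * g.[x]) * dr p q x ^+ m); first by ring.
by rewrite I2; ring.
Qed.

Lemma size_hpol_mp D a t : (size a <= D.+1)%N -> a.[t] != 0 -> size (hpol D a (mp t 1) (mp 1 0)) = D.+1.
Proof.
move=> sa at0; have [s1 c1] := mp_coef t 1; have [s2 c2] := mp_coef (1 : C) 0.
have [h1 h2] := hpol_top D a s1 s2; rewrite !mul1n in h1 h2; rewrite c1 c2 hev_fin // in h2.
by apply/eqP; rewrite eqn_leq h1 ltnNge; apply: contra at0 => /leq_sizeP/(_ _ (leqnn _)); rewrite h2 => ->.
Qed.

Lemma wron_mp t : wron (mp t 1) (mp 1 0) = (-1)%:P.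
Proof.
rewrite /wron /mp !derivD !derivZ !derivX !derivC !addr0 scale1r -!mul_polyC polyCN; ring.
Qed.

Lemma mp10 : mp (1 : C) 0 = 'X. Proof. by rewrite /mp scale1r addr0. Qed.

(** Conjugation by x -> t + 1 / x brings a generic point t to infinity. After cancelling common
    factors of the pulled-back numerator and denominator, [a_const] leaves only a denominator. *)
Lemma normal_form p q a b m k : coprimep p q -> (1 < rdeg p q)%N -> (0 < m)%N ->
  a != 0 -> b != 0 -> k != 0 -> inv_form p q a b m k ->
  exists t P Q B k', (forall x, ratP1 p q (mobius t 1 1 0 x) = mobius t 1 1 0 (ratP1 P Q x)) /\
    rdeg P Q = rdeg p q /\ normal P Q B m k'.
Proof.
move=> c d1 m0 a0 b0 k0 I; have d0 := ltnW d1.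
have fix0 : p - 'X * q != 0.
  apply/eqP => /eqP; rewrite subr_eq0 => /eqP e.
  have sq : size q = 1%N.
    apply/eqP/negPn/negP => /closed_rootP[x rx]; have /coprimep_rootP/(_ x) := c; apply.
    by rewrite e rootM rx orbT.
  move: d1; rewrite /rdeg e; have := size_polyMleq 'X q; rewrite size_polyX sq; lia.
have ab0 : a * b != 0 by rewrite mulf_neq0.
(* The point t is to be no zero or pole of the form, not fixed, and with an image that is finite and
   again no zero or pole. *)
have [t [tab [ft [qt /(_ qt) fab]]]] := cof_ex (cof_and (cof_root ab0) (cof_and (cof_root fix0)
  (cof_and (cof_root (q_neq0 c d0)) (cof_pre c d0 (cof_root ab0))))).
have det : t * 0 - 1 * 1 != 0 :> C by rewrite mulr0 mulr1 sub0r oppr_eq0 oner_eq0.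
have [P [Q [cPQ dPQ ePQ]]] := conj_pair c d0 det.
have cm := mp_coprime det; have dm := mp_rdeg det; have em := mp_ratP1 det.
pose D := maxn (size a) (size b).
have sa : (size a <= D.+1)%N by exact: leq_trans (leq_maxl _ _) (leqnSn _).
have sb : (size b <= D.+1)%N by exact: leq_trans (leq_maxr _ _) (leqnSn _).
have ePQ' x : ratP1 p q (ratP1 (mp t 1) (mp 1 0) x) = ratP1 (mp t 1) (mp 1 0) (ratP1 P Q x).
  by rewrite !em ePQ.
have dP : (1 < rdeg P Q)%N by rewrite dPQ.
have := form_pullback c cm cPQ d0 (ltac:(by rewrite dm)) (ltnW dP) ePQ' sa sb I.
set a1 := _ * _; set b1 := hpol D b _ _ * _ => I1.
move: tab fab; rewrite !hornerM !mulf_eq0 !negb_or => /andP[at0 bt0] /andP[aft bft].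
have sa1 : size a1 = D.+1.
  by rewrite /a1 wron_mp -polyC_exp mulrC mul_polyC size_scale ?size_hpol_mp // expf_neq0 // oppr_eq0 oner_eq0.
have sb1 : size b1 = (D + 2 * m).+1.
  rewrite /b1 mp10 size_Mmonic ?monicXn -?size_poly_eq0 -?mp10 ?size_hpol_mp //.
  by rewrite mp10 size_polyXn addnS /=.
have a10 : a1 != 0 by rewrite -size_poly_eq0 sa1.
have b10 : b1 != 0 by rewrite -size_poly_eq0 sb1.
(* the image of infinity is the finite point s, which is not a root of a1 or b1 *)
have [s [es as0 bs0]] : exists s, [/\ ratP1 P Q None = Some s, a1.[s] != 0 & b1.[s] != 0].
  have := ePQ None; case: (ratP1 P Q None) => [s|]; rewrite [mobius _ _ _ _ None]/= oner_eq0 /= divr1 qt -/(fv p q t); last first.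
    move=> -[] e; case/negP: ft; rewrite !hornerE subr_eq0.
    by rewrite -{2}e /fv divfK.
  rewrite mul1r addr0; case: (eqVneq s 0) => //= s0 [e].
  have H n (w : {poly C}) : (size w <= n.+1)%N -> (hpol n w (mp t 1) (mp 1 0)).[s] = s ^+ n * w.[fv p q t].
    by move=> sw; rewrite hpolE !mpE mul1r addr0 hev_Y // e.
  exists s; split=> //; rewrite hornerM H // mulf_neq0 ?mulf_neq0 ?expf_neq0 //.
    by rewrite wron_mp -polyC_exp hornerC expf_neq0 // oppr_eq0 oner_eq0.
  by rewrite horner_exp mpE mul1r addr0 expf_neq0.
pose g := gcdp a1 b1.
have g0 : g != 0 by rewrite gcdp_eq0 negb_and a10.
have ea : a1 = a1 %/ g * g by rewrite divpK ?dvdp_gcdl.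
have eb : b1 = b1 %/ g * g by rewrite divpK ?dvdp_gcdr.
move: I1; rewrite ea eb => /(inv_form_gcd cPQ (ltnW dP) g0) I1.
have cab : coprimep (a1 %/ g) (b1 %/ g) by apply: coprimep_div_gcd; rewrite a10.
move: cab I1 ea eb; move: (a1 %/ g) (b1 %/ g) => a2 b2 cab I1 ea eb.
have a20 : a2 != 0 by apply: contraNneq a10 => z; rewrite ea z mul0r.
have b20 : b2 != 0 by apply: contraNneq b10 => z; rewrite eb z mul0r.
have [ss sb2] : size b2 = (size a2 + 2 * m)%N /\ (size b2 <= ((size a2).-1 + 2 * m).+1)%N.
  by apply: (@size_quot_sub _ _ (size g) D); rewrite ?size_poly_gt0 // -size_mul // -?ea -?eb.
have sa2 : (size a2 <= (size a2).-1.+1)%N by exact: leqSpred.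
have star := form_star cPQ (ltnW dP) I1 sa2 sb2.
have gen z : root (a2 * b2) z -> ratP1 P Q None != Some z.
  rewrite es; apply: contraL => /eqP[<-]; rewrite rootM !rootE negb_or.
  by move: as0 bs0; rewrite ea eb !hornerM !mulf_eq0 !negb_or => /andP[-> _] /andP[-> _].
have s1 := a_const cPQ dP m0 k0 a20 b20 cab sa2 sb2 star gen.
have [z z0 ez] : exists2 z, z != 0 & a2 = z%:P by apply/size_poly1P; rewrite s1.
exists t, P, Q, b2, k; split; first exact: ePQ.
split; first exact: dPQ.
apply: Normal; rewrite ?es.
- exact: cPQ.
- exact: dP.
- exact: m0.
- by rewrite ss s1.
- exact: k0.
- move: star; rewrite s1 /= ez /hpol big_ord1 coefC /= !expr0 mulr1 alg_polyC add0n -mulrA !mul_polyC.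
  by rewrite [k *: (z *: _)]scalerA [k * z]mulrC -scalerA => /(scalerI z0).
- by [].
- by move=> x rx; rewrite -es; apply: gen; rewrite rootM rx orbT.
- by move=> x; apply: (mup_b_le cPQ dP m0 k0 a20 b20 cab sa2 sb2 star gen).
- by move=> x; apply: (mup_b_dvd cPQ dP m0 k0 a20 b20 cab sa2 sb2 star gen).
by move=> x; apply: (mup_b_top cPQ dP m0 k0 a20 b20 cab sa2 sb2 star gen).
Qed.

End NormalForm.

(** * Power maps and Chebyshev polynomials *)

Section PowerCase.
Variable R : realType.
Local Notation C := R[i].
Local Notation P1 := (P1 R).
Implicit Types (p q b P Q : {poly C}) (x y z c k X Y : C).

Lemma nth_root n c : (0 < n)%N -> exists k, k ^+ n = c.
Proof.
move=> n0; have : size ('X^n - c%:P) != 1%N by rewrite size_XnsubC // eqSS -lt0n.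
by move=> /closed_rootP[k]; rewrite rootE !hornerE subr_eq0 => /eqP; exists k.
Qed.

Lemma hev_lin d p q z X Y : hev d (p - z *: q) X Y = hev d p X Y - z * hev d q X Y.
Proof.
rewrite /hev mulr_sumr -sumrB; apply: eq_bigr => i _.
by rewrite coefB coefZ; ring.
Qed.

Lemma hev_XsubX d c z X Y : hev d (c *: ('X - z%:P) ^+ d) X Y = c * (X - z * Y) ^+ d.
Proof.
have [->|Y0] := eqVneq Y 0.
  have := monic_exp d (monicXsubC z); rewrite monicE lead_coefE size_exp_XsubC => /eqP h.
  by rewrite hev_inf mulr0 subr0 coefZ h mulr1.
rewrite hev_Y //; last by apply: leq_trans (size_scale_leq _ _) _; rewrite size_exp_XsubC.
rewrite hornerZ horner_exp hornerD hornerN hornerX hornerC mulrCA -exprMn; congr (_ * _ ^+ _).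
by field.
Qed.

Lemma hev_1 d X Y : (0 < d)%N -> hev d 1 X Y = Y ^+ d.
Proof.
move=> d0; have [->|Y0] := eqVneq Y 0; first by rewrite hev_inf coef1 expr0n gtn_eqF // mul0r.
by rewrite hev_Y ?size_poly1 // hornerC mulr1.
Qed.

Lemma hev_Xn d X Y : hev d 'X^d X Y = X ^+ d.
Proof. by have := hev_XsubX d 1 0 X Y; rewrite scale1r subr0 mul0r subr0 mul1r. Qed.

Lemma rdeg_pow d : rdeg ('X^d : {poly C}) 1 = d /\ rdeg (1 : {poly C}) 'X^d = d.
Proof. by rewrite /rdeg size_polyXn size_poly1; lia. Qed.

(** The coordinate k (x - z1) / (x - z2) sends z1 to 0 and z2 to infinity and turns the map into a
    multiple of x^d; k^(d - 1) = c1 / c2 makes the multiple 1. *)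
Lemma power_conj P Q z1 z2 c1 c2 : coprimep P Q -> (1 < rdeg P Q)%N -> z1 != z2 -> c1 != 0 -> c2 != 0 ->
  P - z1 *: Q = c1 *: ('X - z1%:P) ^+ rdeg P Q -> P - z2 *: Q = c2 *: ('X - z2%:P) ^+ rdeg P Q ->
  mobius_conj (ratP1 P Q) (ratP1 'X^(rdeg P Q) 1).
Proof.
move=> cPQ d1 z12 c10 c20; set d := rdeg P Q => e1 e2.
have [k ek] := @nth_root d.-1 (c1 / c2) ltac:(by move: d1; rewrite -/d; lia).
have ekd : k ^+ d * c2 = k * c1.
  have dS : d = d.-1.+1 by rewrite (ltn_predK d1).
  by rewrite dS exprS ek; field.
have k0 : k != 0.
  apply: contra_eqN ek => /eqP ->; rewrite expr0n eq_sym.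
  have -> : (d.-1 == 0)%N = false by apply/negbTE; move: d1; rewrite -/d; lia.
  by rewrite mulf_neq0 // invr_neq0.
have det : k * (- z2) - (- (k * z1)) * 1 != 0.
  by rewrite (_ : _ - _ = k * (z1 - z2)); [rewrite mulf_neq0 // subr_eq0 | ring].
exists k, (- (k * z1)), 1, (- z2); split=> // x.
have [X [Y [XY ->]]] := fr_surj x; have n1 := hev_ne0 cPQ XY.
have [E1 n2] := mobius_fr det n1; have [E2 n3] := mobius_fr det XY.
rewrite ratP1_fr // E1 E2 ratP1_fr ?coprimep1 //.
rewrite (rdeg_pow d).1 hev_Xn hev_1 ?(ltnW d1) //.
have h1 := congr1 (fun w => hev d w X Y) e1; have h2 := congr1 (fun w => hev d w X Y) e2.
rewrite /= !hev_lin !hev_XsubX in h1 h2.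
have {}h1 : k * hev d P X Y + - (k * z1) * hev d Q X Y = c2 * (k * X + - (k * z1) * Y) ^+ d.
  rewrite (_ : k * X + _ = k * (X - z1 * Y)); last by ring.
  by rewrite exprMn mulrA [c2 * _]mulrC ekd -mulrA -h1; ring.
have {}h2 : 1 * hev d P X Y + - z2 * hev d Q X Y = c2 * (1 * X + - z2 * Y) ^+ d.
  by rewrite !mul1r !mulNr h2.
by rewrite h1 h2 fr_scale.
Qed.

(** Same coordinate, with the two points exchanged by the map; now the normalisation is k^(d + 1) =
    c2 / c1. *)
Lemma inverse_power_conj P Q z1 z2 c1 c2 : coprimep P Q -> (1 < rdeg P Q)%N -> z1 != z2 -> c1 != 0 -> c2 != 0 ->
  P - z1 *: Q = c1 *: ('X - z2%:P) ^+ rdeg P Q -> P - z2 *: Q = c2 *: ('X - z1%:P) ^+ rdeg P Q ->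
  mobius_conj (ratP1 P Q) (ratP1 1 'X^(rdeg P Q)).
Proof.
move=> cPQ d1 z12 c10 c20; set d := rdeg P Q => e1 e2.
have [k ek] := @nth_root d.+1 (c2 / c1) (ltn0Sn _).
have ekd : k * c1 * k ^+ d = c2.
  by rewrite mulrAC -exprS ek; field.
have k0 : k != 0.
  by apply: contra_eqN ek => /eqP ->; rewrite expr0n eq_sym mulf_neq0 // invr_neq0.
have det : k * (- z2) - (- (k * z1)) * 1 != 0.
  by rewrite (_ : _ - _ = k * (z1 - z2)); [rewrite mulf_neq0 // subr_eq0 | ring].
exists k, (- (k * z1)), 1, (- z2); split=> // x.
have [X [Y [XY ->]]] := fr_surj x; have n1 := hev_ne0 cPQ XY.
have [E1 n2] := mobius_fr det n1; have [E2 n3] := mobius_fr det XY.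
rewrite ratP1_fr // E1 E2 ratP1_fr ?coprime1p //.
rewrite (rdeg_pow d).2 hev_Xn hev_1 ?(ltnW d1) //.
have h1 := congr1 (fun w => hev d w X Y) e1; have h2 := congr1 (fun w => hev d w X Y) e2.
rewrite /= !hev_lin !hev_XsubX in h1 h2.
have {}h1 : k * hev d P X Y + - (k * z1) * hev d Q X Y = k * c1 * (1 * X + - z2 * Y) ^+ d.
  by rewrite (_ : 1 * X + _ = X - z2 * Y); [rewrite -mulrA -h1; ring | ring].
have {}h2 : 1 * hev d P X Y + - z2 * hev d Q X Y = k * c1 * (k * X + - (k * z1) * Y) ^+ d.
  rewrite (_ : k * X + _ = k * (X - z1 * Y)); last by ring.
  by rewrite exprMn mulrA ekd -h2; ring.
by rewrite h1 h2 fr_scale // mulf_neq0.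
Qed.

Lemma mup_sum b (s : seq C) : b != 0 -> uniq s -> (\sum_(x <- s) mup x b <= (size b).-1)%N.
Proof.
move=> b0 us; have [r er] := closed_field_poly_normal b.
have -> : (size b).-1 = size r by rewrite er size_scale ?lead_coef_eq0 // size_prod_XsubC.
rewrite (eq_bigr (fun x => count_mem x r)) => [|x _]; last by rewrite {1}er mupZ ?lead_coef_eq0 // mu_prod_XsubC.
elim: r {er} => [|y r IH]; first by rewrite big1.
rewrite /= big_split /= -add1n leq_add //.
elim: s us {IH} => [|x s IHs] /=; rewrite ?big_nil // big_cons => /andP[xs /IHs].
have [->|_] := eqVneq y x; last by rewrite add0n.
by rewrite big_seq big1 // => z zs; apply/eqP; rewrite eqb0; apply: contraNneq xs => ->.
Qed.

(** Degree 2 m leaves room for no third point of multiplicity m. The map sends z1 and z2 to such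
    points, and total ramification makes the images distinct, so both are fixed or they are
    exchanged. *)
Lemma power_case P Q b m k z1 z2 : normal P Q b m k -> z1 != z2 -> mup z1 b = m -> mup z2 b = m ->
  mobius_conj (ratP1 P Q) (ratP1 'X^(rdeg P Q) 1) \/ mobius_conj (ratP1 P Q) (ratP1 1 'X^(rdeg P Q)).
Proof.
move=> [cPQ d1 m0 sb k0 form fi gen _ _ top] z12 m1 m2.
have b0 : b != 0 by rewrite -size_poly_eq0 sb.
have two x : mup x b = m -> x = z1 \/ x = z2.
  move=> mx; have [|n1] := eqVneq x z1; [by left|]; have [|n2] := eqVneq x z2; [by right|].
  have := @mup_sum b [:: x; z1; z2] b0; rewrite /= !inE z12 !negb_or n1 n2; rewrite !big_cons big_nil mx m1 m2 sb => /(_ isT); move: m0; lia.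
have [q1 /two t1 [c1 c10 e1]] := top _ m1; have [q2 /two t2 [c2 c20 e2]] := top _ m2.
have ne : fv P Q z1 <> fv P Q z2.
  move=> e; move: e1; rewrite e e2 => /(congr1 (fun w => w.[z1])).
  rewrite !hornerZ !horner_exp !hornerE subrr expr0n gtn_eqF ?(ltnW d1) // mulr0 => /eqP.
  by rewrite mulf_eq0 (negPf c20) expf_eq0 subr_eq0 (negPf z12) andbF.
case: t1 ne e1 => -> ne e1; case: t2 ne e2 => -> ne e2 //.
  by left; apply: power_conj c10 c20 e1 e2.
by right; rewrite eq_sym in z12; apply: inverse_power_conj c10 c20 e1 e2.
Qed.

End PowerCase.

(** * One totally ramified point: Chebyshev polynomials *)

Section Chebyshev.
Variable R : realType.
Local Notation C := R[i].
Local Notation P1 := (P1 R).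
Implicit Types (p q b P Q U V g : {poly C}) (x y z c k : C).

Lemma half_mult (m l : nat) : (0 < l)%N -> (l < m)%N -> (m - l %| m)%N -> (m <= 2 * l)%N.
Proof.
move=> l0 lm /dvdnP[[|[|j]] e]; first by lia.
  by lia.
by have : (2 * (m - l) <= m)%N; [rewrite {2}e leq_mul2r orbT | lia].
Qed.

Lemma shape_aux (A : comNzRingType) (c x y z : A) l :
  c * y ^+ l * x ^+ l * z ^+ (2 * l) = c * (z ^+ 2 * (x * y)) ^+ l.
Proof. by rewrite (exprMn l (z ^+ 2)) (exprMn l x) exprM; set Z := _ ^+ l; set Y := y ^+ l; set X := x ^+ l; ring. Qed.

Lemma size_aux1 (s m : nat) : (s + m = (2 * m).+1)%N -> s = m.+1. Proof. lia. Qed.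
Lemma size_aux2 (s l m : nat) : (s + l = m.+1)%N -> (l < m)%N -> s != 1%N. Proof. lia. Qed.
Lemma size_aux3 (s l l' m : nat) : (s + l' + l = m.+1)%N -> (0 < s)%N -> (m <= 2 * l)%N -> (m <= 2 * l')%N ->
  [/\ m = (2 * l)%N, l' = l & s = 1%N].
Proof. by move=> *; split; lia. Qed.

(** Besides (X - z1)^m there remains degree m. By the divisibility of m by m minus the multiplicity,
    every other root has multiplicity at least m / 2, and less than m; so there are exactly two,
    each of multiplicity m / 2. *)
Lemma cheb_shape P Q b m k z1 : normal P Q b m k -> mup z1 b = m -> (forall z, mup z b = m -> z = z1) ->
  exists l x y c, [/\ m = (2 * l)%N, (0 < l)%N, [/\ x != y, x != z1 & y != z1], c != 0 &
    b = c *: ((('X - z1%:P) ^+ 2 * (('X - x%:P) * ('X - y%:P))) ^+ l)].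
Proof.
move=> [_ _ m0 sb _ _ _ _ mle dv _] m1 only.
have b0 : b != 0 by rewrite -size_poly_eq0 sb.
have szX a n z : a != 0 -> size (a * ('X - z%:P) ^+ n) = (size a + n)%N.
  by move=> a0; rewrite size_Mmonic ?monic_exp ?monicXsubC // size_exp_XsubC addnS.
have nr z w n : z != w -> ~~ root (('X - w%:P) ^+ n) z.
  by move=> zw; rewrite rootE horner_exp !hornerE expf_neq0 // subr_eq0.
have half z : z != z1 -> (0 < mup z b)%N -> (m <= 2 * mup z b)%N.
  move=> zz h; have lt : (mup z b < m)%N.
    by rewrite ltn_neqAle mle andbT; apply: contra zz => /eqP/only/eqP.
  exact: half_mult lt (dv _ lt).
have [b1 [e1 r1 b10]] := mup_split z1 b0; rewrite m1 in e1.
have s1 : size b1 = m.+1 by apply: size_aux1; rewrite -(szX b1 m z1 b10) -e1.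
have [x rx] : exists x, root b1 x by apply/closed_rootP; rewrite s1 eqSS -lt0n.
have xz : x != z1 by apply: contraTneq rx => ->; rewrite rootE.
have ex : mup x b = mup x b1 := etrans (congr1 (mup x) e1) (mupMl b1 (nr x z1 m xz)).
have [b2 [e2 r2 b20]] := mup_split x b10; rewrite -ex in e2.
have lx0 : (0 < mup x b)%N by rewrite ex -XsubC_dvd // dvdp_XsubCl.
have lxm : (mup x b < m)%N by rewrite ltn_neqAle mle andbT; apply: contra xz => /eqP/only/eqP.
have s2 : (size b2 + mup x b = m.+1)%N by rewrite -s1 [in RHS]e2 szX.
have [y ry] : exists y, root b2 y by apply/closed_rootP; exact: size_aux2 s2 lxm.
have yx : y != x by apply: contraTneq ry => ->; rewrite rootE.
have yb1 : root b1 y by rewrite e2 rootM ry.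
have yz : y != z1 by apply: contraTneq yb1 => ->; rewrite rootE.
have ey1 : mup y b = mup y b1 := etrans (congr1 (mup y) e1) (mupMl b1 (nr y z1 m yz)).
have ey : mup y b = mup y b2 := etrans ey1 (etrans (congr1 (mup y) e2) (mupMl b2 (nr y x _ yx))).
have [b3 [e3 r3 b30]] := mup_split y b20; rewrite -ey in e3.
have ly0 : (0 < mup y b)%N by rewrite ey -XsubC_dvd // dvdp_XsubCl.
have s3 : (size b3 + mup y b + mup x b = m.+1)%N by rewrite -s2 [in RHS]e3 szX.
have b3g : (0 < size b3)%N by rewrite size_poly_gt0.
have [em el sb3] := size_aux3 s3 b3g (half x xz lx0) (half y yz ly0).
have [c c0 ec] : exists2 c, c != 0 & b3 = c%:P by apply/size_poly1P; rewrite sb3.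
exists (mup x b), x, y, c; split; [exact: em | exact: lx0 | | exact: c0 |].
  by split; [rewrite eq_sym; exact: yx | exact: xz | exact: yz].
clear -e1 e2 e3 em el ec; move: e1 e2 e3; rewrite el em ec; move: (mup x b) => l -> -> ->.
by rewrite -mul_polyC; exact: shape_aux.
Qed.

(** After division by the gcd, a root of one side would be a root of the other, against coprimality;
    both cofactors are constant. *)
Lemma root_extract l U V k : (0 < l)%N -> k != 0 -> V != 0 -> U ^+ l = k *: V ^+ l ->
  exists2 c, c != 0 & U = c *: V.
Proof.
move=> l0 k0 V0 e; pose G := gcdp U V.
have G0 : G != 0 by rewrite gcdp_eq0 negb_and V0 orbT.
have eU : U = U %/ G * G by rewrite divpK ?dvdp_gcdl.
have eV : V = V %/ G * G by rewrite divpK ?dvdp_gcdr.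
have cp : coprimep (U %/ G) (V %/ G) by apply: coprimep_div_gcd; rewrite V0 orbT.
move: eU eV cp; move: (U %/ G) (V %/ G) => u v eU eV cp.
have v0 : v != 0 by apply: contraNneq V0 => z; rewrite eV z mul0r.
have {}e : u ^+ l = k *: v ^+ l.
  by apply: (mulIf (expf_neq0 l G0)); rewrite -scalerAl -!exprMn -eU -eV.
have nr x : ~~ root u x /\ ~~ root v x.
  have E : root u x = root v x.
    have := congr1 (fun w => root w x) e; rewrite rootZ // !rootE !horner_exp.
    by rewrite !expf_eq0 l0.
  by split; apply/negP => h; have /coprimep_rootP/(_ x) := cp; apply; move: h; rewrite E.
have cst w : (forall x, ~~ root w x) -> exists2 c, c != 0 & w = c%:P.
  by move=> h; apply/size_poly1P; apply/negPn/negP => /closed_rootP[x]; apply/negP.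
have [cu cu0 eu] := cst u (fun x => (nr x).1); have [cv cv0 ev] := cst v (fun x => (nr x).2).
exists (cu / cv); first by rewrite mulf_neq0 // invr_neq0.
by rewrite eU eV eu ev !mul_polyC scalerA divfK.
Qed.

Lemma ode_aux (K : fieldType) (z e Z G G' : K) : z != 0 ->
  e * Z * G + z * (Z * (G' * (1 - z ^- 2))) = e * (Z * G) + Z * G' * (z - z^-1).
Proof. by move=> z0; field. Qed.

Lemma ode_aux2 (K : fieldType) (z e Z G G' F A : K) : z != 0 ->
  z * A = e * F + Z * G' * (z - z^-1) -> F = Z * G -> G' ^+ 2 * ((z + z^-1) ^+ 2 - 4) = e ^+ 2 * (G ^+ 2 - 4) ->
  z * (A * (z * A - 2 * e * F)) = - 4 * e ^+ 2 * Z ^+ 2.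
Proof.
move=> z0 h1 h2 h3; have -> : z * (A * (z * A - 2 * e * F)) = (z * A - e * F) ^+ 2 - (e * F) ^+ 2 by ring.
have e2 : (z + z^-1) ^+ 2 - 4 = (z - z^-1) ^+ 2 by field.
rewrite h1 h2 addrAC subrr add0r; rewrite e2 in h3.
transitivity (Z ^+ 2 * (G' ^+ 2 * (z - z^-1) ^+ 2) - (e * (Z * G)) ^+ 2); first by ring.
by rewrite h3; ring.
Qed.

(** Write F(z) = z^d g(z + 1 / z). The equation becomes F' (z F' - 2 d F) = -4 d^2 z^(2 d - 1). The
    second factor divides a power of z and is nonzero at 0, so it is a constant u, which determines
    F from u. Evaluation at 1, where g(2) is 2 or -2, fixes u up to that sign. *)
Lemma cheb_ode d g k : (0 < d)%N -> size g = d.+1 -> k != 0 ->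
  g^`() ^+ 2 * ('X ^+ 2 - 4%:P) = k *: (g ^+ 2 - 4%:P) -> chebyshev d g \/ chebyshev d (- g).
Proof.
move=> d0 sg k0 ode.
have d0C : d%:R != 0 :> C by rewrite pnatr_eq0 -lt0n.
have g_d : g`_d != 0 by have := sg; rewrite -[d]/(d.+1.-1) -sg -lead_coefE lead_coef_eq0 -size_poly_eq0 sg.
have sg2 : (size g <= d.+1)%N by rewrite sg.
have ek : k = d%:R ^+ 2.
  have [s1 t1] : (size (g^`()) <= d.-1.+1)%N /\ g^`()`_d.-1 = d%:R * g`_d.
    split; last by rewrite coef_deriv prednK // mulr_natl.
    by have := lt_size_deriv (_ : g != 0); rewrite -size_poly_eq0 sg prednK // => /(_ isT).
  have [s2 t2] := coef_top_X 2 s1; have [s3 t3] := coef_top_X 2 sg2.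
  have sX : (size ('X ^+ 2 - 4%:P : {poly C})%R <= 3)%N by rewrite size_XnsubC.
  have [_ t4] := coef_top_M s2 sX.
  have := congr1 (fun w : {poly C} => w`_(d * 2)) ode; rewrite /= -{1}[(d * 2)%N](_ : (d.-1 * 2 + 2)%N = _); last by move: d0; clear; lia.
  rewrite t4 t2 t1 coefZ (coefB (g ^+ 2)) t3 coefB coefXn !coefC /= subr0 mulr1.
  have -> : (d * 2 == 0)%N = false by apply/negbTE; move: d0; clear; lia.
  rewrite subr0 exprMn => /esym/mulIf -> //; exact: expf_neq0.
pose F := hpol d g ('X ^+ 2 + 1) 'X.
have FE z : z != 0 -> F.[z] = z ^+ d * g.[z + z^-1].
  move=> z0; rewrite /F hpolE !hornerE hev_Y //; congr (_ * g.[_]).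
  by field.
have F0 : F.[0] = g`_d by rewrite /F hpolE !hornerE hev_inf expr0n add0r expr1n mulr1.
have dF z : z != 0 -> z * F^`().[z] = d%:R * F.[z] + z ^+ d * g^`().[z + z^-1] * (z - z^-1).
  move=> z0; have S1 := sm_poly F z.
  have S2 := sm_mul (sm_poly ('X^d) z) (sm_pcomp g (sm_add (sm_id z) (sm_inv z0))).
  have N : near z (fun w => F.[w] = ('X^d).[w] * g.[w + w^-1]).
    by apply: near_imp (sm_ne0 (sm_id z) z0) => w w0; rewrite FE // hornerXn.
  have /= -> := sm_uniq_near S1 S2 N.
  have e : z * ('X^d)^`().[z] = d%:R * z ^+ d.
    by rewrite derivXn hornerMn hornerXn -mulr_natl mulrCA -exprS prednK.
  rewrite mulrDr mulrA e FE // hornerXn; exact: ode_aux.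
have key : F^`() * ('X * F^`() - (2 * d%:R) *: F) = (- 4 * d%:R ^+ 2) *: 'X ^+ (2 * d).-1.
  apply: (mulfI (_ : 'X != 0 :> {poly C})); first by rewrite polyX_eq0.
  apply: cof_eq; apply: cof_imp (cof_root (_ : 'X != 0 :> {poly C})); last by rewrite polyX_eq0.
  move=> z; rewrite hornerX => z0.
  rewrite !(hornerM, hornerD, hornerN, hornerZ, hornerX, hornerXn).
  rewrite (ode_aux2 z0 (dF z z0) (FE z z0)); last first.
    by have := congr1 (fun w => w.[z + z^-1]) ode; rewrite /= ek hornerM hornerZ !hornerD !hornerN !horner_exp hornerX hornerC.
  have -> : (z ^+ d) ^+ 2 = z * z ^+ (2 * d).-1 by rewrite -exprS prednK ?muln_gt0 // mulnC exprM.
  by rewrite mulrCA.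
set W := _ - _ in key.
have WE z : W.[z] = z * F^`().[z] - 2 * d%:R * F.[z] by rewrite !(hornerM, hornerD, hornerN, hornerZ, hornerX).
have KE z : F^`().[z] * W.[z] = - 4 * d%:R ^+ 2 * z ^+ (2 * d).-1 by rewrite -hornerM key hornerZ hornerXn.
have W0 : W.[0] != 0.
  by rewrite WE F0 mul0r sub0r oppr_eq0 mulf_neq0 // mulf_neq0 // pnatr_eq0.
have [u u0 eW] : exists2 u, u != 0 & W = u%:P.
  apply/size_poly1P; apply/negPn/negP => /closed_rootP[r]; rewrite rootE => rW.
  have := KE r; rewrite (eqP rW) mulr0 => /esym/eqP.
  rewrite !mulf_eq0 oppr_eq0 pnatr_eq0 (negPf d0C) /= expf_eq0 => /andP[_ /eqP r0].
  by rewrite r0 in rW; rewrite rW in W0.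
have FF z : 2 * d%:R * u * F.[z] = - 4 * d%:R ^+ 2 * z ^+ (2 * d) - u ^+ 2.
  have h1 := KE z; have h2 := WE z; rewrite eW hornerC in h1 h2.
  have -> : z ^+ (2 * d) = z * z ^+ (2 * d).-1 by rewrite -exprS prednK // muln_gt0.
  have e : 2 * d%:R * F.[z] = z * F^`().[z] - u by rewrite h2; ring.
  rewrite (_ : 2 * d%:R * u * F.[z] = u * (2 * d%:R * F.[z])); last by ring.
  by rewrite e mulrCA -h1; ring.
have g2 : (g.[2] - 2) * (g.[2] + 2) = 0.
  have := congr1 (fun w => w.[2]) ode; rewrite !hornerE.
  have -> : 2 ^+ 2 - 4 = 0 :> C by ring.
  rewrite mulr0 => /esym/eqP; rewrite mulf_eq0 (negPf k0) /= => /eqP e.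
  by rewrite -e; ring.
have F1 : F.[1] = g.[2] by rewrite FE ?oner_eq0 // expr1n mul1r invr1; congr (_.[_]); ring.
have fin (s : C) : s ^+ 2 = 1 -> g.[2] = 2 * s -> chebyshev d (s *: g).
  move=> s2 gs; have eu : u = - (2 * d%:R * s).
    apply/eqP; rewrite -subr_eq0 opprK -sqrf_eq0; have := FF 1; rewrite F1 gs expr1n => e.
    have -> : (u + 2 * d%:R * s) ^+ 2 = 2 * d%:R * u * (2 * s) + (4 * d%:R ^+ 2 * s ^+ 2 + u ^+ 2) by ring.
    by rewrite e s2; apply/eqP; ring.
  move=> z z0; rewrite hornerZ; have := FF z; rewrite FE // eu.
  have -> : z ^+ (2 * d) = z ^+ d * z ^+ d by rewrite mul2n -addnn exprD.
  have : z ^+ d != 0 by rewrite expf_neq0.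
  set Z := z ^+ d => Z0 e; apply: (mulfI (_ : -4 * d%:R ^+ 2 * Z != 0)).
    by rewrite !mulf_neq0 // ?expf_neq0 // oppr_eq0 pnatr_eq0.
  transitivity (2 * d%:R * - (2 * d%:R * s) * (Z * g.[z + z^-1])); first by ring.
  rewrite e; transitivity (-4 * d%:R ^+ 2 * (Z * Z) - 4 * d%:R ^+ 2 * s ^+ 2); first by ring.
  by rewrite s2; field.
move/eqP: g2; rewrite mulf_eq0 subr_eq0 addr_eq0 => /orP[] /eqP h; [left|right].
  by rewrite -[g]scale1r; apply: fin; rewrite ?expr1n ?mulr1.
by rewrite -scaleN1r; apply: fin; [ring | rewrite h; ring].
Qed.



Lemma wron_mp' (a b c d : C) : wron (mp a b) (mp c d) = (a * d - b * c)%:P.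
Proof.
rewrite /wron /mp !derivD !derivZ !derivX !derivC !addr0 polyCB !polyCM -!mul_polyC; ring.
Qed.

Lemma mp_sub (a b c d z : C) : mp a b - z *: mp c d = (a - z * c) *: 'X + (b - z * d)%:P.
Proof. by rewrite /mp polyCB polyCM -!mul_polyC polyCB polyCM; ring. Qed.

Lemma wron_polyC p (c : C) : wron p c%:P = c *: p^`().
Proof. by rewrite /wron derivC mulr0 subr0 mulrC mul_polyC. Qed.

(** The constants make x -> (z1 x + e1) / (x + e2) send infinity, 2 and -2 to z1, x and y. *)
Lemma cheb_coord (z1 x y : C) : x != y -> x != z1 -> y != z1 -> exists e1 e2,
  z1 * e2 - e1 * 1 != 0 /\ exists2 K, K != 0 &
  hpol 4 (('X - z1%:P) ^+ 2 * (('X - x%:P) * ('X - y%:P))) (mp z1 e1) (mp 1 e2) = K *: ('X ^+ 2 - 4%:P).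
Proof.
move=> xy xz yz; pose e2 := 2 * (2 * z1 - x - y) / (x - y); pose e1 := x * e2 - 2 * (z1 - x).
have xy0 : x - y != 0 by rewrite subr_eq0.
have zx0 : z1 - x != 0 by rewrite subr_eq0 eq_sym.
have zy0 : z1 - y != 0 by rewrite subr_eq0 eq_sym.
have det : z1 * e2 - e1 * 1 = 4 * (z1 - x) * (z1 - y) / (x - y) by rewrite /e1 /e2; field.
have det0 : z1 * e2 - e1 * 1 != 0 by rewrite det !mulf_neq0 ?invr_neq0 // pnatr_eq0.
exists e1, e2; split=> //; exists ((z1 * e2 - e1 * 1) ^+ 2 * (z1 - x) * (z1 - y)).
  by rewrite !mulf_neq0 // expf_neq0.
have v0 : mp 1 e2 != 0.
  by have [_ h] := mp_coef 1 e2; apply: contra_eqN h => /eqP ->; rewrite coef0 eq_sym oner_eq0.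
have h1 w : hpol 1 ('X - w%:P) (mp z1 e1) (mp 1 e2) = (z1 - w) *: 'X + (e1 - w * e2)%:P.
  by have := hpolX 1 (mp z1 e1) w v0; rewrite !expr1 mp_sub mulr1.
rewrite -[X in hpol X _ _ _]/(2 + (1 + 1))%N hpolM ?size_exp_XsubC ?hpolX //; last first.
  by apply: leq_trans (size_polyMleq _ _) _; rewrite !size_XsubC.
rewrite hpolM ?size_XsubC // !h1 mp_sub mulr1 subrr scale0r add0r.
have -> : e1 - x * e2 = - (2 * (z1 - x)) by rewrite /e1; ring.
have -> : e1 - y * e2 = 2 * (z1 - y) by rewrite /e1 /e2; field.
apply: cof_eq; exists [::] => s _.
rewrite !(hornerM, horner_exp, hornerD, hornerN, hornerZ, hornerX, hornerC); ring.
Qed.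

Lemma mobius_conj_inv (a b c d : C) (g1 g2 : P1 -> P1) : a * d - b * c != 0 ->
  (forall x : P1, g1 (mobius a b c d x) = mobius a b c d (g2 x)) -> mobius_conj g1 g2.
Proof.
move=> det e; have det' : d * a - - b * - c != 0 by rewrite mulrNN mulrC.
exists d, (- b), (- c), a; split=> // x.
have := e (mobius d (- b) (- c) a x); have := mobiusK det' x; rewrite !opprK => -> ->.
by rewrite mobiusK.
Qed.

Lemma cheb_aux (D c K p p' s k : C) : D != 0 -> c != 0 -> K != 0 ->
  c ^+ 0 * D * (c * p') ^+ 2 * (K * (s ^+ 2 - 4)) = k * (D * (c ^+ (0 + 2 * 2) * (K * ((p / c) ^+ 2 - 4)))) ->
  (c^-1 * p') ^+ 2 * (s ^+ 2 - 4) = k * ((c^-1 * p) ^+ 2 - 4).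
Proof.
move=> D0 c0 K0; rewrite expr0 => e.
apply: (mulfI (_ : D * c ^+ 4 * K != 0)); first by rewrite !mulf_neq0 ?expf_neq0.
transitivity (1 * D * (c * p') ^+ 2 * (K * (s ^+ 2 - 4))); first by field.
by rewrite e; field.
Qed.

(** In the coordinate where z1 is infinity the map is a polynomial g, as z1 is its own only
    preimage, and the form becomes (x^2 - 4)^(-1) dx^2. Its invariance is the differential equation
    of Chebyshev polynomials. *)
Lemma cheb_case P Q b m k z1 : normal P Q b m k -> mup z1 b = m -> (forall z, mup z b = m -> z = z1) ->
  exists T, chebyshev (rdeg P Q) T /\ (mobius_conj (ratP1 P Q) (ratP1 T 1) \/ mobius_conj (ratP1 P Q) (ratP1 (- T) 1)).
Proof.
move=> nf m1 only; have [l [x [y [c [em l0 [xy xz yz] c0 eb]]]]] := cheb_shape nf m1 only.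
case: nf => cPQ d1 m0 sb k0 form fi gen _ _ top; set d := rdeg P Q.
have d0 := ltnW d1; have Q0 := q_neq0 cPQ d0.
pose B : {poly C} := ('X - z1%:P) ^+ 2 * (('X - x%:P) * ('X - y%:P)).
have sB : size B = 5%N.
  by rewrite /B size_Mmonic ?monic_neq0 ?monicMl ?monicXsubC ?monic_exp // size_exp_XsubC size_Mmonic ?monicXsubC ?polyXsubC_eq0 // !size_XsubC.
have B0 : B != 0 by rewrite -size_poly_eq0 sB.
have hB n : hpol (4 * n) (B ^+ n) P Q = hpol 4 B P Q ^+ n.
  elim: n => [|n IH]; first by rewrite !expr0 muln0 /hpol big_ord1 /= coef1 !expr0 mulr1 scale1r.
  have [sn _] := @coef_top_X _ B 4 n ltac:(by rewrite sB).
  by rewrite mulnS exprS hpolM ?sB // IH exprS.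
have h40 : hpol 4 B P Q != 0.
  have K := cof_ex (cof_and (cof_root Q0) (cof_pre cPQ d0 (cof_root B0))).
  have [w [Qw /(_ Qw) Bw]] := K; apply/eqP => e.
  have := hpol_eval P (_ : (size B <= 5)%N) Qw; rewrite sB e horner0 => /(_ isT)/esym/eqP; apply/negP.
  by rewrite mulf_neq0 ?expf_neq0.
(* Both sides of the invariance are l-th powers; taking the root replaces m = 2 l by 2. *)
have [k1 k10 ek] : exists2 k1, k1 != 0 & wron P Q ^+ 2 * B = k1 *: hpol 4 B P Q.
  apply: (root_extract l0 k0 h40); rewrite exprMn -exprM -em.
  apply: (scalerI c0); rewrite scalerAr -/B in eb *.
  rewrite -eb form eb em mulnA -hB scalerA [c * k]mulrC -scalerA; congr (_ *: _).
  rewrite /hpol scaler_sumr; apply: eq_bigr => i _; by rewrite coefZ scalerA.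
have I1 : inv_form P Q 1 B 2 k1.
  apply: cof_imp (cof_root Q0) => w Qw _; have := congr1 (fun u => u.[w]) ek.
  rewrite hornerM hornerZ hpol_eval ?sB // horner_exp => e; rewrite !hornerC mul1r mulr1.
  apply: (mulfI (expf_neq0 4 Qw)).
  move: e; have -> : (wron P Q).[w] = dr P Q w * Q.[w] ^+ 2 by rewrite /dr divfK // expf_neq0.
  by move=> e; rewrite [RHS]mulrCA -e; ring.
have [e1 [e2 [det [K K0 eK]]]] := cheb_coord xy xz yz.
have [P' [Q' [c' dd E]]] := conj_pair cPQ d0 det.
have cm := mp_coprime det; have dm := mp_rdeg det; have emm := mp_ratP1 det.
have d'1 : (1 < rdeg P' Q')%N by rewrite dd.
have E' w : ratP1 P Q (ratP1 (mp z1 e1) (mp 1 e2) w) = ratP1 (mp z1 e1) (mp 1 e2) (ratP1 P' Q' w).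
  by rewrite !emm E.
have v0 : mp 1 e2 != 0 by apply: (q_neq0 cm); rewrite dm.
have := @form_pullback R P Q (mp z1 e1) (mp 1 e2) P' Q' 1 B 2 k1 4 cPQ cm c' d0 (ltac:(by rewrite dm)) (ltnW d'1) E'
  (ltac:(by rewrite size_poly1)) (ltac:(by rewrite sB)) I1.
rewrite eK wron_mp' -polyC_exp.
have -> : hpol 4 1 (mp z1 e1) (mp 1 e2) = mp 1 e2 ^+ 4.
  by rewrite /hpol (bigD1 ord0) //= coef1 expr0 mul1r scale1r big1 ?addr0 // => i; rewrite coef1 -val_eqE /= => /negPf ->; rewrite scale0r.
rewrite [_ * _%:P]mulrC => /(inv_form_gcd c' (ltnW d'1) (expf_neq0 4 v0)) I2.
have sX : size (K *: ('X ^+ 2 - 4%:P)) = 3%N by rewrite size_scale // size_XnsubC.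
have := @form_star R P' Q' _ _ 2 k1 0 c' (ltnW d'1) I2 (size_polyC_leq1 _) (ltac:(by rewrite sX)).
move=> star.
have [q1 mz [cz cz0 ez]] := top _ m1; rewrite (only _ mz) in ez.
have gz : ratP1 P Q None != Some z1 by apply: gen; rewrite -dvdp_XsubCl XsubC_dvd ?m1 // -size_poly_eq0 sb.
have Nn : mobius z1 e1 1 e2 None = Some z1 by rewrite /= oner_eq0 /= divr1.
(* Total ramification over the fixed point z1: no finite point other than z1 maps to it, and
   infinity does not either. *)
have pre w : ratP1 P Q w = Some z1 -> w = Some z1.
  case: w => [w|] h; last by rewrite h eqxx in gz.
  have Qw : Q.[w] != 0 by move: h => /=; case: ifP.
  have /esym/eqP := congr1 (fun u => u.[w]) ez.
  move: h; rewrite ratP1_fv // => -[h].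
  have eP : P.[w] = z1 * Q.[w] by rewrite -h /fv divfK.
  rewrite hornerD hornerN !hornerZ eP subrr horner_exp hornerD hornerN hornerX hornerC.
  by rewrite mulf_eq0 (negPf cz0) expf_eq0 subr_eq0 => /andP[_ /eqP ->].
have noroot s : ~~ root Q' s.
  apply/negP => rs; have := E (Some s); have -> : ratP1 P' Q' (Some s) = None by rewrite /= (rootP rs) eqxx.
  by rewrite Nn => /pre; rewrite -Nn => /(can_inj (mobiusK det)).
have [q0 q00 eq0] : exists2 q0, q0 != 0 & Q' = q0%:P.
  by apply/size_poly1P; apply/negPn/negP => /closed_rootP[s]; apply/negP.
pose g := q0^-1 *: P'.
have q0V : q0^-1 != 0 by rewrite invr_neq0.
have sP : size P' = d.+1.
  have : rdeg P' Q' = (maxn (size P') 1).-1 by rewrite /rdeg eq0 size_polyC q00.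
  rewrite dd -/d => h; have : (1 < d)%N by []; move: h; rewrite /maxn; case: ltnP; clear; lia.
have sg : size g = d.+1 by rewrite size_scale.
have gP : ratP1 P' Q' =1 ratP1 g 1.
  case=> [s|].
    by rewrite /= eq0 !hornerC q00 oner_eq0 /= divr1 hornerZ mulrC.
  have -> : ratP1 P' Q' None = None.
    by rewrite /= dd eq0 coefC -/d gtn_eqF ?eqxx // ltnW.
  have rg : rdeg g 1 = d by rewrite /rdeg sg size_poly1 (maxn_idPl _).
  by rewrite /= rg coef1 gtn_eqF ?eqxx // ltnW.
have ode : g^`() ^+ 2 * ('X ^+ 2 - 4%:P) = k1 *: (g ^+ 2 - 4%:P).
  apply: cof_eq; exists [::] => s _; have := congr1 (fun u => u.[s]) star.
  have Qs : Q'.[s] != 0 by rewrite eq0 hornerC.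
  rewrite /g derivZ !(hornerM, hornerZ, horner_exp) !hpol_eval ?sX ?size_polyC_leq1 // /fv eq0 wron_polyC.
  rewrite !(hornerD, hornerN, horner_exp, hornerZ, hornerX, hornerC).
  have D0 : (z1 * e2 - e1 * 1) ^+ 2 != 0 by rewrite expf_neq0.
  move: ((z1 * e2 - e1 * 1) ^+ 2) D0 => D D0; exact: cheb_aux.
have [h|h] := cheb_ode (ltnW d1) sg k10 ode.
  exists g; split=> //; left.
  have E3 w : ratP1 P Q (mobius z1 e1 1 e2 w) = mobius z1 e1 1 e2 (ratP1 g 1 w) by rewrite E gP.
  exact: mobius_conj_inv det E3.
exists (- g); split=> //; right; rewrite opprK.
have E3 w : ratP1 P Q (mobius z1 e1 1 e2 w) = mobius z1 e1 1 e2 (ratP1 g 1 w) by rewrite E gP.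
exact: mobius_conj_inv det E3.
Qed.

End Chebyshev.

(** * Fixed points *)

Lemma size_aux4 (s l m k : nat) : k = (s + l)%N -> (k <= (2 * m).+1)%N -> (l < m)%N -> (s <= (2 * m - l).+1)%N.
Proof. lia. Qed.

Section FixedPoints.
Variable R : realType.
Local Notation C := R[i].
Local Notation nm := (@nm R).
Implicit Types (p q b P Q F G H A B D E xi : {poly C}) (x y z c k : C).

(** Lagrange interpolation of Q at the d + 1 simple roots of F, compared in degree d. *)
Lemma lagrange F Q (s : seq C) d : size F = d.+2 -> (size Q <= d.+1)%N -> uniq s -> size s = d.+1 ->
  (forall x, x \in s -> root F x) -> (forall x, x \in s -> F^`().[x] != 0) ->
  lead_coef F * \sum_(x <- s) Q.[x] / F^`().[x] = Q`_d.
Proof.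
move=> sF sQ us ss rF dF; pose g x := F %/ ('X - x%:P).
have gE x : x \in s -> F = g x * ('X - x%:P) by move=> /rF; rewrite -dvdp_XsubCl => h; rewrite /g divpK.
have sg x : x \in s -> size (g x) = d.+1.
  by move=> xs; have := sF; rewrite {1}(gE x xs) size_Mmonic ?monicXsubC ?size_XsubC ?addn2 //=; [move=> [] | apply: contra_eqN sF => /eqP g0; rewrite (gE x xs) g0 mul0r size_poly0].
have gd x : x \in s -> (g x)`_d = lead_coef F.
  by move=> xs; have := congr1 lead_coef (gE x xs); rewrite lead_coef_Mmonic ?monicXsubC // => ->; rewrite lead_coefE sg.
have gx x : x \in s -> (g x).[x] = F^`().[x].
  by move=> xs; have := congr1 (fun w => w^`().[x]) (gE x xs); rewrite /= derivM derivXsubC mulr1 hornerD hornerM hornerXsubC subrr mulr0 add0r => ->.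
have gy x y : x \in s -> y \in s -> y != x -> (g x).[y] = 0.
  move=> xs ys yx; have := rF y ys; rewrite {1}(gE x xs) rootM root_XsubC (negPf yx) orbF.
  by move/rootP.
pose L := \sum_(x <- s) (Q.[x] / F^`().[x]) *: g x - Q.
have L0 : L = 0.
  apply/eqP/negPn/negP => n0.
  have := max_poly_roots n0 _ us; rewrite ss.
  have -> : all (root L) s.
    apply/allP => y ys; rewrite rootE hornerD hornerN horner_sum (bigD1_seq y) //= hornerZ gx // divfK ?dF //.
    by rewrite big_seq_cond big1 ?addr0 ?subrr // => x /andP[xs xy]; rewrite hornerZ gy ?mulr0 // eq_sym.
  move=> /(_ isT); rewrite ltnNge => /negP; apply.
  apply: leq_trans (size_polyD _ _) _; rewrite size_polyN geq_max sQ andbT.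
  apply: leq_trans (size_sum _ _ _) _; rewrite big_seq.
  by elim/big_ind: _ => // [u v hu hv|x xs]; [rewrite geq_max hu | apply: leq_trans (size_scale_leq _ _) _; rewrite sg].
have := congr1 (fun w : {poly C} => w`_d) L0; rewrite /= coefB coef0 coef_sum => /eqP; rewrite subr_eq0 => /eqP <-.
by rewrite mulr_sumr !big_seq; apply: eq_bigr => x xs; rewrite coefZ gd // mulrC.
Qed.

Lemma re_inv_half z : nm z <= 1 -> z != 1 -> 1 / 2 <= complex.Re ((1 - z)^-1).
Proof.
case: z => x y; rewrite /nm normc_def => h ne /=.
have h2 : x ^+ 2 + y ^+ 2 <= 1.
  have : (Num.sqrt (x ^+ 2 + y ^+ 2)) ^+ 2 <= 1 by rewrite exprn_ile1 // sqrtr_ge0.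
  by rewrite sqr_sqrtr // addr_ge0 // sqr_ge0.
have d0 : (1 - x) ^+ 2 + (0 - y) ^+ 2 != 0.
  apply: contra ne; rewrite paddr_eq0 ?sqr_ge0 // !sqrf_eq0 subr_eq0 sub0r oppr_eq0 => /andP[/eqP <- /eqP ->].
  by [].
have dpos : 0 < (1 - x) ^+ 2 + (0 - y) ^+ 2 by rewrite lt_neqAle eq_sym d0 addr_ge0 // sqr_ge0.
by rewrite ler_pdivlMr //; nra.
Qed.

Lemma congr_exp xi A B E n : xi %| (A - B - E) -> xi %| E ^+ 2 -> (xi %| A ^+ n - B ^+ n - n%:R * B ^+ n.-1 * E).
Proof.
move=> h1 h2; pose D := A - B - E; have eA : A = B + E + D by rewrite /D; ring.
have hD : xi %| D by [].
elim: n => [|n IH]; first by rewrite !expr0 mul0r mul0r subr0 subrr dvdp0.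
have -> : A ^+ n.+1 - B ^+ n.+1 - n.+1%:R * B ^+ n.+1.-1 * E =
  A * (A ^+ n - B ^+ n - n%:R * B ^+ n.-1 * E) + D * (B ^+ n + n%:R * B ^+ n.-1 * E) + n%:R * B ^+ n.-1 * E ^+ 2.
  case: n {IH} => [|n] /=; first by rewrite !expr0 !expr1 /D; ring.
  by rewrite !exprS -!natr1 eA; ring.
by apply: dvdp_add; [apply: dvdp_add; [exact: dvdp_mull | exact: dvdp_mulr] | exact: dvdp_mull].
Qed.

Lemma hpol_congr xi n b P P' Q : xi %| P - P' -> xi %| hpol n b P Q - hpol n b P' Q.
Proof.
move=> h; rewrite /hpol -sumrB; elim/big_ind: _ => [|u v|i _]; [exact: dvdp0 | exact: dvdp_add |].
rewrite -scalerBr -mulrBl -mul_polyC dvdp_mull // dvdp_mulr // subrXX dvdp_mulr //.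
Qed.

Lemma hpol_XQ n b Q : Q != 0 -> (size b <= n.+1)%N -> hpol n b ('X * Q) Q = Q ^+ n * b.
Proof.
move=> Q0 sb; apply: cof_eq; apply: cof_imp (cof_root Q0) => x Qx.
by rewrite hpol_eval // hornerM horner_exp /fv hornerM hornerX mulfK.
Qed.

Lemma sqr_dvd xi s G : (0 < s)%N -> xi ^+ s.+1 %| (xi ^+ s * G) ^+ 2.
Proof. by move=> s0; rewrite exprMn -exprM dvdp_mulr // dvdp_exp2l //; lia. Qed.

(* A multiple fixed point (multiplier one) contradicts the invariance of the form: compare the coefficients of xi^s. *)
Lemma no_parabolic P Q b m l s x b1 G : coprimep P Q -> (0 < rdeg P Q)%N -> (l < m)%N ->
  wron P Q ^+ m * b = hpol (2 * m) b P Q -> (size b <= (2 * m).+1)%N ->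
  b = b1 * ('X - x%:P) ^+ l -> b1.[x] != 0 -> Q.[x] != 0 -> (0 < s)%N ->
  P = 'X * Q + ('X - x%:P) ^+ s.+1 * G -> G.[x] != 0 -> False.
Proof.
move=> cPQ d0 lm form sb eb b1x Qx s0 eP Gx; pose xi : {poly C} := 'X - x%:P.
have Q0 : Q != 0 by apply: contraNneq Qx => ->; rewrite horner0.
have xi0 : xi != 0 by rewrite polyXsubC_eq0.
have b10 : b1 != 0 by apply: contraNneq b1x => ->; rewrite horner0.
have sb1 : (size b1 <= (2 * m - l).+1)%N.
  by apply: size_aux4 sb lm; rewrite eb size_Mmonic ?monic_exp ?monicXsubC // size_exp_XsubC addnS.
have ePx : P - x *: Q = xi * (Q + xi ^+ s * G) by rewrite eP /xi exprS -mul_polyC; ring.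
(* The invariance after division by (X - x)^l, which both sides contain because x is fixed. *)
have F1 : wron P Q ^+ m * b1 = (Q + xi ^+ s * G) ^+ l * hpol (2 * m - l) b1 P Q.
  apply: (mulIf (expf_neq0 l xi0)); rewrite -mulrA -eb form eb.
  rewrite -[in LHS](subnK (_ : (l <= 2 * m)%N)); last by apply: leq_trans (ltnW lm) _; rewrite leq_pmull.
  by rewrite hpolM ?size_exp_XsubC // hpolX // ePx exprMn; ring.
pose E := xi ^+ s * (G * Q).
have cong (A B : {poly C}) : xi ^+ s.+1 %| A - B -> exists D, A = B + xi ^+ s.+1 * D.
  by move=> /dvdpP[D e]; exists D; rewrite [_ * D]mulrC -e addrC subrK.
have [D1 e1] : exists D, wron P Q ^+ m = Q ^+ (2 * m) + m%:R * Q ^+ (2 * m).-2 * (s.+1%:R * E) + xi ^+ s.+1 * D.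
  have h : xi ^+ s.+1 %| wron P Q - Q ^+ 2 - s.+1%:R * E.
    apply/dvdpP; exists (G^`() * Q - G * Q^`()).
    rewrite /wron eP /E derivD !derivM derivX mul1r deriv_exp derivXsubC mul1r /= -mulr_natl exprS; ring.
  have h2 : xi ^+ s.+1 %| (s.+1%:R * E) ^+ 2 by rewrite mulrCA sqr_dvd.
  have := congr_exp m h h2; rewrite -addrA -opprD => /cong[D eD]; exists D.
  have -> : (Q ^+ (2 * m).-2 = (Q ^+ 2) ^+ m.-1)%R by rewrite -exprM; congr (_ ^+ _); clear; lia.
  by rewrite [Q ^+ (2 * m)]exprM.
have [D2 e2] : exists D, (Q + xi ^+ s * G) ^+ l = Q ^+ l + l%:R * Q ^+ l.-1 * (xi ^+ s * G) + xi ^+ s.+1 * D.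
  have h : xi ^+ s.+1 %| (Q + xi ^+ s * G) - Q - xi ^+ s * G.
    by rewrite (_ : _ - _ - _ = 0) ?dvdp0 //; ring.
  by have := congr_exp l h (sqr_dvd xi G s0); rewrite -addrA -opprD => /cong.
have [D3 e3] : exists D, hpol (2 * m - l) b1 P Q = Q ^+ (2 * m - l) * b1 + xi ^+ s.+1 * D.
  apply: cong; rewrite -hpol_XQ //; apply: hpol_congr.
  by rewrite eP addrC addKr dvdp_mulr.
move: F1; rewrite e1 e2 e3 /E => F1.
have F2 : xi ^+ s * ((m%:R * s.+1%:R) * Q ^+ (2 * m).-2 * (G * Q) * b1 + xi * D1 * b1)
  = xi ^+ s * (l%:R * Q ^+ l.-1 * G * Q ^+ (2 * m - l) * b1 + xi * (D2 * (Q ^+ (2 * m - l) * b1 + xi ^+ s.+1 * D3) + (Q ^+ l + l%:R * Q ^+ l.-1 * (xi ^+ s * G)) * D3)).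
  have e : Q ^+ (2 * m) = Q ^+ l * Q ^+ (2 * m - l).
    by rewrite -exprD subnKC //; apply: leq_trans (ltnW lm) _; rewrite leq_pmull.
  rewrite e in F1; apply: (addrI (Q ^+ l * Q ^+ (2 * m - l) * b1)).
  move: F1; rewrite exprS => F1; transitivity ((Q ^+ l * Q ^+ (2 * m - l) + m%:R * Q ^+ (2 * m).-2 * (s.+1%:R * (xi ^+ s * (G * Q))) + xi * xi ^+ s * D1) * b1); first by ring.
  by rewrite F1; ring.
have /(congr1 (fun w => w.[x])) := mulfI (expf_neq0 s xi0) F2.
have xix : xi.[x] = 0 by rewrite /xi hornerXsubC subrr.
rewrite hornerD [in RHS]hornerD !(hornerM xi) xix !mul0r !addr0 !hornerM !horner_exp xix !mul0r addr0.
rewrite -!polyC_natr !hornerC => e.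
have e4 : Q.[x] ^+ (2 * m).-2 * Q.[x] = Q.[x] ^+ (2 * m).-1 by rewrite -exprSr; congr (_ ^+ _); move: lm; clear; lia.
have l0 : (0 < l)%N.
  rewrite lt0n; apply/eqP => z; move: e; rewrite z !mul0r => /eqP.
  by rewrite !mulf_eq0 !pnatr_eq0 (negPf Gx) (negPf Qx) (negPf b1x) !expf_eq0 (negPf Qx) !andbF; move: lm; clear; lia.
have e5 : Q.[x] ^+ l.-1 * Q.[x] ^+ (2 * m - l) = Q.[x] ^+ (2 * m).-1 by rewrite -exprD; congr (_ ^+ _); move: lm l0; clear; lia.
(* What remains of the coefficients of xi^s is m (s + 1) = l, against l < m. *)
have : (m * s.+1)%:R * (Q.[x] ^+ (2 * m).-1 * G.[x] * b1.[x]) = l%:R * (Q.[x] ^+ (2 * m).-1 * G.[x] * b1.[x]).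
  by rewrite -{1}e4 -e5 natrM; move: e; set X1 := Q.[x] ^+ _; set X2 := Q.[x] ^+ _; set X3 := Q.[x] ^+ _ => e; transitivity (m%:R * s.+1%:R * X1 * (G.[x] * Q.[x]) * b1.[x]); [ring | rewrite e; ring].
move/(mulIf (_ : Q.[x] ^+ (2 * m).-1 * G.[x] * b1.[x] != 0)) => h.
have /eqP := h ltac:(by rewrite !mulf_neq0 ?expf_neq0); rewrite eqr_nat => /eqP; move: lm s0; clear; nia.
Qed.

End FixedPoints.

(** * A repelling fixed point and the classification *)

Section Exceptional.
Variable R : realType.
Local Notation C := R[i].
Local Notation nm := (@nm R).
Local Notation P1 := (P1 R).
Implicit Types (p q b P Q F : {poly C}) (x y z c k : C).

Lemma hpol_factor n l P Q b b1 x : Q != 0 -> (l <= n)%N -> (size b1 <= (n - l).+1)%N ->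
  b = b1 * ('X - x%:P) ^+ l -> hpol n b P Q = hpol (n - l) b1 P Q * (P - x *: Q) ^+ l.
Proof.
move=> Q0 ln sb ->; rewrite -[in hpol n](subnK ln) hpolM ?size_exp_XsubC // hpolX //.
Qed.

Lemma mult_aux (M Q B k : C) m l : (l < m)%N -> M != 0 -> Q != 0 -> B != 0 ->
  (M * Q ^+ 2) ^+ m * B = k * ((M * Q) ^+ l * (Q ^+ (2 * m - l) * B)) -> M ^+ (m - l) = k.
Proof.
move=> lm M0 Q0 B0; rewrite (exprMn m M) (exprMn l M) -exprM -{1}(subnK (ltnW lm)) exprD => e.
have lm2 : (l <= 2 * m)%N by apply: leq_trans (ltnW lm) _; rewrite leq_pmull.
apply: (mulIf (_ : M ^+ l * Q ^+ (2 * m) * B != 0)); first by rewrite !mulf_neq0 ?expf_neq0.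
transitivity (M ^+ (m - l) * M ^+ l * Q ^+ (2 * m) * B); first by ring.
by rewrite e -[in RHS](subnKC lm2) exprD; ring.
Qed.

Lemma half_aux (u : R) : 2 <= u -> (u + 1) * (1 / 2) <= 1 -> False.
Proof. by lra. Qed.

Section NoTotal.
Variables (P Q b : {poly C}) (m : nat) (k : C).
Hypotheses (nf : normal P Q b m k) (lt : forall x, (mup x b < m)%N).
Local Notation mu := (dr P Q).

Lemma nt_b0 : b != 0. Proof. by rewrite -size_poly_eq0 (nf_size nf). Qed.

(** At a fixed point, with l the order of b, the orders in the invariance give m e = l e for the
    order e of the Wronskian, so e = 0 by l < m and the point is not critical. The leading
    coefficients then give the multiplier. *)
Lemma fixed_multiplier x : P.[x] = x * Q.[x] ->
  [/\ Q.[x] != 0, fv P Q x = x, mu x != 0 & mu x ^+ (m - mup x b) = k].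
Proof.
move=> fx; have cPQ := nf_cop nf; have d0 := ltnW (nf_deg nf); have lm := lt x.
have Qx : Q.[x] != 0.
  apply/eqP => e; have /coprimep_rootP/(_ x) := cPQ; apply.
  by rewrite !rootE fx e mulr0.
have ffx : fv P Q x = x by rewrite /fv fx mulfK.
have w0 := wron_neq0 cPQ d0; have b0 := nt_b0.
have sb : (size b <= (2 * m).+1)%N by rewrite (nf_size nf).
have [b1 [eb b1x b10]] := mup_split x b0; move: lm eb; set l := mup x b => lm eb.
have Q0 := q_neq0 cPQ d0.
have sb1 : (size b1 <= (2 * m - l).+1)%N.
  by apply: size_aux4 sb lm; rewrite {1}eb size_Mmonic ?monic_exp ?monicXsubC // size_exp_XsubC addnS.
have lm2 : (l <= 2 * m)%N by apply: leq_trans (ltnW lm) _; rewrite leq_pmull.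
have wx : (wron P Q).[x] != 0.
  have := congr1 (mup x) (nf_form nf).
  have h0 : hpol (2 * m) b P Q != 0.
    apply/eqP => e; move: (nf_form nf); rewrite e scaler0 => /eqP; apply/negP.
    by rewrite mulf_neq0 ?expf_neq0.
  rewrite mupZ ?(nf_k nf) // mupM ?expf_neq0 // mupXn // mup_hpol // ffx -/l => e.
  have e0 : mup x (wron P Q) = 0%N by move: e lm; set e' := mup x (wron P Q); clear; nia.
  have [w1 [e1 h1 _]] := mup_split x w0.
  by move: h1; rewrite e1 e0 expr0 mulr1.
have mx : mu x != 0 by rewrite mulf_neq0 // invr_neq0 // expf_neq0.
split=> //.
have rP : root (P - x *: Q) x by rewrite rootE hornerD hornerN hornerZ fx subrr.
have [g eg] : exists g, P - x *: Q = g * ('X - x%:P).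
  by move: rP; rewrite -dvdp_XsubCl => /dvdpP[g ->]; exists g.
have gx : g.[x] = mu x * Q.[x].
  have := congr1 (fun w => w^`().[x]) eg; rewrite /= derivM derivXsubC mulr1 [in RHS]hornerD hornerM hornerXsubC subrr mulr0 add0r => <-.
  by rewrite /dr /wron derivB derivZ !(hornerD, hornerN, hornerM, hornerZ) fx; field.
have xi0 : ('X - x%:P : {poly C}) != 0 by rewrite polyXsubC_eq0.
have F1 : wron P Q ^+ m * b1 = k *: (g ^+ l * hpol (2 * m - l) b1 P Q).
  apply: (mulIf (expf_neq0 l xi0)); rewrite -mulrA -eb (nf_form nf) -scalerAl; congr (_ *: _).
  by rewrite (hpol_factor P Q0 lm2 sb1 eb) eg exprMn mulrA [X in X * _]mulrC.
have := congr1 (fun w => w.[x]) F1.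
rewrite hornerZ !hornerM !horner_exp hpol_eval // ffx gx.
have -> : (wron P Q).[x] = mu x * Q.[x] ^+ 2 by rewrite /dr divfK // expf_neq0.
exact: mult_aux.
Qed.

Lemma nt_fix : size (P - 'X * Q) = (rdeg P Q).+2 /\ lead_coef (P - 'X * Q) = - Q`_(rdeg P Q).
Proof.
have [s1 s2] := rdeg_size P Q; have Qd : Q`_(rdeg P Q) != 0.
  by have := nf_inf nf; rewrite /=; case: ifP.
have h : (P - 'X * Q)`_(rdeg P Q).+1 = - Q`_(rdeg P Q).
  by rewrite coefB coefXM nth_default // sub0r.
have s : size (P - 'X * Q) = (rdeg P Q).+2.
  apply/eqP; rewrite eqn_leq; apply/andP; split.
    apply: leq_trans (size_polyD _ _) _; rewrite size_polyN geq_max (leq_trans s1) //=.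
    by apply: leq_trans (size_polyMleq _ _) _; rewrite size_polyX.
  by rewrite ltnNge; apply: contra Qd => /leq_sizeP/(_ _ (leqnn _)); rewrite h => /eqP; rewrite oppr_eq0.
by split=> //; rewrite lead_coefE s.
Qed.

(** Infinity is not fixed, so all d + 1 fixed points are finite, and [lagrange] yields the fixed
    point formula: the sum of 1 / (1 - mu) is 1. If no multiplier exceeded 1 in modulus, each term
    would have real part at least 1/2, since mu = 1 is excluded by [no_parabolic], and the sum would
    be at least (d + 1) / 2 > 1. *)
Lemma exists_repelling : exists2 x, P.[x] = x * Q.[x] & 1 < nm (mu x).
Proof.
have cPQ := nf_cop nf; have d0 := ltnW (nf_deg nf); have [sF lF] := nt_fix.
apply: contrapT => no.
have le1 x : P.[x] = x * Q.[x] -> nm (mu x) <= 1.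
  by move=> h; rewrite leNgt; apply/negP => h2; apply: no; exists x.
have Qd : Q`_(rdeg P Q) != 0 by have := nf_inf nf; rewrite /=; case: ifP.
have F0 : P - 'X * Q != 0 by rewrite -size_poly_eq0 sF.
have rFE x : root (P - 'X * Q) x -> P.[x] = x * Q.[x].
  by rewrite rootE hornerD hornerN hornerM hornerX subr_eq0 => /eqP.
have dFE x : P.[x] = x * Q.[x] -> Q.[x] != 0 -> (P - 'X * Q)^`().[x] = Q.[x] * (mu x - 1).
  move=> fx Qx; rewrite derivB derivM derivX mul1r /dr /wron !(hornerD, hornerN, hornerM, hornerX) fx.
  by field.
have n1 x : P.[x] = x * Q.[x] -> mu x != 1.
  move=> fx; have [Qx ffx mx ek] := fixed_multiplier fx; apply/eqP => m1.
  have k1 : k = 1 by rewrite -ek m1 expr1n.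
  have [G [eG Gx _]] := mup_split x F0.
  have rF : root (P - 'X * Q) x by rewrite rootE hornerD hornerN hornerM hornerX fx subrr.
  have dF0 : (P - 'X * Q)^`().[x] = 0 by rewrite dFE // m1 subrr mulr0.
  move: eG; case e: (mup x (P - 'X * Q)) => [|[|s]] eG.
  - by move: rF; rewrite eG expr0 mulr1 rootE (negPf Gx).
  - move: dF0; rewrite eG expr1 derivM derivXsubC mulr1 hornerD hornerM hornerXsubC subrr mulr0 add0r => /eqP.
    by rewrite (negPf Gx).
  have b0 := nt_b0; have [b1 [eb b1x b10]] := mup_split x b0.
  apply: (@no_parabolic R P Q b m (mup x b) s.+1 x b1 G cPQ d0 (lt x)) => //.
  - by rewrite (nf_form nf) k1 scale1r.
  - by rewrite (nf_size nf).
  by rewrite [_ ^+ s.+2 * _]mulrC -eG addrC subrK.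
have [s es] : exists s : seq C, P - 'X * Q = lead_coef (P - 'X * Q) *: \prod_(z <- s) ('X - z%:P).
  by have [s es] := closed_field_poly_normal (P - 'X * Q); exists s.
have rs x : x \in s -> root (P - 'X * Q) x.
  by move=> xs; rewrite es rootZ ?lead_coef_eq0 // root_prod_XsubC.
have ss : size s = (rdeg P Q).+1.
  by have := sF; rewrite {1}es size_scale ?lead_coef_eq0 // size_prod_XsubC => -[].
have dFs x : x \in s -> (P - 'X * Q)^`().[x] != 0.
  move=> /rs/rFE fx; have [Qx _ _ _] := fixed_multiplier fx.
  by rewrite dFE // mulf_neq0 // subr_eq0 n1.
have us : uniq s.
  apply: count_mem_uniq => x; have mc : mup x (P - 'X * Q) = count_mem x s.
    by rewrite {1}es mupZ ?lead_coef_eq0 // mu_prod_XsubC.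
  have [xs|xs] := boolP (x \in s); last by apply/count_memPn.
  have c1 : (0 < count_mem x s)%N by rewrite -has_count has_pred1.
  have c0 : (0 < mup x (P - 'X * Q))%N by rewrite mc; exact: c1.
  suff e1 : mup x (P - 'X * Q) = 1%N by exact: etrans (esym mc) e1.
  have [G [eG Gx _]] := mup_split x F0; move: eG c0; case: (mup x _) => [|[|j]] // eG _.
  have := dFs x xs; rewrite eG derivM deriv_exp derivXsubC mul1r /= -mulr_natl !exprS.
  by rewrite !(hornerD, hornerM, hornerN, hornerX, hornerC) subrr !(mul0r, mulr0) addr0 eqxx.
have [s1 s2] := rdeg_size P Q.
have := lagrange sF s2 us ss rs dFs; rewrite lF mulNr => L.
have S1 : \sum_(x <- s) (1 - mu x)^-1 = 1.
  apply: (mulfI Qd); rewrite mulr1 -[RHS]L -mulrN; congr (_ * _); rewrite -sumrN !big_seq; apply: eq_bigr => x /rs/rFE fx.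
  have [Qx _ _ _] := fixed_multiplier fx; rewrite dFE //.
  by have m1 := n1 x fx; field; rewrite subr_eq0 m1 /= Qx subr_eq0 eq_sym m1.
have := congr1 (@complex.Re R) S1; rewrite /= => S2.
have S3 : complex.Re (\sum_(x <- s) (1 - mu x)^-1) = \sum_(x <- s) complex.Re ((1 - mu x)^-1).
  by elim: (s) => [|x s' IH]; rewrite ?big_nil ?big_cons //= -IH; case: (_^-1) (\sum_(j <- s') _) => [? ?] [].
have : (size s)%:R * (1 / 2) <= \sum_(x <- s) complex.Re ((1 - mu x)^-1).
  rewrite -sum1_size natr_sum mulr_suml !big_seq; apply: ler_sum => x /rs/rFE fx.
  by rewrite mul1r; apply: re_inv_half; [exact: le1 | exact: n1].
rewrite -S3 S2 ss; have : (2%:R : R) <= (rdeg P Q)%:R by rewrite ler_nat (nf_deg nf).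
rewrite -(natr1 (R := R) (rdeg P Q)); exact: half_aux.
Qed.

Lemma normal_lattes p q t : (forall x : P1, ratP1 p q (mobius t 1 1 0 x) = mobius t 1 1 0 (ratP1 P Q x)) -> lattes p q.
Proof.
move=> E; have det : t * 0 - 1 * 1 != 0 :> C by rewrite mulr0 mulr1 sub0r oppr_eq0 oner_eq0.
have [x fx mu1] := exists_repelling; have [Qx ffx mx ek] := fixed_multiplier fx.
have b0 := nt_b0; have [b1 [eb b1x b10]] := mup_split x b0; rewrite mulrC in eb.
have [n hn] : exists n, (n * (m - mup x b))%N = m.
  by have /dvdnP[n hn] := nf_dvd nf (lt x); exists n.
have emu : (fun y : C => (P^`().[y] * Q.[y] - P.[y] * Q^`().[y]) / Q.[y] ^+ 2) x = mu x.
  by rewrite /dr /wron hornerD hornerN !hornerM.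
have [T [lam [C0 [S C00 lam1 F]]]] := theta_exists (nf_cop nf) (ltnW (nf_deg nf)) (nf_m nf)
  (eq_leq (nf_size nf)) (nf_form nf) eb b1x hn (lt x) fx Qx emu mu1 ek.
have nd y : ~~ (('X - y%:P) ^+ m %| b) by rewrite -mup_ltn.
have cm := mp_coprime det; have em := mp_ratP1 det.
apply: (lattes_of_solution (nf_m nf) C00 (nf_size nf) S nd cm _ _ F).
- by move=> y1 y2; rewrite !em => /(can_inj (mobiusK det)).
- by apply: contraTneq lam1 => ->; rewrite nm0 ltr10.
by move=> y; rewrite !em E.
Qed.

End NoTotal.

Theorem exceptional_of_form p q (a b : {poly C}) m k : coprimep p q -> (1 < rdeg p q)%N -> (0 < m)%N ->
  a != 0 -> b != 0 -> k != 0 -> inv_form p q a b m k -> exceptional p q.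
Proof.
move=> c d1 m0 a0 b0 k0 I; have [t [P [Q [B [k' [E [dd nf]]]]]]] := normal_form c d1 m0 a0 b0 k0 I.
have det : t * 0 - 1 * 1 != 0 :> C by rewrite mulr0 mulr1 sub0r oppr_eq0 oner_eq0.
have det' : 0 * t - - 1 * - 1 != 0 :> C by rewrite mul0r mulrNN mulr1 sub0r oppr_eq0 oner_eq0.
have back g : mobius_conj (ratP1 P Q) g -> mobius_conj (ratP1 p q) g.
  apply: (mobius_conj_trans det') => x.
  by have := E (mobius 0 (-1) (-1) t x); have := mobiusK det' x; rewrite !opprK => -> ->; rewrite mobiusK.
have [[z1 m1]|no] := pselect (exists z, mup z B = m); last first.
  right; right; right; apply: (normal_lattes nf _ E) => x.
  by rewrite ltn_neqAle (nf_le nf) andbT; apply/eqP => h; apply: no; exists x.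
have [[z2 [m2 z12]]|no] := pselect (exists z, mup z B = m /\ z != z1).
  rewrite eq_sym in z12.
  by have [h|h] := power_case nf z12 m1 m2; rewrite dd in h; [left | right; left]; apply: back.
right; right; left; have [|T [h1 h2]] := cheb_case nf m1.
  by move=> z mz; apply/eqP/negPn/negP => n; apply: no; exists z.
by rewrite dd in h1; exists T; split=> //; case: h2 => /back; [left|right].
Qed.

End Exceptional.

(** * Algebraic elements over an integral domain *)

Section Algebraic.
(** In the application [K] is a ring of functions on a set, with zero divisors; only the subset [A]
    of restrictions of polynomials to an irreducible variety has none. *)
Variables (K B : comNzRingType) (tau : {rmorphism B -> K}) (A : K -> Prop).
Hypotheses (AD : forall x y, A x -> A y -> A (x + y)) (AM : forall x y, A x -> A y -> A (x * y))
  (Atau : forall b, A (tau b)) (Adom : forall x y, A x -> A y -> x * y = 0 -> x = 0 \/ y = 0).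

(* Algebraic over the fraction field of the image of tau. *)
Definition alg z := A z /\ exists2 s, tau s <> 0 & integralOver tau (tau s * z).

Lemma tau1 : tau 1 <> 0. Proof. by rewrite rmorph1; apply/eqP/oner_neq0. Qed.

Lemma dom_mul x y : A x -> A y -> x <> 0 -> y <> 0 -> x * y <> 0.
Proof. by move=> Ax Ay x0 y0 /(Adom Ax Ay) []. Qed.

Lemma tau_mul s t : tau s <> 0 -> tau t <> 0 -> tau (s * t) <> 0.
Proof. by rewrite rmorphM; apply: dom_mul. Qed.

Lemma alg_int z : A z -> integralOver tau z -> alg z.
Proof. by move=> Az iz; split=> //; exists 1; [exact: tau1 | rewrite rmorph1 mul1r]. Qed.

Lemma alg_base b : alg (tau b).
Proof. by apply: alg_int => //; exact: integral_id. Qed.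

Lemma algM x y : alg x -> alg y -> alg (x * y).
Proof.
move=> [Ax [s s0 is_]] [Ay [t t0 it]]; split; first exact: AM.
by exists (s * t); [exact: tau_mul | rewrite rmorphM mulrACA; exact: integral_mul].
Qed.

Lemma algD x y : alg x -> alg y -> alg (x + y).
Proof.
move=> [Ax [s s0 is_]] [Ay [t t0 it]]; split; first exact: AD.
exists (s * t); first exact: tau_mul.
rewrite rmorphM mulrDr; apply: integral_add.
  by rewrite [tau s * _]mulrC -mulrA; apply: integral_mul => //; exact: integral_id.
by rewrite -mulrA; apply: integral_mul => //; exact: integral_id.
Qed.

Lemma alg0 : alg 0. Proof. by rewrite -(rmorph0 tau); exact: alg_base. Qed.
Lemma alg_common (s : seq K) : (forall x, x \in s -> alg x) ->
  exists2 t, tau t <> 0 & forall x, x \in s -> integralOver tau (tau t * x).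
Proof.
elim: s => [|y s IH] H; first by exists 1; [exact: tau1 | by []].
have [|t t0 ht] := IH; first by move=> x xs; apply: H; rewrite inE xs orbT.
have [_ [u u0 hu]] := H y (mem_head _ _).
exists (t * u); first exact: tau_mul.
move=> x; rewrite inE => /orP[/eqP ->|xs]; rewrite rmorphM.
  by rewrite -mulrA; apply: integral_mul => //; exact: integral_id.
by rewrite mulrAC; apply: integral_mul; [exact: ht | exact: integral_id].
Qed.

(** In a relation for w = s z, divide by w as long as the constant term is zero. The first nonzero
    constant term is, up to sign, a multiple w g lying in the base. *)
Lemma alg_div z : alg z -> z <> 0 -> exists g e, [/\ alg g, tau e <> 0 & z * g = tau e].
Proof.
move=> [Az [s s0 [p pm pz]]] z0; pose w := tau s * z.
have Aw : A w by exact: AM.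
have w0 : w <> 0 by exact: dom_mul.
have aw : alg w by apply: alg_int => //; exists p.
have horner_alg (r : {poly B}) : alg (map_poly tau r).[w].
  elim/poly_ind: r => [|r c IH]; first by rewrite rmorph0 horner0; exact: alg0.
  rewrite rmorphD rmorphM /= map_polyX map_polyC hornerMXaddC.
  by apply: algD; [exact: algM | exact: alg_base].
have H : forall r : {poly B}, (exists i, tau r`_i <> 0) -> root (map_poly tau r) w ->
    exists g e, [/\ alg g, tau e <> 0 & w * g = tau e].
  elim/poly_ind => [|r c IH]; first by move=> [j]; rewrite coef0 rmorph0.
  move=> [j hj].
  rewrite rootE rmorphD rmorphM /= map_polyX map_polyC hornerMXaddC => /eqP e.
  have [c0|c0] := pselect (tau c = 0); last first.
    exists (map_poly tau r).[w], (- c); split=> //; first by rewrite rmorphN => /eqP; rewrite oppr_eq0 => /eqP.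
    by rewrite rmorphN mulrC; apply/eqP; rewrite -addr_eq0 e.
  apply: IH.
    case: j hj => [|j]; rewrite coefD coefMX coefC /= ?add0r ?addr0 //.
    by move=> h; exists j.
  rewrite /= c0 addr0 in e; have [Ar _] := horner_alg r.
  by apply/eqP; case: (Adom Ar Aw e).
have [|g [e [ag e0 eq]]] := H p _ pz.
  exists (size p).-1; rewrite -lead_coefE (monicP pm); exact: tau1.
by exists (tau s * g), e; split=> //; [apply: algM => //; exact: alg_base | rewrite mulrCA mulrA].
Qed.

(** Multiply p by the cofactor g that brings its leading coefficient into the base, and by a common
    denominator t of the coefficients; then t e z is a root of a monic polynomial with integral
    coefficients. *)
Lemma alg_root (p : {poly K}) z : A z -> (forall i, alg p`_i) -> lead_coef p <> 0 -> root p z -> alg z.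
Proof.
move=> Az ap lp pz; have [g [e [ag e0 eg]]] := alg_div (ap _ : alg (lead_coef p)) lp.
pose p1 := g *: p.
have ap1 i : alg p1`_i by rewrite coefZ; exact: algM.
have p1z : root p1 z by rewrite rootE hornerZ (rootP pz) mulr0.
pose d := (size p).-1.
have p1d : p1`_d = tau e by rewrite coefZ mulrC -eg.
have [t t0 ht] := alg_common (s := p1) ltac:(by move=> x /(nthP 0)[i _ <-]).
have hti i : integralOver tau (tau t * p1`_i).
  have [h|h] := ltnP i (size p1); first by apply: ht; exact: mem_nth.
  by rewrite nth_default // mulr0; exact: integral0.
have sp : size p = d.+1.
  by rewrite prednK // lt0n size_poly_eq0; apply/eqP => p0; apply: lp; rewrite p0 lead_coef0.
pose c := tau (t * e); pose w := c * z.
have [d0|d0] := posnP d.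
  move: p1z; rewrite rootE (horner_coef_wide _ (_ : size p1 <= 1)%N); last first.
    by apply: leq_trans (size_scale_leq _ _) _; rewrite sp d0.
  by move: p1d; rewrite d0 big_ord1 expr0 mulr1 /= => -> /eqP.
pose q : {poly K} := 'X^d + \poly_(i < d) (tau t * p1`_i * c ^+ (d.-1 - i)).
have sq : (size (\poly_(i < d) (tau t * p1`_i * c ^+ (d.-1 - i)))%R < size ('X^d : {poly K})%R)%N.
  by rewrite size_polyXn ltnS size_poly.
have qm : q \is monic by rewrite monicE lead_coefDl // lead_coefXn.
have qw : root q w.
  rewrite rootE /q hornerD hornerXn horner_poly.
  have := p1z; rewrite rootE (horner_coef_wide _ (_ : size p1 <= d.+1)%N); last first.
    by apply: leq_trans (size_scale_leq _ _) _; rewrite sp.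
  rewrite big_ord_recr /= p1d => /eqP E.
  have -> : \sum_(i < d) tau t * p1`_i * c ^+ (d.-1 - i) * w ^+ i = tau t * c ^+ d.-1 * \sum_(i < d) p1`_i * z ^+ i.
    rewrite mulr_sumr; apply: eq_bigr => i _; rewrite /w exprMn.
    have -> : c ^+ d.-1 = c ^+ (d.-1 - i) * c ^+ i by rewrite -exprD subnK // -ltnS prednK.
    by ring.
  have -> : w ^+ d = tau t * c ^+ d.-1 * (tau e * z ^+ d).
    by rewrite /w exprMn -{1}(prednK d0) exprS /c rmorphM; ring.
  by rewrite -mulrDr addrC E mulr0.
split=> //; exists (t * e); first exact: tau_mul.
apply: (integral_root_monic qm qw); apply/integral_poly => i.
rewrite coefD coefXn coef_poly; apply: integral_add; first exact: integral_nat.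
case: ifP => _; last exact: integral0.
apply: integral_mul => //; rewrite /c -rmorphXn; exact: integral_id.
Qed.

Lemma alg_rel z : alg z -> exists p : {poly B}, tau (lead_coef p) <> 0 /\ root (map_poly tau p) z.
Proof.
move=> [Az [s s0 [p pm pz]]]; pose q' := \poly_(i < size p) (p`_i * s ^+ i).
have q'E x : (map_poly tau q').[x] = (map_poly tau p).[tau s * x].
  rewrite (horner_coef_wide _ (_ : size (map_poly tau q') <= size p)%N); last first.
    by apply: leq_trans (size_poly _ _) _; exact: size_poly.
  rewrite [RHS](horner_coef_wide _ (_ : size (map_poly tau p) <= size p)%N) ?size_poly //.
  apply: eq_bigr => i _; rewrite !coef_map /= coef_poly ltn_ord rmorphM rmorphXn exprMn; ring.
have p0 : (0 < size p)%N by rewrite size_poly_gt0 monic_neq0.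
have s0' n : tau (s ^+ n) <> 0 by elim: n => [|n IH]; rewrite ?expr0 ?exprS; [exact: tau1 | exact: tau_mul].
have qd : q'`_(size p).-1 = s ^+ (size p).-1.
  by rewrite coef_poly prednK // leqnn -lead_coefE (monicP pm) mul1r.
have sq : size q' = size p.
  apply/eqP; rewrite eqn_leq size_poly /= -(prednK p0) ltnNge; apply/negP => /leq_sizeP/(_ _ (leqnn _)).
  by rewrite qd => e; apply: (s0' (size p).-1); rewrite e rmorph0.
exists q'; split; first by rewrite lead_coefE sq qd.
by rewrite rootE q'E -rootE.
Qed.

End Algebraic.

(** * Multivariate polynomials *)

Section Mpoly.
Variables (C : numClosedFieldType) (r : nat).
Local Notation A := {mpoly C[r]}.
Implicit Types (P Q H : A) (u v : 'I_r -> C) (a b c i : 'I_r).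

Lemma mpoly_gen (S : A -> Prop) : (forall x : C, S x%:MP) -> (forall i, S 'X_i) ->
  (forall P Q, S P -> S Q -> S (P + Q)) -> (forall P Q, S P -> S Q -> S (P * Q)) -> forall P, S P.
Proof.
move=> hc hx hD hM P; rewrite (mpolyE P); elim/big_ind: _ => [|//|m _].
  by rewrite -(mpolyC0 r C).
rewrite -mul_mpolyC; apply: (hM) => //; rewrite mpolyXE_id.
elim/big_ind: _ => [||i _]; [exact: (hc 1) | exact: hM |].
by elim: (m i) => [|k IH]; rewrite ?expr0 ?exprS; [exact: (hc 1) | apply: (hM)].
Qed.

Lemma morph_ext (S : nzRingType) (f g : {rmorphism A -> S}) :
  (forall x : C, f x%:MP = g x%:MP) -> (forall i, f 'X_i = g 'X_i) -> f =1 g.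
Proof.
move=> h1 h2 P; elim/mpoly_gen: P => // P Q e1 e2.
  by rewrite (rmorphD f) (rmorphD g) e1 e2.
by rewrite (rmorphM f) (rmorphM g) e1 e2.
Qed.

(** P read as a polynomial in [X_c]. The type does not say that its coefficients are free of [X_c];
    [map_subst_zeta] expresses it. *)
Definition zeta c : A -> {poly A} := mmap (polyC \o @mpolyC r C) (fun i => if i == c then 'X else ('X_i)%:P).
HB.instance Definition _ c := GRing.RMorphism.on (zeta c).
Definition subst c P0 : A -> A := mmap (@mpolyC r C) (fun i => if i == c then P0 else 'X_i).
HB.instance Definition _ c P0 := GRing.RMorphism.on (subst c P0).

Lemma zetaC c (x : C) : zeta c x%:MP = (x%:MP)%:P. Proof. by rewrite /zeta mmapC. Qed.
Lemma zetaX c i : zeta c 'X_i = if i == c then 'X else ('X_i)%:P. Proof. by rewrite /zeta mmapX mmap1U. Qed.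
Lemma substC c P0 (x : C) : subst c P0 x%:MP = x%:MP. Proof. by rewrite /subst mmapC. Qed.
Lemma substX c P0 i : subst c P0 'X_i = if i == c then P0 else 'X_i. Proof. by rewrite /subst mmapX mmap1U. Qed.

Lemma substD c P0 : {morph subst c P0 : P Q / P + Q}. Proof. exact: rmorphD. Qed.
Lemma substM c P0 : {morph subst c P0 : P Q / P * Q}. Proof. exact: rmorphM. Qed.

Lemma zetaK c P : (zeta c P).['X_c] = P.
Proof.
apply: (@morph_ext _ (horner_eval ('X_c : A) \o zeta c) idfun) => [x|i] /=; rewrite /horner_eval.
  by rewrite zetaC hornerC.
by rewrite zetaX; case: eqP => [->|_]; rewrite ?hornerX ?hornerC.
Qed.

Lemma map_subst_zeta c P0 P : map_poly (subst c P0) (zeta c P) = zeta c P.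
Proof.
apply: (@morph_ext _ (map_poly (subst c P0) \o zeta c) (zeta c)) => [x|i] /=.
  by rewrite zetaC map_polyC /= substC.
by rewrite zetaX; case: eqP => [_|/eqP/negPf ic]; rewrite ?map_polyX ?map_polyC //= substX ic.
Qed.

Lemma zeta_inj c P : zeta c P = 0 -> P = 0.
Proof. by move=> e; rewrite -(zetaK c P) e horner0. Qed.

Definition upd u a (x : C) : 'I_r -> C := fun i => if i == a then x else u i.

Lemma upd_same u a : upd u a (u a) =1 u. Proof. by move=> i; rewrite /upd; case: eqP => // ->. Qed.
Lemma upd_at u a x : upd u a x a = x. Proof. by rewrite /upd eqxx. Qed.
Lemma upd_upd u a x y : upd (upd u a x) a y =1 upd u a y.
Proof. by move=> i; rewrite /upd; case: eqP. Qed.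

Lemma meval_subst c P0 P u : (subst c P0 P).@[u] = P.@[upd u c P0.@[u]].
Proof.
apply: (@morph_ext _ (meval u \o subst c P0) (meval (upd u c P0.@[u]))) => [x|i] /=.
  by rewrite substC !mevalC.
by rewrite substX mevalXU /upd; case: eqP; rewrite // mevalXU.
Qed.

(** The restriction of P to the line through u in the direction of coordinate a. *)
Definition lin a u P : {poly C} := map_poly (meval u) (zeta a P).
HB.instance Definition _ a u := GRing.RMorphism.copy (lin a u) (map_poly (meval u) \o zeta a).

Lemma lin0 a u : lin a u 0 = 0. Proof. exact: rmorph0. Qed.

Lemma linC a u (x : C) : lin a u x%:MP = x%:P.
Proof. by rewrite /lin zetaC map_polyC /= mevalC. Qed.
Lemma linX a u i : lin a u 'X_i = if i == a then 'X else (u i)%:P.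
Proof. by rewrite /lin zetaX; case: eqP; rewrite ?map_polyX // map_polyC /= mevalXU. Qed.

Lemma linE a u P x : (lin a u P).[x] = P.@[upd u a x].
Proof.
apply: (@morph_ext _ (horner_eval x \o lin a u) (meval (upd u a x))) => [y|i] /=; rewrite /horner_eval.
  by rewrite linC hornerC mevalC.
by rewrite linX mevalXU /upd; case: eqP; rewrite ?hornerX ?hornerC.
Qed.

Lemma linEu a u P : (lin a u P).[u a] = P.@[u].
Proof. by rewrite linE; apply: meval_eq; exact: upd_same. Qed.

Lemma size_lin a u P : (size (lin a u P) <= size (zeta a P))%N.
Proof. exact: size_poly. Qed.

Lemma mderivXU a i : ('X_i : A)^`M(a) = (a == i)%:R.
Proof.
rewrite mderivX mnm1E eq_sym; case: eqP => [->|_]; last by rewrite scale0r.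
by rewrite scale1r (_ : (U_(i) - U_(i))%MM = 0%MM) ?mpolyX0 //; apply/mnmP => j; rewrite mnmBE subnn mnm0E.
Qed.

Lemma deriv_ext (S : nzRingType) (g : {rmorphism A -> S}) (D : S -> S) a :
  (forall x y, D (x + y) = D x + D y) -> (forall x y, D (x * y) = D x * y + x * D y) ->
  (forall x : C, D (g x%:MP) = 0) -> (forall i, D (g 'X_i) = (i == a)%:R) -> forall P, D (g P) = g P^`M(a).
Proof.
move=> hD hM h1 h2 P; elim/mpoly_gen: P => [x|i|P Q e1 e2|P Q e1 e2].
- by rewrite h1 mderivC (rmorph0 g).
- by rewrite h2 mderivXU eq_sym (rmorph_nat g).
- by rewrite (rmorphD g) hD e1 e2 -(rmorphD g) mderivD.
by rewrite (rmorphM g) hM e1 e2 -!(rmorphM g) -(rmorphD g) mderivM.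
Qed.

Lemma deriv_lin a u P : (lin a u P)^`() = lin a u P^`M(a).
Proof.
apply: (@deriv_ext _ (lin a u) (@deriv C)) => [x y|x y|x|i].
- exact: derivD.
- exact: derivM.
- by transitivity ((x%:P)^`() : {poly C}); [congr deriv; exact: linC | exact: derivC].
have := linX a u i; case: eqP => _ e.
  by transitivity (('X)^`() : {poly C}); [congr deriv; exact: e | exact: derivX].
by transitivity (((u i)%:P)^`() : {poly C}); [congr deriv; exact: e | exact: derivC].
Qed.

Lemma exists_const (f : {poly A}) : f != 0 -> exists x : C, f.[x%:MP] != 0.
Proof.
move=> f0; apply: contrapT => no.
have rt (x : C) : root f x%:MP by rewrite rootE; apply/negPn/negP => h; apply: no; exists x.
pose s : seq A := [seq (j%:R : C)%:MP | j <- iota 0 (size f)].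
have us : uniq s.
  rewrite map_inj_uniq ?iota_uniq // => j k /(congr1 (meval (fun=> 0))).
  by rewrite !mevalC => /eqP; rewrite eqr_nat => /eqP.
have al : all (root f) s by apply/allP => y /mapP[j _ ->].
by have := max_poly_roots f0 al us; rewrite size_map size_iota ltnn.
Qed.

Lemma zeta_const c P (x : C) : (zeta c P).[x%:MP] = subst c x%:MP P.
Proof.
apply: (@morph_ext _ (horner_eval (x%:MP : A) \o zeta c) (subst c x%:MP)) => [y|i] /=; rewrite /horner_eval.
  by rewrite zetaC hornerC substC.
by rewrite zetaX substX; case: eqP; rewrite ?hornerX ?hornerC.
Qed.

Definition substs v (s : seq 'I_r) P : A := foldr (fun c Q => subst c (v c)%:MP Q) P s.

Lemma substsE v s P : (forall i, i \in s) -> substs v s P = (P.@[v])%:MP.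
Proof.
move=> hs; have sC (x : C) : substs v s x%:MP = x%:MP by elim: (s) => //= c s' ->; rewrite substC.
have sD (P' Q : A) : substs v s (P' + Q) = substs v s P' + substs v s Q by elim: (s) => //= c s' ->; rewrite substD.
have sM (P' Q : A) : substs v s (P' * Q) = substs v s P' * substs v s Q by elim: (s) => //= c s' ->; rewrite substM.
elim/mpoly_gen: P => [x|i|P Q h1 h2|P Q h1 h2].
- by rewrite sC mevalC.
- rewrite mevalXU; have nX (s' : seq 'I_r) : i \notin s' -> substs v s' 'X_i = 'X_i.
    elim: s' => //= c s' IH; rewrite inE negb_or => /andP[ic is']; rewrite IH // substX (negPf ic) //.
  have {hs} := hs i; elim: s {sC sD sM} => //= c s' IH; rewrite inE.
  have [is'|nis] := boolP (i \in s'); first by rewrite IH // substC.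
  by rewrite orbF => /eqP e; rewrite nX // substX e eqxx.
- by rewrite sD h1 h2 mevalD rmorphD.
by rewrite sM h1 h2 mevalM rmorphM.
Qed.

(** Coordinates are specialised one at a time, each to a constant at which the current polynomial in
    that variable does not vanish. *)
Lemma nonzero_pt P : P != 0 -> exists u, P.@[u] != 0.
Proof.
move=> P0; have H (s : seq 'I_r) : uniq s -> exists v, substs v s P != 0.
  elim: s => [|c s IH] /=; first by exists (fun=> 0).
  move=> /andP[cs us]; have [v hv] := IH us.
  have [x hx] := exists_const (contra_neq (@zeta_inj c _) hv).
  exists (upd v c x); rewrite upd_at -zeta_const.
  suff -> : substs (upd v c x) s P = substs v s P by [].
  elim: (s) cs => [//|i s' IH']; rewrite inE negb_or => /andP[ic cs]; rewrite [LHS]/= [RHS]/= (IH' cs).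
  by rewrite /upd eq_sym (negPf ic).
have [v hv] := H _ (enum_uniq 'I_r); rewrite substsE in hv; last by move=> i; rewrite mem_enum.
by exists v; apply: contra hv => /eqP ->; rewrite mpolyC0.
Qed.

Lemma meval_inj P Q : (forall u, P.@[u] = Q.@[u]) -> P = Q.
Proof.
move=> h; apply/eqP; rewrite -subr_eq0; apply/negPn/negP => /nonzero_pt[u].
by rewrite mevalB h subrr eqxx.
Qed.

Lemma deriv0_size (f : {poly C}) : f^`() = 0 -> (size f <= 1)%N.
Proof.
move=> e; apply/leq_sizeP => j hj.
have := coef_deriv f j.-1; rewrite e coef0 prednK // => /esym/eqP.
by rewrite -mulr_natr mulf_eq0 pnatr_eq0 orbC eqn0Ngt hj => /eqP.
Qed.

Definition indep c P := forall u x, P.@[upd u c x] = P.@[u].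

Lemma indep_subst c P (x : C) : indep c P -> subst c x%:MP P = P.
Proof. by move=> h; apply: meval_inj => u; rewrite meval_subst h. Qed.

Lemma indep_substC c P (x : C) : indep c (subst c x%:MP P).
Proof.
by move=> u y; rewrite !meval_subst !mevalC; apply: meval_eq; exact: upd_upd.
Qed.

Lemma indep_mderiv c P : P^`M(c) = 0 -> indep c P.
Proof.
move=> e u x; rewrite -linE -(linEu c u).
have : (size (lin c u P) <= 1)%N by apply: deriv0_size; rewrite deriv_lin e lin0.
by move=> /size1_polyC ->; rewrite !hornerC.
Qed.

Lemma msize_mderiv a P : P^`M(a) != 0 -> (msize P^`M(a) < msize P)%N.
Proof.
move=> h; rewrite (msizeE (P^`M(a))).
have H m : m \in msupp P^`M(a) -> ((mdeg m).+1 < msize P)%N.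
  rewrite mcoeff_msupp mcoeff_mderiv => hm.
  have : (m + U_(a))%MM \in msupp P.
    by rewrite mcoeff_msupp; apply: contra hm => /eqP ->; rewrite mul0rn.
  by move/msize_mdeg_lt; rewrite mdegD mdeg1 addn1.
have P0 : (0 < msize P)%N.
  by rewrite lt0n msize_poly_eq0; apply: contra h => /eqP ->; rewrite mderiv0.
rewrite big_seq; elim/big_ind: _ => [|x y hx hy|m ms]; [exact: P0 | by rewrite gtn_max hx | exact: H].
Qed.

Section Numerators.
Variables (p q : 'I_r -> {poly C}).

(** The coordinatewise map and its derivatives in the affine chart, meaningful at the points
    satisfying [fin], where no coordinate goes to infinity. *)
Definition Fm u : 'I_r -> C := fun i => (p i).[u i] / (q i).[u i].
Definition DFm u : 'I_r -> C := fun i => ((p i)^`().[u i] * (q i).[u i] - (p i).[u i] * (q i)^`().[u i]) / (q i).[u i] ^+ 2.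
Definition uni (f : {poly C}) i : A := (map_poly (@mpolyC r C) f).['X_i].
Definition den : A := \prod_i uni (q i) i.
Definition fin u := forall i, (q i).[u i] != 0.

Lemma uni_rec f (x : C) i : uni (f * 'X + x%:P) i = uni f i * 'X_i + x%:MP.
Proof. by rewrite /uni rmorphD rmorphM /= map_polyX map_polyC /= hornerMXaddC. Qed.

Lemma uni0 i : uni 0 i = 0. Proof. by rewrite /uni rmorph0 horner0. Qed.

Lemma uniE f i u : (uni f i).@[u] = f.[u i].
Proof.
elim/poly_ind: f => [|f x IH]; first by rewrite uni0 horner0 meval0.
by rewrite uni_rec hornerMXaddC mevalD mevalM IH mevalXU mevalC.
Qed.

Lemma uni_mderiv f a i u : ((uni f i)^`M(a)).@[u] = (a == i)%:R * f^`().[u i].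
Proof.
elim/poly_ind: f => [|f x IH]; first by rewrite uni0 mderiv0 deriv0 horner0 meval0 mulr0.
rewrite uni_rec derivMXaddC mderivD mderivC addr0 mderivM mderivXU hornerD hornerM hornerX.
by rewrite mevalD !mevalM IH mevalXU uniE rmorph_nat; ring.
Qed.

Lemma denE u : den.@[u] = \prod_i (q i).[u i].
Proof. by rewrite /den rmorph_prod; apply: eq_bigr => i _; rewrite /= uniE. Qed.

Lemma den_fin u : (den.@[u] != 0) <-> fin u.
Proof.
rewrite denE; split=> [/prodf_neq0 h i|h]; first exact: h.
by apply/prodf_neq0 => i _; exact: h.
Qed.

Lemma mderiv_exp a P e : (P ^+ e)^`M(a) = e%:R * P ^+ e.-1 * P^`M(a).
Proof.
elim: e => [|e IH]; first by rewrite expr0 mul0r mul0r (_ : (1 : A) = 1%:MP) ?mderivC // mpolyC1.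
rewrite exprS mderivM IH /=; case: e {IH} => [|e]; first by rewrite /= expr0; ring.
by rewrite /= -(natr1 e.+1) exprS; ring.
Qed.

(* Clearing denominators in P(F(u)), together with the chain rule. *)
Lemma num P : exists K e, forall u, fin u -> K.@[u] = den.@[u] ^+ e * P.@[Fm u] /\ forall a,
  (K^`M(a)).@[u] = den.@[u] ^+ e * (P^`M(a)).@[Fm u] * DFm u a + e%:R * den.@[u] ^+ e.-1 * (den^`M(a)).@[u] * P.@[Fm u].
Proof.
elim/mpoly_gen: P => [x|i|P Q [K [e h]] [L [f k]]|P Q [K [e h]] [L [f k]]].
- by exists x%:MP, 0%N => u _; rewrite expr0 mul1r !mevalC; split=> // a; rewrite !mderivC !meval0; ring.
- have [K eK] : exists K, K * uni (q i) i = den * uni (p i) i.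
    have e : den = uni (q i) i * \prod_(j | j != i) uni (q j) j by rewrite /den (bigD1 i).
    by exists (\prod_(j | j != i) uni (q j) j * uni (p i) i); rewrite e; move: (\prod_(j | _) _) (uni _ _) (uni _ _) => x y z; ring.
  exists K, 1%N => u fu; have qi := fu i; have e0 := congr1 (meval u) eK.
  rewrite !mevalM !uniE in e0; have K0 : K.@[u] = den.@[u] * Fm u i.
    by apply: (mulIf qi); rewrite e0 /Fm -mulrA divfK.
  rewrite expr1 mevalXU; split=> // a; have := congr1 (fun w => (w^`M(a)).@[u]) eK.
  rewrite /= !mderivM !mevalD !mevalM !uni_mderiv !uniE mderivXU rmorph_nat K0 /DFm expr0.
  case: (eqVneq a i) => [->|_]; rewrite /= ?mul1r ?mul0r ?mulr0 ?mulr1 ?addr0 ?add0r /Fm => e1; apply: (mulIf qi).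
    rewrite -[LHS](addrK (den.@[u] * ((p i).[u i] / (q i).[u i]) * (q i)^`().[u i])) e1; field.
    by rewrite qi.
  by rewrite e1 mul0r add0r -mulrA divfK.
- exists (K * den ^+ f + L * den ^+ e), (e + f)%N => u fu; have [h1 h2] := h u fu; have [k1 k2] := k u fu.
  split=> [|a]; first by rewrite !mevalD !mevalM !rmorphXn /= h1 k1 exprD; ring.
  rewrite !mderivD !mderivM !mderiv_exp !mevalD !mevalM !rmorphXn !rmorph_nat /= h1 k1 h2 k2.
  move: (den.@[u]) => D; case: e {h h1 h2} => [|e]; case: f {k k1 k2} => [|f]; rewrite /= ?addn0 ?add0n ?addSn ?addnS /= ?exprS ?exprD ?exprS ?expr0 -?natr1 ?natrD -?natr1; ring.
exists (K * L), (e + f)%N => u fu; have [h1 h2] := h u fu; have [k1 k2] := k u fu.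
split=> [|a]; first by rewrite !mevalM h1 k1 exprD; ring.
rewrite !mderivM !mevalD !mevalM h1 k1 h2 k2.
move: (den.@[u]) => D; case: e {h h1 h2} => [|e]; case: f {k k1 k2} => [|f]; rewrite /= ?addn0 ?add0n ?addSn ?addnS /= ?exprS ?exprD ?exprS ?expr0 -?natr1 ?natrD -?natr1; ring.
Qed.

Lemma uni_neq0 f i : f != 0 -> uni f i != 0.
Proof.
move=> f0; apply: contra f0 => /eqP e.
have h x : f.[x] = 0 by have := uniE f i (fun=> x); rewrite e meval0.
apply/negPn/negP => f0; pose s : seq C := [seq j%:R | j <- iota 0 (size f)].
have us : uniq s by rewrite map_inj_uniq ?iota_uniq // => j k /eqP; rewrite eqr_nat => /eqP.
have al : all (root f) s by apply/allP => y _; rewrite rootE h.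
by have := max_poly_roots f0 al us; rewrite size_map size_iota ltnn.
Qed.

End Numerators.
End Mpoly.

(** * Specialisation along orbits *)

Lemma mevalM_neq0 (F : numClosedFieldType) n (P Q : {mpoly F[n]}) u :
  ((P * Q).@[u] != 0) = (P.@[u] != 0) && (Q.@[u] != 0).
Proof. by rewrite mevalM mulf_eq0 negb_or. Qed.

Lemma mevalM_neq0P (F : numClosedFieldType) n (P Q : {mpoly F[n]}) u :
  (P * Q).@[u] != 0 <-> P.@[u] != 0 /\ Q.@[u] != 0.
Proof. by rewrite mevalM_neq0; split=> [/andP|h]; last exact/andP. Qed.

Lemma meval_prod_neq0 (F : numClosedFieldType) n (I : finType) (f : I -> {mpoly F[n]}) u :
  (\prod_i f i).@[u] != 0 -> forall i, (f i).@[u] != 0.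
Proof. by rewrite rmorph_prod => /prodf_neq0 h i; exact: h. Qed.

Section Specialise.
Variable R : realType.
Local Notation C := R[i].
Local Notation P1 := (P1 R).

Lemma cof_nat (J : nat) (Pr : nat -> C -> Prop) :
  (forall j, (j <= J)%N -> cof (Pr j)) -> cof (fun x => forall j, (j <= J)%N -> Pr j x).
Proof.
elim: J => [|J IH] h; first by apply: cof_imp (h 0%N (leqnn _)) => x hx j; rewrite leqn0 => /eqP ->.
apply: cof_imp (cof_and (h _ (leqnn _)) (IH (fun j hj => h j (leqW hj)))) => x [h1 h2] j.
by rewrite leq_eqVlt => /orP[/eqP ->|/h2].
Qed.

(* The quotient a_0 / b_0 is constant on the fibres of the J-th iterate, which are larger than its degree. *)
Lemma fiber_const (P Q : {poly C}) (a b : nat -> {poly C}) (k : nat -> C) M J :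
  coprimep P Q -> (1 < rdeg P Q)%N -> (forall j, (j <= J)%N -> a j != 0 /\ b j != 0) ->
  (size (a 0%N) <= M)%N -> (size (b 0%N) <= M)%N -> (M < 2 ^ J)%N -> (forall j, k j != 0) ->
  (forall j, (j < J)%N -> cof (fun x => Q.[x] != 0 ->
     (a j.+1).[fv P Q x] * (b j).[x] = k j * (a j).[x] * (b j.+1).[fv P Q x])) ->
  exists2 c, c != 0 & a 0%N = c *: b 0%N.
Proof.
move=> c d1 ab sa sb MJ k0 H; have d0 := ltnW d1.
have [avoid hav] : cof (fun x => Q.[x] != 0 /\ forall j, (j <= J)%N -> (b j).[x] != 0 /\ ((j < J)%N -> Q.[x] != 0 ->
     (a j.+1).[fv P Q x] * (b j).[x] = k j * (a j).[x] * (b j.+1).[fv P Q x])).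
  apply: cof_and (cof_root (q_neq0 c d0)) _; apply: cof_nat => j hj.
  apply: cof_and; first by apply: cof_root; have [] := ab j hj.
  have [lt|ge] := ltnP j J; last by exists [::].
  by apply: cof_imp (H j lt) => x h _.
have [bad hbad] := many_preimages J avoid c d1.
have [t [tbad tav]] := @cof_ex R (fun t => t \notin bad /\ t \notin avoid) ltac:(by apply: cof_and; [exists bad | exists avoid]).
have [s [us ss hs]] := hbad t tbad.
pose K j := \prod_(i < j) k i.
have K0 j : K j != 0 by apply/prodf_neq0 => i _; exact: k0.
pose cc := (a J).[t] / (b J).[t] / K J.
have key x : x \in s -> (a 0%N).[x] = cc * (b 0%N).[x].
  move=> xs; have [e1 e2] := hs x xs.
  have e3 j : (j <= J)%N -> exists2 u, u \notin avoid & iter j (ratP1 P Q) (Some x) = Some u.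
    by rewrite leq_eqVlt => /orP[/eqP ->|/e2 //]; exists t.
  have xav : x \notin avoid by have [u ua] := e3 0%N (leq0n _); move=> [->].
  have It j : (j <= J)%N -> forall u, iter j (ratP1 P Q) (Some x) = Some u ->
      (a j).[u] * (b 0%N).[x] = K j * (a 0%N).[x] * (b j).[u].
    elim: j => [|j IH] hj u' eu'.
      by move: eu' => [<-]; rewrite /K big_ord0 mul1r.
    have [u ua eu] := e3 j (ltnW hj).
    have [Qu hu] := hav u ua; have [bu /(_ hj Qu) h] := hu j (ltnW hj).
    move: eu'; rewrite iterS eu ratP1_fv // => -[<-].
    apply: (mulIf bu); transitivity ((a j.+1).[fv P Q u] * (b j).[u] * (b 0%N).[x]); first by ring.
    rewrite h; transitivity (k j * (b j.+1).[fv P Q u] * ((a j).[u] * (b 0%N).[x])); first by ring.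
    by rewrite (IH (ltnW hj) u eu) /K big_ord_recr /=; ring.
  have [_ hJ] := hav t tav; have [bt _] := hJ J (leqnn _).
  have e4 := It J (leqnn _) t e1.
  apply: (mulfI (K0 J)); apply: (mulIf bt); rewrite -e4 /cc.
  by field; rewrite bt K0.
have cE : a 0%N = cc *: b 0%N.
  apply/eqP; rewrite -subr_eq0; apply/negPn/negP => n0.
  have al : all (root (a 0%N - cc *: b 0%N)) s.
    by apply/allP => x /key e; rewrite rootE hornerD hornerN hornerZ e subrr.
  have := max_poly_roots n0 al us; rewrite ltnNge => /negP; apply.
  apply: leq_trans (leq_trans (ltnW MJ) ss).
  apply: leq_trans (size_polyD _ _) _; rewrite size_polyN geq_max sa /=.
  by apply: leq_trans (size_scale_leq _ _) _.
exists cc => //; have [a0 _] := ab 0%N (leq0n _).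
by apply: contraNneq a0 => z; rewrite cE z scale0r.
Qed.

(** The function f^* w / w, here U / V, is unchanged by the iterate, since f commutes with it and w
    is multiplied by a constant. By [fiber_const] it is constant. *)
Lemma inv_form_iter p q pk qk (A B : {poly C}) D k n : coprimep p q -> (1 < rdeg p q)%N ->
  coprimep pk qk -> (1 < rdeg pk qk)%N -> (forall x, ratP1 pk qk x = iter n (ratP1 p q) x) ->
  A != 0 -> B != 0 -> k != 0 -> inv_form pk qk A B D k -> exists2 k', k' != 0 & inv_form p q A B D k'.
Proof.
move=> c d1 ck dk it A0 B0 k0 I; have d0 := ltnW d1; have dk0 := ltnW dk.
pose N := maxn (size A) (size B).
have sA : (size A <= N.+1)%N by exact: leq_trans (leq_maxl _ _) (leqnSn _).
have sB : (size B <= N.+1)%N by exact: leq_trans (leq_maxr _ _) (leqnSn _).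
pose U := hpol N A p q * B * wron p q ^+ D; pose V := A * hpol N B p q * q ^+ (2 * D).
have q0 := q_neq0 c d0; have qk0 := q_neq0 ck dk0; have w0 := wron_neq0 c d0.
have UE x : q.[x] != 0 -> U.[x] = q.[x] ^+ N * q.[x] ^+ (2 * D) * (A.[fv p q x] * B.[x] * dr p q x ^+ D).
  move=> qx; rewrite /U !hornerM horner_exp hpol_eval //.
  have -> : (wron p q).[x] = dr p q x * q.[x] ^+ 2 by rewrite /dr divfK // expf_neq0.
  by rewrite (exprMn D (dr p q x)) -exprM; ring.
have VE x : q.[x] != 0 -> V.[x] = q.[x] ^+ N * q.[x] ^+ (2 * D) * (A.[x] * B.[fv p q x]).
  by move=> qx; rewrite /V !hornerM horner_exp hpol_eval //; ring.
have hp0 (w : {poly C}) : w != 0 -> (size w <= N.+1)%N -> hpol N w p q != 0.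
  move=> w00 sw; have [x [qx /(_ qx) wx]] := cof_ex (cof_and (cof_root q0) (cof_pre c d0 (cof_root w00))).
  by apply/eqP => e; have := hpol_eval p sw qx; rewrite e horner0 => /esym/eqP; apply/negP; rewrite mulf_neq0 ?expf_neq0.
have U0 : U != 0 by rewrite !mulf_neq0 ?expf_neq0 ?hp0.
have V0 : V != 0 by rewrite !mulf_neq0 ?expf_neq0 ?hp0.
pose M := maxn (size U) (size V).
have comm x : ratP1 pk qk (ratP1 p q x) = ratP1 p q (ratP1 pk qk x) by rewrite !it -iterSr.
have [| c' c'0 eU] := @fiber_const pk qk (fun=> U) (fun=> V) (fun=> 1) M M ck dk (fun _ _ => conj U0 V0)
  (leq_maxl _ _) (leq_maxr _ _) (ltn_expl M (ltnSn 1)) (fun=> oner_neq0 _).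
  move=> j _; have K1 := cof_and (cof_and I (cof_root q0)) (cof_pre c d0 (cof_and I (cof_root qk0))).
  have K2 := cof_and (cof_root (wron_neq0 ck dk0)) (cof_pre ck dk0 (cof_root q0)).
  apply: cof_imp (cof_and K1 K2) => x [[[Ix qx] /(_ qx) [If qkf]] [wx h]] qkx.
  have {h} qF := h qkx; have {}Ix := Ix qkx; have {}If := If qkf.
  have [ch1 ch2] := chain ck c ck comm qx qkf qkx qF.
  rewrite mul1r !UE // !VE // -ch1; rewrite ch1 in If.
  have drx : dr pk qk x ^+ D != 0 by rewrite expf_neq0 // mulf_neq0 // invr_neq0 // expf_neq0.
  have ch3 : dr pk qk (fv p q x) ^+ D * dr p q x ^+ D = dr p q (fv pk qk x) ^+ D * dr pk qk x ^+ D.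
    by rewrite -!exprMn ch2.
  apply: (mulIf drx); apply: (mulfI k0); move: Ix If ch3; rewrite -ch1.
  set f := fv p q x; set F := fv pk qk x; set G := fv pk qk f.
  move: (q.[F] ^+ N) (q.[F] ^+ (2 * D)) (q.[x] ^+ N) (q.[x] ^+ (2 * D)) => q1 q2 q3 q4.
  move: (dr pk qk f ^+ D) (dr p q x ^+ D) (dr p q F ^+ D) (dr pk qk x ^+ D) => d2 d3 d4 d5 Ix If ch3.
  transitivity (k * q1 * q2 * q3 * q4 * (A.[G] * B.[F] * A.[x] * B.[f]) * (d4 * d5)); first by ring.
  rewrite -ch3; transitivity (k * q1 * q2 * q3 * q4 * B.[F] * A.[x] * d3 * (A.[G] * B.[f] * d2)); first by ring.
  rewrite If; transitivity (k * q1 * q2 * q3 * q4 * A.[f] * B.[G] * d3 * (k * A.[x] * B.[F])); first by ring.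
  by rewrite -Ix; ring.
exists c' => //; apply: cof_imp (cof_root q0) => x qx _.
have := congr1 (fun w => w.[x]) eU; rewrite /= hornerZ UE // VE // => e.
apply: (mulfI (_ : q.[x] ^+ N * q.[x] ^+ (2 * D) != 0)); first by rewrite mulf_neq0 ?expf_neq0.
by rewrite e; ring.
Qed.

(** Put w_j = (aa_j / bb_j) dx^D; the hypothesis says f^* w_(j+1) = cc_j w_j. The quotients w_(j+1)
    / w_j are functions of degree bounded by M, each pulled back by f to a multiple of the preceding
    one, so [fiber_const] gives w_1 = c w_0. *)
Lemma spec_abs P Q (aa bb : nat -> {poly C}) (cc : nat -> C) M D : coprimep P Q -> (1 < rdeg P Q)%N ->
  (forall j, (j <= M.+2)%N -> aa j != 0) -> (forall j, (j <= M.+2)%N -> bb j != 0) ->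
  (forall j, (j <= M.+2)%N -> cc j != 0) -> (forall i j, (size (aa i) + size (bb j) <= M)%N) ->
  (forall j x, (j <= M.+2)%N -> Q.[x] != 0 ->
     (bb j).[x] * (aa j.+1).[fv P Q x] * dr P Q x ^+ D = (aa j).[x] * (bb j.+1).[fv P Q x] * cc j) ->
  exists2 k, k != 0 & inv_form P Q (aa 0%N) (bb 0%N) D k.
Proof.
move=> cPQ d1 aa0 bb0 cc0 sz I; have d0 := ltnW d1.
pose A' j := aa j.+1 * bb j; pose B' j := bb j.+1 * aa j.
(* The value 1 beyond the range only keeps all constants nonzero. *)
pose kk j := if (j < M.+2)%N then cc j.+1 / cc j else 1.
have kk0 j : kk j != 0.
  by rewrite /kk; case: ltnP => h; [apply: mulf_neq0; [exact: cc0 | rewrite invr_neq0 // cc0 // ltnW] | exact: oner_neq0].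
have le1 j : (j <= M)%N -> (j <= M.+2)%N /\ (j.+1 <= M.+2)%N by clear; lia.
have AB0 j : (j <= M)%N -> A' j != 0 /\ B' j != 0.
  by move=> /le1[h1 h2]; split; apply: mulf_neq0; [exact: aa0 | exact: bb0 | exact: bb0 | exact: aa0].
have szm (u v : {poly C}) : (size u + size v <= M)%N -> (size (u * v : {poly C})%R <= M)%N.
  by move=> h; apply: leq_trans (size_polyMleq _ _) (leq_trans (leq_pred _) h).
have MM := ltn_expl M (ltnSn 1).
have H j : (j < M)%N -> cof (fun x => Q.[x] != 0 ->
     (A' j.+1).[fv P Q x] * (B' j).[x] = kk j * (A' j).[x] * (B' j.+1).[fv P Q x]).
  move=> hj; apply: cof_imp (cof_root (wron_neq0 cPQ d0)) => x wx qx.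
  have [hj1 hj2] := le1 j (ltnW hj).
  have I1 := I j x hj1 qx; have I2 := I j.+1 x hj2 qx.
  have drx : dr P Q x ^+ D != 0 by rewrite expf_neq0 // mulf_neq0 // invr_neq0 // expf_neq0.
  have c0 := cc0 j hj1; rewrite /kk hj2.
  rewrite /A' /B' !hornerM; move: I1 I2 drx c0.
  move: (dr _ _ x ^+ D) (cc j) (cc j.+1) => e c1 c2.
  move: ((aa j.+2).[_]) ((bb j.+1).[fv _ _ _]) ((bb j.+1).[x]) ((aa j).[x]) => x1 x2 x3 x4.
  move: ((aa j.+1).[fv _ _ _]) ((bb j.+2).[_]) ((aa j.+1).[x]) ((bb j).[x]) => x5 x6 x7 x8 I1 I2 e0 c0.
  apply: (mulIf (_ : e * c1 != 0)); first exact: mulf_neq0.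
  transitivity ((x3 * x1 * e) * (x4 * x2 * c1)); first by ring.
  by rewrite I2 -I1; field.
have sB : (size (B' 0%N) <= M)%N by apply: szm; rewrite addnC.
have [c c0 ec] := @fiber_const P Q A' B' kk M M cPQ d1 AB0 (szm _ _ (sz 1%N 0%N)) sB MM kk0 H.
exists (cc 0%N / c); first by apply: mulf_neq0; [exact: cc0 | rewrite invr_neq0].
have b1 : bb 1%N != 0 by exact: bb0.
apply: cof_imp (cof_pre cPQ d0 (cof_root b1)) => x b1x qx.
have {}b1x := b1x qx; have I0 := I 0%N x (leq0n _) qx.
have := congr1 (fun w => w.[fv P Q x]) ec; rewrite /A' /B' hornerZ !hornerM => ec2.
apply: (mulIf b1x); apply: (mulfI c0); move: I0 ec2 c0.
move: ((aa 0%N).[fv _ _ _]) ((bb 0%N).[fv _ _ _]) ((aa 1%N).[fv _ _ _]) ((bb 1%N).[fv _ _ _]) => y1 y2 y3 y4.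
move: ((aa 0%N).[x]) ((bb 0%N).[x]) (dr _ _ x ^+ D) (cc 0%N) => y5 y6 y7 y8 I0 ec2 c0.
transitivity (y6 * y7 * (c * (y4 * y1))); first by ring.
rewrite -ec2; transitivity (y6 * y3 * y7 * y2); first by ring.
by rewrite I0; field.
Qed.

Section Orbits.
Variables (r : nat) (p q : 'I_r -> {poly C}).
Local Notation A := {mpoly C[r]}.
Local Notation F := (Fm p q).
Hypotheses (cpq : forall i, coprimep (p i) (q i)) (d1 : forall i, (1 < rdeg (p i) (q i))%N).
Let d0 i : (0 < rdeg (p i) (q i))%N. Proof. exact: ltnW. Qed.

Lemma DFmE u i : DFm p q u i = dr (p i) (q i) (u i).
Proof. by rewrite /DFm /dr /wron hornerD hornerN !hornerM. Qed.

Lemma den_neq0 : den q != 0.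
Proof. by apply/prodf_neq0 => i _; apply: uni_neq0; exact: q_neq0. Qed.

(** A target point is chosen off P = 0 with no coordinate equal to the image of infinity, so that
    all its preimages are finite. *)
Lemma pull_pt (P : A) : P != 0 -> exists u, fin q u /\ P.@[F u] != 0.
Proof.
move=> P0; pose v i := odflt 0 (ratP1 (p i) (q i) None).
have [w hw] : exists w, (P * \prod_i uni ('X - (v i)%:P) i).@[w] != 0.
  apply: nonzero_pt; apply: mulf_neq0 => //; apply/prodf_neq0 => i _; apply: uni_neq0; by rewrite polyXsubC_eq0.
have [Pw /meval_prod_neq0 {}hw] := (mevalM_neq0P _ _ _).1 hw.
have ex i : exists t, (q i).[t] != 0 /\ fv (p i) (q i) t = w i.
  have [[t|] e] := ratP1_surj (Some (w i)) (cpq i) (d0 i); last first.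
    by have := hw i; rewrite uniE hornerD hornerN hornerX hornerC /v e subrr eqxx.
  have qt : (q i).[t] != 0 by move: e => /=; case: ifP.
  by exists t; split=> //; move: e; rewrite ratP1_fv // => -[].
pose u i := projT1 (cid (ex i)); have hu i : (q i).[u i] != 0 /\ fv (p i) (q i) (u i) = w i by rewrite /u; case: (cid _).
exists u; split=> [i|]; first by have [] := hu i.
by rewrite (@meval_eq _ _ (F u) w) // => i; have [] := hu i.
Qed.

Lemma pull (P : A) : P != 0 -> exists2 P', P' != 0 & forall u, P'.@[u] != 0 -> fin q u /\ P.@[F u] != 0.
Proof.
move=> P0; have [K [e hK]] := num p q P; exists (K * den q).
  have [u [fu Pu]] := pull_pt P0; have [h _] := hK u fu.
  apply/eqP => z; have : (K * den q).@[u] != 0.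
    have dn : (den q).@[u] != 0 by exact/den_fin.
    apply: (mevalM_neq0P _ _ _).2; split; last exact: dn.
    by rewrite h; apply: mulf_neq0; [exact: expf_neq0 | exact: Pu].
  by rewrite z meval0 eqxx.
move=> u /(mevalM_neq0P _ _ _).1[Ku /den_fin fu]; split; first exact: fu.
by have [h _] := hK u fu; move: Ku; rewrite h mulf_eq0 negb_or => /andP[].
Qed.

Lemma orbit_pt (P : A) J : P != 0 -> exists u, forall j, (j <= J)%N -> P.@[iter j F u] != 0.
Proof.
move=> P0; suff [P' P'0 h] : exists2 P', P' != 0 & forall u, P'.@[u] != 0 -> forall j, (j <= J)%N -> P.@[iter j F u] != 0.
  by have [u hu] := nonzero_pt P'0; exists u; exact: h.
elim: J => [|J [P' P'0 IH]]; first by exists P; [exact: P0 | move=> u hu j; rewrite leqn0 => /eqP ->].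
have [P2 P20 h2] := pull P'0; exists (P * P2); first exact: mulf_neq0.
move=> u /(mevalM_neq0P _ _ _).1[Pu /h2[_ h]] [|j] hj; first exact: Pu.
by rewrite iterSr; apply: IH.
Qed.

(** The coordinates other than a follow the orbit of u0 while the coordinate a is free. At time j
    this gives the form (N0 / N1) dx^D on a line, and the derivative in direction b is just a
    constant. *)
Lemma specialise (N0 N1 : A) a b D : a != b -> N0 != 0 -> N1 != 0 ->
  (forall u, fin q u -> N1.@[u] * N0.@[F u] * DFm p q u a ^+ D = N0.@[u] * N1.@[F u] * DFm p q u b ^+ D) ->
  exists (A' B' : {poly C}) k, [/\ A' != 0, B' != 0, k != 0 & inv_form (p a) (q a) A' B' D k].
Proof.
move=> ab N00 N10 E; pose M := (size (zeta a N0) + size (zeta a N1))%N.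
(* Along the orbit the two polynomials must not vanish, the coordinates must stay finite, and the
   derivative in direction b must be nonzero. *)
pose Gd := N0 * N1 * uni (wron (p b) (q b)) b * den q.
have Gd0 : Gd != 0.
  apply: mulf_neq0; last exact: den_neq0.
  apply: mulf_neq0; [exact: mulf_neq0 | apply: uni_neq0; exact: wron_neq0].
have [u0 hu0] := orbit_pt M.+2 Gd0; pose u j := iter j F u0.
have good j : (j <= M.+2)%N -> [/\ N0.@[u j] != 0, N1.@[u j] != 0, fin q (u j) & DFm p q (u j) b != 0].
  move=> /hu0.
  case/(mevalM_neq0P _ _ _).1 => /(mevalM_neq0P _ _ _).1[/(mevalM_neq0P _ _ _).1[h1 h2]]; rewrite uniE => h3 /den_fin h4.
  split; [exact: h1 | exact: h2 | exact: h4 |].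
  by rewrite DFmE mulf_neq0 // invr_neq0 // expf_neq0.
pose aa j := lin a (u j) N0; pose bb j := lin a (u j) N1; pose cc j := DFm p q (u j) b ^+ D.
have aa0 j : (j <= M.+2)%N -> aa j != 0.
  move=> /good[h _ _ _]; apply: contraNneq h => e; rewrite -(linEu a (u j) N0) -/(aa j) e horner0 //.
have bb0 j : (j <= M.+2)%N -> bb j != 0.
  move=> /good[_ h _ _]; apply: contraNneq h => e; rewrite -(linEu a (u j) N1) -/(bb j) e horner0 //.
have I j x : (j <= M.+2)%N -> (q a).[x] != 0 ->
    (bb j).[x] * (aa j.+1).[fv (p a) (q a) x] * dr (p a) (q a) x ^+ D = (aa j).[x] * (bb j.+1).[fv (p a) (q a) x] * cc j.
  move=> hj qx; have [_ _ fu _] := good j hj.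
  have fx : fin q (upd (u j) a x) by move=> i; rewrite /upd; case: (eqVneq i a) => [->|_]; [exact: qx | exact: fu].
  have e N : N.@[F (upd (u j) a x)] = (lin a (u j.+1) N).[fv (p a) (q a) x].
    by rewrite linE; apply: meval_eq => i; rewrite /u /= /Fm /upd; case: eqP => // ->.
  have E1 := E _ fx; rewrite (e N0) (e N1) -(linE a (u j) N0 x) -(linE a (u j) N1 x) in E1.
  have ea : DFm p q (upd (u j) a x) a = dr (p a) (q a) x by rewrite DFmE upd_at.
  have eb : DFm p q (upd (u j) a x) b = DFm p q (u j) b by rewrite /DFm /upd eq_sym (negPf ab).
  by rewrite ea eb in E1; exact: E1.
pose A' j := aa j.+1 * bb j; pose B' j := bb j.+1 * aa j.
have cc0 j : (j <= M.+2)%N -> cc j != 0 by move=> /good[_ _ _ h]; exact: expf_neq0.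
have sz i j : (size (aa i) + size (bb j) <= M)%N by apply: leq_add; exact: size_lin.
have [k k0 J] := spec_abs (cpq a) (d1 a) aa0 bb0 cc0 sz I.
by exists (aa 0%N), (bb 0%N), k; split; [exact: aa0 | exact: bb0 | exact: k0 | exact: J].
Qed.

End Orbits.
End Specialise.

(** * Functions on an affine variety *)

Section Pts.
Variables (C : numClosedFieldType) (r : nat).
Definition pts : Type := 'I_r -> C.
HB.instance Definition _ := gen_eqMixin pts.
HB.instance Definition _ := gen_choiceMixin pts.
HB.instance Definition _ := isPointed.Build pts (fun=> 0).
End Pts.

Section Variety.
Variables (C : numClosedFieldType) (r : nat) (X : ('I_r -> C) -> Prop).
Local Notation A := {mpoly C[r]}.
Implicit Types P Q L : A.

Definition van P := forall u, X u -> P.@[u] = 0.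
Definition vprime := (exists u, X u) /\ forall P Q, van (P * Q) -> van P \/ van Q.

Lemma van0 : van 0. Proof. by move=> u _; rewrite meval0. Qed.
Lemma vanD P Q : van P -> van Q -> van (P + Q).
Proof. by move=> h k u Xu; rewrite mevalD h // k // addr0. Qed.
Lemma vanN P : van P -> van (- P).
Proof. by move=> h u Xu; rewrite mevalN h // oppr0. Qed.
Lemma vanMl P Q : van Q -> van (P * Q).
Proof. by move=> h u Xu; rewrite mevalM h // mulr0. Qed.
Hypothesis prX : vprime.

Lemma van_prod P Q : ~ van P -> ~ van Q -> ~ van (P * Q).
Proof. by move=> h k; case: prX => _ pr /pr[]. Qed.
Lemma van1 : ~ van 1.
Proof. by case: prX => -[u Xu] _ h; have := h u Xu; rewrite meval1 => /eqP; rewrite oner_eq0. Qed.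
Lemma van_exp P e : ~ van P -> ~ van (P ^+ e).
Proof. by move=> h; elim: e => [|e IH]; rewrite ?expr0 ?exprS; [exact: van1 | exact: van_prod]. Qed.
Lemma van_cancel P Q : ~ van P -> van (P * Q) -> van Q.
Proof. by case: prX => _ pr h /pr[]. Qed.
Lemma van_bigprod (I : finType) (f : I -> A) : (forall i, ~ van (f i)) -> ~ van (\prod_i f i).
Proof. by move=> h; elim/big_ind: _ => [||i _]; [exact: van1 | exact: van_prod | exact: h]. Qed.

(** Functions on X are represented by functions on all points, composed with a retraction onto X.
    This puts the coordinate ring inside a plain function ring, where a polynomial is zero exactly
    when it vanishes on X. *)
Definition ret (u : pts C r) : pts C r := if asbool (X u) then u else projT1 (cid prX.1).
Lemma retX u : X (ret u).
Proof. by rewrite /ret; case: asboolP => // _; case: (cid _). Qed.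
Lemma ret_id u : X u -> ret u = u.
Proof. by rewrite /ret; case: asboolP. Qed.

Definition res P : pts C r -> C := fun u => P.@[ret u].
Lemma res_zmod : zmod_morphism res.
Proof. by move=> P Q; apply: funext => u; rewrite /res mevalB. Qed.
Lemma res_monoid : monoid_morphism res.
Proof. by split=> [|P Q]; apply: funext => u; rewrite /res ?meval1 ?mevalM. Qed.
HB.instance Definition _ := GRing.isZmodMorphism.Build A (pts C r -> C) res res_zmod.
HB.instance Definition _ := GRing.isMonoidMorphism.Build A (pts C r -> C) res res_monoid.

Lemma res0 P : res P = 0 <-> van P.
Proof.
split=> [h u Xu|h]; last by apply: funext => u; exact: h (retX u).
by have := congr1 (@^~ u) h; rewrite /res /= ret_id.
Qed.

Section Algebraic.
Variables (B : comNzRingType) (sg : {rmorphism B -> A}).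
Let tau : {rmorphism B -> (pts C r -> C)} := res \o sg.
Let AA (f : pts C r -> C) := exists P, f = res P.

Definition va P := alg tau AA (res P).

Let AD f g : AA f -> AA g -> AA (f + g).
Proof. by move=> [P ->] [Q ->]; exists (P + Q); rewrite rmorphD. Qed.
Let AM f g : AA f -> AA g -> AA (f * g).
Proof. by move=> [P ->] [Q ->]; exists (P * Q); rewrite rmorphM. Qed.
Let At b : AA (tau b). Proof. by exists (sg b). Qed.
Let Ad f g : AA f -> AA g -> f * g = 0 -> f = 0 \/ g = 0.
Proof.
move=> [P ->] [Q ->]; rewrite -rmorphM => /res0 h; case: prX => _ /(_ _ _ h)[k|k]; [left|right]; exact/res0.
Qed.

Lemma va_base b : va (sg b). Proof. by apply: alg_base => //; exact: At. Qed.
Lemma vaD P Q : va P -> va Q -> va (P + Q). Proof. by rewrite /va rmorphD; exact: algD. Qed.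
Lemma vaM P Q : va P -> va Q -> va (P * Q). Proof. by rewrite /va rmorphM; exact: algM. Qed.

Lemma va_div P : va P -> ~ van P -> exists Q e, [/\ va Q, ~ van (sg e) & van (P * Q - sg e)].
Proof.
move=> aP nP; have [|g [e [ag e0]]] := alg_div AD AM At Ad aP; first by move/res0.
case: (ag) => [[Q gE]] _ eq; exists Q, e; split; first by rewrite /va -gE.
  by move/res0.
by apply/res0; rewrite rmorphB rmorphM; move: eq; rewrite gE => ->; rewrite subrr.
Qed.

Lemma va_root (f : {poly A}) z : (forall i, va f`_i) -> ~ van (lead_coef f) -> van f.[z] -> va z.
Proof.
move=> af lf fz.
have lE : res (lead_coef f) <> 0 by move/res0.
have lE2 : lead_coef (map_poly res f) = res (lead_coef f) by rewrite lead_coef_map_eq //; exact/eqP.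
apply: (alg_root AD AM At Ad (p := map_poly res f)).
- by exists z.
- by move=> i; rewrite coef_map; exact: af.
- by rewrite lE2.
by rewrite rootE horner_map; apply/eqP/res0.
Qed.

Lemma va_rel P : va P -> exists s : {poly B}, ~ van (sg (lead_coef s)) /\ van (map_poly sg s).[P].
Proof.
move=> /(alg_rel At Ad)[s [h k]]; exists s; split; first by move/res0.
apply/res0; move: k; rewrite rootE => /eqP <-.
by rewrite -horner_map -map_poly_comp.
Qed.

Lemma va_gen : (forall x : C, exists b, sg b = x%:MP) -> (forall i, va 'X_i) -> forall P, va P.
Proof.
move=> hc hx P; elim/mpoly_gen: P => // [x|P Q|P Q]; [|exact: vaD|exact: vaM].
by have [b <-] := hc x; exact: va_base.
Qed.

End Algebraic.
End Variety.

(** * Equations of a circuit *)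

Lemma min_size (B : Type) (m : B -> nat) (Pr : B -> Prop) :
  (exists x, Pr x) -> exists2 x, Pr x & forall y, Pr y -> (m x <= m y)%N.
Proof.
move=> [x0 h0]; have ex : exists n, `[< exists2 x, Pr x & m x = n >].
  by exists (m x0); apply/asboolP; exists x0.
case: (ex_minnP ex) => n /asboolP[x hx mx] mn; exists x => // y hy.
by rewrite mx; apply: mn; apply/asboolP; exists y.
Qed.

Section Circuit.
Variables (C : numClosedFieldType) (r : nat) (p q : 'I_r -> {poly C}).
Local Notation A := {mpoly C[r]}.
Local Notation F := (Fm p q).
Variables (X : ('I_r -> C) -> Prop) (a b c : 'I_r) (gam : C).
Local Notation van := (van X).
(** [rho] retracts onto the polynomials free of [X_c], which serve as the base ring for
    algebraicity; [gam] is a value at which q_c does not vanish. *)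
Local Notation rho := (subst c gam%:MP).
Hypotheses (q0 : forall i, q i != 0) (qgam : (q c).[gam] != 0).
Hypotheses (ab : a != b) (ca : c != a) (cb : c != b) (prX : vprime X).
Hypotheses (invX : forall u, X u -> fin q u -> X (F u))
  (domX : forall P, (forall u, X u -> fin q u -> P.@[F u] = 0) -> van P)
  (depX : exists2 P, P != 0 & van P)
  (cirX : forall i P, i \in [:: a; b; c] -> P != 0 -> indep i P -> ~ van P).

Let rho_indep P : rho P = P -> indep c P.
Proof. by move=> <-; exact: indep_substC. Qed.

Let nvan_rho P : rho P = P -> P != 0 -> ~ van P.
Proof. by move=> e P0; apply: (cirX (i := c)) => //; [rewrite !inE eqxx !orbT | exact: rho_indep]. Qed.

Let rho_rho P : rho (rho P) = rho P.
Proof. by apply: indep_subst; exact: indep_substC. Qed.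

Let nvan_uni f i : f != 0 -> ~ van (uni f i).
Proof.
move=> f0; have [j jin ji] : exists2 j, j \in [:: a; b; c] & j != i.
  have [e|h] := eqVneq a i; last by exists a; rewrite ?inE ?eqxx.
  by exists b; rewrite ?inE ?eqxx ?orbT // -e eq_sym.
by apply: (cirX jin); [exact: uni_neq0 | move=> u x; rewrite !uniE /upd eq_sym (negPf ji)].
Qed.

Let nvan_den : ~ van (den q).
Proof. by apply: (van_bigprod prX) => i; apply: nvan_uni; exact: q0. Qed.

Let van_fin P : (forall u, X u -> fin q u -> P.@[u] = 0) -> van P.
Proof.
move=> h; apply: (van_cancel prX nvan_den) => u Xu; rewrite mevalM.
have [e|/den_fin fu] := eqVneq (den q).@[u] 0; first by rewrite e mul0r.
by rewrite h // mulr0.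
Qed.

Definition elim_poly (f : {poly A}) := [/\ f != 0, map_poly rho f = f & van f.['X_c]].

(** The vanishing ideal is principal up to factors that do not vanish on X: pseudo-division by an
    element of least degree in [X_c] multiplies only by powers of its leading coefficient, which is
    free of [X_c]. Applying [rho] keeps the remainder among the competitors. *)
Lemma minimal_elim : exists G, van G /\ forall K, van K -> exists L Q, ~ van L /\ L * K = Q * G.
Proof.
have [|g [g0 gr gv] gmin] := @min_size _ (fun f : {poly A} => size f) elim_poly.
  have [P P0 vP] := depX; exists (zeta c P); split.
  - by apply: contra_neq P0; exact: zeta_inj.
  - exact: map_subst_zeta.
  by rewrite zetaK.
exists g.['X_c]; split=> // K vK.
have e := Pdiv.Idomain.divp_eq (zeta c K) g.
have := congr1 (map_poly rho) e.
rewrite map_polyZ rmorphD rmorphM /= gr map_subst_zeta.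
set l := rho _; set Q := map_poly rho _; set rem := map_poly rho _ => e2.
have lE : l = lead_coef g ^+ scalp (zeta c K) g.
  rewrite /l rmorphXn /=; congr (_ ^+ _).
  by have := congr1 (fun f : {poly A} => f`_(size g).-1) gr; rewrite coef_map /= -lead_coefE.
have e3 := congr1 (fun f : {poly A} => f.['X_c]) e2.
rewrite /= hornerZ zetaK hornerD hornerM in e3.
have vrem : van rem.['X_c].
  have -> : rem.['X_c] = l * K - Q.['X_c] * g.['X_c] by rewrite e3; ring.
  by apply: vanD; [exact: vanMl | apply/vanN/vanMl].
have rem0 : rem = 0.
  apply: contrapT => /eqP r0; have := gmin rem; rewrite leqNgt => /(_ _)/negP; apply.
    split=> //; rewrite /rem -map_poly_comp; apply: eq_map_poly => P /=; exact: rho_rho.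
  by apply: leq_ltn_trans (size_poly _ _) _; rewrite ltn_modp.
exists l, Q.['X_c]; split; last by rewrite e3 rem0 horner0 addr0.
rewrite lE; apply: (van_exp prX); apply: nvan_rho; last by rewrite lead_coef_eq0.
by have := congr1 (fun f : {poly A} => f`_(size g).-1) gr; rewrite coef_map /= -lead_coefE.
Qed.

(** On X the gradient of every element of the ideal is a multiple of that of G, so any two are
    proportional. H is chosen of least total degree so that its partial derivatives, of smaller
    degree, do not vanish on X; if one were zero, H would be free of a coordinate of the circuit. *)
Lemma proportional_gradient : exists H, [/\ van H, ~ van H^`M(a), ~ van H^`M(b) &
  forall K, van K -> van (K^`M(a) * H^`M(b) - K^`M(b) * H^`M(a))].
Proof.
have [G [vG hG]] := minimal_elim.
have [|H [H0 vH] Hmin] := @min_size _ (fun P : A => msize P) (fun P => P != 0 /\ van P).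
  by have [P P0 vP] := depX; exists P.
have nv i : i \in [:: a; b; c] -> ~ van H^`M(i).
  move=> iin v; have [e|n0] := eqVneq H^`M(i) 0.
    by apply: (cirX iin H0 _ vH); exact: indep_mderiv.
  by have := Hmin _ (conj n0 v); rewrite leqNgt msize_mderiv.
have nva : ~ van H^`M(a) by apply: nv; rewrite inE eqxx.
have nvb : ~ van H^`M(b) by apply: nv; rewrite !inE eqxx orbT.
exists H; split=> // K vK.
have grad K' L Q i u : van K' -> L * K' = Q * G -> X u -> L.@[u] * (K'^`M(i)).@[u] = Q.@[u] * (G^`M(i)).@[u].
  move=> vK' e Xu; have := congr1 (fun P => (P^`M(i)).@[u]) e.
  by rewrite /= !mderivM !mevalD !mevalM vK' // vG // !mulr0 !add0r.
have [L1 [Q1 [nL1 e1]]] := hG H vH; have [L [Q [nL e]]] := hG K vK.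
apply: (van_cancel prX (P := L * L1)); first exact: van_prod.
move=> u Xu; have h1 i := grad H L1 Q1 i u vH e1 Xu; have h i := grad K L Q i u vK e Xu.
rewrite !mevalM mevalB !mevalM.
transitivity (L.@[u] * (K^`M(a)).@[u] * (L1.@[u] * (H^`M(b)).@[u]) - L.@[u] * (K^`M(b)).@[u] * (L1.@[u] * (H^`M(a)).@[u])); first by ring.
by rewrite !h !h1; ring.
Qed.

Section Relation.
Variables (Ha Hb : A).
Hypotheses (nHa : ~ van Ha) (nHb : ~ van Hb).

(** Hb^D f(Ha / Hb): relations for the quotient of the partial derivatives are kept homogeneous to
    avoid fractions. *)
Definition hom D (f : {poly A}) : A := \sum_(j < D.+1) f`_j * Ha ^+ j * Hb ^+ (D - j).
Definition relation D (f : {poly A}) := [/\ f != 0, (size f <= D.+1)%N, map_poly rho f = f & van (hom D f)].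

Lemma homS D (f : {poly A}) : (size f <= D.+1)%N -> hom D.+1 f = Hb * hom D f.
Proof.
move=> sf; rewrite /hom big_ord_recr /= nth_default // !mul0r addr0 mulr_sumr.
by apply: eq_bigr => j _; rewrite subSn -1?ltnS // exprS; ring.
Qed.

Lemma homSX D (f : {poly A}) : hom D.+1 (f * 'X) = Ha * hom D f.
Proof.
rewrite /hom big_ord_recl /= coefMX !mul0r add0r mulr_sumr.
by apply: eq_bigr => j _; rewrite /bump /= add1n coefMX /= subSS exprS; ring.
Qed.

Lemma hom_eval D (f : {poly A}) u :
  (hom D f).@[u] = \sum_(j < D.+1) (f`_j).@[u] * Ha.@[u] ^+ j * Hb.@[u] ^+ (D - j).
Proof. by rewrite rmorph_sum; apply: eq_bigr => j _; rewrite /= !mevalM !rmorphXn. Qed.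

Lemma all_alg (P : A) : va prX rho P.
Proof.
apply: va_gen => [x|i]; first by exists x%:MP; exact: substC.
have [-> {i}|ic] := eqVneq i c; last by have := va_base prX rho 'X_i; rewrite /= substX (negPf ic).
have [P0 P00 vP] := depX.
have z0 : zeta c P0 != 0 by apply: contra_neq P00; exact: zeta_inj.
have co j : rho (zeta c P0)`_j = (zeta c P0)`_j.
  by have := congr1 (fun f : {poly A} => f`_j) (map_subst_zeta c gam%:MP P0); rewrite coef_map.
apply: (va_root (f := zeta c P0)).
- by move=> j; rewrite -co; exact: va_base.
- by apply: nvan_rho; [rewrite lead_coefE co | rewrite lead_coef_eq0].
by rewrite zetaK.
Qed.

(** Choose Q with Hb Q = e on X for some e in the base. Then Ha / Hb = Ha Q / e, and a relation for
    the algebraic element Ha Q, rescaled by powers of e, is one for Ha / Hb. *)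
Lemma relation_ex : exists D f, relation D f.
Proof.
have [Q [e [aQ ne ve]]] := va_div (all_alg Hb) nHb.
have [s [nl vs]] := va_rel (vaM (all_alg Ha) aQ).
pose D := (size s).-1.
pose f := \poly_(j < D.+1) rho (s`_j * e ^+ j).
have s0 : s != 0 by apply: contra_notN nl => /eqP ->; rewrite lead_coef0 rmorph0; exact: van0.
have sD : size s = D.+1 by rewrite prednK // size_poly_gt0.
have eD : ~ van (rho (e ^+ D)) by rewrite (rmorphXn rho); exact: van_exp.
exists D, f; split.
- have : f`_D != 0.
    rewrite coef_poly leqnn rmorphM; apply: contra_notN (van_prod prX nl eD) => /eqP.
    by rewrite lead_coefE => ->; exact: van0.
  by apply: contraNneq => ->; rewrite coef0.
- exact: size_poly.
- by apply/polyP => j; rewrite coef_map /= coef_poly; case: ifP => _; rewrite ?rho_rho ?rmorph0.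
move=> u Xu; have := vs u Xu; have {ve} := ve u Xu.
rewrite mevalB mevalM => /eqP; rewrite subr_eq0 => /eqP ve.
rewrite (@horner_coef_wide _ D.+1) ?rmorph_sum /=; last by rewrite -sD; exact: size_poly.
move=> vsu; transitivity (Hb.@[u] ^+ D * \sum_(i < D.+1) ((map_poly rho s)`_i * (Ha * Q) ^+ i).@[u]); last by rewrite vsu mulr0.
rewrite mulr_sumr; apply: eq_bigr => j _.
have eE : (rho (s`_j * e ^+ j)).@[u] = (rho s`_j).@[u] * (Hb.@[u] * Q.@[u]) ^+ j.
  by rewrite ve rmorphM rmorphXn /= mevalM (rmorphXn (meval u)).
rewrite coef_map coef_poly ltn_ord !mevalM eE !(rmorphXn (meval u)) /= mevalM !(exprMn j).
have -> : Hb.@[u] ^+ D = Hb.@[u] ^+ (D - j) * Hb.@[u] ^+ j by rewrite -exprD subnK // -ltnS.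
ring.
Qed.

(** If an extreme coefficient were zero, Ha or Hb could be cancelled and the degree would drop; in
    degree 0 the relation would be a nonzero polynomial free of [X_c] vanishing on X. *)
Lemma minimal_relation : exists D f, [/\ relation D f, (0 < D)%N, f`_0 != 0, f`_D != 0 &
  forall S : {poly A}, (size S <= D)%N -> map_poly rho S = S -> van (hom D S) -> S = 0].
Proof.
have [|[D f] /= rel mn] := @min_size (nat * {poly A}) fst (fun x => relation x.1 x.2).
  by have [D [f h]] := relation_ex; exists (D, f).
have [f0 sf rf vf] := rel; have cf j : rho f`_j = f`_j.
  by have := congr1 (fun w : {poly A} => w`_j) rf; rewrite coef_map.
have D0 : (0 < D)%N.
  rewrite lt0n; apply/negP => /eqP e; move: vf sf; rewrite e /hom big_ord1 expr0 !mulr1 => vf sf.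
  apply: (nvan_rho (cf 0%N)) => //; apply: contra f0 => /eqP e0.
  by rewrite (size1_polyC sf) e0.
have dS (S : {poly A}) : (size S <= D)%N -> map_poly rho S = S -> van (hom D S) -> S = 0.
  case: D D0 {rel vf sf} mn => // D _ mn sS rS; rewrite homS // => /(van_cancel prX nHb) vS.
  apply: contrapT => /eqP S0; have := mn (D, S); rewrite /= ltnn => h.
  by have : false by apply: h; split.
exists D, f; split=> //.
- apply/eqP => f00; have [g fE] : exists g, f = g * 'X.
    have /factor_theorem[g fE] : root f 0 by rewrite rootE horner_coef0 f00.
    by exists g; rewrite fE polyC0 subr0.
  case: D D0 {rel dS} mn vf sf => // D _ mn vf sf; move: vf; rewrite fE homSX => /(van_cancel prX nHa) vg.
  have g0 : g != 0 by apply: contraNneq f0 => e; rewrite fE e mul0r.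
  have := mn (D, g); rewrite /= ltnn => h; have : false => //; apply: h; split=> //.
    by move: sf; rewrite fE size_mulX.
  by apply/polyP => j; have := cf j.+1; rewrite fE coefMX coef_map.
apply/eqP => fD; move/eqP: f0; apply; apply: dS => //.
apply/leq_sizeP => j; rewrite leq_eqVlt => /orP[/eqP <- //|Dj].
by rewrite nth_default //; exact: leq_trans sf Dj.
Qed.

End Relation.

(** Along F the quotient Ha / Hb is multiplied by F_b' / F_a', so the relation at F u becomes a
    relation of the same degree at u. By minimality it is proportional to f, and the extreme
    coefficients give the identity. As these are polynomials free of [X_c], it holds for all u, not
    only on X. *)
Lemma circuit_relation : exists (N0 N1 : A) D, [/\ (0 < D)%N, N0 != 0, N1 != 0 & forall u, fin q u ->
  N1.@[u] * N0.@[F u] * DFm p q u a ^+ D = N0.@[u] * N1.@[F u] * DFm p q u b ^+ D].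
Proof.
have [H [vH nHa nHb hH]] := proportional_gradient.
have [D [f [[f0 sf rf vf] D0 fz fD min]]] := minimal_relation nHa nHb.
exists f`_0, f`_D, D; split=> //.
have cf j : rho f`_j = f`_j by have := congr1 (fun w : {poly A} => w`_j) rf; rewrite coef_map.
have [K [e hK]] := num p q H.
(* K, the cleared numerator of H(F u), vanishes on X, so its gradient there is proportional to that
   of H. *)
have sym u : X u -> fin q u ->
    (H^`M(a)).@[F u] * DFm p q u a * (H^`M(b)).@[u] = (H^`M(b)).@[F u] * DFm p q u b * (H^`M(a)).@[u].
  have vK : van K by apply: van_fin => v Xv fv; have [-> _] := hK v fv; rewrite vH ?mulr0 //; exact: invX.
  move=> Xu fu; have [_ dK] := hK u fu; have := hH K vK u Xu.
  rewrite mevalB !mevalM !dK vH; last exact: invX.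
  rewrite !mulr0 !addr0 => /eqP; rewrite subr_eq0 => /eqP E.
  have de : (den q).@[u] ^+ e != 0 by rewrite expf_neq0 //; apply/den_fin.
  by apply: (mulfI de); rewrite !mulrA in E *; exact: E.
pose Kf j := projT1 (cid (num p q f`_j)).
have hKf j : exists e, forall u, fin q u -> (Kf j).@[u] = (den q).@[u] ^+ e * (f`_j).@[F u].
  by rewrite /Kf; case: cid => K' [e' h]; exists e' => u /h[].
pose ex j := projT1 (cid (hKf j)).
have hex j u : fin q u -> (Kf j).@[u] = (den q).@[u] ^+ ex j * (f`_j).@[F u] by rewrite /ex; case: cid => e' h /h.
pose E := (\sum_(j < D.+1) ex j)%N.
have exE (j : 'I_D.+1) : (ex j <= E)%N by rewrite /E (bigD1 j) //= leq_addr.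
pose w i := (p i)^`() * q i - p i * (q i)^`().
have DFE u i : fin q u -> (w i).[u i] = DFm p q u i * (q i).[u i] ^+ 2.
  by move=> fu; rewrite /w hornerD hornerN !hornerM /DFm divfK // expf_neq0 //; exact: fu.
(* f_j(F u) F_b'^j F_a'^(D - j) with denominators cleared by the common factor [cc u]. Putting [gam]
   for [X_c] makes the first factor free of [X_c] and leaves f_j(F u) unchanged, as f_j does not
   depend on that coordinate. *)
pose g j : A := rho (Kf j * den q ^+ (E - ex j)) * uni (w b) b ^+ j * uni (q b) b ^+ (2 * (D - j)) * uni (w a) a ^+ (D - j) * uni (q a) a ^+ (2 * j).
pose cc u := (den q).@[upd u c gam] ^+ E * ((q b).[u b] * (q a).[u a]) ^+ (2 * D).
have fin_upd u : fin q u -> fin q (upd u c gam).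
  by move=> fu i; rewrite /upd; case: (eqVneq i c) => [->|_]; [exact: qgam | exact: fu].
have cc0 u : fin q u -> cc u != 0.
  move=> fu; rewrite /cc mulf_neq0 ?expf_neq0 ?mulf_neq0 ?fu //.
  by apply/den_fin; exact: fin_upd.
have gE (j : 'I_D.+1) u : fin q u -> (g j).@[u] = cc u * ((f`_j).@[F u] * DFm p q u b ^+ j * DFm p q u a ^+ (D - j)).
  move=> fu; have fu' := fin_upd u fu; rewrite /g !mevalM !rmorphXn /= !uniE meval_subst mevalC mevalM rmorphXn /= hex //.
  have -> : (f`_j).@[F (upd u c gam)] = (f`_j).@[F u].
    rewrite -(rho_indep (cf j) (F u) (F (upd u c gam) c)); apply: meval_eq => i.
    by rewrite /upd; case: eqP => [->|ic] //; rewrite /Fm /upd; case: eqP ic.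
  rewrite (DFE u b fu) (DFE u a fu) (exprMn j (DFm p q u b)) (exprMn (D - j) (DFm p q u a)) -!exprM /cc (exprMn (2 * D)).
  rewrite -{2}(subnKC (exE j)) exprD.
  have -> : (2 * D = 2 * j + 2 * (D - j))%N by rewrite -mulnDr subnKC // -ltnS.
  rewrite !exprD.
  move: ((den q).@[_] ^+ _) ((den q).@[_] ^+ _) ((q b).[_] ^+ _) ((q b).[_] ^+ _) ((q a).[_] ^+ _) ((q a).[_] ^+ _) => x1 x2 x3 x4 x5 x6.
  move: (DFm _ _ _ _ ^+ _) (DFm _ _ _ _ ^+ _) (_.@[F u]) => x7 x8 x9; ring.
pose G : {poly A} := \poly_(j < D.+1) g j.
have rg j : rho (g j) = g j.
  apply: indep_subst => u x; have ua : upd u c x a = u a by rewrite /upd eq_sym (negPf ca).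
  have ub : upd u c x b = u b by rewrite /upd eq_sym (negPf cb).
  rewrite /g; set Z := Kf j * _; have eZ := @indep_substC _ _ c Z gam u x.
  by rewrite !mevalM !rmorphXn /= !uniE ua ub eZ.
have vG : van (hom H^`M(a) H^`M(b) D G).
  have [KH [e' hKH]] := num p q H^`M(b).
  have nKH : ~ van KH.
    move=> v; apply: nHb; apply: domX => u Xu fu; have [h _] := hKH u fu; have := v u Xu; rewrite h => /eqP.
    by rewrite mulf_eq0 expf_eq0 => /orP[/andP[_ /eqP z]|/eqP //]; have /den_fin := fu; rewrite z eqxx.
  apply: (van_cancel prX (van_exp prX (e := D) nKH)); apply: van_fin => u Xu fu.
  have [h _] := hKH u fu; rewrite mevalM rmorphXn /= h exprMn -mulrA.
  have S := sym u Xu fu; have vfu := vf _ (invX Xu fu).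
  suff -> : (H^`M(b)).@[F u] ^+ D * (hom H^`M(a) H^`M(b) D G).@[u] =
      cc u * (DFm p q u a * (H^`M(b)).@[u]) ^+ D * (hom H^`M(a) H^`M(b) D f).@[F u] by rewrite vfu !mulr0.
  rewrite !hom_eval; move: S; move: ((H^`M(a)).@[F u]) ((H^`M(b)).@[F u]) ((H^`M(a)).@[u]) ((H^`M(b)).@[u]) => z1 z2 x1 x2 S.
  rewrite !mulr_sumr; apply: eq_bigr => j _.
  rewrite /G coef_poly ltn_ord gE //.
  have jD : (j <= D)%N by rewrite -ltnS.
  move: S; move: (DFm p q u a) (DFm p q u b) => y1 y2 S.
  have HD (x : C) : x ^+ D = x ^+ j * x ^+ (D - j) by rewrite -exprD subnKC.
  rewrite !HD; have := congr1 (fun z => z ^+ j) S; rewrite /= !(exprMn j) (exprMn (D - j)) => Sj.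
  transitivity (cc u * (f`_j).@[F u] * y1 ^+ (D - j) * z2 ^+ (D - j) * x2 ^+ (D - j) * (z2 ^+ j * y2 ^+ j * x1 ^+ j)); first by ring.
  by rewrite -Sj; ring.
have homB (f1 f2 : {poly A}) (x y : A) : hom H^`M(a) H^`M(b) D (x *: f1 - y *: f2) = x * hom H^`M(a) H^`M(b) D f1 - y * hom H^`M(a) H^`M(b) D f2.
  rewrite /hom !mulr_sumr -sumrB; apply: eq_bigr => j _; rewrite coefB !coefZ; ring.
have GD j : (j <= D)%N -> G`_j = g j by rewrite /G coef_poly ltnS => ->.
have S0 : f`_D *: G - g D *: f = 0.
  apply: min.
  - apply/leq_sizeP => j; rewrite leq_eqVlt => /orP[/eqP <-|Dj]; rewrite coefB !coefZ.
      by rewrite GD // mulrC subrr.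
    by rewrite [f`_j]nth_default ?(leq_trans sf) // [G]lock /= -lock /G coef_poly ltnS leqNgt Dj !mulr0 subrr.
  - have rB (x y z t : A) : rho x = x -> rho y = y -> rho z = z -> rho t = t -> rho (x * y - z * t) = x * y - z * t.
      by move=> e1 e2 e3 e4; rewrite (rmorphB rho) !(rmorphM rho) /= e1 e2 e3 e4.
    apply/polyP => j; rewrite coef_map /= !coefB !coefZ; apply: rB => //.
    by rewrite /G coef_poly; case: ifP => _; rewrite ?rg ?rmorph0.
  by rewrite homB; apply: vanD; [exact: vanMl | apply/vanN/vanMl].
move=> u fu; have := congr1 (fun w : {poly A} => (w`_0).@[u]) S0.
have := gE ord_max u fu; have := gE ord0 u fu; rewrite /= subnn subn0 !expr0 coefB !coefZ GD // coef0 meval0.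
move: (g 0%N) (g D) (cc u) (cc0 u fu) (DFm _ _ _ _ ^+ _) (DFm _ _ _ _ ^+ _) => x1 x2 x3 cu y1 y2 e1 e2.
rewrite mevalB !mevalM e1 e2 => /eqP; rewrite subr_eq0 => /eqP E0; apply: (mulfI cu).
transitivity ((f`_D).@[u] * (x3 * ((f`_0).@[F u] * 1 * y2))); first by ring.
by rewrite E0; ring.
Qed.

End Circuit.

(** * Closed subsets of (P^1)^n *)

Section Multihom.
Variables (C : numClosedFieldType) (n : nat).
Local Notation A := {mpoly C[n + n]}.
Implicit Types (P Q : A) (dg : 'I_n -> nat).

Definition mhom dg P := forall m, m \in msupp P -> forall i : 'I_n, (m (lshift n i) + m (rshift n i))%N = dg i.

Lemma mhom0 dg : mhom dg 0. Proof. by move=> m; rewrite msupp0. Qed.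
Lemma mhomD dg P Q : mhom dg P -> mhom dg Q -> mhom dg (P + Q).
Proof. by move=> h k m /msuppD_le; rewrite mem_cat => /orP[/h|/k]. Qed.
Lemma mhomM dg dg' P Q : mhom dg P -> mhom dg' Q -> mhom (fun i => dg i + dg' i)%N (P * Q).
Proof.
move=> h k m /msuppM_le /allpairsP[[m1 m2] [/h h1 /k k2 ->]] i.
by rewrite !mnmDE -h1 -k2 addnACA.
Qed.
Lemma mhomC c : mhom (fun=> 0%N) (c%:MP : A).
Proof. by move=> m; rewrite msuppC; case: ifP => // _; rewrite inE => /eqP -> i; rewrite !mnm0E. Qed.
Lemma mhom1 : mhom (fun=> 0%N) 1.
Proof. by have := @mhomC 1; rewrite mpolyC1. Qed.
Lemma mhom_eq dg dg' P : mhom dg P -> dg =1 dg' -> mhom dg' P.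
Proof. by move=> h e m /h k i; rewrite k. Qed.
Lemma mhomXl i : mhom (fun j => nat_of_bool (j == i)) ('X_(lshift n i) : A).
Proof.
move=> m; rewrite msuppX inE => /eqP -> j; rewrite !mnm1E eq_sym eq_lshift eq_lrshift addn0; by case: eqP.
Qed.
Lemma mhomXr i : mhom (fun j => nat_of_bool (j == i)) ('X_(rshift n i) : A).
Proof.
move=> m; rewrite msuppX inE => /eqP -> j; rewrite !mnm1E [rshift n i == rshift _ _]eq_sym eq_rshift eq_rlshift add0n; by case: eqP.
Qed.
Lemma mhomX dg P k : mhom dg P -> mhom (fun i => dg i * k)%N (P ^+ k).
Proof.
move=> h; elim: k => [|k IH].
  by rewrite expr0; apply: (mhom_eq mhom1) => i; rewrite muln0.
by rewrite exprS; apply: (mhom_eq (mhomM h IH)) => i; rewrite mulnS.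
Qed.
Lemma mhom_prod (I : Type) (s : seq I) (pr : pred I) (dg : I -> 'I_n -> nat) (P : I -> A) :
  (forall i, pr i -> mhom (dg i) (P i)) -> mhom (fun j => \sum_(i <- s | pr i) dg i j)%N (\prod_(i <- s | pr i) P i).
Proof.
move=> h; elim: s => [|i s IH].
  by rewrite big_nil; apply: (mhom_eq mhom1) => j; rewrite big_nil.
rewrite big_cons; case: ifP => pi; last by apply: (mhom_eq IH) => j; rewrite big_cons pi.
by apply: (mhom_eq (mhomM (h i pi) IH)) => j; rewrite big_cons pi.
Qed.

Lemma mhom_scale dg P (lam : 'I_n -> C) (v w : 'I_(n + n) -> C) : mhom dg P ->
  (forall i, w (lshift n i) = lam i * v (lshift n i)) -> (forall i, w (rshift n i) = lam i * v (rshift n i)) ->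
  P.@[w] = \prod_i lam i ^+ dg i * P.@[v].
Proof.
move=> h hl hr; rewrite !mevalE mulr_sumr big_seq [RHS]big_seq; apply: eq_bigr => m ms.
rewrite mulrCA; congr (_ * _); rewrite !big_split_ord /= -!big_split /=.
apply: eq_bigr => i _; rewrite hl hr -(h m ms i) !exprMn exprD; ring.
Qed.
End Multihom.

(** * Restriction to a set of variables and renaming *)

Section Support.
Variables (C : numClosedFieldType) (n : nat).
Implicit Types T : {set 'I_n}.

(** Variables outside T are set to 0, so [sig T P = P] says that P involves only variables of T. *)
Definition sig T : {mpoly C[n]} -> {mpoly C[n]} := mmap (@mpolyC n C) (fun i => if i \in T then 'X_i else 0).
HB.instance Definition _ T := GRing.RMorphism.on (sig T).
Lemma sigC T c : sig T c%:MP = c%:MP. Proof. by rewrite /sig mmapC. Qed.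
Lemma sigX T i : sig T 'X_i = if i \in T then 'X_i else 0. Proof. by rewrite /sig mmapX mmap1U. Qed.

Lemma sig_eval T P v : (sig T P).@[v] = P.@[fun i => if i \in T then v i else 0].
Proof.
apply: (@morph_ext C n _ (meval v \o sig T) (meval (fun i => if i \in T then v i else 0))) => [x|i] /=.
  by rewrite sigC !mevalC.
by rewrite sigX mevalXU; case: ifP; rewrite ?mevalXU ?meval0.
Qed.

Lemma sig_sub T T' P : T \subset T' -> sig T' (sig T P) = sig T P.
Proof.
move=> /fintype.subsetP TT; apply: (@morph_ext C n _ (sig T' \o sig T) (sig T)) => [x|i] /=.
  by rewrite !sigC.
by rewrite sigX; case: ifP => [/TT|_]; rewrite ?sigX ?rmorph0 // => ->.
Qed.
End Support.

Section Renaming.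
Variables (C : numClosedFieldType) (r n : nat) (g : 'I_r -> 'I_n).
Definition ren : {mpoly C[r]} -> {mpoly C[n]} := mmap (@mpolyC n C) (fun k => 'X_(g k)).
HB.instance Definition _ := GRing.RMorphism.on ren.
Definition unren : {mpoly C[n]} -> {mpoly C[r]} :=
  mmap (@mpolyC r C) (fun i => if [pick k | g k == i] is Some k then 'X_k else 0).
HB.instance Definition _ := GRing.RMorphism.on unren.

Lemma renC c : ren c%:MP = c%:MP. Proof. by rewrite /ren mmapC. Qed.
Lemma renX k : ren 'X_k = 'X_(g k). Proof. by rewrite /ren mmapX mmap1U. Qed.
Lemma unrenC c : unren c%:MP = c%:MP. Proof. by rewrite /unren mmapC. Qed.
Lemma unrenX i : unren 'X_i = if [pick k | g k == i] is Some k then 'X_k else 0.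
Proof. by rewrite /unren mmapX mmap1U. Qed.

Lemma ren_eval P v : (ren P).@[v] = P.@[fun k => v (g k)].
Proof.
apply: (@morph_ext C r _ (meval v \o ren) (meval (fun k => v (g k)))) => [x|k] /=.
  by rewrite renC !mevalC.
by rewrite renX !mevalXU.
Qed.

Hypothesis gi : injective g.

Lemma renK : cancel ren unren.
Proof.
move=> P; apply: (@morph_ext C r _ (unren \o ren) idfun) => [x|k] /=; first by rewrite renC unrenC.
by rewrite renX unrenX; case: pickP => [k' /eqP/gi -> //|/(_ k)]; rewrite eqxx.
Qed.

Lemma ren_sig (T : {set 'I_r}) P : ren (sig T P) = sig (g @: T) (ren P).
Proof.
apply: (@morph_ext C r _ (ren \o sig T) (sig (g @: T) \o ren)) => [x|k] /=; first by rewrite sigC !renC sigC.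
by rewrite sigX renX sigX mem_imset //; case: ifP; rewrite ?renX ?rmorph0.
Qed.

Lemma unrenK (T : {set 'I_r}) Q : ren (unren (sig (g @: T) Q)) = sig (g @: T) Q.
Proof.
apply: (@morph_ext C n _ (ren \o (unren \o sig (g @: T))) (sig (g @: T))) => [x|i] /=.
  by rewrite sigC unrenC renC.
rewrite sigX; case: ifP => [/imsetP[k kT ->]|_]; last by rewrite !rmorph0.
by rewrite unrenX; case: pickP => [k' /eqP/gi ->|/(_ k)]; rewrite ?renX ?eqxx.
Qed.
End Renaming.

(** * Zariski closed sets, irreducibility and coordinate maps *)

Section Closed.
Variable R : realType.
Local Notation C := R[i].
Local Notation P1 := (P1 R).

Section Sets.
Variable n : nat.
Implicit Types (A B Z : pset R n) (x : pt R n) (T : {set 'I_n}).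

Lemma hcoord_l x i : hcoord x (lshift n i) = if x i is Some z then z else 1.
Proof. by rewrite /hcoord (unsplitK (inl i)). Qed.
Lemma hcoord_r x i : hcoord x (rshift n i) = if x i is Some _ then 1 else 0.
Proof. by rewrite /hcoord (unsplitK (inr i)). Qed.

Lemma mhom_multi dg (P : {mpoly C[n + n]}) : mhom dg P -> multihom P.
Proof. by exists dg. Qed.

Lemma zclosed_single (P : {mpoly C[n + n]}) : multihom P -> zclosed (fun x => P.@[hcoord x] = 0).
Proof. by move=> hP; exists (fun Q => Q = P); split=> [Q -> //|x]; split=> [h Q -> //|h]; exact: h. Qed.

Lemma zclosed_ext A B : zclosed A -> seteq A B -> zclosed B.
Proof. by move=> [E [h1 h2]] e; exists E; split=> // x; split=> [/e/h2|/h2/e]. Qed.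

Lemma zclosed_or A B : zclosed A -> zclosed B -> zclosed (fun x => A x \/ B x).
Proof.
move=> [E [h1 h2]] [E' [k1 k2]].
exists (fun P => exists Q Q', [/\ E Q, E' Q' & P = Q * Q']); split.
  move=> P [Q [Q' [/h1[dg hQ] /k1[dg' hQ'] ->]]].
  by exists (fun i => dg i + dg' i)%N; exact: mhomM.
move=> x; split=> [H P [Q [Q' [EQ EQ' ->]]]|H].
  by rewrite mevalM; case: H => [/h2/(_ _ EQ) ->|/k2/(_ _ EQ') ->]; rewrite ?mul0r ?mulr0.
have [|nA] := pselect (A x); first by left.
right; apply/k2 => Q' EQ'; apply: contrapT => n'; apply: nA; apply/h2 => Q EQ.
have /eqP := H _ (ex_intro _ Q (ex_intro _ Q' (And3 EQ EQ' erefl))).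
by rewrite mevalM mulf_eq0 => /orP[/eqP|/eqP].
Qed.

Lemma zclosure_closed A : zclosed (zclosure A).
Proof.
exists (fun P => multihom P /\ forall x, A x -> P.@[hcoord x] = 0); split=> [P []//|x]; split=> [h P [hP AP]|h Z [E [h1 h2]] AZ].
  exact: (h _ (zclosed_single hP)).
by apply/h2 => P EP; apply: h; split=> [|y /AZ/h2]; [exact: h1 | exact].
Qed.

Lemma sub_zclosure A : subs A (zclosure A). Proof. by move=> x Ax Z _; exact. Qed.
Lemma zclosure_min A Z : zclosed Z -> subs A Z -> subs (zclosure A) Z.
Proof. by move=> h k x; exact. Qed.
Lemma zclosure_mono A B : subs A B -> subs (zclosure A) (zclosure B).
Proof. by move=> h; apply: zclosure_min; [exact: zclosure_closed | move=> x /h; exact: sub_zclosure]. Qed.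
Lemma zclosure_id Z : zclosed Z -> seteq (zclosure Z) Z.
Proof. by move=> h x; split; [exact: zclosure_min | exact: sub_zclosure]. Qed.

Definition fx x : 'I_n -> C := fun i => odflt 0 (x i).
(* On the part of (P^1)^n where the coordinates in T are finite, this is the zero set of P with X_i := 0 off T. *)
Definition ZT T (P : {mpoly C[n]}) x := (exists2 i, i \in T & x i = None) \/ (sig T P).@[fx x] = 0.

(** Every large N is allowed, so that sums can be formed in a common degree and products in
    complementary ones. *)
Lemma homogenise T (P : {mpoly C[n]}) : exists N0, forall N, (N0 <= N)%N -> exists Q : {mpoly C[n + n]},
  mhom (fun i => if i \in T then N else 0%N) Q /\
  forall x, (forall i, i \in T -> x i != None) -> Q.@[hcoord x] = (sig T P).@[fx x].
Proof.
pose Y N : {mpoly C[n + n]} := \prod_(i in T) 'X_(rshift n i) ^+ N.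
have hY N : mhom (fun i => if i \in T then N else 0%N) (Y N).
  have h := mhom_prod (s := index_enum 'I_n) (fun i (_ : i \in T) => mhomX (k := N) (@mhomXr C n i)).
  apply: (mhom_eq h) => j; case: ifP => jT.
    by rewrite (bigD1 j) //= eqxx mul1n big1 ?addn0 // => i /andP[_ /negPf ij]; rewrite eq_sym ij.
  by apply: big1 => i iT; case: eqP => // e; rewrite e iT in jT.
have eY N x : (forall i, i \in T -> x i != None) -> (Y N).@[hcoord x] = 1.
  move=> fT; rewrite rmorph_prod /= big1 // => i /fT; rewrite rmorphXn /= mevalXU hcoord_r.
  by case: (x i) => //= z _; rewrite expr1n.
elim/mpoly_gen: P => [c|i|P1 P2 [N1 h1] [N2 h2]|P1 P2 [N1 h1] [N2 h2]].
- exists 0%N => N _; exists (c%:MP * Y N); split; first by apply: (mhom_eq (mhomM (@mhomC _ n c) (hY N))).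
  by move=> x fT; rewrite mevalM eY // mulr1 sigC !mevalC.
- have [iT|niT] := boolP (i \in T); last first.
    by exists 0%N => N _; exists 0; split; [exact: mhom0 | move=> x _; rewrite sigX (negPf niT) !meval0].
  exists 1%N => N hN.
  exists ('X_(lshift n i) * 'X_(rshift n i) ^+ N.-1 * \prod_(j in T | j != i) 'X_(rshift n j) ^+ N); split.
    have h := mhom_prod (s := index_enum 'I_n) (fun j (_ : (j \in T) && (j != i)) => mhomX (k := N) (@mhomXr C n j)).
    apply: (mhom_eq (mhomM (mhomM (@mhomXl C n i) (mhomX (k := N.-1) (@mhomXr C n i))) h)) => j.
    have [->|ji] := eqVneq j i.
      rewrite iT mul1n big1 ?addn0; first by rewrite add1n prednK.
      by move=> k /andP[_ /negPf]; rewrite eq_sym => ->.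
    rewrite mul0n !add0n; case: ifP => jT.
      rewrite (bigD1 j) /= ?jT // eqxx mul1n big1 ?addn0 // => k /andP[_ /negPf]; by rewrite eq_sym => ->.
    by apply: big1 => k /andP[kT _]; case: eqP => // e; rewrite e kT in jT.
  move=> x fT; rewrite !mevalM rmorphXn rmorph_prod /= !mevalXU hcoord_l hcoord_r sigX iT mevalXU.
  rewrite big1; last first.
    by move=> j /andP[/fT]; rewrite rmorphXn /= mevalXU hcoord_r; case: (x j) => //= z _ _; rewrite expr1n.
  by have := fT i iT; rewrite /fx; case: (x i) => //= z _; rewrite expr1n !mulr1.
- exists (maxn N1 N2) => N; rewrite geq_max => /andP[/h1[Q1 [m1 e1]] /h2[Q2 [m2 e2]]].
  exists (Q1 + Q2); split; first exact: mhomD.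
  by move=> x fT; rewrite mevalD e1 // e2 // rmorphD /= mevalD.
exists (N1 + N2)%N => N hN; have [Q1 [m1 e1]] := h1 N1 (leqnn _).
have hN1 : (N1 <= N)%N := leq_trans (leq_addr _ _) hN.
have [|Q2 [m2 e2]] := h2 (N - N1)%N; first by rewrite leq_subRL.
exists (Q1 * Q2); split; last by move=> x fT; rewrite mevalM e1 // e2 // rmorphM /= mevalM.
by apply: (mhom_eq (mhomM m1 m2)) => i; case: ifP => // _; rewrite subnKC.
Qed.

Lemma ZT_closed T P : zclosed (ZT T P).
Proof.
have [N h] := homogenise T P; have [Q [mQ eQ]] := h N (leqnn _).
(* The extra factors Y_i add to the zero set exactly the points with a coordinate of T at
   infinity. *)
pose Y : {mpoly C[n + n]} := \prod_(i in T) 'X_(rshift n i).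
have cl : zclosed (fun x => (Q * Y).@[hcoord x] = 0).
  apply: zclosed_single; have k := mhom_prod (s := index_enum 'I_n) (fun i (_ : i \in T) => @mhomXr C n i).
  exact: mhom_multi (mhomM mQ k).
apply: (zclosed_ext cl) => x; rewrite mevalM rmorph_prod /=.
have [[i [iT xi]]|none] := pselect (exists i, i \in T /\ x i = None).
  split=> _; first by left; exists i.
  by rewrite (bigD1 i) //= mevalXU hcoord_r xi mul0r mulr0.
have fT i : i \in T -> x i != None by move=> iT; apply/eqP => e; apply: none; exists i.
rewrite big1 ?mulr1; last by move=> i /fT; rewrite mevalXU hcoord_r; case: (x i).
by rewrite eQ //; split=> [e|[[i iT e]|//]]; [right | have := fT i iT; rewrite e].
Qed.

Lemma coord_closed i (a : P1) : zclosed (fun x => x i = a).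
Proof.
case: a => [a|]; last first.
  apply: (zclosed_ext (zclosed_single (mhom_multi (@mhomXr C n i)))) => x.
  by rewrite mevalXU hcoord_r; case: (x i) => // z; split=> // /eqP; rewrite oner_eq0.
have h : mhom (fun j => nat_of_bool (j == i)) ('X_(lshift n i) - a%:MP * 'X_(rshift n i) : {mpoly C[n + n]}).
  rewrite -mulNr -rmorphN; apply: mhomD; first exact: mhomXl.
  by apply: (mhom_eq (mhomM (@mhomC _ n _) (@mhomXr C n i))).
apply: (zclosed_ext (zclosed_single (mhom_multi h))) => x.
rewrite mevalB mevalM mevalC !mevalXU hcoord_l hcoord_r; case: (x i) => [z|].
  by rewrite mulr1; split=> [/eqP|[->]]; rewrite ?subrr // subr_eq0 => /eqP ->.
by rewrite mulr0 subr0; split=> // /eqP; rewrite oner_eq0.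
Qed.

Lemma zclosed_bigor (I : eqType) (s : seq I) (Z : I -> pset R n) : (forall i, zclosed (Z i)) ->
  zclosed (fun x => exists2 i, i \in s & Z i x).
Proof.
move=> h; elim: s => [|i s IH].
  have c1 : zclosed (fun x : pt R n => (1%:MP : {mpoly C[n + n]}).@[hcoord x] = 0).
    by apply: zclosed_single; exists (fun=> 0%N); exact: mhomC.
  apply: (zclosed_ext c1) => x; rewrite mevalC; split=> [/eqP|[j //]]; by rewrite oner_eq0.
apply: (zclosed_ext (zclosed_or (h i) IH)) => x; split=> [[Zi|[j js Zj]]|[j]].
- by exists i; rewrite ?mem_head.
- by exists j; rewrite // inE js orbT.
by rewrite inE => /orP[/eqP ->|js] Zj; [left | right; exists j].
Qed.

Lemma irred_bigor V (I : eqType) (s : seq I) (Z : I -> pset R n) : irred V -> (forall i, zclosed (Z i)) ->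
  subs V (fun x => exists2 i, i \in s & Z i x) -> exists2 i, i \in s & subs V (Z i).
Proof.
move=> [_ [[x0 Vx0] ir]] cZ; elim: s => [|i s IH] h; first by have [j] := h _ Vx0.
have [h'|h'] := ir _ _ (cZ i) (zclosed_bigor s cZ)
    ltac:(by move=> x /h[j]; rewrite inE => /orP[/eqP -> Zj|js Zj]; [left | right; exists j]).
  by exists i; rewrite ?mem_head.
by have [j js jZ] := IH h'; exists j; rewrite // inE js orbT.
Qed.

End Sets.

Section Maps.
Variables (n m : nat) (e : 'I_m -> 'I_n) (p q : 'I_m -> {poly C}).
Hypotheses (cpq : forall k, coprimep (p k) (q k)) (d0 : forall k, (0 < rdeg (p k) (q k))%N).

(** Coordinates may be selected, repeated and mapped at the same time: projections, iterates of
    [Phi] and graph maps are all of this shape, so closedness and irreducibility are transported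
    once for all. *)
Definition cmap (x : pt R n) : pt R m := fun k => ratP1 (p k) (q k) (x (e k)).

Let d k := rdeg (p k) (q k).
Let hp (f : {poly C}) k : {mpoly C[n + n]} := \sum_(t < (d k).+1) f`_t *: ('X_(lshift n (e k)) ^+ t * 'X_(rshift n (e k)) ^+ (d k - t)).

Let mhom_hp (f : {poly C}) k : mhom (fun j => (j == e k) * d k)%N (hp f k).
Proof.
rewrite /hp; elim/big_ind: _ => [||t _]; [exact: mhom0 | exact: mhomD |].
rewrite -mul_mpolyC; apply: (mhom_eq (mhomM (@mhomC _ n _) (mhomM (mhomX (k := t) (@mhomXl C n _)) (mhomX (k := (d k - t)%N) (@mhomXr C n _))))).
by move=> j; rewrite add0n -mulnDr subnKC // -ltnS.
Qed.

Let hp_eval (f : {poly C}) k (x : pt R n) : (size f <= (d k).+1)%N -> (hp f k).@[hcoord x] = if x (e k) is Some z then f.[z] else f`_(d k).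
Proof.
move=> sf; rewrite /hp rmorph_sum /=.
have E t : (f`_t *: ('X_(lshift n (e k)) ^+ t * 'X_(rshift n (e k)) ^+ (d k - t)) : {mpoly C[n + n]}).@[hcoord x] =
    f`_t * (hcoord x (lshift n (e k)) ^+ t * hcoord x (rshift n (e k)) ^+ (d k - t)).
  by rewrite mevalZ mevalM !rmorphXn /= !mevalXU.
under eq_bigr => t _ do rewrite E hcoord_l hcoord_r.
case: (x (e k)) => [z|].
  by rewrite (horner_coef_wide z sf); apply: eq_bigr => t _; rewrite expr1n mulr1.
rewrite big_ord_recr /= big1 ?add0r; first by rewrite expr1n subnn expr0 !mulr1.
by move=> t _; rewrite expr1n mul1r expr0n subn_eq0 leqNgt ltn_ord mulr0.
Qed.

Lemma cmap_closed (Z : pset R m) : zclosed Z -> zclosed (fun x => Z (cmap x)).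
Proof.
move=> [E [hE ZE]].
pose sub (P : {mpoly C[m + m]}) : {mpoly C[n + n]} :=
  mmap (@mpolyC (n + n) C) (fun kk => match fintype.split kk with inl k => hp (p k) k | inr k => hp (q k) k end) P.
(* The factor between the homogenised pair (p, q) evaluated at x and the normalised coordinates, (z,
   1) or (1, 0), of the image point. *)
pose lam (x : pt R n) k := match x (e k) with
  | Some z => if (q k).[z] != 0 then (q k).[z] else (p k).[z]
  | None => if (q k)`_(d k) != 0 then (q k)`_(d k) else (p k)`_(d k) end.
have sz k : (size (p k) <= (d k).+1)%N /\ (size (q k) <= (d k).+1)%N.
  have [s1 s2] : (0 < maxn (size (p k)) (size (q k)))%N /\ (d k = (maxn (size (p k)) (size (q k))).-1)%N.
    by split=> //; move: (d0 k); rewrite /rdeg; case: maxn.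
  by rewrite s2 prednK // leq_maxl leq_maxr.
have lam0 x k : lam x k != 0.
  rewrite /lam; case: (x (e k)) => [z|].
    case: ifP => // /negbFE qz; apply/negP => pz.
    by have := coprimep_root (cpq k) pz; rewrite qz.
  case: ifP => // /negbFE/eqP qd; apply/eqP => pd; have dk := d0 k; rewrite -/(d k) in dk.
  have ds (f : {poly C}) : (size f <= (d k).+1)%N -> f`_(d k) = 0 -> (size f <= d k)%N.
    move=> sf f0; apply/leq_sizeP => j; rewrite leq_eqVlt => /orP[/eqP <- //|dj].
    by rewrite nth_default //; exact: leq_trans sf dj.
  have [s1 s2] := sz k; have := ds _ s1 pd; have := ds _ s2 qd => h2 h1.
  have : (maxn (size (p k)) (size (q k)) <= d k)%N by rewrite geq_max h1.
  by move: dk; rewrite /d /rdeg; case: maxn => // j _; rewrite ltnn.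
have sub_eval P dg x : mhom dg P -> (sub P).@[hcoord x] = \prod_k lam x k ^+ dg k * P.@[hcoord (cmap x)].
  move=> hP; rewrite -(mhom_scale (w := fun kk => (match fintype.split kk with inl k => hp (p k) k | inr k => hp (q k) k end).@[hcoord x]) hP).
  - rewrite [RHS]mevalE /sub /mmap rmorph_sum; apply: eq_bigr => mm _; rewrite /= mevalM mevalC; congr (_ * _).
    by rewrite /mmap1 rmorph_prod; apply: eq_bigr => kk _; rewrite /= rmorphXn.
  - move=> k; rewrite (unsplitK (inl k)) hp_eval ?(sz k).1 // hcoord_l /cmap /lam /ratP1.
    by case: (x (e k)) => [z|]; case: ifP => h; rewrite ?mulr1 // mulrC divfK.
  move=> k; rewrite (unsplitK (inr k)) hp_eval ?(sz k).2 // hcoord_r /cmap /lam /ratP1.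
  by case: (x (e k)) => [z|]; case: ifP => [h|/negbFE/eqP ->]; rewrite ?mulr1 ?mulr0.
exists (fun Q => exists2 P, E P & Q = sub P); split.
  move=> Q [P /hE[dg hP] ->]; exists (fun j => \sum_k (j == e k) * d k * dg k)%N.
  rewrite /sub /mmap big_seq; elim/big_ind: _ => [||mm ms]; [exact: mhom0 | exact: mhomD |].
  have h := mhom_prod (s := index_enum 'I_m) (fun k (_ : true) => mhomM (mhomX (k := mm (lshift m k)) (@mhom_hp (p k) k)) (mhomX (k := mm (rshift m k)) (@mhom_hp (q k) k))).
  rewrite /mmap1 big_split_ord /= -big_split /=.
  under eq_bigr => k _ do rewrite (unsplitK (inl k)) (unsplitK (inr k)).
  apply: (mhom_eq (mhomM (@mhomC _ n _) h)) => j; rewrite add0n; apply: eq_bigr => k _.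
  by rewrite -mulnDr hP.
move=> x; split=> [/ZE h Q [P EP ->]|h].
  by have [dg hP] := hE P EP; rewrite (sub_eval P dg) // h // mulr0.
apply/ZE => P EP; have [dg hP] := hE P EP; have /eqP := h _ (ex_intro2 _ _ P EP erefl).
rewrite (sub_eval P dg) // mulf_eq0 => /orP[/prodf_eq0[k _]|/eqP //].
by rewrite expf_eq0 => /andP[_ /eqP z]; have := lam0 x k; rewrite z eqxx.
Qed.

Lemma zclosure_cmap (A : pset R n) Z : zclosed Z -> (forall x, A x -> Z (cmap x)) -> forall x, zclosure A x -> Z (cmap x).
Proof. by move=> cZ h; apply: zclosure_min => //; exact: cmap_closed. Qed.

Lemma zclosure_image (A : pset R n) : 
  seteq (zclosure (fun y => exists2 x, zclosure A x & cmap x = y)) (zclosure (fun y => exists2 x, A x & cmap x = y)).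
Proof.
move=> y; split; last by apply: zclosure_mono => z [x Ax <-]; exists x => //; exact: sub_zclosure.
apply: zclosure_min; first exact: zclosure_closed.
move=> _ [x clx <-]; apply: (zclosure_cmap _ _ clx); first exact: zclosure_closed.
by move=> z Az; apply: sub_zclosure; exists z.
Qed.

Lemma irred_image (V : pset R n) : irred V -> irred (zclosure (fun y => exists2 x, V x & cmap x = y)).
Proof.
move=> [cV [[x0 Vx0] ir]]; split; first exact: zclosure_closed.
split; first by exists (cmap x0); apply: sub_zclosure; exists x0.
move=> Z1 Z2 c1 c2 h.
have [k|k] := ir _ _ (cmap_closed c1) (cmap_closed c2) ltac:(by move=> x Vx; apply: h; apply: sub_zclosure; exists x);
  [left|right]; by apply: zclosure_min => // _ [x /k ? <-].
Qed.

End Maps.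
End Closed.

(** * The matroid of algebraic dependence *)

Section Matroid.
Variables (C : numClosedFieldType) (n : nat) (X : ('I_n -> C) -> Prop).
Local Notation A := {mpoly C[n]}.
Implicit Types (P Q : A) (T U : {set 'I_n}) (i j l r : 'I_n).

Definition dep T := exists P, [/\ P != 0, sig T P = P & van X P].

Lemma depS T U : T \subset U -> dep T -> dep U.
Proof. by move=> TU [P [P0 e v]]; exists P; split=> //; rewrite -e sig_sub. Qed.

Hypothesis prX : vprime X.

Lemma map_sig_zeta T j P : map_poly (sig T) (zeta j P) = zeta j (sig (j |: T) P).
Proof.
apply: (@morph_ext C n _ (map_poly (sig T) \o zeta j) (zeta j \o sig (j |: T))) => [x|i] /=.
  by rewrite sigC !zetaC map_polyC /= sigC.
rewrite zetaX sigX in_setU1; have [->|ij] := eqVneq i j; first by rewrite map_polyX zetaX eqxx.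
by rewrite map_polyC /= sigX; case: ifP; rewrite ?zetaX ?(negPf ij) // !rmorph0.
Qed.

Lemma zeta_sig T j P : j \notin T -> zeta j (sig T P) = (sig T P)%:P.
Proof.
move=> jT; apply: (@morph_ext C n _ (zeta j \o sig T) (polyC \o sig T)) => [x|i] /=.
  by rewrite sigC zetaC.
rewrite sigX; case: ifP => [iT|_]; last by rewrite !rmorph0.
by rewrite zetaX; case: eqP => // e; rewrite -e iT in jT.
Qed.

Lemma va_sig T U P : (forall i, i \in U -> va prX (sig T) 'X_i) -> va prX (sig T) (sig U P).
Proof.
move=> h; have hC (x : C) : va prX (sig T) x%:MP by rewrite -(sigC T); exact: va_base.
elim/mpoly_gen: P => [x|i|P Q|P Q]; first by rewrite sigC.
- rewrite sigX; case: ifP => [/h //|_]; by rewrite -(mpolyC0 n C).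
- by rewrite rmorphD; exact: vaD.
by rewrite rmorphM; exact: vaM.
Qed.

Lemma va_self T i : i \in T -> va prX (sig T) 'X_i.
Proof. by move=> iT; have := va_base prX (sig T) 'X_i; rewrite /= sigX iT. Qed.

Lemma dep_alg T U j : ~ dep U -> dep (j |: U) -> (forall i, i \in U -> va prX (sig T) 'X_i) -> va prX (sig T) 'X_j.
Proof.
move=> nU [P [P0 e vP]] h.
have fixf : map_poly (sig U) (zeta j P) = zeta j P by rewrite map_sig_zeta e.
have fixc t : sig U (zeta j P)`_t = (zeta j P)`_t by rewrite -{2}fixf coef_map.
apply: (va_root (f := zeta j P)).
- by move=> t; rewrite -fixc; exact: va_sig.
- move=> v; apply: nU; exists (lead_coef (zeta j P)); split=> //; first last.
    by rewrite lead_coefE fixc.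
  by rewrite lead_coef_eq0; apply: contra_neq P0; exact: zeta_inj.
by rewrite zetaK.
Qed.

Lemma alg_dep T j : j \notin T -> va prX (sig T) 'X_j -> dep (j |: T).
Proof.
move=> jT /va_rel[s [ls vs]]; pose f := map_poly (sig T) s.
have f0 : f != 0.
  apply: contra_notN ls => /eqP e; have := congr1 (fun w : {poly A} => w`_(size s).-1) e.
  by rewrite coef_map coef0 /= -lead_coefE => ->; exact: van0.
have mz : map_poly (zeta j) f = map_poly polyC f.
  by apply/polyP => t; rewrite !coef_map /= zeta_sig.
exists f.['X_j]; split=> //.
  have e : zeta j f.['X_j] = f.
    by rewrite -horner_map mz /= zetaX eqxx -/(comp_poly _ _) comp_polyXr.
  by apply: contraNneq f0 => e0; rewrite -e e0 rmorph0.
rewrite -horner_map /= sigX setU11; congr _.['X_j].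
by apply/polyP => t; rewrite !coef_map /= sig_sub // finset.subsetU1.
Qed.

(** r is algebraic over l, and l over U unless U is already dependent; transitivity of algebraicity
    gives the claim. *)
Lemma exchange l r U : ~ dep [set l] -> dep [set r; l] -> r \notin U -> dep (l |: U) -> dep (r |: U).
Proof.
move=> nl lr rU lU; have [dU|nU] := pselect (dep U); first by apply: depS dU; exact: finset.subsetU1.
apply: (alg_dep rU); apply: (dep_alg nl lr) => i; rewrite inE => /eqP ->.
by apply: (dep_alg nU lU) => k; exact: va_self.
Qed.

(* Exchanging parallel elements one at a time. *)
Lemma exchange_all (m : nat) (f g : 'I_m -> 'I_n) (T : {set 'I_m}) : injective g -> (forall i j : 'I_m, f i != g j) ->
  (forall i : 'I_m, i \in T -> ~ dep [set f i] /\ dep [set g i; f i]) -> dep (f @: T) -> dep (g @: T).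
Proof.
move=> gi fg h; suff H (s : seq 'I_m) (U : {set 'I_n}) : uniq s -> {subset s <= T} -> (forall i : 'I_m, i \in s -> g i \notin U) ->
    dep (U :|: [set f i | i in s]) -> dep (U :|: [set g i | i in s]).
  have e (k : 'I_m -> 'I_n) : [set k i | i in enum T] = k @: T.
    by apply/setP => i; apply/imsetP/imsetP => -[x xT ->]; exists x; rewrite ?mem_enum // -mem_enum.
  have := H (enum T) (finset.set0) (enum_uniq _); rewrite !finset.set0U !e; apply=> [i|i _]; by rewrite ?mem_enum ?inE.
have econs (k : 'I_m -> 'I_n) (j : 'I_m) (s' : seq 'I_m) (V : {set 'I_n}) :
  V :|: [set k i | i in j :: s'] = (k j |: V) :|: [set k i | i in s'].
  apply/setP => x; rewrite !inE; apply/orP/orP.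
    case=> [xV|/imsetP[t]]; first by left; rewrite xV orbT.
    by rewrite inE => /orP[/eqP -> ->|ts ->]; [left; rewrite eqxx | right; apply: imset_f].
  case=> [/orP[/eqP ->|->]|/imsetP[i is_ ->]]; [right|left|right] => //; apply: imset_f; by rewrite inE ?eqxx ?is_ ?orbT.
elim: s U => [|j s IH] U /=.
  move=> _ _ _; have e (k : 'I_m -> 'I_n) : [set k i | i in [::]] = finset.set0.
    by apply/setP => x; rewrite inE; apply/imsetP => -[].
  by rewrite !e.
move=> /andP[js us] sT hU; rewrite !econs => d.
have [nf df] := h j (sT j (mem_head _ _)).
apply: (IH _ us) => [t ts|t ts|]; first by apply: sT; rewrite inE ts orbT.
  have -> : g t \in g j |: U = (g t == g j) by rewrite in_setU1 (negPf (hU t _)) ?orbF // inE ts orbT.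
  by apply: contraNneq js => /gi <-.
rewrite -finset.setUA; apply: (exchange nf df); last by rewrite finset.setUA.
rewrite inE negb_or hU ?mem_head //=; apply/negP => /imsetP[i _ /eqP].
by rewrite eq_sym (negPf (fg _ _)).
Qed.

End Matroid.

(* A nonzero algebraic function on X' divides a nonzero function of the coordinates in T. *)
Lemma van_transfer (C : numClosedFieldType) n (X X' : ('I_n -> C) -> Prop) (prX' : vprime X') (T : {set 'I_n}) P :
  (forall u, X u -> X' u) -> ~ dep X T -> va prX' (sig T) P -> van X P -> van X' P.
Proof.
move=> XX nT aP vP; apply: contrapT => nP; have [Q [e [_ ne ve]]] := va_div aP nP.
apply: nT; exists (sig T e); split.
- apply/eqP => z; apply: ne => u _; have := congr1 (meval u) z; rewrite meval0; exact.
- exact: sig_sub.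
move=> u Xu; have := ve u (XX u Xu); rewrite mevalB mevalM vP // mul0r sub0r => /eqP.
by rewrite oppr_eq0 => /eqP.
Qed.

(** * Dependent coordinates of an irreducible closed set *)

Section Dependence.
Variable R : realType.
Local Notation C := R[i].
Variable n : nat.
Implicit Types (A V : pset R n) (x : pt R n) (T N : {set 'I_n}).

(* The coordinates in T are algebraically dependent on A; points with one of them at infinity are ignored. *)
Definition D A T := exists P : {mpoly C[n]}, [/\ P != 0, sig T P = P & subs A (ZT T P)].
Definition nc A i := ~ D A [set i].
Definition XT A T (v : 'I_n -> C) := exists2 x, A x & (forall i, i \in T -> x i != None) /\
  forall i, v i = if i \in T then fx x i else 0.

Lemma van_XT A T P : van (XT A T) P <-> subs A (ZT T P).
Proof.
split=> [h x Ax|h v [x Ax [fT e]]].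
  have [[i [iT xi]]|none] := pselect (exists i, i \in T /\ x i = None); first by left; exists i.
  right; rewrite sig_eval; apply: h; exists x => //; split=> // i iT.
  by apply/eqP => xi; apply: none; exists i.
case: (h x Ax) => [[i iT xi]|]; first by have := fT i iT; rewrite xi.
by rewrite sig_eval => <-; apply: meval_eq.
Qed.

Lemma D_closure A T : D (zclosure A) T <-> D A T.
Proof.
split=> -[P [P0 e h]]; exists P; split=> //; first by move=> x Ax; apply: (h x); exact: sub_zclosure.
by apply: zclosure_min => //; exact: ZT_closed.
Qed.

Lemma D_sub A V T : subs A V -> D V T -> D A T.
Proof. by move=> h [P [P0 e k]]; exists P; split=> // x /h/k. Qed.

Lemma nc_avoid A i (s : seq (P1 R)) : nc A i -> exists2 x, A x & x i \notin s.
Proof.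
move=> ni; apply: contrapT => no; apply: ni.
pose f : {poly C} := \prod_(a <- pmap id s) ('X - a%:P).
have f0 : f != 0 by rewrite prodf_seq_neq0; apply/allP => a _; rewrite polyXsubC_eq0.
have e : sig [set i] (uni f i : {mpoly C[n]}) = uni f i.
  by apply: meval_inj => u; rewrite sig_eval !uniE inE eqxx.
exists (uni f i); split=> // [|x Ax]; first exact: uni_neq0.
have xs : x i \in s by apply/negPn/negP => h; apply: no; exists x.
case xi : (x i) => [z|]; last by left; exists i; rewrite ?inE.
right; rewrite e uniE /fx xi /= /f horner_prod; apply/eqP; rewrite prodf_seq_eq0; apply/hasP; exists z.
  by rewrite mem_pmap map_id -xi.
by rewrite hornerD hornerN hornerX hornerC subrr /=.
Qed.

Lemma D_const V i : irred V -> D V [set i] -> exists a, forall x, V x -> x i = a.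
Proof.
move=> iV [P [P0 e h]]; pose f : {poly C} := lin i (fun=> 0) P.
have ev z : f.[z] = P.@[upd (fun=> 0) i z] by rewrite /f linE.
have evx x : (sig [set i] P).@[fx x] = f.[fx x i].
  by rewrite sig_eval ev; apply: meval_eq => k; rewrite /upd inE; case: eqP => // ->.
have f0 : f != 0.
  have [u Pu] := nonzero_pt P0; apply: contraNneq Pu => z; rewrite -{1}e.
  by have -> := evx (fun k => Some (u k)); rewrite z horner0.
have [rs hrs] := roots_seq f0.
have [||a _ ha] := @irred_bigor R n V _ (None :: [seq Some z | z <- rs]) (fun a x => x i = a) iV.
- by move=> a; exact: coord_closed.
- move=> x Vx; case xi : (x i) => [z|]; last by exists None.
  exists (Some z) => //; rewrite inE /=; apply/map_f; rewrite -hrs rootE.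
  by case: (h x Vx) => [[k]|]; [rewrite inE => /eqP ->; rewrite xi | rewrite evx /fx xi => ->].
by exists a.
Qed.

(** V is covered by Z and the closed sets where a coordinate of N is infinite; the latter cannot
    contain V, as these coordinates are not constant on V. *)
Lemma finite_part V N Z : irred V -> (forall i, i \in N -> nc V i) -> zclosed Z ->
  subs V (fun x => (exists2 i, i \in N & x i = None) \/ Z x) -> subs V Z.
Proof.
move=> iV ncN cZ h.
have [||[i|] is_ sub] := @irred_bigor R n V _ (None :: [seq Some i | i <- enum N])
    (fun o => match o with Some i => fun x => x i = None | None => Z end) iV.
- by case=> // i; exact: coord_closed.
- move=> x /h[[i iN xi]|Zx]; [exists (Some i) | exists None] => //.
  by rewrite inE /=; apply/map_f; rewrite mem_enum.
- move: is_; rewrite inE /= => /mapP[k]; rewrite mem_enum => kN [e]; rewrite e in sub.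
  have [x Vx] := nc_avoid [:: None] (ncN k kN).
  by rewrite inE sub.
exact: sub.
Qed.

Lemma prime_XT V N : irred V -> (forall i, i \in N -> nc V i) -> vprime (XT V N).
Proof.
move=> iV ncN; split.
  apply: contrapT => no; have : van (XT V N) 1 by move=> u Xu; case: no; exists u.
  move=> /van_XT h; have [_ [[x Vx] _]] := iV.
  have c0 : zclosed (fun x : pt R n => False).
    by apply: (zclosed_ext (zclosed_bigor [::] (fun i : 'I_n => @coord_closed R n i None))) => y; split=> // -[].
  apply: (finite_part iV ncN c0 _ Vx) => y /h[[i iN yi]|/eqP]; first by left; exists i.
  by rewrite rmorph1 meval1 oner_eq0.
move=> P Q /van_XT h; have [_ [_ ir]] := iV.
have [|k|k] := ir _ _ (@ZT_closed R n N P) (@ZT_closed R n N Q); [|left|right]; try by apply/van_XT.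
move=> x /h[[i iN xi]|/eqP]; first by left; left; exists i.
by rewrite rmorphM /= mevalM mulf_eq0 => /orP[/eqP|/eqP] e; [left|right]; right.
Qed.

Lemma D_XT V N T : irred V -> (forall i, i \in N -> nc V i) -> T \subset N -> D V T <-> dep (XT V N) T.
Proof.
move=> iV ncN TN; split=> -[P [P0 e h]]; exists P; split=> //.
  apply/van_XT => x /h[[i iT xi]|z]; first by left; exists i => //; exact: (fintype.subsetP TN).
  by right; rewrite -e sig_sub.
move/van_XT: h => h; apply: (finite_part iV ncN); first exact: ZT_closed.
move=> x /h[[i iN xi]|z]; first by left; exists i.
by right; right; rewrite -(sig_sub P TN) e.
Qed.
End Dependence.

Section Projection.
Variable R : realType.
Variables (r n : nat) (g : 'I_r -> 'I_n).
Hypothesis gi : injective g.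
Implicit Types (A : pset R n).

Definition comp A : pset R r := fun y => exists2 x, A x & (fun k => x (g k)) = y.

Lemma ZT_ren A (T : {set 'I_r}) P : subs (comp A) (ZT T P) <-> subs A (ZT (g @: T) (ren g P)).
Proof.
have E x : (sig (g @: T) (ren g P)).@[fx x] = (sig T P).@[fx (fun k => x (g k))] by rewrite -ren_sig // ren_eval.
split=> [h x Ax|h _ [x Ax <-]].
  have [[k kT xk]|z] := h _ (ex_intro2 _ _ x Ax erefl); last by right; rewrite E.
  by left; exists (g k) => //; exact: imset_f.
by have [[_ /imsetP[k kT ->] xk]|z] := h x Ax; [left; exists k | right; rewrite -E].
Qed.

Lemma D_comp A (T : {set 'I_r}) : D (comp A) T <-> D A (g @: T).
Proof.
split=> -[P [P0 e h]].
  exists (ren g P); split; last exact/ZT_ren.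
    by apply: contraNneq P0 => z; rewrite -(renK gi P) z rmorph0.
  by rewrite -(ren_sig gi) e.
have rP : ren g (unren g P) = P by rewrite -e unrenK.
exists (unren g P); split.
- by apply: contraNneq P0 => z; rewrite -rP z rmorph0.
- by apply: (can_inj (renK gi)); rewrite (ren_sig gi) rP.
by apply/ZT_ren; rewrite rP.
Qed.
End Projection.

(** * Circuits of a preperiodic variety *)

Section Transport.
Variable R : realType.
Local Notation C := R[i].

Lemma seteq_eq n (A B : pset R n) : seteq A B -> A = B.
Proof. by move=> h; apply: funext => x; apply: propext; exact: h. Qed.

Lemma ratP1_id (x : P1 R) : ratP1 'X 1 x = x.
Proof.
case: x => [z|] /=; first by rewrite hornerX hornerC oner_eq0 divr1.
by rewrite /rdeg size_polyX size_poly1 /= coef1 eqxx.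
Qed.
Lemma coprime_id : coprimep ('X : {poly C}) 1. Proof. exact: coprimep1. Qed.
Lemma rdeg_id : rdeg ('X : {poly C}) 1 = 1%N. Proof. by rewrite /rdeg size_polyX size_poly1. Qed.

Section Comp.
Variables (r n : nat) (g : 'I_r -> 'I_n).
Let cmapE (x : pt R n) : cmap g (fun=> 'X) (fun=> 1) x = fun k => x (g k).
Proof. by apply: funext => k; exact: ratP1_id. Qed.
Let compE (A : pset R n) : comp g A = fun y => exists2 x, A x & cmap g (fun=> 'X) (fun=> 1) x = y.
Proof. by apply: seteq_eq => y; split=> -[x Ax <-]; exists x => //; rewrite cmapE. Qed.
Let cid1 (k : 'I_r) := coprime_id.
Let did1 (k : 'I_r) : (0 < rdeg ('X : {poly C}) 1)%N. Proof. by rewrite rdeg_id. Qed.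

Lemma cl_comp (A : pset R n) : zclosure (comp g (zclosure A)) = zclosure (comp g A).
Proof. by rewrite !compE; apply: seteq_eq; exact: zclosure_image. Qed.
Lemma irred_comp (V : pset R n) : irred V -> irred (zclosure (comp g V)).
Proof. by rewrite compE; exact: irred_image. Qed.
End Comp.

Section Iterate.
Variables (n : nat) (p q : 'I_n -> {poly C}).
Hypotheses (cpq : forall i, coprimep (p i) (q i)) (d1 : forall i, (1 < rdeg (p i) (q i))%N).

Lemma iter_Phi m (x : pt R n) : iter m (Phi p q) x = fun k => iter m (ratP1 (p k) (q k)) (x k).
Proof. by elim: m => //= m ->. Qed.

Lemma iterates m : exists pm qm : 'I_n -> {poly C}, [/\ forall i, coprimep (pm i) (qm i),
  forall i, rdeg (pm i) (qm i) = (rdeg (p i) (q i) ^ m)%N,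
  forall i x, ratP1 (pm i) (qm i) x = iter m (ratP1 (p i) (q i)) x &
  forall x : pt R n, iter m (Phi p q) x = cmap id pm qm x].
Proof.
have ex i : exists pq : {poly C} * {poly C}, [/\ coprimep pq.1 pq.2, rdeg pq.1 pq.2 = (rdeg (p i) (q i) ^ m)%N
    & forall x, ratP1 pq.1 pq.2 x = iter m (ratP1 (p i) (q i)) x].
  by have [pk [qk h]] := iter_rat m (cpq i); exists (pk, qk).
pose pq i := projT1 (cid (ex i)); have hpq i := projT2 (cid (ex i)).
exists (fun i => (pq i).1), (fun i => (pq i).2); split=> [i|i|i x|x]; try by have [] := hpq i.
by rewrite iter_Phi; apply: funext => k; rewrite /cmap /pq; have [_ _ ->] := hpq k.
Qed.

Lemma rdeg_exp m i : (0 < rdeg (p i) (q i) ^ m)%N. Proof. by rewrite expn_gt0 ltnW. Qed.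

Lemma image_cmap m (A : pset R n) pm qm : (forall x : pt R n, iter m (Phi p q) x = cmap id pm qm x) ->
  Defs.image (iter m (Phi p q)) A = fun y => exists2 x, A x & cmap id pm qm x = y.
Proof. by move=> h; apply: seteq_eq => y; split=> [[x [Ax <-]]|[x Ax <-]]; exists x; rewrite ?h. Qed.

Lemma cl_Phi m (A : pset R n) :
  zclosure (Defs.image (iter m (Phi p q)) (zclosure A)) = zclosure (Defs.image (iter m (Phi p q)) A).
Proof.
have [pm [qm [c d _ h]]] := iterates m; rewrite !(image_cmap _ h); apply: seteq_eq; apply: zclosure_image => // k.
by rewrite d rdeg_exp.
Qed.

Lemma irred_Phi m (V : pset R n) : irred V -> irred (zclosure (Defs.image (iter m (Phi p q)) V)).
Proof.
have [pm [qm [c d _ h]]] := iterates m; rewrite (image_cmap _ h); apply: irred_image => // k.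
by rewrite d rdeg_exp.
Qed.
End Iterate.

Lemma comp_Phi r n (g : 'I_r -> 'I_n) (p q : 'I_n -> {poly C}) m (A : pset R n) :
  Defs.image (iter m (Phi (fun k => p (g k)) (fun k => q (g k)))) (comp g A) = comp g (Defs.image (iter m (Phi p q)) A).
Proof.
apply: seteq_eq => y; split=> [[_ [[x Ax <-] <-]]|[_ [x [Ax <-]] <-]].
  by exists (iter m (Phi p q) x); [exists x | rewrite !iter_Phi].
by exists (fun k => x (g k)); split; [exists x | rewrite !iter_Phi].
Qed.

Section Periodic.
Variables (r n : nat) (g : 'I_r -> 'I_n) (p q : 'I_n -> {poly C}).
Hypotheses (cpq : forall i, coprimep (p i) (q i)) (d1 : forall i, (1 < rdeg (p i) (q i))%N).
Local Notation pg := (fun k => p (g k)).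
Local Notation qg := (fun k => q (g k)).

Lemma comp_image m (A : pset R n) : zclosure (Defs.image (iter m (Phi pg qg)) (zclosure (comp g A))) =
  zclosure (comp g (zclosure (Defs.image (iter m (Phi p q)) A))).
Proof. by rewrite cl_Phi // comp_Phi cl_comp. Qed.
End Periodic.

Section Circuits.
Variables (r : nat) (p q : 'I_r -> {poly C}) (W : pset R r) (k : nat).
Hypotheses (cpq : forall i, coprimep (p i) (q i)) (d1 : forall i, (1 < rdeg (p i) (q i))%N).
Hypotheses (iW : irred W) (k0 : (0 < k)%N) (perW : zclosure (Defs.image (iter k (Phi p q)) W) = W).

(** The relation is derived for the iterate that fixes W; [inv_form_iter] descends the resulting
    form to the map of coordinate a itself. *)
Lemma circuit_exceptional (a b c : 'I_r) : a != b -> c != a -> c != b -> (forall i, nc W i) ->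
  D W [set: 'I_r] -> (forall i, i \in [:: a; b; c] -> ~ D W [set~ i]) -> exceptional (p a) (q a).
Proof.
move=> ab ca cb ncW dW cW.
have [pk [qk [ck dk ik hk]]] := iterates cpq k.
have dk1 i : (1 < rdeg (pk i) (qk i))%N by rewrite dk -{1}(expn0 (rdeg (p i) (q i))) ltn_exp2l.
have q0 i : qk i != 0 by apply: q_neq0 => //; exact: ltnW.
have ncT i : i \in [set: 'I_r] -> nc W i by move=> _; exact: ncW.
have prX := prime_XT iW ncT.
set X := XT W [set: 'I_r] in prX.
have XP u : X u <-> exists2 x, W x & forall i, x i = Some (u i).
  split=> [[x Wx [fX e]]|[x Wx e]]; exists x => //.
    by move=> i; have := fX i (finset.in_setT i); rewrite e finset.in_setT /fx; case: (x i).
  by split=> i; rewrite ?finset.in_setT /= ?e // /fx e.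
have sT (P : {mpoly C[r]}) : sig [set: 'I_r] P = P.
  by apply: meval_inj => u; rewrite sig_eval; apply: meval_eq => i; rewrite finset.in_setT.
have kU u x : fin qk u -> (forall i, x i = Some (u i)) -> forall i, iter k (Phi p q) x i = Some (Fm pk qk u i).
  by move=> fu e i; rewrite hk /cmap e /ratP1 fu.
have invX u : X u -> fin qk u -> X (Fm pk qk u).
  move=> /XP[x Wx e] fu; apply/XP; exists (iter k (Phi p q) x); last exact: kU.
  by rewrite -perW; apply: sub_zclosure; exists x.
have nvan_single P i : P != 0 -> sig [set i] P = P -> ~ van X P.
  by move=> P0 e v; apply: (ncW i); apply/(D_XT iW ncT (finset.subsetT _)); exists P.
have nden : ~ van X (den qk).
  apply: (van_bigprod prX) => i; apply: (@nvan_single _ i); first exact: uni_neq0.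
  by apply: meval_inj => u; rewrite sig_eval !uniE inE eqxx.
(* W is covered by the closed set of points whose image satisfies P = 0 or is partly infinite, and
   by the points where a denominator vanishes or a coordinate is infinite. Irreducibility selects
   the first, and W is the closure of its own image. *)
have domX (P : {mpoly C[r]}) : (forall u, X u -> fin qk u -> P.@[Fm pk qk u] = 0) -> van X P.
  move=> h; apply/van_XT.
  have cZ : zclosed (fun x : pt R r => ZT [set: 'I_r] P (cmap id pk qk x)).
    by apply: (cmap_closed _ ck) => [i|]; [exact: ltnW | exact: ZT_closed].
  have [_ [_ ir]] := iW.
  have [|sub|sub] := ir _ _ cZ (@ZT_closed R r [set: 'I_r] (den qk)).
  - move=> x Wx; have [[i xi]|none] := pselect (exists i, x i = None); first by right; left; exists i.
    have [u e] : exists u, forall i, x i = Some (u i).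
      by exists (fx x) => i; rewrite /fx; case xi : (x i) => //; case: none; exists i.
    have [z|/den_fin fu] := eqVneq (den qk).@[u] 0.
      by right; right; rewrite sT -z; apply: meval_eq => i; rewrite /fx e.
    have Xu : X u by apply/XP; exists x.
    left; right; rewrite sT -(h u Xu fu).
    by apply: meval_eq => i; rewrite /fx -hk (kU u x fu e).
  - by move=> x Wx; rewrite -perW in Wx; apply: zclosure_min Wx; [exact: ZT_closed | move=> _ [y [Wy <-]]; rewrite hk; exact: sub].
  by case: nden; apply/van_XT.
have cirX i (P : {mpoly C[r]}) : i \in [:: a; b; c] -> P != 0 -> indep i P -> ~ van X P.
  move=> iin P0 iP v; apply: (cW i iin); apply/(D_XT iW ncT (finset.subsetT _)); exists P; split=> //.
  apply: meval_inj => u; rewrite sig_eval -(iP u 0); apply: meval_eq => t.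
  by rewrite !inE /upd; case: eqP.
have depX : exists2 P : {mpoly C[r]}, P != 0 & van X P.
  by have [P [P0 _ vP]] := (D_XT iW ncT (finset.subsetT _)).1 dW; exists P.
have [gam qg] := cof_ex (cof_root (q0 c)).
have [N0 [N1 [D [D0 N00 N10 E]]]] := circuit_relation q0 qg ab ca cb prX invX domX depX cirX.
have [A' [B' [t [A0 B0 t0 I]]]] := specialise ck dk1 ab N00 N10 E.
have [t' t'0 I'] := inv_form_iter (cpq a) (d1 a) (ck a) (dk1 a) (ik a) A0 B0 t0 I.
exact: exceptional_of_form (cpq a) (d1 a) D0 A0 B0 t'0 I'.
Qed.
End Circuits.

(** * Dependence on a variety and on its images *)

Section Graph.
Variables (n : nat) (p q : 'I_n -> {poly C}) (V : pset R n) (m : nat).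
Hypotheses (cpq : forall i, coprimep (p i) (q i)) (d1 : forall i, (1 < rdeg (p i) (q i))%N) (iV : irred V).
Local Notation W := (zclosure (Defs.image (iter m (Phi p q)) V)).

Lemma nc_image i : nc V i -> nc W i.
Proof.
move=> nV dW; have [a Wa] := D_const (irred_Phi cpq d1 m iV) dW.
have [pm [qm [c d _ h]]] := iterates cpq m.
have [B hB] := @fin_fiber R (pm i) (qm i) [:: a] (c i) ltac:(by rewrite d rdeg_exp).
have [x Vx] := nc_avoid B nV; rewrite hB // inE.
have -> : ratP1 (pm i) (qm i) (x i) = iter m (Phi p q) x i by rewrite h.
by apply/eqP/Wa; apply: sub_zclosure; exists x.
Qed.

(* On the closure of the graph of the m-th iterate the coordinates [lshift n i] and [rshift n i] are parallel. *)
Lemma D_image (T : {set 'I_n}) : (forall i, i \in T -> nc V i) -> D V T <-> D W T.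
Proof.
move=> ncT; have [pm [qm [c d _ h]]] := iterates cpq m.
pose e2 (k : 'I_(n + n)) := match fintype.split k with inl i => i | inr i => i end.
pose p2 (k : 'I_(n + n)) : {poly C} := match fintype.split k with inl _ => 'X | inr i => pm i end.
pose q2 (k : 'I_(n + n)) : {poly C} := match fintype.split k with inl _ => 1 | inr i => qm i end.
pose gr y := exists2 x, V x & cmap e2 p2 q2 x = y; pose V2 := zclosure gr.
have cmL x i : cmap e2 p2 q2 x (lshift n i) = x i.
  by rewrite /cmap /e2 /p2 /q2 (unsplitK (inl i)); exact: ratP1_id.
have cmR x i : cmap e2 p2 q2 x (rshift n i) = ratP1 (pm i) (qm i) (x i).
  by rewrite /cmap /e2 /p2 /q2 (unsplitK (inr i)).
have iV2 : irred V2.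
  apply: irred_image iV => k; rewrite /p2 /q2; case: (fintype.split k) => i //; first exact: coprime_id.
    by rewrite rdeg_id.
  by rewrite d rdeg_exp.
have compL : comp (@lshift n n) gr = V.
  apply: seteq_eq => y; split=> [[_ [x Vx <-] <-]|Vy].
    by rewrite (_ : (fun k => _) = x) //; apply: funext => i; rewrite cmL.
  by exists (cmap e2 p2 q2 y); [exists y | apply: funext => i; rewrite cmL].
have compR : comp (@rshift n n) gr = Defs.image (iter m (Phi p q)) V.
  apply: seteq_eq => y; split=> [[_ [x Vx <-] <-]|[x [Vx <-]]].
    by exists x; split=> //; apply: funext => i; rewrite cmR h.
  by exists (cmap e2 p2 q2 x); [exists x | apply: funext => i; rewrite cmR h].
have DL (T' : {set 'I_n}) : D V2 (@lshift n n @: T') <-> D V T'.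
  by rewrite -compL; apply: (iff_trans (D_closure _ _)); apply: iff_sym; apply: D_comp; exact: lshift_inj.
have DR (T' : {set 'I_n}) : D V2 (@rshift n n @: T') <-> D W T'.
  apply: (iff_trans (D_closure _ _)); apply: iff_trans (iff_sym (D_closure _ _)).
  by rewrite -compR; apply: iff_sym; apply: D_comp; exact: rshift_inj.
pose N := [set k : 'I_(n + n) | `[<nc V2 k>]].
have ncN k : k \in N -> nc V2 k by rewrite inE => /asboolP.
have nL i : i \in T -> lshift n i \in N.
  by move=> /ncT ni; rewrite inE; apply/asboolP; rewrite /nc -imset_set1 => /DL.
have nR i : i \in T -> rshift n i \in N.
  by move=> /ncT /nc_image ni; rewrite inE; apply/asboolP; rewrite /nc -imset_set1 => /DR.
have subN (f : 'I_n -> 'I_(n + n)) : (forall i, i \in T -> f i \in N) -> f @: T \subset N.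
  by move=> hf; apply/fintype.subsetP => _ /imsetP[t tT ->]; exact: hf.
have pair i : D V2 [set rshift n i; lshift n i].
  (* The equation y q(x) = p(x) of the graph of a coordinate map. *)
  pose P : {mpoly C[n + n]} := 'X_(rshift n i) * uni (qm i) (lshift n i) - uni (pm i) (lshift n i).
  have Pe u : P.@[u] = u (rshift n i) * (qm i).[u (lshift n i)] - (pm i).[u (lshift n i)].
    by rewrite mevalB mevalM mevalXU !uniE.
  have sP : sig [set rshift n i; lshift n i] P = P.
    by apply: meval_inj => u; rewrite sig_eval !Pe !inE !eqxx orbT.
  exists P; split=> //.
    have qi : qm i != 0 by apply: (q_neq0 (c i)); rewrite d rdeg_exp.
    have [z qz] := cof_ex (cof_root qi).
    pose u := upd (fun=> z) (rshift n i) ((pm i).[z] / (qm i).[z] + 1).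
    have : P.@[u] != 0.
      by rewrite Pe /u /upd eqxx eq_lrshift mulrDl divfK // mul1r addrC addKr.
    by apply: contraNneq => ->; rewrite meval0.
  apply: zclosure_min; first exact: ZT_closed.
  move=> _ [x Vx <-]; case xi : (x i) => [z|]; last first.
    by left; exists (lshift n i); rewrite ?inE ?eqxx ?orbT // cmL.
  have [qz|qz] := eqVneq (qm i).[z] 0.
    by left; exists (rshift n i); rewrite ?inE ?eqxx // cmR xi /= qz eqxx.
  by right; rewrite sP Pe /fx cmL cmR xi /= qz /= divfK // subrr.
have prX := prime_XT iV2 ncN.
have single k : k \in N -> ~ dep (XT V2 N) [set k].
  by move=> kN /(D_XT iV2 ncN); rewrite finset.sub1set => /(_ kN); exact: ncN.
have pairX i : i \in T -> dep (XT V2 N) [set rshift n i; lshift n i].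
  move=> iT; apply/(D_XT iV2 ncN); last exact: pair.
  by apply/fintype.subsetP => k; rewrite in_set2 => /orP[/eqP ->|/eqP ->]; [exact: nR | exact: nL].
have sL := subN _ nL; have sR := subN _ nR.
split=> dT.
  have dX := (D_XT iV2 ncN sL).1 ((DL T).2 dT); apply: (DR T).1; apply: (D_XT iV2 ncN sR).2.
  apply: (exchange_all prX _ _ _ dX); [exact: rshift_inj | by move=> t t'; rewrite eq_lrshift |].
  by move=> t tT; split; [exact: single (nL t tT) | exact: pairX].
have dX := (D_XT iV2 ncN sR).1 ((DR T).2 dT); apply: (DL T).1; apply: (D_XT iV2 ncN sL).2.
apply: (exchange_all prX _ _ _ dX); [exact: lshift_inj | by move=> t t'; rewrite eq_rlshift |].
by move=> t tT; split; [exact: single (nR t tT) | rewrite finset.setUC; exact: pairX].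
Qed.

Variable (k : nat).
Hypotheses (k0 : (0 < k)%N) (perW : zclosure (Defs.image (iter k (Phi p q)) W) = W).

(** Otherwise U would be a circuit. Dependence is the same on V and on its periodic image, so after
    relabelling the coordinates of U one is in the situation of [circuit_exceptional]. *)
Lemma no_circuit (U : {set 'I_n}) : (forall i, ~ exceptional (p i) (q i)) -> (2 < #|U|)%N ->
  (forall i, i \in U -> nc V i) -> D V U -> exists2 i, i \in U & D V (U :\ i).
Proof.
move=> nex U3 ncU dU; apply: contrapT => no.
pose g (t : 'I_#|U|) := enum_val t.
have gi : injective g by exact: enum_val_inj.
have gU t : g t \in U by exact: enum_valP.
have imT : g @: [set: 'I_#|U|] = U.
  apply/setP => x; apply/imsetP/idP => [[t _ ->] //|xU].
  by exists (enum_rank_in xU x); rewrite ?finset.in_setT // /g enum_rankK_in.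
have imC t : g @: [set~ t] = U :\ g t.
  apply/setP => x; rewrite in_setD1; apply/imsetP/andP => [[t' t't ->]|[xt xU]].
    by split=> //; apply: contraTneq t't => /gi ->; rewrite !inE eqxx.
  exists (enum_rank_in xU x); last by rewrite /g enum_rankK_in.
  by rewrite !inE; apply: contraNneq xt => <-; rewrite /g enum_rankK_in.
have iW := irred_Phi cpq d1 m iV.
pose Wg := zclosure (comp g W); have iWg := irred_comp g iW.
have DW T : D Wg T <-> D W (g @: T) by apply: (iff_trans (D_closure _ _)); exact: D_comp.
have a0 : (0 < #|U|)%N := ltn_trans (ltnSn 0) (ltn_trans (ltnSn 1) U3).
have a1 : (1 < #|U|)%N := ltn_trans (ltnSn 1) U3.
pose a := Ordinal a0; pose b := Ordinal a1; pose c := Ordinal U3.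
apply: (nex (g a)).
have perWg : zclosure (Defs.image (iter k (Phi (fun t => p (g t)) (fun t => q (g t)))) Wg) = Wg.
  by rewrite /Wg (comp_image g cpq d1) perW.
apply: (circuit_exceptional (fun t => cpq (g t)) (fun t => d1 (g t)) iWg k0 perWg (a := a) (b := b) (c := c)) => //.
- by move=> t /(DW _).1; rewrite imset_set1; exact: nc_image (ncU _ (gU t)).
- by apply: (DW _).2; rewrite imT; exact: (D_image ncU).1.
move=> t _ /(DW _).1; rewrite imC => dt; apply: no; exists (g t); first exact: gU.
by apply: (D_image _).2 dt => i; rewrite in_setD1 => /andP[_ /ncU].
Qed.
End Graph.
End Transport.

(** * Curves in P^1 x P^1 *)

Section Curves.
Variable R : realType.
Local Notation C := R[i].
Local Notation P1 := (P1 R).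

Lemma D_mono n (A : pset R n) (T U : {set 'I_n}) : T \subset U -> D A T -> D A U.
Proof.
move=> TU [P [P0 e h]]; exists P; split; [exact: P0 | by rewrite -e (sig_sub P TU) |].
move=> x /h[[i iT xi]|z]; first by left; exists i => //; exact: (fintype.subsetP TU).
by right; rewrite -(sig_sub P TU) e in z.
Qed.

Lemma nD0 n (A : pset R n) : (exists x, A x) -> ~ D A finset.set0.
Proof.
move=> [x Ax] [P [P0 e h]]; have [u Pu] := nonzero_pt P0.
have : P.@[u] = (sig finset.set0 P).@[fx x].
  by rewrite -{1}e !sig_eval; apply: meval_eq => i; rewrite !inE.
by case: (h x Ax) => [[t]|-> e0]; [rewrite inE | rewrite e0 eqxx in Pu].
Qed.

Lemma fresh (s : seq P1) : exists t : C, Some t \notin s.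
Proof.
have [t ht] := @cof_ex R (fun t => t \notin pmap id s) ltac:(by exists (pmap id s)).
by exists t; apply: contra ht; rewrite mem_pmap map_id.
Qed.

Lemma In_map (A : Type) (B : eqType) (f : A -> B) l x : List.In x l -> f x \in map f l.
Proof. by elim: l => //= y l IH [->|/IH h]; rewrite inE ?eqxx // h orbT. Qed.

(** Used with the diagonal pair (i, i): a point projects into [line a] exactly when its coordinate i
    equals a, which encodes a constant coordinate by a curve. *)
Definition line (a : P1) : pset R 2 := fun y => y ord0 = a.
Definition mk2 (a b : P1) : pt R 2 := fun k => if val k == 0%N then a else b.

Let ord2P (k : 'I_2) : k = ord0 \/ k = ord_max.
Proof. by case: k => -[|[|//]] h; [left|right]; apply: val_inj. Qed.

(* In homogeneous coordinates a nonzero value at infinity persists at nearby finite points. *)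
Lemma line_generic a (P : {mpoly C[2 + 2]}) y : multihom P -> line a y -> P.@[hcoord y] != 0 ->
  exists t, P.@[hcoord (mk2 a (Some t))] != 0.
Proof.
move=> [dg mP] ya Py; have yE : y = mk2 a (y ord_max).
  by apply: funext => k; have [->|->] := ord2P k; rewrite /mk2 /= ?ya.
case y1 : (y ord_max) => [t|]; rewrite y1 in yE; first by exists t; rewrite -yE.
pose g := lin (rshift 2 ord_max) (hcoord y) P.
have g0 : g.[0] != 0.
  rewrite linE; apply: contra Py => /eqP <-; apply/eqP/meval_eq => kk.
  by rewrite /upd; case: eqP => // ->; rewrite hcoord_r y1.
have gn0 : g != 0 by apply: contraNneq g0 => ->; rewrite horner0.
have [s [gs s0]] := cof_ex (cof_and (cof_root gn0) (@cof_root R 'X (negbT (polyX_eq0 _)))).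
rewrite hornerX in s0; exists s^-1; apply: contra gs => /eqP e; rewrite linE.
pose lam (k : 'I_2) := if val k == 0%N then 1 else s.
rewrite (mhom_scale (v := hcoord (mk2 a (Some s^-1))) (lam := lam) mP) ?e ?mulr0 // => k.
  rewrite /upd eq_lrshift !hcoord_l yE /mk2 /lam; case: ifP => _; first by rewrite mul1r.
  by rewrite divff.
rewrite /upd eq_rshift !hcoord_r yE /mk2 /lam; have [->|->] := ord2P k; rewrite /= ?mul1r //.
by rewrite mulr1.
Qed.

Lemma line_curve a : curve2 (line a).
Proof.
have cl : zclosed (line a) by exact: coord_closed.
split; [split=> //; split|split].
- by exists (mk2 a a).
- move=> Z1 Z2 c1 c2 h; apply: contrapT => /not_orP[n1 n2].
  have wit Z : zclosed Z -> ~ subs (line a) Z -> exists P t, [/\ multihom P, (forall y, Z y -> P.@[hcoord y] = 0) & P.@[hcoord (mk2 a (Some t))] != 0].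
    move=> [E [hE ZE]] nZ; apply: contrapT => no; apply: nZ => y ly; apply/ZE => P EP.
    apply: contrapT => /eqP Py; have [t ht] := line_generic (hE P EP) ly Py.
    by apply: no; exists P, t; split=> [||//]; [exact: hE | move=> z /ZE/(_ _ EP)].
  have [P1 [t1 [m1 v1 e1]]] := wit Z1 c1 n1; have [P2 [t2 [m2 v2 e2]]] := wit Z2 c2 n2.
  pose g P := lin (lshift 2 (ord_max : 'I_2)) (hcoord (mk2 a (Some 0))) P.
  have gE P t : (g P).[t] = P.@[hcoord (mk2 a (Some t))].
    rewrite linE; apply: meval_eq => kk; rewrite -(splitK kk) /upd; case: (fintype.split kk) => k /=.
      by rewrite eq_lshift !hcoord_l; have [->|->] := ord2P k.
    by rewrite !hcoord_r; have [->|->] := ord2P k.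
  have g1 : g P1 != 0 by apply: contraNneq e1 => z; rewrite -gE z horner0.
  have g2 : g P2 != 0 by apply: contraNneq e2 => z; rewrite -gE z horner0.
  have [t [h1 h2]] := cof_ex (cof_and (cof_root g1) (cof_root g2)).
  have [/v1 z|/v2 z] := h (mk2 a (Some t)) erefl; [move: h1 | move: h2]; by rewrite gE z eqxx.
- have [t ht] := fresh [:: a]; exists (mk2 (Some t) a) => e; move: ht; rewrite inE.
  by move: e; rewrite /line /mk2 /= => ->; rewrite eqxx.
move=> l; have [t ht] := fresh [seq y ord_max | y <- l].
exists (mk2 a (Some t)); split=> // hl; move: ht => /negP; apply.
exact: (In_map (fun y : pt R 2 => y ord_max) hl).
Qed.

Section Pairs.
Variables (n : nat) (p q : 'I_n -> {poly C}).
Hypotheses (cpq : forall i, coprimep (p i) (q i)) (d1 : forall i, (1 < rdeg (p i) (q i))%N).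

Definition pick2 (i j : 'I_n) (k : 'I_2) := if val k == 0%N then i else j.

Lemma Phi2E i j : Phi2 p q i j = Phi (fun k => p (pick2 i j k)) (fun k => q (pick2 i j k)).
Proof. by apply: funext => y; apply: funext => k; rewrite /Phi2 /Phi /pick2; case: ifP. Qed.
Lemma proj2E i j (x : pt R n) : proj2 i j x = fun k => x (pick2 i j k).
Proof. by apply: funext => k; rewrite /proj2 /pick2; case: ifP. Qed.
Lemma pick2_inj i j : i != j -> injective (pick2 i j).
Proof.
move=> /eqP ij k k'; have [->|->] := ord2P k; have [->|->] := ord2P k'; rewrite /pick2 //= => e; case: ij => //.
Qed.
Lemma pick2_im i j : pick2 i j @: [set: 'I_2] = [set i; j].
Proof.
apply/setP => t; rewrite in_set2; apply/imsetP/orP => [[k _ ->]|[/eqP ->|/eqP ->]].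
- by have [->|->] := ord2P k; [left|right].
- by exists ord0; rewrite ?finset.in_setT.
by exists ord_max; rewrite ?finset.in_setT.
Qed.

Lemma iter_surj i m (y : P1) : exists x, iter m (ratP1 (p i) (q i)) x = y.
Proof.
elim: m y => [|m IH] y; first by exists y.
have [z <-] := ratP1_surj y (cpq i) (ltnW (d1 i)); have [x <-] := IH z.
by exists x.
Qed.

Lemma image_line i a m : Defs.image (iter m (Phi2 p q i i)) (line a) = line (iter m (ratP1 (p i) (q i)) a).
Proof.
rewrite Phi2E; have e (k : 'I_2) : pick2 i i k = i by rewrite /pick2; case: ifP.
apply: seteq_eq => y; split=> [[x [xa <-]]|yb].
  by rewrite /line iter_Phi e xa.
have [x1 e1] := iter_surj i m (y ord_max).
exists (mk2 a x1); split=> //; rewrite iter_Phi; apply: funext => k; rewrite e.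
by have [->|->] := ord2P k; rewrite /mk2 /= ?e1 ?yb.
Qed.

Variables (V : pset R n) (m k : nat).
Hypotheses (iV : irred V) (k0 : (0 < k)%N).
Local Notation W := (zclosure (Defs.image (iter m (Phi p q)) V)).
Hypothesis perW : zclosure (Defs.image (iter k (Phi p q)) W) = W.

Lemma line_preperiodic i a : (forall x, V x -> x i = a) -> preperiodic (Phi2 p q i i) (line a).
Proof.
move=> Va; pose f := ratP1 (p i) (q i); pose b := iter m f a.
have Wb x : W x -> x i = b.
  by move=> h; apply: (zclosure_min (coord_closed i b) _ h) => _ [y [Vy <-]]; rewrite iter_Phi Va.
have [_ [[x Vx] _]] := iV.
have Ww : W (iter m (Phi p q) x) by apply: sub_zclosure; exists x.
have bk : iter k f b = b.
  have /Wb : W (iter k (Phi p q) (iter m (Phi p q) x)).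
    by rewrite -perW; apply: sub_zclosure; exists (iter m (Phi p q) x).
  by rewrite iter_Phi (Wb _ Ww).
have cl c : zclosure (line c) = line c by apply: seteq_eq; apply: zclosure_id; exact: coord_closed.
exists m, k; split=> //; rewrite image_line cl -/f -/b image_line -/f bk cl.
by move=> y; split.
Qed.

Lemma pair_preperiodic i j : preperiodic (Phi2 p q i j) (zclosure (comp (pick2 i j) V)).
Proof.
exists m, k; split=> //; rewrite Phi2E !(comp_image (pick2 i j) cpq d1) perW.
by move=> y; split.
Qed.

Lemma pair_curve i j : i != j -> nc V i -> D V [set i; j] -> curve2 (zclosure (comp (pick2 i j) V)).
Proof.
move=> ij ni dij; split; first exact: irred_comp.
have DC : D (zclosure (comp (pick2 i j) V)) [set: 'I_2].
  by apply: (D_closure _ _).2; apply: (D_comp (pick2_inj ij) _ _).2; rewrite pick2_im.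
split.
  have [P [P0 e h]] := DC; have [u Pu] := nonzero_pt P0.
  exists (fun t => Some (u t)) => /h[[]//|]; rewrite e => z; move: Pu.
  by rewrite -z eqxx.
move=> l; have [x Vx xl] := nc_avoid [seq y ord0 | y <- l] ni.
exists (fun t => x (pick2 i j t)); split; first by apply: sub_zclosure; exists x.
move=> hl; move: xl => /negP; apply.
exact: (In_map (fun y : pt R 2 => y ord0) hl).
Qed.
End Pairs.
End Curves.

(** * The component cut out by the curves *)

Section Component.
Variable R : realType.
Local Notation C := R[i].
Variables (n : nat) (p q : 'I_n -> {poly C}).
Hypotheses (cpq : forall i, coprimep (p i) (q i)) (d1 : forall i, (1 < rdeg (p i) (q i))%N)
  (nex : forall i, ~ exceptional (p i) (q i)).
Variables (V : pset R n) (m k : nat).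
Hypotheses (iV : irred V) (k0 : (0 < k)%N).
Local Notation W := (zclosure (Defs.image (iter m (Phi p q)) V)).
Hypothesis perW : zclosure (Defs.image (iter k (Phi p q)) W) = W.

Local Notation N := [set i : 'I_n | `[<nc V i>]].

Lemma ncN i : i \in N -> nc V i.
Proof. by rewrite inE => /asboolP. Qed.

Lemma parallel_to_base (T0 : {set 'I_n}) j : T0 \subset N -> ~ D V T0 -> j \in N -> j \notin T0 -> D V (j |: T0) ->
  exists2 i, i \in T0 & D V [set i; j].
Proof.
move=> TN nT jN jT dj.
have [|T [TT dT] Tmin] := @min_size _ (fun T : {set 'I_n} => #|T|) (fun T => T \subset T0 /\ D V (j |: T)).
  by exists T0; split; [apply/fintype.subsetP => x | exact: dj].
have nj t : t \in T -> ~ D V (j |: (T :\ t)).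
  have sub : T :\ t \subset T0 by apply: fintype.subset_trans TT; exact: subD1set.
  by move=> tT h; have := Tmin _ (conj sub h); rewrite (cardsD1 t T) tT add1n ltnn.
have [T0e|[i iT]] := set_0Vmem T; first by have := ncN jN; rewrite T0e finset.setU0 in dT.
exists i; first exact: (fintype.subsetP TT).
have jnT : j \notin T by apply: contra jT; exact: (fintype.subsetP TT).
have [c1|c2] := leqP #|T| 1.
  have -> : [set i; j] = j |: T; last exact: dT.
  have /eqP -> : [set i] == T by rewrite eqEcard finset.sub1set iT cards1 c1.
  by rewrite finset.setUC.
have [||t] := no_circuit cpq d1 iV k0 perW nex _ _ dT.
- by rewrite cardsU1 jnT.
- by move=> t; rewrite in_setU1 => /orP[/eqP ->|/(fintype.subsetP TT) tT]; [exact: ncN | exact: ncN (fintype.subsetP TN _ tT)].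
rewrite in_setU1 => /orP[/eqP ->|tT] h.
  by case: nT; apply: D_mono h; rewrite setU1K.
case: (nj t tT); apply: D_mono h; apply/fintype.subsetP => x.
rewrite in_setD1 in_setU1 => /andP[xt /orP[/eqP ->|xT]]; first exact: setU11.
by rewrite in_setU1 in_setD1 xt xT orbT.
Qed.

Lemma maximal_independent : exists T0 : {set 'I_n}, [/\ T0 \subset N, ~ D V T0 &
  forall j, j \in N -> j \notin T0 -> D V (j |: T0)].
Proof.
have [|T [TN nT] Tmin] := @min_size _ (fun T : {set 'I_n} => n - #|T|)%N (fun T => T \subset N /\ ~ D V T).
  by exists finset.set0; split; [exact: finset.sub0set | have [_ [ne _]] := iV; exact: nD0 ne].
exists T; split=> // j jN jT; apply: contrapT => nj.
have sub : j |: T \subset N.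
  by apply/fintype.subsetP => x; rewrite in_setU1 => /orP[/eqP -> //|]; exact: (fintype.subsetP TN).
have c : (#|j |: T| <= n)%N by rewrite -[X in (_ <= X)%N](card_ord n) max_card.
have := Tmin _ (conj sub nj); rewrite cardsU1 jT add1n in c *.
by rewrite leqNgt (ltn_sub2l c (ltnSn _)).
Qed.

(** The curves make every nonconstant coordinate algebraic over T0 also on V', as each is parallel
    to an element of T0. So [van_transfer] carries every equation of V over to V', constant
    coordinates being handled by substitution. *)
Lemma component_unique (V' : pset R n) : irred V' -> subs V V' ->
  (forall i a, i \notin N -> (forall x, V x -> x i = a) -> forall x, V' x -> x i = a) ->
  (forall i j, i \in N -> j \in N -> i != j -> D V [set i; j] -> D V' [set i; j]) -> subs V' V.
Proof.
move=> iV' VV' cst pr.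
have [T0 [TN nT0 maxT]] := maximal_independent.
have ncN' i : i \in N -> nc V' i by move=> /ncN ni /(D_sub VV').
have prX := prime_XT iV ncN; have prX' := prime_XT iV' ncN'.
have nsingle i : i \in N -> ~ dep (XT V' N) [set i].
  by move=> iN /(D_XT iV' ncN' _).2; rewrite finset.sub1set iN => /(_ isT); exact: ncN'.
have all_va j : j \in N -> va prX' (sig T0) 'X_j.
  move=> jN; have [jT|jT] := boolP (j \in T0); first exact: va_self.
  have [i iT dij] := parallel_to_base TN nT0 jN jT (maxT j jN jT).
  have iN := fintype.subsetP TN _ iT.
  have ij : i != j by apply: contraNneq jT => <-.
  have dX : dep (XT V' N) (j |: [set i]).
    rewrite finset.setUC; apply: (D_XT iV' ncN' _).1; last exact: pr.
    by apply/fintype.subsetP => t; rewrite in_set2 => /orP[/eqP ->|/eqP ->].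
  apply: (dep_alg (nsingle i iN) dX) => t; rewrite inE => /eqP ->; exact: va_self.
have sN (Q : {mpoly C[n]}) : sig N (sig N Q) = sig N Q by apply: sig_sub.
have key (Q : {mpoly C[n]}) : subs V (ZT N Q) -> subs V' (ZT N Q).
  move=> vQ; suff : van (XT V' N) (sig N Q) by move=> /van_XT; rewrite /ZT sN.
  have nX : ~ dep (XT V N) T0 by move=> /(D_XT iV ncN TN).2.
  apply: (van_transfer _ nX (va_sig (prX := prX') Q all_va)); first by move=> v [x Vx hx]; exists x; [exact: VV' |].
  by apply/van_XT; rewrite /ZT sN.
have [[E [hE VE]] [[x0 Vx0] _]] := iV.
have const_eq i x : i \notin N -> V' x -> x i = x0 i.
  move=> iN; apply: (cst i (x0 i) iN) => y Vy.
  have [a Va] : exists a, forall z, V z -> z i = a.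
    by apply: D_const iV _; apply: contrapT => ni; move: iN; rewrite inE => /asboolP; apply.
  by rewrite !Va.
move=> x Vx; apply/VE => P EP.
(* Dehomogenisation: nonconstant coordinates become (X_i, 1), constant ones their fixed homogeneous
   coordinates, possibly at infinity. *)
pose s (kk : 'I_(n + n)) : {mpoly C[n]} := match fintype.split kk with
  | inl i => if i \in N then 'X_i else (hcoord x0 kk)%:MP
  | inr i => if i \in N then 1 else (hcoord x0 kk)%:MP end.
pose Q := mmap (@mpolyC n C) s P.
have Qe y : V' y -> (forall i, i \in N -> y i != None) -> (sig N Q).@[fx y] = P.@[hcoord y].
  move=> Vy fy; pose v i := if i \in N then fx y i else 0.
  rewrite sig_eval -/v /Q.
  have -> : (mmap (@mpolyC n C) s P).@[v] = P.@[fun kk => (s kk).@[v]].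
    apply: (@morph_ext C _ _ (meval v \o mmap (@mpolyC n C) s) (meval (fun kk => (s kk).@[v]))) => [z|kk] /=.
      by rewrite mmapC !mevalC.
    by rewrite mmapX mmap1U mevalXU.
  apply: meval_eq => kk; rewrite /s -{2 3}(splitK kk) -[in RHS](splitK kk); case: (fintype.split kk) => i /=.
    case: ifP => iN; last by rewrite mevalC !hcoord_l (const_eq i y) // iN.
    by rewrite mevalXU /v iN hcoord_l /fx; have := fy i iN; case: (y i).
  case: ifP => iN; last by rewrite mevalC !hcoord_r (const_eq i y) // iN.
  by rewrite meval1 hcoord_r; have := fy i iN; case: (y i).
have none_or (y : pt R n) : (exists2 i, i \in N & y i = None) \/ (forall i, i \in N -> y i != None).
  have [h|no] := pselect (exists2 i, i \in N & y i = None); [by left | right=> i iN].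
  by apply/eqP => yi; apply: no; exists i.
have VQ : subs V (ZT N Q).
  move=> y Vy; have [h|fy] := none_or y; [by left | right].
  by rewrite Qe //; [exact: (VE y).1 | exact: VV'].
apply: (finite_part iV' ncN' (zclosed_single (hE P EP)) _ Vx) => y Vy.
have [h|fy] := none_or y; [by left | right].
have [[i iN yi]|z] := key Q VQ y Vy; first by have := fy i iN; rewrite yi.
by rewrite -Qe.
Qed.

(** Diagonal pairs stand for the constant coordinates, the others for dependent pairs of nonconstant
    ones. *)
Definition cond i j := (i == j) && (i \notin N) || [&& i != j, i \in N, j \in N & `[<D V [set i; j]>]].

Theorem component_of_curves : exists (S : seq ('I_n * 'I_n)) (Cv : 'I_n -> 'I_n -> pset R 2),
  (forall ij, ij \in S -> curve2 (Cv ij.1 ij.2) /\ preperiodic (Phi2 p q ij.1 ij.2) (Cv ij.1 ij.2)) /\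
  irr_component V (fun x => forall ij, ij \in S -> Cv ij.1 ij.2 (proj2 ij.1 ij.2 x)).
Proof.
have [_ [[x0 Vx0] _]] := iV.
pose Cv i j := if i == j then line (x0 i) else zclosure (comp (pick2 i j) V).
pose S := [seq ij <- enum [set: 'I_n * 'I_n] | cond ij.1 ij.2].
have inS i j : cond i j -> (i, j) \in S by move=> c; rewrite mem_filter c mem_enum finset.in_setT.
have cst i : i \notin N -> forall x, V x -> x i = x0 i.
  move=> iN x Vx; have [a Va] : exists a, forall z, V z -> z i = a.
    by apply: D_const iV _; apply: contrapT => ni; move: iN; rewrite inE => /asboolP; apply.
  by rewrite !Va.
exists S, Cv; split.
  move=> [i j]; rewrite mem_filter => /andP[] /= /orP[/andP[/eqP <- iN]|/and4P[ij iN jN /asboolP dij]] _.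
    rewrite /Cv eqxx; split; first exact: line_curve.
    exact: (line_preperiodic cpq d1 iV k0 perW (cst i iN)).
  by rewrite /Cv (negPf ij); split; [exact: (pair_curve iV ij (ncN iN) dij) | exact: (pair_preperiodic cpq d1 k0 perW)].
split=> //; split.
  move=> x Vx [i j]; rewrite mem_filter => /andP[] /= /orP[/andP[/eqP <- iN]|/and4P[ij _ _ _]] _.
    by rewrite /Cv eqxx; exact: cst.
  by rewrite /Cv (negPf ij) proj2E; apply: sub_zclosure; exists x.
move=> V' iV' VV' V'S x; split; last exact: VV'.
move: x; apply: (component_unique iV' VV').
  move=> i a iN Va x V'x; rewrite -(Va x0 Vx0).
  have /(V'S x V'x) : (i, i) \in S by apply: inS; rewrite /cond eqxx iN.
  by rewrite /= /Cv eqxx.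
move=> i j iN jN ij dij.
have ijS : (i, j) \in S.
  by apply: inS; rewrite /cond ij iN jN /=; apply/orP; right; apply/asboolP.
rewrite -pick2_im; apply: (D_comp (pick2_inj ij) _ _).1.
have : D (zclosure (comp (pick2 i j) V)) [set: 'I_2].
  by apply: (D_closure _ _).2; apply: (D_comp (pick2_inj ij) _ _).2; rewrite pick2_im.
apply: D_sub => _ [x V'x <-]; have := V'S x V'x _ ijS.
by rewrite /= /Cv (negPf ij) proj2E.
Qed.

End Component.

Theorem theorem1p3 (R : realType) (n : nat) (p q : 'I_n -> {poly R[i]})
  (Hcop : forall i, coprimep (p i) (q i))
  (Hdeg : forall i, (1 < rdeg (p i) (q i))%N)
  (Hnex : forall i, ~ exceptional (p i) (q i))
  (V : pset R n) (HV : irred V) (Hpre : preperiodic (Phi p q) V) :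
  exists (S : seq ('I_n * 'I_n)) (Cv : 'I_n -> 'I_n -> pset R 2),
    (forall ij, ij \in S ->
       curve2 (Cv ij.1 ij.2) /\ preperiodic (Phi2 p q ij.1 ij.2) (Cv ij.1 ij.2)) /\
    irr_component V
      (fun x => forall ij, ij \in S -> Cv ij.1 ij.2 (proj2 ij.1 ij.2 x)).
Proof.
have [m [k [k0 /seteq_eq perW]]] := Hpre.
exact: (component_of_curves Hcop Hdeg Hnex HV k0 perW).
Qed.
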